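(* Let $A\in\mathbb{C}^{m\times n}$ be given with both $\mathrm{SQ}_\phi(A)$ and $\mathrm{SQ}_\phi(A^\dagger)$, and let $f\colon\mathbb{R}\to\mathbb{C}$ satisfy $f(0)=0$, with $g(x):=f(\sqrt x)/\sqrt x$ being $L$-Lipschitz and $\bar g(x):=g(x)/x$ being $\bar L$-Lipschitz. Then, for $0<\varepsilon\lesssim L\|A\|^3$, we can output sketches $R:=SA\in\mathbb{C}^{r\times n}$ and $C:=AT\in\mathbb{C}^{m\times c}$ (with $S$, $T$ row/column sampling matrices), along with $M\in\mathbb{C}^{c\times r}$, such that \[\Pr\big[\|CMR+g(0)A-f^{(\mathrm{SV})}(A)\|>\varepsilon\big]<\delta,\] with $r=\tilde\Omega\big(\phi^2L^2\|A\|^2\|A\|_{\mathrm F}^4\frac1{\varepsilon^2}\log\frac1\delta\big)$ and $c=\tilde\Omega\big(\phi^2L^2\|A\|^4\|A\|_{\mathrm F}^2\frac1{\varepsilon^2}\log\frac1\delta\big)$. Finding $S$, $M$ and $T$ takes time \begin{multline*}\tilde O\Big((\bar L^2\|A\|^8\|A\|_{\mathrm F}^2+L^2\|A\|^2\|A\|_{\mathrm F}^4)\frac{\phi^2}{\varepsilon^2}\log\frac1\delta(\mathrm{s}_\phi(A)+\mathrm{s}_\phi(A^\dagger)+\mathrm{p}_\phi(A)+\mathrm{p}_\phi(A^\dagger))\\+(L^2\bar L^2\|A\|^{12}\|A\|_{\mathrm F}^4+L^4\|A\|^6\|A\|_{\mathrm F}^6)\frac{\phi^4}{\varepsilon^4}\log^2\frac1\delta\,\mathrm{q}(A)\\+(L^4\bar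 L^2\|A\|^{16}\|A\|_{\mathrm F}^6+L^6\|A\|^{10}\|A\|_{\mathrm F}^8)\frac{\phi^6}{\varepsilon^6}\log^3\frac1\delta+\mathrm{n}_\phi(A)\Big).\end{multline*}
   Context: $\|\cdot\|$ spectral norm, $\|\cdot\|_{\mathrm F}$ Frobenius norm. For $f$ with $f(0)=0$ and an SVD $A=\sum_k\sigma_ku_kv_k^\dagger$, $f^{(\mathrm{SV})}(A):=\sum_kf(\sigma_k)u_kv_k^\dagger$. Oversampling and query access $\mathrm{SQ}_\phi(A)$ ($\phi\ge1$): we can query entries of $A$ (cost $\mathrm q(A)$), and there is $\tilde A$ with $|\tilde A(i,j)|\ge|A(i,j)|$ and $\|\tilde A\|_{\mathrm F}^2=\phi\|A\|_{\mathrm F}^2$ for which we can sample row $i$ with probability $\|\tilde A(i,\cdot)\|^2/\|\tilde A\|_{\mathrm F}^2$ and then an index $j$ with probability $|\tilde A(i,j)|^2/\|\tilde A(i,\cdot)\|^2$ (cost $\mathrm s_\phi(A)$), query entries and row norms of $\tilde A$ (cost $\mathrm p_\phi(A)$), and query $\|\tilde A\|_{\mathrm F}$ (cost $\mathrm n_\phi(A)$); similarly for $A^\dagger$. Unit-cost arithmetic. $\lesssim$ hides an absolute constant; $\tilde\Omega,\tilde O$ hide polylogarithmic factors. *)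

(* Defs.v *)
From mathcomp Require Import all_boot all_order all_algebra.
From mathcomp Require Import complex.
From mathcomp Require Import boolp classical_sets reals exp.

Set Implicit Arguments.
Unset Strict Implicit.
Unset Printing Implicit Defensive.

Import Order.TTheory GRing.Theory Num.Theory.

Local Open Scope ring_scope.
Local Open Scope complex_scope.
Local Open Scope sesquilinear_scope.

Section Matrices.
Variable R : realType.
Local Notation C := R[i].

Definition frob_norm m n (A : 'M[C]_(m, n)) : R :=
  Num.sqrt (\sum_i \sum_j Normc.normc (A i j) ^+ 2).

(* On a column vector [frob_norm] is the Euclidean norm. *)
Definition spec_norm m n (A : 'M[C]_(m, n)) : R :=
  sup [set x | exists2 v : 'cV[C]_n, frob_norm v <= 1 & x = frob_norm (A *m v)].

Definition row_norm m n (A : 'M[C]_(m, n)) (i : 'I_m) : R := frob_norm (row i A).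

(* [\sum_k a k u_k v_k^dagger], where [u_k], [v_k] are the columns of [U], [V]. *)
Definition dyad_sum m n l (a : 'I_l -> C) (U : 'M[C]_(m, l)) (V : 'M[C]_(n, l)) :
    'M[C]_(m, n) :=
  \sum_k a k *: (col k U *m (col k V)^t*).

(* A singular value decomposition with any number [l] of triples, zero singular
   values being allowed. *)
Definition is_svd m n l (A : 'M[C]_(m, n)) (sigma : 'I_l -> R)
    (U : 'M[C]_(m, l)) (V : 'M[C]_(n, l)) : Prop :=
  [/\ forall k, 0 <= sigma k,
      U^t* \is unitarymx,
      V^t* \is unitarymx
    & A = dyad_sum (fun k => (sigma k)%:C) U V].

(* For [f 0 = 0] the value depends only on the matrix decomposed by
   [sigma, U, V]. *)
Definition svt m n l (f : R -> C) (sigma : 'I_l -> R)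
    (U : 'M[C]_(m, l)) (V : 'M[C]_(n, l)) : 'M[C]_(m, n) :=
  dyad_sum (fun k => f (sigma k)) U V.

Definition lipschitz_in (D : set R) (h : R -> C) (L : R) : Prop :=
  forall x y, D x -> D y -> Normc.normc (h x - h y) <= L * `|x - y|.

(* [g x = f (sqrt x) / sqrt x]; the quotient is undefined at [0], where the value
   is [g0].  If this function is Lipschitz on [0, +oo[, then [g0] is the limit of
   the quotient at [0]. *)
Definition gfun (f : R -> C) (g0 : C) (x : R) : C :=
  if x == 0 then g0 else f (Num.sqrt x) / (Num.sqrt x)%:C.

(* The matrix with rows [e_(I t) / sqrt (r p(I t))], [t < r]. *)
Definition sampling_mx r m (p : 'I_m -> R) (I : {ffun 'I_r -> 'I_m}) :
    'M[C]_(r, m) :=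
  \matrix_(t, i) if i == I t then ((Num.sqrt (r%:R * p i))^-1)%:C else 0.

(* Oversampling and query access to [A].  The last four fields are the costs
   q(A), s_phi(A), p_phi(A) and n_phi(A). *)
Record SQ m n (phi : R) (A : 'M[C]_(m, n)) := {
  tilde : 'M[C]_(m, n);
  tilde_ge : forall i j, Normc.normc (A i j) <= Normc.normc (tilde i j);
  tilde_frob : frob_norm tilde ^+ 2 = phi * frob_norm A ^+ 2;
  cost_q : R;
  cost_s : R;
  cost_p : R;
  cost_n : R;
  cost_ge0 : [/\ 0 <= cost_q, 0 <= cost_s, 0 <= cost_p & 0 <= cost_n]
}.

End Matrices.

(* Algorithms are finite programs for a randomised random-access machine with
   unit-cost exact arithmetic.  The machine has integer and complex registers,
   and integer and complex arrays (named by numbers); integers serve as indices.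
   Operands are register numbers, except for the constant of [ISet], the array
   name in the second argument of [IGet], [ZGet] and the first one of [IPut],
   [ZPut], and the target of the jumps. *)
Variant oracle :=
  | QEntry of nat & nat & nat   (* z i j:  z := A(i,j) *)
  | QTilde of nat & nat & nat   (* z i j:  z := A~(i,j) *)
  | QRow of nat & nat           (* z i:    z := |A~(i,.)| *)
  | QFro of nat                 (* z:      z := |A~|_F *)
  | SRow of nat                 (* x:      x := a sampled row index *)
  | SCol of nat & nat.          (* x i:    x := a column index sampled from row i *)

Variant side := OnMatrix | OnAdjoint.

Variant instr :=
  | ISet of nat & nat
  | IAdd of nat & nat & nat
  | ISub of nat & nat & nat
  | IMul of nat & nat & nat
  | IGet of nat & nat & nat     (* x b y:  x := b[y] *)
  | IPut of nat & nat & nat     (* b y x:  b[y] := x *)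
  | IRand of nat & nat          (* x y:    x := uniform in {0, ..., y - 1} *)
  | IJumpLt of nat & nat & nat  (* x y l:  goto l if x < y *)
  | ZNat of nat & nat           (* z x:    z := x, an integer register *)
  | ZImag of nat                (* z:      z := 'i *)
  | ZAdd of nat & nat & nat
  | ZSub of nat & nat & nat
  | ZMul of nat & nat & nat
  | ZDiv of nat & nat & nat
  | ZConj of nat & nat
  | ZSqrt of nat & nat          (* z w:    z := sqrt (Re w) *)
  | ZFun of nat & nat           (* z w:    z := f (Re w) *)
  | ZGet of nat & nat & nat
  | ZPut of nat & nat & nat
  | ZJumpLt of nat & nat & nat  (* z w l:  goto l if Re z < Re w *)
  | Ask of side & oracle.

Definition program := seq instr.

Section Machine.
Variable R : realType.
Local Notation C := R[i].

Record state := State {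
  pc : nat;
  ireg : nat -> nat;
  zreg : nat -> C;
  iarr : nat -> nat -> nat;
  zarr : nat -> nat -> C;
  clock : R
}.

Definition upd (T : Type) (h : nat -> T) (x : nat) (v : T) : nat -> T :=
  fun y => if y == x then v else h y.

(* One instruction takes time [1], plus the cost [c] of the oracle it calls. *)
Definition next (c : R) (s : state) : state :=
  State (pc s).+1 (ireg s) (zreg s) (iarr s) (zarr s) (clock s + 1 + c).

Definition goto (l : nat) (s : state) : state :=
  State l (ireg s) (zreg s) (iarr s) (zarr s) (clock s + 1).

Definition set_i (x v : nat) (s : state) : state :=
  State (pc s) (upd (ireg s) x v) (zreg s) (iarr s) (zarr s) (clock s).

Definition set_z (z : nat) (v : C) (s : state) : state :=
  State (pc s) (ireg s) (upd (zreg s) z v) (iarr s) (zarr s) (clock s).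

Definition put_i (b y v : nat) (s : state) : state :=
  State (pc s) (ireg s) (zreg s) (upd (iarr s) b (upd (iarr s b) y v)) (zarr s)
    (clock s).

Definition put_z (b y : nat) (v : C) (s : state) : state :=
  State (pc s) (ireg s) (zreg s) (iarr s) (upd (zarr s) b (upd (zarr s b) y v))
    (clock s).

(* [ask acc o s K] and [exec ins s K] below are the expectations of [K] over the
   state that follows [s].  A call with an index out of range, the sampling from
   a zero row and [IRand] over the empty range have no successor: they lose
   their probability mass. *)
Definition ask m n phi (A : 'M[C]_(m, n)) (acc : SQ phi A) (o : oracle)
    (s : state) (K : state -> R) : R :=
  match o with
  | QEntry z x y =>
      if (insub (ireg s x), insub (ireg s y)) is (Some i, Some j)
      then K (next (cost_q acc) (set_z z (A i j) s)) else 0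
  | QTilde z x y =>
      if (insub (ireg s x), insub (ireg s y)) is (Some i, Some j)
      then K (next (cost_p acc) (set_z z (tilde acc i j) s)) else 0
  | QRow z x =>
      if insub (ireg s x) is Some i
      then K (next (cost_p acc) (set_z z (row_norm (tilde acc) i)%:C s)) else 0
  | QFro z => K (next (cost_n acc) (set_z z (frob_norm (tilde acc))%:C s))
  | SRow x =>
      \sum_(i < m) row_norm (tilde acc) i ^+ 2 / frob_norm (tilde acc) ^+ 2
        * K (next (cost_s acc) (set_i x i s))
  | SCol x y =>
      if insub (ireg s y) is Some i then
        \sum_(j < n) Normc.normc (tilde acc i j) ^+ 2
                       / row_norm (tilde acc) i ^+ 2
          * K (next (cost_s acc) (set_i x j s))
      else 0
  end.

Section Run.
Variables (m n : nat) (phi : R) (A : 'M[C]_(m, n)).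
Variables (acc : SQ phi A) (acc' : SQ phi (A^t*)) (f : R -> C) (P : program).

Definition exec (ins : instr) (s : state) (K : state -> R) : R :=
  let I := ireg s in
  let Z := zreg s in
  let seti x v := K (next 0 (set_i x v s)) in
  let setz z v := K (next 0 (set_z z v s)) in
  match ins with
  | ISet x k => seti x k
  | IAdd x y z => seti x (I y + I z)%N
  | ISub x y z => seti x (I y - I z)%N
  | IMul x y z => seti x (I y * I z)%N
  | IGet x b y => seti x (iarr s b (I y))
  | IPut b y x => K (next 0 (put_i b (I y) (I x) s))
  | IRand x y => \sum_(k < I y) (I y)%:R^-1 * seti x k
  | IJumpLt x y l => K (if (I x < I y)%N then goto l s else next 0 s)
  | ZNat z x => setz z (I x)%:R
  | ZImag z => setz z 'i
  | ZAdd z u v => setz z (Z u + Z v)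
  | ZSub z u v => setz z (Z u - Z v)
  | ZMul z u v => setz z (Z u * Z v)
  | ZDiv z u v => setz z (Z u / Z v)
  | ZConj z u => setz z (Z u)^*
  | ZSqrt z u => setz z (Num.sqrt (complex.Re (Z u)))%:C
  | ZFun z u => setz z (f (complex.Re (Z u)))
  | ZGet z b y => setz z (zarr s b (I y))
  | ZPut b y z => K (next 0 (put_z b (I y) (Z z) s))
  | ZJumpLt u v l =>
      K (if complex.Re (Z u) < complex.Re (Z v) then goto l s else next 0 s)
  | Ask OnMatrix o => ask acc o s K
  | Ask OnAdjoint o => ask acc' o s K
  end.

(* The expectation of [K] at the final state, over the runs from [s] that halt
   after fewer than [N] instructions; a run halts when [pc] leaves the program. *)
Fixpoint run (N : nat) (s : state) (K : state -> R) : R :=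
  if N isn't N'.+1 then 0 else
  if onth P (pc s) is Some ins then exec ins s (fun s' => run N' s' K) else K s.

Definition pr_from (s0 : state) (N : nat) (E : state -> Prop) : R :=
  run N s0 (fun s => `[< E s >]%:R).

End Run.

(* The program is told the dimensions, the sizes of the sketches and the listed
   real parameters; it reaches the matrix through the oracles only, and the
   function through [ZFun] only. *)
Definition init_state (m n r c : nat) (phi L Lbar eps delta a : R) : state :=
  State 0 (nth 0%N [:: m; n; r; c])
    (nth 0 [:: phi%:C; L%:C; Lbar%:C; eps%:C; delta%:C; a%:C])
    (fun _ _ => 0%N) (fun _ _ => 0) 0.

(* Output convention: row [t] of [S] has its only nonzero entry, [zarr 0 t], in
   column [iarr 0 t]; column [t] of [T] has its only nonzero entry, [zarr 1 t],
   in row [iarr 1 t]; array [2] holds [M], row after row. *)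
Definition out_S r m (s : state) : 'M[C]_(r, m) :=
  \matrix_(t, i) if i == iarr s 0 t :> nat then zarr s 0 t else 0.

Definition out_T n c (s : state) : 'M[C]_(n, c) :=
  \matrix_(j, t) if j == iarr s 1 t :> nat then zarr s 1 t else 0.

Definition out_M c r (s : state) : 'M[C]_(c, r) :=
  \matrix_(a, b) zarr s 2 (a * r + b)%N.

(* Under [Pr], the random matrix [X] is a row sampling matrix: for some
   probability vector [p], its rows are independent, each being
   [e_i / sqrt (r p(i))] with probability [p i]. *)
Definition row_sampling (Pr : (state -> Prop) -> R) r m
    (X : state -> 'M[C]_(r, m)) : Prop :=
  exists p : 'I_m -> R,
    [/\ forall i, 0 <= p i, \sum_i p i = 1
      & forall I : {ffun 'I_r -> 'I_m},
          Pr (fun s => X s = sampling_mx p I) = \prod_t p (I t)].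

End Machine.

Section Bounds.
Variable R : realType.

(* A quantity is [O~(x)] when it is at most [K * x * polylog k x] for constants
   [K] and [k], and [Omega~(x)], in the sense of large enough up to
   polylogarithmic factors, when it is at least such an expression. *)
Definition polylog (k : nat) (x : R) : R := (1 + ln (1 + x)) ^+ k.

(* [log (1 / delta)], taken to be at least [1]: a bound proportional to
   [log (1 / delta)] itself would tend to [0] as [delta] tends to [1]. *)
Definition log_inv (delta : R) : R := Num.max 1 (ln delta^-1).

(* [a] and [F] stand for the spectral and the Frobenius norm, and [d] for
   [log (1 / delta)]. *)
Definition row_bound (phi L a F eps d : R) : R :=
  phi ^+ 2 * L ^+ 2 * a ^+ 2 * F ^+ 4 * (eps ^+ 2)^-1 * d.

Definition col_bound (phi L a F eps d : R) : R :=
  phi ^+ 2 * L ^+ 2 * a ^+ 4 * F ^+ 2 * (eps ^+ 2)^-1 * d.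

Definition time_bound (phi L Lbar a F eps d s s' p p' q nu : R) : R :=
  (Lbar ^+ 2 * a ^+ 8 * F ^+ 2 + L ^+ 2 * a ^+ 2 * F ^+ 4)
    * (phi ^+ 2 / eps ^+ 2) * d * (s + s' + p + p')
  + (L ^+ 2 * Lbar ^+ 2 * a ^+ 12 * F ^+ 4 + L ^+ 4 * a ^+ 6 * F ^+ 6)
    * (phi ^+ 4 / eps ^+ 4) * d ^+ 2 * q
  + (L ^+ 4 * Lbar ^+ 2 * a ^+ 16 * F ^+ 6 + L ^+ 6 * a ^+ 10 * F ^+ 8)
    * (phi ^+ 6 / eps ^+ 6) * d ^+ 3
  + nu.

End Bounds.

(* Main.v *)
(* With g0 = 0 forced by the second Lipschitz condition, f^(SV)(A) = g(A A^* ) A and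
   g(x) = x gbar(x).  Put C = A T and R = S A.  Then C C^* is close to A A^*, so
   g(A A^* ) A is close to g(C C^* ) A = C gbar(C^* C) C^* A, and C^* A is close to
   C^* S^* S A.  Hence M = gbar(G~) C^* S^*, where G~ estimates the c x c matrix
   C^* C from entries of A: forming C^* C exactly would cost a factor m, so its
   rows are sampled a second time.  gbar is applied after diagonalising G~ by
   finitely many Jacobi rotations, and at a shifted spectrum, which keeps it away
   from 0.

   Both Gram estimates are controlled by even trace moments, through an
   exchangeable pair argument that replaces the matrix Chernoff bound, and an
   error in norm passes through g at the cost of a logarithmic factor, g being
   Lipschitz.  The estimate of C^* A is a sum of independent vectors; rows of S C
   that are too large are discarded, which makes its moments bounded. *)
Require Import Defs.
From mathcomp Require Import all_boot all_order all_algebra.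
From mathcomp Require Import complex.
From mathcomp Require Import boolp classical_sets reals sequences exp.
From mathcomp Require Import ring lra zify.

Set Implicit Arguments.
Unset Strict Implicit.
Unset Printing Implicit Defensive.

Import Order.TTheory GRing.Theory Num.Theory.

Local Open Scope ring_scope.
Local Open Scope sesquilinear_scope.

(** * Adjoints, norms and matrix products *)

(** Every logarithm has to be one of the stated bounds, never of [m] or [n]. The trace moments
    therefore start from an intrinsic dimension [\tr H / h], at most [phi F^2 / a^2] ([a] the
    spectral, [F] the Frobenius norm of [A]), and the error in [C^* A] is measured in Frobenius
    norm, where no dimension enters. The grid behind the operator Lipschitz estimate has the error
    itself as its step, so that the number of its points is a ratio of norms as well. The sizes [r]
    and [c] are given and do not see [Lbar]. Hence two tolerances coexist: [a^2 / (4096 la l1)] with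
    [la = L a^3 / eps] for [C C^*], paid by [c], and [a^2 / (4096 s ell)] with [s = rate] for
    [C^* C], paid by the second sample, whose size the program chooses. Truncation is forced because
    the row probabilities control the rows of [A] but not those of [C]; the bias it causes is of the
    order of the fluctuations. The program gets its logarithms by counting doublings. *)

Section Adjoint.
Variable C : numClosedFieldType.

Lemma adjE m n (A : 'M[C]_(m, n)) i j : (A^t*) i j = (A j i)^*.
Proof. by rewrite !mxE. Qed.

Lemma adjM m n p (A : 'M[C]_(m, n)) (B : 'M[C]_(n, p)) :
  (A *m B)^t* = B^t* *m A^t*.
Proof. by rewrite trmx_mul map_mxM. Qed.

Lemma adjD m n (A B : 'M[C]_(m, n)) : (A + B)^t* = A^t* + B^t*.
Proof. by apply/matrixP=> i j; rewrite !mxE rmorphD. Qed.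

Lemma adjB m n (A B : 'M[C]_(m, n)) : (A - B)^t* = A^t* - B^t*.
Proof. by apply/matrixP=> i j; rewrite !mxE rmorphB. Qed.

Lemma adj_scale m n (a : C) (A : 'M[C]_(m, n)) : (a *: A)^t* = a^* *: A^t*.
Proof. by apply/matrixP=> i j; rewrite !mxE rmorphM. Qed.

Lemma adj1 n : (1%:M : 'M[C]_n)^t* = 1%:M.
Proof. by apply/matrixP=> i j; rewrite !mxE eq_sym; case: eqP; rewrite ?conjC1 ?conjC0. Qed.

Lemma adj_sum m n I (r : seq I) (P : pred I) (F : I -> 'M[C]_(m, n)) :
  (\sum_(i <- r | P i) F i)^t* = \sum_(i <- r | P i) (F i)^t*.
Proof.
apply: (big_morph (fun M : 'M[C]_(m, n) => M^t*)) => [A B|]; first exact: adjD.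
by apply/matrixP=> i j; rewrite !mxE conjC0.
Qed.

Lemma adj_exp n (S : 'M[C]_n) k : S^t* = S -> (S ^+ k)^t* = S ^+ k.
Proof.
move=> hS; elim: k => [|k IH]; first by rewrite expr0 adj1.
by rewrite {1}exprS adjM hS IH mulmxE -exprSr.
Qed.

Lemma adj_diag n (d : 'rV[C]_n) :
  (forall i, d 0 i \is Num.real) -> (diag_mx d)^t* = diag_mx d.
Proof.
move=> dR; apply/matrixP=> i j; rewrite !mxE eq_sym.
by case: eqP => [->|_]; rewrite ?mulr1n ?mulr0n ?conjC0 //; apply/CrealP.
Qed.

Lemma conj_trace n (M : 'M[C]_n) : (\tr M)^* = \tr (M^t*).
Proof. by rewrite rmorph_sum; apply: eq_bigr => i _; rewrite adjE. Qed.

Lemma unitary_adjl n (U : 'M[C]_n) : U \is unitarymx -> U^t* *m U = 1%:M.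
Proof. by rewrite -trmxC_unitary => /unitarymxP; rewrite trmxCK. Qed.

Lemma herm_spectral n (S : 'M[C]_n) : S^t* = S ->
  exists (U : 'M[C]_n) (d : 'rV[C]_n), [/\ U \is unitarymx, forall i, d 0 i \is Num.real
                & S = U^t* *m diag_mx d *m U].
Proof.
move=> hS; have Sh : S \is hermsymmx.
  by apply/is_hermitianmxP; rewrite expr0 scale1r hS.
exists (spectralmx S), (spectral_diag S); split.
- exact: spectral_unitarymx.
- by move=> i; have /mxOverP/(_ 0 i) := hermitian_spectral_diag_real Sh.
- rewrite -invmx_unitary ?spectral_unitarymx //.
  exact/orthomx_spectralP/hermitian_normalmx.
Qed.

Lemma spectral_exp n (U : 'M[C]_n) (d : 'rV[C]_n) k : U \is unitarymx ->
  (U^t* *m diag_mx d *m U) ^+ k = U^t* *m diag_mx (\row_i d 0 i ^+ k) *m U.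
Proof.
move=> UU; elim: k => [|k IH].
  rewrite expr0 (_ : diag_mx _ = 1%:M) ?mulmx1 ?unitary_adjl //.
  by apply/matrixP=> i j; rewrite !mxE.
rewrite exprS IH -mulmxE !mulmxA mulmxtVK // -(mulmxA (U^t*)) mulmx_diag.
by congr (_ *m diag_mx _ *m _); apply/rowP=> i; rewrite !mxE exprS.
Qed.

(** The squared Frobenius norm, with values in [C]; working with squares keeps most estimates free
    of roots. *)
Definition fsq m n (M : 'M[C]_(m, n)) : C := \sum_i \sum_j `|M i j| ^+ 2.

Lemma fsq_ge0 m n (M : 'M[C]_(m, n)) : 0 <= fsq M.
Proof. by do 2 (apply: sumr_ge0 => ? _); rewrite exprn_ge0. Qed.

Lemma fsq_tr m n (M : 'M[C]_(m, n)) : fsq M = \tr (M *m M^t*).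
Proof.
by apply: eq_bigr => i _; rewrite !mxE; apply: eq_bigr => j _; rewrite normCK adjE.
Qed.

Lemma fsq_trl m n (M : 'M[C]_(m, n)) : fsq M = \tr (M^t* *m M).
Proof. by rewrite fsq_tr mxtrace_mulC. Qed.

Lemma fsq_adj m n (M : 'M[C]_(m, n)) : fsq (M^t*) = fsq M.
Proof. by rewrite fsq_tr trmxCK -fsq_trl. Qed.

Lemma fsqUl m n p (U : 'M[C]_(m, p)) (M : 'M[C]_(p, n)) :
  U^t* *m U = 1%:M -> fsq (U *m M) = fsq M.
Proof. by move=> h; rewrite !fsq_trl adjM mulmxA -(mulmxA (M^t*)) h mulmx1. Qed.

Lemma fsqUr m n p (U : 'M[C]_(n, p)) (M : 'M[C]_(m, n)) :
  U *m U^t* = 1%:M -> fsq (M *m U) = fsq M.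
Proof. by move=> h; rewrite !fsq_tr adjM mulmxA -(mulmxA M) h mulmx1. Qed.

Lemma diag_mulE n (d : 'rV[C]_n) p (M : 'M[C]_(n, p)) i j :
  (diag_mx d *m M) i j = d 0 i * M i j.
Proof. by rewrite mul_diag_mx mxE. Qed.

Lemma mul_diagE n (d : 'rV[C]_n) p (M : 'M[C]_(p, n)) i j :
  (M *m diag_mx d) i j = M i j * d 0 j.
Proof. by rewrite mul_mx_diag mxE. Qed.

Lemma trace_two_diag m n (Z : 'M[C]_(m, n)) (d : 'rV[C]_m) (e : 'rV[C]_n) :
  \tr (Z^t* *m diag_mx d *m Z *m diag_mx e) =
  \sum_i \sum_j `|Z i j| ^+ 2 * (d 0 i * e 0 j).
Proof.
rewrite exchange_big; apply: eq_bigr => j _; rewrite mul_diagE !mxE mulr_suml.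
apply: eq_bigr => i _; rewrite mul_diagE adjE normCK.
by rewrite (mulrC (Z i j)) -!mulrA; congr (_ * _); rewrite !mulrA; congr (_ * _); rewrite mulrC.
Qed.

Lemma even_exp_ge0 (x : C) p : x \is Num.real -> 0 <= x ^+ p.*2.
Proof. by move=> xR; rewrite -muln2 exprM real_exprn_even_ge0 ?realX. Qed.

Lemma norm_even_exp (x : C) p : x \is Num.real -> `|x| ^+ p.*2 = x ^+ p.*2.
Proof. by move=> xR; rewrite -muln2 mulnC !exprM real_normK. Qed.

(** The larger of the two moduli dominates all [2p] factors. Only [k + l] is even, hence the modulus
    on the left. *)
Lemma mix_exp_le (s t : C) k l p : s \is Num.real -> t \is Num.real ->
  (k + l = p.*2)%N -> `|s ^+ k * t ^+ l| <= s ^+ p.*2 + t ^+ p.*2.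
Proof.
move=> sR tR kl; rewrite normrM !normrX -(norm_even_exp p sR) -(norm_even_exp p tR).
case: (real_leP (normr_real s) (normr_real t)) => st.
- apply: (@le_trans _ _ (`|t| ^+ k * `|t| ^+ l)).
    by apply: ler_wpM2r; rewrite ?exprn_ge0 // lerXn2r ?nnegrE.
  by rewrite -exprD kl ler_wpDl // exprn_ge0.
- apply: (@le_trans _ _ (`|s| ^+ k * `|s| ^+ l)).
    by apply: ler_wpM2l; rewrite ?exprn_ge0 // lerXn2r ?nnegrE // ltW.
  by rewrite -exprD kl ler_wpDr // exprn_ge0.
Qed.

(** With [S] and [T] each written in its own eigenbasis, the trace is a sum of [d_i^k e_j^l] with
    the nonnegative weights [|Z i j|^2], so the scalar inequality applies term by term although [S],
    [T] and [D] do not commute. *)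
Lemma trace_mixed_le n (S T D : 'M[C]_n) k l p :
  S^t* = S -> T^t* = T -> D^t* = D -> (k + l = p.*2)%N ->
  `|\tr (D *m S ^+ k *m D *m T ^+ l)| <=
  \tr (D *m D *m S ^+ p.*2) + \tr (D *m D *m T ^+ p.*2).
Proof.
move=> /herm_spectral[U [d [UU dR ->]]] /herm_spectral[V [e [VV eR ->]]] hD kl.
rewrite !spectral_exp //.
set Z := U *m D *m V^t*.
have hZ : Z^t* = V *m D *m U^t* by rewrite /Z !adjM trmxCK hD mulmxA.
have one (f : 'rV[C]_n) : (diag_mx (const_mx 1) : 'M[C]_n) = 1%:M.
  by apply/matrixP=> i j; rewrite !mxE.
have -> : \tr (D *m (U^t* *m diag_mx (\row_i d 0 i ^+ k) *m U) *m D *m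
    (V^t* *m diag_mx (\row_i e 0 i ^+ l) *m V)) =
  \tr (Z^t* *m diag_mx (\row_i d 0 i ^+ k) *m Z *m diag_mx (\row_i e 0 i ^+ l)).
  by rewrite hZ /Z !mulmxA [LHS]mxtrace_mulC !mulmxA.
have -> : \tr (D *m D *m (U^t* *m diag_mx (\row_i d 0 i ^+ p.*2) *m U)) =
  \tr (Z^t* *m diag_mx (\row_i d 0 i ^+ p.*2) *m Z *m diag_mx (const_mx 1)).
  rewrite (one d) mulmx1 hZ /Z !mulmxA [RHS]mxtrace_mulC !mulmxA unitary_adjl // mul1mx.
  by rewrite [RHS]mxtrace_mulC !mulmxA.
have -> : \tr (D *m D *m (V^t* *m diag_mx (\row_i e 0 i ^+ p.*2) *m V)) =
  \tr (Z^t* *m diag_mx (const_mx 1) *m Z *m diag_mx (\row_i e 0 i ^+ p.*2)).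
  rewrite (one d) mulmx1 hZ /Z !mulmxA -(mulmxA (V *m D)) unitary_adjl // mulmx1.
  by rewrite [LHS]mxtrace_mulC !mulmxA.
rewrite !trace_two_diag -big_split /=; apply: le_trans (ler_norm_sum _ _ _) _.
apply: ler_sum => i _; rewrite -big_split /=; apply: le_trans (ler_norm_sum _ _ _) _.
apply: ler_sum => j _; rewrite !mxE mulr1 mul1r -mulrDr normrM ger0_norm ?exprn_ge0 //.
by rewrite ler_wpM2l ?exprn_ge0 //; apply: mix_exp_le.
Qed.

Lemma telescope_expr n (S T : 'M[C]_n) k :
  S ^+ k - T ^+ k = \sum_(i < k) S ^+ (k - i.+1) *m (S - T) *m T ^+ i.
Proof.
elim: k => [|k IH]; first by rewrite big_ord0 !expr0 subrr.
have -> : S ^+ k.+1 - T ^+ k.+1 = S * (S ^+ k - T ^+ k) + (S - T) * T ^+ k.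
  by rewrite mulrBr mulrBl !exprS addrA subrK.
rewrite IH mulr_sumr big_ord_recr /= subnn expr0 mul1mx; congr (_ + _).
apply: eq_bigr => i _; rewrite -!mulmxE !mulmxA mulmxE -exprS.
by rewrite -subSn // subSS.
Qed.

End Adjoint.

(** * Product weights and resampling of one coordinate *)

Section Product.
Variables (C : numClosedFieldType) (T : finType) (p : T -> C) (c : nat).
Implicit Types (I : {ffun 'I_c -> T}).

Definition pw I : C := \prod_t p (I t).

Definition setf I t y : {ffun 'I_c -> T} := [ffun s => if s == t then y else I s].

Lemma sum_pw : \sum_y p y = 1 -> \sum_I pw I = 1.
Proof.
move=> p1; rewrite -(bigA_distr_bigA (fun (_ : 'I_c) => p)) /=.
by rewrite big1 // => i _.
Qed.

Lemma pw_ge0 : (forall y, 0 <= p y) -> forall I, 0 <= pw I.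
Proof. by move=> p0 I; apply: prodr_ge0. Qed.

Lemma pw_setf I t y : pw (setf I t y) * p (I t) = pw I * p y.
Proof.
rewrite /pw (bigD1 t) //= [in RHS](bigD1 t) //= ffunE eqxx.
rewrite (eq_bigr (fun s => p (I s))) => [|s /negbTE st]; last by rewrite ffunE st.
by rewrite mulrC mulrA [in RHS]mulrC mulrA (mulrC (p y)).
Qed.

(** Exchanging coordinate [t] with a fresh sample is an involution that preserves the product
    weight. This is the exchangeable pair behind both moment bounds. *)
Lemma resample (t : 'I_c) (G : {ffun 'I_c -> T} -> T -> C) :
  \sum_I \sum_y pw I * p y * G (setf I t y) (I t) =
  \sum_I \sum_y pw I * p y * G I y.
Proof.
rewrite !pair_big /=.
have inv : involutive (fun q : {ffun 'I_c -> T} * T => (setf q.1 t q.2, q.1 t)).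
  move=> [I y] /=; congr (_, _); last by rewrite ffunE eqxx.
  by apply/ffunP=> s; rewrite !ffunE; case: eqP => [->|].
rewrite [RHS](reindex_inj (can_inj inv)) /=.
by apply: eq_bigr => -[I y] _ /=; rewrite pw_setf.
Qed.

Lemma sum_free (F : {ffun 'I_c -> T} -> C) : \sum_y p y = 1 ->
  \sum_I \sum_y pw I * p y * F I = \sum_I pw I * F I.
Proof.
move=> p1; apply: eq_bigr => I _; rewrite -mulr_suml -mulr_sumr p1 mulr1 //.
Qed.

End Product.

(** * Moments of an empirical Gram matrix *)

Section Moments.
Variables (C : numClosedFieldType) (T : finType) (p : T -> C) (m c : nat).
Variables (x : T -> 'cV[C]_m) (rho h : C).
Hypothesis p_ge0 : forall y, 0 <= p y.
Hypothesis p_sum : \sum_y p y = 1.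
Hypothesis c_gt0 : (0 < c)%N.
Hypothesis x_le : forall y, fsq (x y) <= rho.
Let X y := x y *m (x y)^t*.
Let H := \sum_y p y *: X y.
Hypothesis h_gt0 : 0 < h.
Hypothesis H_le : forall v : 'cV[C]_m, (v^t* *m H *m v) 0 0 <= h * fsq v.
Implicit Types (I : {ffun 'I_c -> T}).

Definition emp_dev I : 'M[C]_m := c%:R^-1 *: (\sum_t X (I t)) - H.
Local Notation S := emp_dev.
Local Notation E F := (\sum_I pw p I * F I).
Let Y y : 'M[C]_m := c%:R^-1 *: (X y - H).

Let c_neq0 : c%:R != 0 :> C. Proof. by rewrite pnatr_eq0 -lt0n. Qed.

Let Xadj y : (X y)^t* = X y. Proof. by rewrite adjM trmxCK. Qed.

Let Hadj : H^t* = H.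
Proof.
rewrite adj_sum; apply: eq_bigr => y _; rewrite adj_scale Xadj; congr (_ *: _).
exact/CrealP/ger0_real.
Qed.

Let cR : (c%:R^-1 : C)^* = c%:R^-1.
Proof. by rewrite fmorphV rmorph_nat. Qed.

Lemma emp_dev_adj I : (S I)^t* = S I.
Proof. by rewrite adjB adj_scale adj_sum Hadj cR; congr (_ *: _ - _); apply: eq_bigr. Qed.
Let Sadj := emp_dev_adj.

Let Yadj y : (Y y)^t* = Y y.
Proof. by rewrite adj_scale adjB Xadj Hadj cR. Qed.

Let S_sumY I : S I = \sum_t Y (I t).
Proof.
rewrite /emp_dev /Y -scaler_sumr sumrB scalerBr sumr_const card_ord -scaler_nat.
by rewrite scalerA mulVf // scale1r.
Qed.

Let Y_mean : \sum_y p y *: Y y = 0.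
Proof.
rewrite /Y; under eq_bigr do rewrite scalerA mulrC -scalerA scalerBr.
by rewrite -scaler_sumr sumrB -scaler_suml p_sum scale1r subrr scaler0.
Qed.

Let S_setf I t y : S I - S (setf I t y) = Y (I t) - Y y.
Proof.
rewrite !S_sumY (bigD1 t) //= [X in _ - X](bigD1 t) //= ffunE eqxx.
rewrite [X in _ - (_ + X)](eq_bigr (fun s => Y (I s))).
  by rewrite opprD addrACA subrr addr0.
by move=> s /negbTE st; rewrite ffunE st.
Qed.

Lemma tr_psd_ge0 (A R : 'M[C]_m) : A^t* = A -> R^t* = R ->
  0 <= \tr (A *m A *m (R *m R)).
Proof.
move=> hA hR; have -> : \tr (A *m A *m (R *m R)) = fsq (R *m A).
  by rewrite fsq_tr adjM hA hR !mulmxA mxtrace_mulC !mulmxA.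
exact: fsq_ge0.
Qed.

Let X_sq y : X y *m X y = fsq (x y) *: X y.
Proof.
rewrite /X mulmxA -(mulmxA _ _ (x y)) [_^t* *m x y]mx11_scalar -mulmxA.
by rewrite mul_scalar_mx scalemxAr fsq_trl /mxtrace big_ord1.
Qed.

Let trX (R : 'M[C]_m) y : R^t* = R -> \tr (X y *m (R *m R)) = fsq (R *m x y).
Proof. by move=> hR; rewrite fsq_tr adjM hR !mulmxA mxtrace_mulC !mulmxA. Qed.

Let trX_ge0 (R : 'M[C]_m) y : R^t* = R -> 0 <= \tr (X y *m (R *m R)).
Proof. by move=> hR; rewrite trX // fsq_ge0. Qed.

Let tr_sq_le (R : 'M[C]_m) y : R^t* = R ->
  \tr (X y *m X y *m (R *m R)) <= rho * \tr (X y *m (R *m R)).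
Proof. by move=> hR; rewrite X_sq -scalemxAl mxtraceZ ler_wpM2r // trX_ge0. Qed.

(** In the positive order [(X y - X z)^2] is at most [2 (X y^2 + X z^2)], and
    [X y^2 = fsq (x y) X y] is at most [rho X y]. The square of the increment is thus bounded by
    first powers, whose averages are known. *)
Let tr_diff_le (R : 'M[C]_m) y z : R^t* = R ->
  \tr ((Y y - Y z) *m (Y y - Y z) *m (R *m R)) <=
  2 * rho / c%:R ^+ 2 * (\tr (X y *m (R *m R)) + \tr (X z *m (R *m R))).
Proof.
move=> hR; have -> : Y y - Y z = c%:R^-1 *: (X y - X z).
  by rewrite /Y -scalerBr opprB addrA subrK.
rewrite -scalemxAl -scalemxAr -!scalemxAl !mxtraceZ mulrA -expr2 -exprVn.
have -> : 2 * rho * c%:R^-1 ^+ 2 = c%:R^-1 ^+ 2 * (2 * rho) by rewrite mulrC.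
rewrite -[leRHS]mulrA ler_wpM2l ?exprn_ge0 ?invr_ge0 ?ler0n //.
apply: (@le_trans _ _ (2 * (\tr (X y *m X y *m (R *m R)) + \tr (X z *m X z *m (R *m R))))).
  rewrite -subr_ge0 -mxtraceD -mulmxDl.
  have := @tr_psd_ge0 (X y + X z) R; rewrite adjD !Xadj => /(_ erefl hR).
  rewrite -mxtraceZ scalemxAl -raddfB -mulmxBl /=; congr (0 <= \tr (_ *m _)).
  rewrite mulmxBl !mulmxBr mulmxDl !mulmxDr.
  move: (X y *m X y) (X y *m X z) (X z *m X y) (X z *m X z) => a1 a2 a3 a4.
  by apply/matrixP => i j; rewrite !mxE; ring.
by rewrite -mulrA ler_wpM2l // mulrDr lerD // tr_sq_le.
Qed.

(** Symmetrisation: both sides may be replaced by the sum with their resampled copies, which have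
    the same expectations. *)
Let le_of_doubled (a a' b b' k : C) : a = a' -> b = b' ->
  a + a' <= k * (b + b') -> a <= k * b.
Proof. by move=> <- <-; rewrite -!mulr2n mulrnAr lerMn2r. Qed.

(* Resampling one coordinate [t] of [I] gives an exchangeable copy [S'] of [S] with
   [D := S - S' = Y (I t) - Y y], so that [tr (Y (I t) S^k)] has half the expectation
   of [tr (D (S^k - S'^k))].  After telescoping, the mixed traces [tr (D S^i D S'^j)]
   are bounded by [tr (D^2 S^(i+j))] and [tr (D^2 S'^(i+j))]. *)
Lemma moment_step q :
  E (fun I => \tr (S I ^+ q.+1.*2)) <=
  q.*2.+1%:R * (2 * rho / c%:R) *
    E (fun I => \tr ((S I + 2 *: H) *m S I ^+ q.*2)).
Proof.
set k := q.*2.+1.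
have PE I : S I ^+ q.*2 = S I ^+ q *m S I ^+ q by rewrite -addnn exprD.
have Sq I : (S I ^+ q)^t* = S I ^+ q by apply: adj_exp.
pose G I t y : C := \tr ((Y (I t) - Y y) *m (Y (I t) - Y y) *m S I ^+ q.*2).
have pp I y : 0 <= pw p I * p y by rewrite mulr_ge0 ?pw_ge0.
have step t : \sum_I \sum_y pw p I * p y * \tr (Y (I t) *m S I ^+ k) <=
    k%:R * \sum_I \sum_y pw p I * p y * G I t y.
  have zero : \sum_I \sum_y pw p I * p y * \tr (Y y *m S I ^+ k) = 0.
    rewrite big1 // => I _; under eq_bigr do rewrite -mulrA.
    rewrite -mulr_sumr (_ : \sum_y _ = \tr ((\sum_y p y *: Y y) *m S I ^+ k)).
      by rewrite Y_mean mul0mx mxtrace0 mulr0.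
    by rewrite mulmx_suml raddf_sum; apply: eq_bigr => y _; rewrite -mxtraceZ scalemxAl.
  pose B I y : C := \tr ((Y (I t) - Y y) *m S I ^+ k).
  have -> : \sum_I \sum_y pw p I * p y * \tr (Y (I t) *m S I ^+ k) =
      \sum_I \sum_y pw p I * p y * B I y.
    rewrite -[LHS]subr0 -[X in _ - X]zero -sumrB; apply: eq_bigr => I _.
    by rewrite -sumrB; apply: eq_bigr => y _; rewrite /B mulmxBl raddfB mulrBr.
  have sw : \sum_I \sum_y pw p I * p y * B I y =
     \sum_I \sum_y pw p I * p y * \tr ((Y y - Y (I t)) *m S (setf I t y) ^+ k).
    rewrite -(resample p t) /B; apply: eq_bigr => I _; apply: eq_bigr => y _.
    by rewrite ffunE eqxx.
  have swG : \sum_I \sum_y pw p I * p y * G I t y =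
     \sum_I \sum_y pw p I * p y *
        \tr ((Y (I t) - Y y) *m (Y (I t) - Y y) *m S (setf I t y) ^+ q.*2).
    rewrite -(resample p t (fun I y => G I t y)) /G.
    apply: eq_bigr => I _; apply: eq_bigr => y _; rewrite ffunE eqxx.
    by rewrite -opprB mulNmx mulmxN opprK.
  apply: (le_of_doubled sw swG); rewrite -!big_split /= mulr_sumr.
  apply: ler_sum => I _; rewrite -!big_split mulr_sumr; apply: ler_sum => y _ /=.
  rewrite -!mulrDr mulrCA ler_wpM2l // /B /G.
  have -> : \tr ((Y (I t) - Y y) *m S I ^+ k) + \tr ((Y y - Y (I t)) *m S (setf I t y) ^+ k)
     = \tr ((Y (I t) - Y y) *m (S I ^+ k - S (setf I t y) ^+ k)).
    by rewrite -(opprB (Y (I t))) mulNmx raddfN mulmxBr raddfB.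
  set D := Y (I t) - Y y.
  have hD : D^t* = D by rewrite adjB !Yadj.
  have tR : \tr (D *m (S I ^+ k - S (setf I t y) ^+ k)) \is Num.real.
    apply/CrealP; rewrite conj_trace adjM hD adjB !adj_exp //.
    exact: mxtrace_mulC.
  apply: le_trans (real_ler_norm tR) _.
  rewrite telescope_expr S_setf -/D mulmx_sumr raddf_sum /=.
  rewrite mulr_natl -[k in _ *+ k]card_ord -sumr_const.
  apply: le_trans (ler_norm_sum _ _ _) _; apply: ler_sum => i _.
  by rewrite !mulmxA; apply: trace_mixed_le => //; have := ltn_ord i; rewrite /k; lia.
have -> : E (fun I => \tr (S I ^+ q.+1.*2)) =
    \sum_t \sum_I \sum_y pw p I * p y * \tr (Y (I t) *m S I ^+ k).
  rewrite exchange_big; apply: eq_bigr => I _; rewrite exchange_big /=.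
  rewrite (eq_bigr (fun y => pw p I * p y * \tr (S I ^+ q.+1.*2))) => [|y _].
    by rewrite -mulr_suml -mulr_sumr p_sum mulr1.
  rewrite -mulr_sumr; congr (_ * _).
  by rewrite -raddf_sum -mulmx_suml -S_sumY doubleS [in RHS]exprS.
apply: (le_trans (ler_sum _ (fun t _ => step t))).
rewrite -mulr_sumr -!mulrA ler_wpM2l ?ler0n // exchange_big.
rewrite !mulr_sumr; apply: ler_sum => I _; rewrite exchange_big /=.
(* Summed over the [c] coordinates, the terms [X (I t)] give [c (S I + H)] and the mean of [X y]
   gives [c H]; this is the origin of [S I + 2 H]. *)
apply: (@le_trans _ _ (\sum_y pw p I * p y * (2 * rho / c%:R ^+ 2 *
   \sum_t (\tr (X (I t) *m S I ^+ q.*2) + \tr (X y *m S I ^+ q.*2))))).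
  apply: ler_sum => y _; rewrite -mulr_sumr ler_wpM2l // mulr_sumr.
  by apply: ler_sum => t _; rewrite /G PE tr_diff_le.
set P := S I ^+ q.*2.
have sX : \sum_t \tr (X (I t) *m P) = c%:R * \tr ((S I + H) *m P).
  rewrite -raddf_sum -mulmx_suml -mxtraceZ scalemxAl /emp_dev subrK scalerA.
  by rewrite mulfV // scale1r.
have sH : \sum_y p y * \tr (X y *m P) = \tr (H *m P).
  rewrite mulmx_suml raddf_sum; apply: eq_bigr => y _ /=.
  by rewrite -mxtraceZ scalemxAl.
rewrite (eq_bigr (fun y => pw p I * (2 * rho / c%:R) *
    (p y * \tr ((S I + H) *m P) + p y * \tr (X y *m P)))) => [|y _]; last first.
  rewrite big_split /= sX sumr_const card_ord -[_ *+ c]mulr_natl; field.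
  exact: c_neq0.
rewrite -mulr_sumr big_split /= -mulr_suml p_sum mul1r sH.
rewrite [leRHS]mulrA [X in _ <= X * _]mulrC -[leRHS]mulrA [leRHS]mulrCA.
have -> : \tr ((S I + 2 *: H) *m P) = \tr ((S I + H) *m P) + \tr (H *m P).
  by rewrite -raddfD -mulmxDl scaler_nat mulr2n addrA.
by rewrite le_eqVlt; apply/orP; left; apply/eqP; ring.
Qed.

Let mq q := E (fun I => \tr (S I ^+ q.*2)).

Let E_ge0 (F : {ffun 'I_c -> T} -> C) : (forall I, 0 <= F I) -> 0 <= E F.
Proof. by move=> F0; apply: sumr_ge0 => I _; rewrite mulr_ge0 ?pw_ge0. Qed.

Lemma tr_even_ge0 I q : 0 <= \tr (S I ^+ q.*2).
Proof.
rewrite -addnn exprD -mulmxE -{2}(adj_exp q (Sadj I)) -fsq_tr; exact: fsq_ge0.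
Qed.

Lemma trH_ge0 : 0 <= \tr H.
Proof.
rewrite raddf_sum; apply: sumr_ge0 => y _ /=; rewrite mxtraceZ mulr_ge0 //.
by rewrite -fsq_tr fsq_ge0.
Qed.

Let rho_ge0 : 0 <= rho.
Proof.
case: (pickP (fun y : T => true)) => [y _|no].
  exact: le_trans (fsq_ge0 _) (x_le y).
move: p_sum; rewrite big_pred0 // => /eqP; rewrite eq_sym oner_eq0 //.
Qed.

Let mean_S : \sum_I pw p I *: S I = 0.
Proof.
under eq_bigr do rewrite S_sumY scaler_sumr; rewrite exchange_big big1 //= => t _.
apply/matrixP => i j; rewrite summxE mxE.
pose G I y : C := (Y y) i j.
have := resample p t G; rewrite /G => e.
transitivity (\sum_I \sum_y pw p I * p y * Y (I t) i j).
  rewrite sum_free //; apply: eq_bigr => I _; by rewrite mxE.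
rewrite e big1 // => I _; under eq_bigr do rewrite -mulrA.
rewrite -mulr_sumr (_ : \sum_y _ = 0) ?mulr0 //.
have /matrixP/(_ i j) := Y_mean; rewrite summxE [X in _ = X -> _]mxE => e0.
by rewrite -[RHS]e0; apply: eq_bigr => y _; rewrite [RHS]mxE.
Qed.

(** Since [S] has mean zero, only [2 H] survives. Starting the recursion at [\tr H], rather than at
    the dimension times [h], is what produces the intrinsic dimension. *)
Let moment1 : mq 1 <= 4 * rho / c%:R * \tr H.
Proof.
apply: le_trans (moment_step 0) _; rewrite mul1r.
have -> : E (fun I => \tr ((S I + 2 *: H) *m S I ^+ 0.*2)) = 2 * \tr H.
  under eq_bigr do rewrite expr0 mulmx1 mxtraceD mxtraceZ mulrDr.
  rewrite big_split /= -mulr_suml sum_pw // mul1r -[RHS]add0r; congr (_ + _).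
  rewrite -[RHS](mxtrace0 C m) -mean_S raddf_sum; apply: eq_bigr => I _.
  by rewrite /= mxtraceZ.
by rewrite le_eqVlt; apply/orP; left; apply/eqP; field.
Qed.

(** From [H <= h] the second term is at most [2 h] times the trace, and [(S - h)^2 >= 0] splits the
    first one into the next moment over [2 h] plus [h / 2] times the present one; [2 + 1 / 2] is the
    [5 / 2]. *)
Let cross_le I q : \tr ((S I + 2 *: H) *m S I ^+ q.*2) <=
  (2 * h)^-1 * \tr (S I ^+ q.+1.*2) + (5%:R / 2 * h) * \tr (S I ^+ q.*2).
Proof.
set P := S I ^+ q.*2; pose R := S I ^+ q.
have PE : P = R *m R by rewrite /P -addnn exprD.
have hR : R^t* = R by apply: adj_exp.
rewrite mulmxDl mxtraceD -scalemxAl mxtraceZ.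
have H1 : \tr (H *m P) <= h * \tr P.
  have hRR k l : R k l = (R l k)^* by rewrite -adjE hR.
  have -> : \tr P = fsq R by rewrite PE fsq_tr hR.
  have -> : \tr (H *m P) = \sum_j ((col j R)^t* *m H *m col j R) 0 0.
    rewrite PE mulmxA mxtrace_mulC mulmxA; apply: eq_bigr => j _.
    rewrite [LHS]mxE [RHS]mxE; apply: eq_bigr => k _.
    rewrite [col j R k 0]mxE; congr (_ * _).
    by rewrite [LHS]mxE [RHS]mxE; apply: eq_bigr => l _; rewrite adjE [col j R _ _]mxE -hRR.
  rewrite /fsq exchange_big mulr_sumr; apply: ler_sum => j _ /=.
  apply: le_trans (H_le _) _; rewrite /fsq le_eqVlt; apply/orP; left; apply/eqP.
  by congr (_ * _); apply: eq_bigr => i _; rewrite big_ord1 mxE.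
have H2 : 2 * h * \tr (S I *m P) <= \tr (S I ^+ q.+1.*2) + h ^+ 2 * \tr P.
  have := @tr_psd_ge0 (S I - h%:M) R.
  rewrite adjB Sadj (_ : (h%:M)^t* = h%:M); last first.
    by rewrite -scalemx1 adj_scale adj1; congr (_ *: _); apply/CrealP/gtr0_real.
  move=> /(_ erefl hR); rewrite -PE.
  have -> : (S I - h%:M) *m (S I - h%:M) *m P =
     S I ^+ q.+1.*2 - (2 * h) *: (S I *m P) + h ^+ 2 *: P.
    rewrite doubleS [_ ^+ (q.*2).+2]exprS [_ ^+ (q.*2).+1]exprS -/P -!mulmxE.
    have expand (s P' : 'M[C]_m) : (s - h%:M) *m (s - h%:M) *m P' =
        s *m (s *m P') - (2 * h) *: (s *m P') + h ^+ 2 *: P'.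
      rewrite mulmxBl !mulmxBr !mul_scalar_mx !mul_mx_scalar !mulmxBl -!scalemxAl !mulmxA.
      move: (s *m s *m P') (s *m P') => a1 a2.
      by rewrite mul_scalar_mx; apply/matrixP => i j; rewrite !mxE; ring.
    exact: expand.
  rewrite mxtraceD raddfB /= !mxtraceZ => e; rewrite -subr_ge0; apply: le_trans e _.
  by rewrite le_eqVlt; apply/orP; left; apply/eqP; ring.
have h0 : h != 0 by rewrite gt_eqF.
have H3 : \tr (S I *m P) <= (2 * h)^-1 * (\tr (S I ^+ q.+1.*2) + h ^+ 2 * \tr P).
  by rewrite mulrC ler_pdivlMr ?mulr_gt0 // mulrC.
apply: le_trans (lerD H3 (ler_wpM2l _ H1)) _ => //.
by rewrite le_eqVlt; apply/orP; left; apply/eqP; field.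
Qed.

(** The side condition makes the factor [A] of the recursion at most [h], so the next moment returns
    on the right with coefficient at most [1 / 2] and is absorbed. What is left is the factor
    [2 A (5 h / 2) <= 20 Q rho h / c] per step. *)
Lemma moment_bound Q : (0 < Q)%N -> 4 * Q%:R * rho <= c%:R * h ->
  mq Q <= (20 * Q%:R * rho * h / c%:R) ^+ Q * (\tr H / h).
Proof.
case: Q => // Q _ Qle; set N := Q.+1 in Qle *.
have c0 : 0 < c%:R :> C by rewrite ltr0n.
have h0 : h != 0 by rewrite gt_eqF.
set w := 20 * N%:R * rho * h / c%:R.
have w0 : 0 <= w by rewrite divr_ge0 ?(ltW c0) // !mulr_ge0 // ltW.
suff: forall q, (q <= Q)%N -> mq q.+1 <= w ^+ q.+1 * (\tr H / h) by apply.
elim=> [|q IH] qQ.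
  apply: le_trans moment1 _; rewrite expr1.
  have -> : w * (\tr H / h) = (5 * N)%:R * (4 * rho / c%:R * \tr H).
    by rewrite /w natrM; field; rewrite h0 gt_eqF.
  rewrite ler_peMl ?ler1n ?muln_gt0 // mulr_ge0 ?trH_ge0 // divr_ge0 ?(ltW c0) //.
  by rewrite mulr_ge0.
apply: (@le_trans _ _ (w * mq q.+1)); last first.
  by rewrite exprS -mulrA ler_wpM2l // IH // ltnW.
set A := q.+1.*2.+1%:R * (2 * rho / c%:R) : C.
have rc : 0 <= 2 * rho / c%:R by rewrite divr_ge0 ?(ltW c0) // mulr_ge0.
have A0 : 0 <= A by rewrite mulr_ge0.
have Ale : A <= (2 * N)%:R * (2 * rho / c%:R).
  by rewrite ler_wpM2r // ler_nat; clear -qQ; rewrite /N; lia.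
have Ah : A <= h.
  apply: le_trans Ale _.
  have -> : (2 * N)%:R * (2 * rho / c%:R) = 4 * N%:R * rho / c%:R.
    by rewrite natrM; field; rewrite gt_eqF.
  by rewrite ler_pdivrMr // (mulrC h).
have m0 k : 0 <= mq k by apply: E_ge0 => I; apply: tr_even_ge0.
have st : mq q.+2 <= A * ((2 * h)^-1 * mq q.+2 + 5%:R / 2 * h * mq q.+1).
  apply: le_trans (moment_step _) _; rewrite -/A ler_wpM2l //.
  rewrite !mulr_sumr -big_split /=; apply: ler_sum => I _.
  by rewrite !(mulrCA _ (pw p I)) -mulrDr ler_wpM2l ?pw_ge0 //; apply: cross_le.
have st2 : mq q.+2 <= 2^-1 * mq q.+2 + 2^-1 * w * mq q.+1.
  apply: le_trans st _; rewrite mulrDr !mulrA lerD // ler_wpM2r //.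
    by rewrite ler_pdivrMr ?mulr_gt0 // mulrA mulVf ?mul1r // pnatr_eq0.
  apply: (@le_trans _ _ ((2 * N)%:R * (2 * rho / c%:R) * (5%:R / 2 * h))).
    have -> : A * 5%:R / 2 * h = A * (5%:R / 2 * h) by rewrite !mulrA.
    by rewrite ler_wpM2r // !mulr_ge0 ?invr_ge0 // ltW.
  by rewrite natrM le_eqVlt; apply/orP; left; apply/eqP; field; rewrite gt_eqF.
rewrite -(@ler_pM2l _ 2^-1) ?invr_gt0 // mulrA -(lerD2l (2^-1 * mq q.+2)).
apply: le_trans st2; rewrite -mulrDl le_eqVlt; apply/orP; left; apply/eqP.
by field.
Qed.

End Moments.

(** * Operator norm bounds *)

Section OpNorm.
Variable C : numClosedFieldType.

(** The relation that [b] bounds the operator norm, which makes sense without a supremum; [spec_opn]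
    and [spec_le] connect it with [spec_norm]. *)
Definition opn m n (M : 'M[C]_(m, n)) (b : C) : Prop :=
  forall v : 'cV[C]_n, fsq (M *m v) <= b ^+ 2 * fsq v.

Lemma fsq_cV m (x : 'cV[C]_m) : fsq x = \sum_i `|x i 0| ^+ 2.
Proof. by apply: eq_bigr => i _; rewrite big_ord1. Qed.

Lemma fsqZ m n (a : C) (M : 'M[C]_(m, n)) : fsq (a *: M) = `|a| ^+ 2 * fsq M.
Proof.
rewrite /fsq mulr_sumr; apply: eq_bigr => i _; rewrite mulr_sumr.
by apply: eq_bigr => j _; rewrite mxE normrM exprMn.
Qed.

Lemma fsq0_eq0 m n (M : 'M[C]_(m, n)) : fsq M <= 0 -> M = 0.
Proof.
move=> M0; have e : fsq M = 0 by apply/le_anti; rewrite M0 fsq_ge0.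
apply/matrixP => i j; rewrite mxE.
have e1 : \sum_j `|M i j| ^+ 2 = 0.
  apply: (psumr_eq0P _ e) => // k _; apply: sumr_ge0 => l _; exact: exprn_ge0.
have /eqP : `|M i j| ^+ 2 = 0 by apply: (psumr_eq0P _ e1) => // k _; exact: exprn_ge0.
by rewrite expf_eq0 normr_eq0 => /andP[_ /eqP].
Qed.

Lemma inner_le m (x z : 'cV[C]_m) :
  `|(x^t* *m z) 0 0| <= 2^-1 * (fsq x + fsq z).
Proof.
rewrite mxE !fsq_cV -big_split mulr_sumr; apply: le_trans (ler_norm_sum _ _ _) _.
apply: ler_sum => i _ /=; rewrite adjE normrM norm_conjC.
rewrite [leRHS]mulrC ler_pdivlMr // -subr_ge0.
have -> : `|x i 0| ^+ 2 + `|z i 0| ^+ 2 - `|x i 0| * `|z i 0| * 2 =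
  (`|x i 0| - `|z i 0|) ^+ 2 by ring.
by rewrite real_exprn_even_ge0 // rpredB ?normr_real.
Qed.

(** The bound is put as a half sum of squares rather than a product of norms. In this form it is
    additive, which serves [opnD] and, after masking of coordinates, the Schur multiplier. *)
Lemma opn_bil m n (M : 'M[C]_(m, n)) (b : C) : 0 <= b -> opn M b ->
  forall (x : 'cV_m) (y : 'cV_n), `|(x^t* *m M *m y) 0 0| <= b / 2 * (fsq x + fsq y).
Proof.
move=> b0 Mb x y; rewrite -mulmxA; have := Mb y.
rewrite le_eqVlt in b0; case/orP: b0 => [/eqP<-|b0].
  rewrite expr0n mul0r => /fsq0_eq0 ->.
  by rewrite mulmx0 mxE normr0 !mul0r.
move=> My; rewrite -(ler_pM2l b0).
have -> : b * `|(x^t* *m (M *m y)) 0 0| = `|((b *: x)^t* *m (M *m y)) 0 0|.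
  rewrite adj_scale -scalemxAl [in RHS]mxE normrM norm_conjC.
  by rewrite (ger0_norm (ltW b0)).
apply: le_trans (inner_le _ _) _; rewrite fsqZ (ger0_norm (ltW b0)).
have -> : b * (b / 2 * (fsq x + fsq y)) = 2^-1 * (b ^+ 2 * fsq x + b ^+ 2 * fsq y).
  by ring.
by rewrite ler_pM2l ?invr_gt0 // lerD2l.
Qed.

(** The form is tested at [x = b^-1 M v], the scaling that balances the two squares. *)
Lemma bil_opn m n (M : 'M[C]_(m, n)) (b : C) : 0 <= b ->
  (forall (x : 'cV_m) (y : 'cV_n), `|(x^t* *m M *m y) 0 0| <= b / 2 * (fsq x + fsq y)) -> opn M b.
Proof.
move=> b0 Mb v; set z := M *m v.
have zz : (z^t* *m z) 0 0 = fsq z by rewrite fsq_trl /mxtrace big_ord1.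
rewrite le_eqVlt in b0; case/orP: b0 => [/eqP b0|b0].
  have := Mb z v; rewrite -mulmxA -/z zz -b0 !mul0r normr_le0 => /eqP ->.
  by rewrite expr0n mul0r.
have := Mb (b^-1 *: z) v; rewrite -mulmxA -/z adj_scale -scalemxAl mxE zz fsqZ.
rewrite geC0_conj ?invr_ge0 ?(ltW b0) // ger0_norm ?mulr_ge0 ?fsq_ge0 ?invr_ge0 ?(ltW b0) //.
rewrite ger0_norm ?invr_ge0 ?(ltW b0) // => e.
rewrite -(@ler_pM2l _ (b^-1 / 2)) ?divr_gt0 ?invr_gt0 //.
rewrite -(lerD2l (b^-1 / 2 * fsq z)); apply: le_trans (le_trans _ e) _.
  by rewrite le_eqVlt; apply/orP; left; apply/eqP; field; rewrite gt_eqF.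
by rewrite le_eqVlt; apply/orP; left; apply/eqP; field; rewrite gt_eqF.
Qed.

Lemma opnD m n (M N : 'M[C]_(m, n)) (a b : C) : 0 <= a -> 0 <= b ->
  opn M a -> opn N b -> opn (M + N) (a + b).
Proof.
move=> a0 b0 Ma Nb; apply: bil_opn; first exact: addr_ge0.
move=> x y; rewrite mulmxDr mulmxDl mxE !mulrDl.
by apply: le_trans (ler_normD _ _) _; rewrite lerD // opn_bil.
Qed.

Lemma opnZ m n (M : 'M[C]_(m, n)) (a b : C) : opn M b -> opn (a *: M) (`|a| * b).
Proof.
move=> Mb v; rewrite -scalemxAl fsqZ exprMn -[leRHS]mulrA ler_wpM2l ?exprn_ge0 //.
Qed.

Lemma opnN m n (M : 'M[C]_(m, n)) (b : C) : opn M b -> opn (- M) b.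
Proof.
by move=> Mb v; have := @opnZ _ _ M (-1) b Mb v; rewrite scaleN1r normrN1 mul1r.
Qed.

Lemma opnB m n (M N : 'M[C]_(m, n)) (a b : C) : 0 <= a -> 0 <= b ->
  opn M a -> opn N b -> opn (M - N) (a + b).
Proof. by move=> a0 b0 Ma Nb; apply: opnD => //; apply: opnN. Qed.

Lemma opnM m n p (M : 'M[C]_(m, n)) (N : 'M[C]_(n, p)) (a b : C) :
  0 <= a -> opn M a -> opn N b -> opn (M *m N) (a * b).
Proof.
move=> a0 Ma Nb v; rewrite -mulmxA; apply: le_trans (Ma _) _.
by rewrite exprMn -[leRHS]mulrA ler_wpM2l ?exprn_ge0.
Qed.

Lemma opnW m n (M : 'M[C]_(m, n)) (a b : C) : 0 <= a -> a <= b -> opn M a -> opn M b.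
Proof.
move=> a0 ab Ma v; apply: le_trans (Ma v) _; rewrite ler_wpM2r ?fsq_ge0 //.
by rewrite lerXn2r ?nnegrE // (le_trans a0).
Qed.

Lemma opn_adj m n (M : 'M[C]_(m, n)) (b : C) : 0 <= b -> opn M b -> opn (M^t*) b.
Proof.
move=> b0 Mb; apply: bil_opn => // x y.
rewrite -norm_conjC -adjE !adjM !trmxCK mulmxA (addrC (fsq x)).
exact: opn_bil.
Qed.

(** Cauchy-Schwarz, from [inner_le] with [u] rescaled by the optimal factor [|z| / s]. *)
Lemma inner_sq_le m (u v : 'cV[C]_m) :
  `|(u^t* *m v) 0 0| ^+ 2 <= fsq u * fsq v.
Proof.
set z := (u^t* *m v) 0 0; have s0 := fsq_ge0 u; set s := fsq u in s0 *.
rewrite le_eqVlt in s0; case/orP: s0 => [/eqP s0|s0].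
  have u0 : u = 0 by apply: fsq0_eq0; rewrite -/s -s0.
  by rewrite -s0 mul0r /z u0 mxE big1 ?normr0 ?expr0n // => i _; rewrite adjE mxE conjC0 mul0r.
have := inner_le ((`|z| / s) *: u) v.
rewrite adj_scale -scalemxAl mxE -/z normrM norm_conjC fsqZ -/s normrM normr_id.
rewrite normfV (ger0_norm (ltW s0)) => e.
rewrite -(ler_pM2l (_ : 0 < s^-1 / 2)) ?divr_gt0 ?invr_gt0 //.
rewrite -(lerD2l (s^-1 / 2 * `|z| ^+ 2)); apply: le_trans (le_trans _ e) _.
  by rewrite le_eqVlt; apply/orP; left; apply/eqP; field; rewrite gt_eqF.
by rewrite le_eqVlt; apply/orP; left; apply/eqP; field; rewrite gt_eqF.
Qed.

Lemma opn_fsq m n (M : 'M[C]_(m, n)) (b : C) : fsq M <= b ^+ 2 -> opn M b.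
Proof.
move=> Mb v; apply: le_trans (ler_wpM2r (fsq_ge0 v) Mb).
rewrite fsq_cV [fsq M]/fsq mulr_suml; apply: ler_sum => i _.
have -> : (M *m v) i 0 = ((\col_j (M i j)^*)^t* *m v) 0 0.
  by rewrite [LHS]mxE [RHS]mxE; apply: eq_bigr => j _; rewrite adjE mxE conjCK.
apply: le_trans (inner_sq_le _ _) _; rewrite le_eqVlt; apply/orP; left; apply/eqP.
by congr (_ * _); rewrite fsq_cV; apply: eq_bigr => j _; rewrite mxE norm_conjC.
Qed.

Lemma opn_unitary n (U : 'M[C]_n) : U \is unitarymx -> opn U 1.
Proof. by move=> UU v; rewrite expr1n mul1r fsqUl // unitary_adjl. Qed.

Lemma opn_diag n (d : 'rV[C]_n) (b : C) : (forall i, `|d 0 i| <= b) -> opn (diag_mx d) b.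
Proof.
move=> db v; rewrite !fsq_cV mulr_sumr; apply: ler_sum => i _.
rewrite diag_mulE normrM exprMn ler_wpM2r ?exprn_ge0 // lerXn2r ?nnegrE //.
exact: le_trans (normr_ge0 _) (db i).
Qed.

Lemma opn_spectral n (U : 'M[C]_n) (d : 'rV[C]_n) (b : C) : 0 <= b -> U \is unitarymx ->
  (forall i, `|d 0 i| <= b) -> opn (U^t* *m diag_mx d *m U) b.
Proof.
move=> b0 UU db; rewrite -[b]mulr1 -[b * 1]mul1r mulrA.
apply: opnM; [by rewrite mul1r| |exact: opn_unitary].
by apply: opnM => //; [apply: opn_unitary; rewrite trmxC_unitary|apply: opn_diag].
Qed.

Lemma opn_eigen n (U : 'M[C]_n) (d : 'rV[C]_n) (b : C) : 0 <= b -> U \is unitarymx ->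
  opn (U^t* *m diag_mx d *m U) b -> forall i, `|d 0 i| <= b.
Proof.
move=> b0 UU Sb i.
have := Sb (U^t* *m delta_mx i (0 : 'I_1)).
have -> : U^t* *m diag_mx d *m U *m (U^t* *m delta_mx i (0 : 'I_1)) =
   d 0 i *: (U^t* *m delta_mx i 0).
  rewrite !mulmxA mulmxtVK // -mulmxA scalemxAr; congr (_ *m _).
  apply/matrixP => k l; rewrite diag_mulE !mxE.
  by case: (k =P i) => [->|]; rewrite ?mulr0.
rewrite fsqZ fsqUl; last by rewrite trmxCK (unitarymxP UU).
have -> : fsq (delta_mx i 0 : 'cV[C]_n) = 1.
  rewrite fsq_cV (bigD1 i) //= mxE !eqxx normr1 expr1n big1 ?addr0 // => k /negbTE ki.
  by rewrite mxE ki normr0 expr0n.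
by rewrite !mulr1 ler_sqr ?nnegrE.
Qed.

(** Each eigenvalue to the power [2q] is one of the nonnegative summands of the trace. *)
Lemma moment_opn n (S : 'M[C]_n) q (e : C) : S^t* = S -> 0 <= e -> (0 < q)%N ->
  \tr (S ^+ q.*2) <= e ^+ q.*2 -> opn S e.
Proof.
move=> /herm_spectral[U [d [UU dR ->]]] e0 q0; rewrite spectral_exp //.
have -> : \tr (U^t* *m diag_mx (\row_i d 0 i ^+ q.*2) *m U) = \sum_i d 0 i ^+ q.*2.
  rewrite mxtrace_mulC mulmxA (unitarymxP UU) mul1mx mxtrace_diag.
  by apply: eq_bigr => i _; rewrite mxE.
move=> le_e; apply: opn_spectral => // i.
rewrite -(@ler_pXn2r _ q.*2) ?nnegrE ?double_gt0 // norm_even_exp //.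
apply: le_trans le_e; rewrite (bigD1 i) //= lerDl sumr_ge0 // => k _.
exact: even_exp_ge0.
Qed.

End OpNorm.

(** * Euclidean geometry of column vectors *)

Section Hilbert.
Variables (C : numClosedFieldType) (n : nat).
Implicit Types (u v w : 'cV[C]_n).

Definition ip u v : C := (u^t* *m v) 0 0.
Definition nrm u : C := sqrtC (fsq u).

Lemma nrm_ge0 u : 0 <= nrm u. Proof. by rewrite sqrtC_ge0 fsq_ge0. Qed.
Lemma nrm_sq u : nrm u ^+ 2 = fsq u. Proof. exact: sqrtCK. Qed.
Lemma ip_fsq u : ip u u = fsq u. Proof. by rewrite /ip fsq_trl /mxtrace big_ord1. Qed.
Lemma ipDr u v w : ip u (v + w) = ip u v + ip u w.
Proof. by rewrite /ip mulmxDr mxE. Qed.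
Lemma ipZr u (a : C) v : ip u (a *: v) = a * ip u v.
Proof. by rewrite /ip -scalemxAr mxE. Qed.
Lemma ipDl u v w : ip (u + v) w = ip u w + ip v w.
Proof. by rewrite /ip adjD mulmxDl mxE. Qed.
Lemma ipNl u v : ip (- u) v = - ip u v.
Proof. by rewrite /ip -scaleN1r adj_scale -scalemxAl mxE rmorphN1 mulN1r. Qed.
Lemma ipNr u v : ip u (- v) = - ip u v.
Proof. by rewrite -scaleN1r ipZr mulN1r. Qed.
Lemma ip_suml I (r : seq I) (F : I -> 'cV[C]_n) v :
  ip (\sum_(i <- r) F i) v = \sum_(i <- r) ip (F i) v.
Proof. by rewrite /ip adj_sum mulmx_suml summxE. Qed.

Lemma CS u v : `|ip u v| <= nrm u * nrm v.
Proof.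
rewrite -(@ler_pXn2r _ 2) ?nnegrE ?mulr_ge0 ?nrm_ge0 // exprMn !nrm_sq.
exact: inner_sq_le.
Qed.

Lemma nrmD u v : nrm (u + v) <= nrm u + nrm v.
Proof.
rewrite -(@ler_pXn2r _ 2) ?nnegrE ?addr_ge0 ?nrm_ge0 //.
have e : fsq (u + v) = fsq u + (ip u v + ip v u) + fsq v.
  by rewrite -!ip_fsq ipDl !ipDr; ring.
rewrite sqrrD !nrm_sq -[leLHS]ger0_norm ?fsq_ge0 // e.
apply: le_trans (ler_normD _ _) _; rewrite (ger0_norm (fsq_ge0 v)) lerD2r.
apply: le_trans (ler_normD _ _) _; rewrite (ger0_norm (fsq_ge0 u)) lerD2l.
by apply: le_trans (ler_normD _ _) _; rewrite mulr2n lerD ?CS // mulrC CS.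
Qed.

Lemma nrmN u : nrm (- u) = nrm u.
Proof. by rewrite /nrm -scaleN1r fsqZ normrN1 expr1n mul1r. Qed.

Lemma nrmB u v : nrm (u - v) <= nrm u + nrm v.
Proof. by rewrite -(nrmN v) nrmD. Qed.

Lemma nrm_dist u v : `|nrm u - nrm v| <= nrm (u - v).
Proof.
have rr : nrm u - nrm v \is Num.real by rewrite rpredB // ger0_real ?nrm_ge0.
rewrite real_ler_norml //; apply/andP; split.
  by rewrite lerNl opprB lerBlDr; have := nrmD (v - u) u; rewrite subrK -(nrmN (u - v)) opprB.
by rewrite lerBlDr; have := nrmD (u - v) v; rewrite subrK.
Qed.

Lemma fsqB_le u v : fsq (u - v) <= 2 * (fsq u + fsq v).
Proof.
have := fsq_ge0 (u + v); rewrite -!ip_fsq !ipDl !ipDr !ipNl !ipNr.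
move=> e; rewrite -subr_ge0; apply: le_trans e _.
by rewrite le_eqVlt; apply/orP; left; apply/eqP; ring.
Qed.

Lemma dist_exp (a b M : C) k : 0 <= a -> 0 <= b -> a <= M -> b <= M ->
  `|a ^+ k.+1 - b ^+ k.+1| <= `|a - b| * (k.+1%:R * M ^+ k).
Proof.
move=> a0 b0 aM bM; rewrite subrXX normrM ler_wpM2l //.
have M0 := le_trans a0 aM.
apply: le_trans (ler_norm_sum _ _ _) _.
rewrite mulr_natl -[k.+1 in X in _ <= X]card_ord -sumr_const; apply: ler_sum => i _.
rewrite ger0_norm ?mulr_ge0 ?exprn_ge0 //.
apply: (@le_trans _ _ (M ^+ (k.+1 - i.+1) * M ^+ i)).
  by rewrite ler_pM ?exprn_ge0 // lerXn2r ?nnegrE.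
by rewrite -exprD subSS subnK // -ltnS.
Qed.

(** The field [u |-> |u|^(2q) u] is, up to a factor, the gradient of [|u|^(2q+2)]. Of its Lipschitz
    constant [(2q + 1) M^(2q)] the part [2q] comes from the change of the modulus and [1] from
    [u - v] itself. *)
Lemma power_field_le u v M q : nrm u <= M -> nrm v <= M ->
  `|ip (u - v) (fsq u ^+ q *: u - fsq v ^+ q *: v)| <=
  q.*2.+1%:R * M ^+ q.*2 * fsq (u - v).
Proof.
move=> uM vM; have M0 := le_trans (nrm_ge0 u) uM.
have -> : fsq u ^+ q *: u - fsq v ^+ q *: v =
    fsq u ^+ q *: (u - v) + (fsq u ^+ q - fsq v ^+ q) *: v.
  by rewrite scalerBr scalerBl addrA subrK.
rewrite ipDr !ipZr; apply: le_trans (ler_normD _ _) _.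
rewrite normrM ip_fsq (ger0_norm (fsq_ge0 _)) ger0_norm ?exprn_ge0 ?fsq_ge0 //.
have -> : q.*2.+1%:R * M ^+ q.*2 * fsq (u - v) =
  q.*2%:R * M ^+ q.*2 * fsq (u - v) + M ^+ q.*2 * fsq (u - v) by rewrite -natr1; ring.
rewrite addrC lerD //.
  rewrite normrM; case: q => [|q]; first by rewrite !expr0 subrr normr0 !mul0r.
  rewrite -!nrm_sq -!exprM mul2n doubleS.
  apply: (@le_trans _ _ (nrm (u - v) * (q.*2.+2%:R * M ^+ q.*2.+1) * (nrm (u - v) * M))).
    rewrite ler_pM //.
      apply: le_trans (dist_exp _ (nrm_ge0 _) (nrm_ge0 _) uM vM) _.
      by rewrite ler_wpM2r ?nrm_dist // mulr_ge0 ?exprn_ge0.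
    by apply: le_trans (CS _ _) _; rewrite ler_wpM2l ?nrm_ge0.
  by rewrite le_eqVlt; apply/orP; left; apply/eqP; rewrite [M ^+ q.*2.+2]exprS; ring.
rewrite ler_wpM2r ?fsq_ge0 // -nrm_sq -exprM mul2n lerXn2r ?nnegrE ?nrm_ge0 //.
Qed.

End Hilbert.

(** * Concentration of sums of independent vectors *)

Section Bernstein.
Variables (C : numClosedFieldType) (T : finType) (p : T -> C) (n c : nat).
Variables (Z : T -> 'cV[C]_n) (b vr : C).
Hypothesis p_ge0 : forall y, 0 <= p y.
Hypothesis p_sum : \sum_y p y = 1.
Hypothesis b_ge0 : 0 <= b.
Hypothesis Z_le : forall y, fsq (Z y) <= b ^+ 2.
Hypothesis Z_var : \sum_y p y * fsq (Z y) <= vr.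
Implicit Types (I : {ffun 'I_c -> T}).
Let mu : 'cV[C]_n := \sum_y p y *: Z y.
Definition sum_dev I : 'cV[C]_n := \sum_t (Z (I t) - mu).
Local Notation S := sum_dev.
Local Notation E F := (\sum_I pw p I * F I).

Let S_setf I t y : S I - S (setf I t y) = Z (I t) - Z y.
Proof.
rewrite /S (bigD1 t) //= [X in _ - X](bigD1 t) //= ffunE eqxx.
rewrite [X in _ - (_ + X)](eq_bigr (fun s => Z (I s) - mu)).
  by rewrite opprD addrACA subrr addr0 opprB addrA subrK.
by move=> s /negbTE st; rewrite ffunE st.
Qed.

Let Z_le' y : nrm (Z y) <= b.
Proof. by rewrite -(@ler_pXn2r _ 2) ?nnegrE ?nrm_ge0 // nrm_sq. Qed.

Let vr_ge0 : 0 <= vr.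
Proof. by apply: le_trans Z_var; apply: sumr_ge0 => y _; rewrite mulr_ge0 ?fsq_ge0. Qed.

Let pp I y : 0 <= pw p I * p y. Proof. by rewrite mulr_ge0 ?pw_ge0. Qed.

Let nrm_setf I t y : nrm (S (setf I t y)) <= nrm (S I) + 2 * b.
Proof.
rewrite -[S (setf _ _ _)](subrK (S I)) addrC; apply: le_trans (nrmD _ _) _.
rewrite lerD2l -nrmN opprB S_setf; apply: le_trans (nrmB _ _) _.
by rewrite mulr_natl mulr2n lerD.
Qed.

Let nrm_setf' I t y : nrm (S I) <= nrm (S (setf I t y)) + 2 * b.
Proof.
rewrite -[S I](subrK (S (setf I t y))) addrC; apply: le_trans (nrmD _ _) _.
rewrite lerD2l S_setf; apply: le_trans (nrmB _ _) _.
by rewrite mulr_natl mulr2n lerD.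
Qed.

Let Zmean (F : {ffun 'I_c -> T} -> 'cV[C]_n) :
  \sum_I \sum_y pw p I * p y * ip (Z y - mu) (F I) = 0.
Proof.
rewrite big1 // => I _; under eq_bigr do rewrite -mulrA.
rewrite -mulr_sumr (_ : \sum_y _ = 0) ?mulr0 //.
under eq_bigr do rewrite ipDl mulrDr.
rewrite big_split /= -mulr_suml p_sum mul1r ipNl -[mu in X in _ - X]/mu.
rewrite ip_suml; apply/eqP; rewrite subr_eq0; apply/eqP.
by apply: eq_bigr => y _; rewrite /ip adj_scale -scalemxAl [RHS]mxE geC0_conj.
Qed.

(** The exchangeable pair again, now for [|S|^(2q+2) = <S, |S|^(2q) S>]. Each [|Z|^2] is paired with
    the sum from which that sample is absent, so that the expectation factors. Resampling moves the
    sum by at most [2 b], and the passage to the sum without the sample costs another [2 b];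
    together this is the [4 b]. *)
Lemma bernstein_step q :
  E (fun I => fsq (S I) ^+ q.+1) <=
  (4 * q + 2)%:R * (c%:R * vr) * E (fun I => (nrm (S I) + 4 * b) ^+ q.*2).
Proof.
pose Fq I := fsq (S I) ^+ q *: S I.
pose W I (y : T) := (nrm (S I) + 4 * b) ^+ q.*2 * fsq (Z y).
have nb I : 0 <= nrm (S I) + 4 * b by rewrite addr_ge0 ?nrm_ge0 ?mulr_ge0.
have W_le : \sum_I \sum_y pw p I * p y * W I y <=
    vr * E (fun I => (nrm (S I) + 4 * b) ^+ q.*2).
  rewrite mulr_sumr; apply: ler_sum => I _; rewrite /W.
  under eq_bigr do rewrite -mulrA (mulrCA (p _)).
  rewrite -mulr_sumr mulrCA ler_wpM2l ?pw_ge0 // -mulr_sumr mulrC.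
  by rewrite ler_wpM2r ?exprn_ge0.
have step t : `|\sum_I \sum_y pw p I * p y * ip (Z (I t) - mu) (Fq I)| <=
    (4 * q + 2)%:R * (vr * E (fun I => (nrm (S I) + 4 * b) ^+ q.*2)).
  pose B I y := ip (Z (I t) - Z y) (Fq I).
  have -> : \sum_I \sum_y pw p I * p y * ip (Z (I t) - mu) (Fq I) =
      \sum_I \sum_y pw p I * p y * B I y.
    rewrite -[LHS]subr0 -[X in _ - X](Zmean Fq) -sumrB; apply: eq_bigr => I _.
    rewrite -sumrB; apply: eq_bigr => y _; rewrite -mulrBr; congr (_ * _).
    by rewrite /B -ipNl -ipDl opprB addrA subrK.
  have sw : \sum_I \sum_y pw p I * p y * B I y =
     \sum_I \sum_y pw p I * p y * ip (Z y - Z (I t)) (Fq (setf I t y)).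
    rewrite -(resample p t) /B; apply: eq_bigr => I _; apply: eq_bigr => y _.
    by rewrite ffunE eqxx.
  have swW := resample p t W.
  have dbl (x : C) (k : C) : `|x + x| <= 2 * k -> `|x| <= k.
    by rewrite -[x + x]mulr2n -[x *+ 2]mulr_natl normrM ger0_norm // ler_pM2l.
  apply: dbl; rewrite [X in _ + X]sw -big_split /=.
  apply: (@le_trans _ _ (\sum_I \sum_y pw p I * p y *
      ((4 * q + 2)%:R * (W I y + W (setf I t y) (I t))))).
    apply: le_trans (ler_norm_sum _ _ _) _; apply: ler_sum => I _.
    rewrite -big_split /=; apply: le_trans (ler_norm_sum _ _ _) _.
    apply: ler_sum => y _; rewrite -mulrDr normrM (ger0_norm (pp _ _)) ler_wpM2l //.
    rewrite /B -(opprB (Z (I t))) ipNl -ipNr -ipDr -(S_setf I t y).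
    have M0 : 0 <= nrm (S I) + 2 * b by rewrite addr_ge0 ?nrm_ge0 ?mulr_ge0.
    have M1 : nrm (S I) <= nrm (S I) + 2 * b by rewrite lerDl mulr_ge0.
    apply: le_trans (power_field_le q M1 (nrm_setf I t y)) _.
    rewrite S_setf (_ : (4 * q + 2)%N = (q.*2.+1 * 2)%N); last by lia.
    rewrite natrM -!mulrA ler_wpM2l //.
    apply: le_trans (ler_wpM2l _ (fsqB_le _ _)) _; first exact: exprn_ge0.
    rewrite mulrCA ler_wpM2l // mulrDr addrC lerD // /W ?ffunE ?eqxx ler_wpM2r ?fsq_ge0 //.
      by rewrite lerXn2r ?nnegrE // lerD2l ler_wpM2r // ler_nat.
    rewrite lerXn2r ?nnegrE //.
    have -> : 4 * b = 2 * b + 2 * b by ring.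
    by rewrite addrA lerD2r nrm_setf'.
  rewrite (eq_bigr (fun I => (4 * q + 2)%:R * (\sum_y pw p I * p y * W I y +
      \sum_y pw p I * p y * W (setf I t y) (I t)))) => [|I _]; last first.
    by rewrite -big_split mulr_sumr; apply: eq_bigr => y _; rewrite /= mulrCA mulrDr.
  rewrite -mulr_sumr big_split /= swW -mulr2n -[X in _ * X]mulr_natl mulrCA.
  by rewrite ler_pM2l // ler_wpM2l // W_le.
have E0 : 0 <= E (fun I => fsq (S I) ^+ q.+1).
  by apply: sumr_ge0 => I _; rewrite mulr_ge0 ?pw_ge0 // exprn_ge0 ?fsq_ge0.
have EE : E (fun I => fsq (S I) ^+ q.+1) =
    \sum_t \sum_I \sum_y pw p I * p y * ip (Z (I t) - mu) (Fq I).
  rewrite exchange_big; apply: eq_bigr => I _; rewrite exchange_big /=.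
  rewrite (eq_bigr (fun y => pw p I * p y * fsq (S I) ^+ q.+1)) => [|y _].
    by rewrite -mulr_suml -mulr_sumr p_sum mulr1.
  rewrite -mulr_sumr; congr (_ * _).
  by rewrite -ip_suml -/(S I) /Fq ipZr ip_fsq exprSr.
rewrite -(ger0_norm E0) EE.
apply: le_trans (ler_norm_sum _ _ _) _.
apply: (le_trans (ler_sum _ (fun t _ => step t))).
rewrite sumr_const card_ord -mulr_natl le_eqVlt; apply/orP; left; apply/eqP; ring.
Qed.

(** By induction [(1 + x)^j (1 - j x) <= 1], and the second factor is at least [1 / 2] at
    [j = k]. *)
Lemma bernoulli_inv (x : C) k : 0 <= x -> k%:R * x <= 2^-1 -> (1 + x) ^+ k <= 2.
Proof.
move=> x0 kx; have B : forall j, (j <= k)%N -> (1 + x) ^+ j * (1 - j%:R * x) <= 1.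
  elim=> [|j IH] jk; first by rewrite mul0r subr0 mulr1.
  apply: le_trans (IH (ltnW jk)); rewrite exprSr -mulrA ler_wpM2l ?exprn_ge0 ?addr_ge0 //.
  rewrite -subr_ge0 -natr1.
  have -> : 1 - j%:R * x - (1 + x) * (1 - (j%:R + 1) * x) = (j%:R + 1) * x ^+ 2 by ring.
  by rewrite mulr_ge0 ?addr_ge0 ?exprn_ge0.
have := B k (leqnn k) => e.
rewrite -(@ler_pM2r _ 2^-1) ?invr_gt0 // mulfV ?pnatr_eq0 //; apply: le_trans e.
rewrite ler_wpM2l ?exprn_ge0 ?addr_ge0 // lerBrDr -lerBrDl.
by apply: le_trans kx _; rewrite le_eqVlt; apply/orP; left; apply/eqP; field.
Qed.

(** Once the shift by [4 b] is removed, each step multiplies by at most [4 Q (c vr) 3], which is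
    below [16 Q (c vr) <= U]. *)
Lemma bernstein_bound Q (U : C) : (0 < Q)%N ->
  16 * Q%:R * (c%:R * vr) <= U -> (20 * Q%:R * b) ^+ 2 <= U ->
  E (fun I => fsq (S I) ^+ Q) <= U ^+ Q.
Proof.
move=> Q0 U1 U2.
have U0 : 0 <= U by apply: le_trans U2; rewrite exprn_ge0 // !mulr_ge0.
suff: forall q, (q <= Q)%N -> E (fun I => fsq (S I) ^+ q) <= U ^+ q by apply.
elim=> [|q IH] qQ.
  by rewrite expr0; under eq_bigr do rewrite mulr1; rewrite sum_pw.
apply: le_trans (bernstein_step q) _.
have cv : 0 <= c%:R * vr by rewrite mulr_ge0.
have h1 I : (nrm (S I) + 4 * b) ^+ q.*2 <= 2 * fsq (S I) ^+ q + U ^+ q.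
  have s0 := nrm_ge0 (S I).
  have bQ0 : 0 <= 16 * Q%:R * b by rewrite !mulr_ge0.
  have nb : 0 <= nrm (S I) + 4 * b by rewrite addr_ge0 ?mulr_ge0.
  (* When [|S|] is at least [16 Q b], the shift by [4 b] is a factor [1 + 1 / (4 Q)], whose power
     [2q] is at most [2]; otherwise the whole base is below [20 Q b], hence its square below [U]. *)
  case: (real_leP (ger0_real bQ0) (ger0_real s0)) => sb.
    apply: (@le_trans _ _ (2 * fsq (S I) ^+ q)); last by rewrite lerDl exprn_ge0.
    have q4 : 0 < (4 * Q)%:R :> C by rewrite ltr0n muln_gt0.
    apply: (@le_trans _ _ ((nrm (S I) * (1 + (4 * Q)%:R^-1)) ^+ q.*2)).
      rewrite lerXn2r ?nnegrE ?mulr_ge0 ?addr_ge0 ?invr_ge0 ?ler0n ?mulr_ge0 //.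
      rewrite mulrDr mulr1 lerD2l ler_pdivlMr // natrM; apply: le_trans sb.
      by rewrite le_eqVlt; apply/orP; left; apply/eqP; ring.
    rewrite exprMn -nrm_sq -exprM mul2n mulrC ler_wpM2r ?exprn_ge0 //.
    apply: bernoulli_inv; first by rewrite invr_ge0 ler0n.
    rewrite ler_pdivrMr // mulrC ler_pdivlMr // -natrM ler_nat; clear -qQ; lia.
  apply: (@le_trans _ _ (U ^+ q)); last by rewrite lerDr mulr_ge0 // exprn_ge0 // fsq_ge0.
  rewrite -mul2n exprM lerXn2r ?nnegrE ?exprn_ge0 //; apply: le_trans U2.
  rewrite lerXn2r ?nnegrE ?mulr_ge0 //; apply: le_trans (lerD (ltW sb) (lexx _)) _.
  have -> : 20 * Q%:R * b = 16 * Q%:R * b + 4 * Q%:R * b by ring.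
  by rewrite lerD2l ler_wpM2r // ler_peMr // ler1n.
apply: (@le_trans _ _ ((4 * Q)%:R * (c%:R * vr) * (3 * U ^+ q))).
  apply: ler_pM; rewrite ?mulr_ge0 //.
  - by apply: sumr_ge0 => I _; rewrite mulr_ge0 ?pw_ge0 ?exprn_ge0 ?addr_ge0 ?nrm_ge0 ?mulr_ge0.
  - by rewrite ler_wpM2r // ler_nat; clear -qQ; lia.
  apply: (@le_trans _ _ (2 * E (fun I => fsq (S I) ^+ q) + U ^+ q)).
    have -> : U ^+ q = \sum_(I : {ffun 'I_c -> T}) pw p I * U ^+ q by rewrite -mulr_suml sum_pw // mul1r.
    rewrite mulr_sumr -big_split /=.
    by apply: ler_sum => I _; rewrite mulrCA -mulrDr ler_wpM2l ?pw_ge0.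
  have -> : 3 * U ^+ q = 2 * U ^+ q + U ^+ q by ring.
  by rewrite lerD2r ler_wpM2l // IH // ltnW.
rewrite exprS mulrA ler_wpM2r ?exprn_ge0 //; apply: le_trans U1.
rewrite natrM -subr_ge0.
have -> : 16 * Q%:R * (c%:R * vr) - 4 * Q%:R * (c%:R * vr) * 3 = 4 * Q%:R * (c%:R * vr) by ring.
by rewrite !mulr_ge0.
Qed.

End Bernstein.

(** * Harmonic sums *)

Section Harmonic.
Variable C : numClosedFieldType.

Definition harm K : C := \sum_(1 <= j < K.+1) j%:R^-1.

Lemma harm_mono k K : (k <= K)%N -> harm k <= harm K.
Proof.
move=> kK; rewrite /harm (@big_cat_nat _ _ _ k.+1 1 K.+1) //= lerDl.
by apply: sumr_ge0 => i _; rewrite invr_ge0.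
Qed.

Lemma harm_ge0 K : 0 <= harm K.
Proof. by apply: sumr_ge0 => i _; rewrite invr_ge0. Qed.

(** Each of the [k] dyadic blocks of reciprocals sums to at most [1]. *)
Lemma harm_log k K : (K < 2 ^ k)%N -> harm K <= k%:R.
Proof.
move=> Kk; apply: (@le_trans _ _ (harm (2 ^ k).-1)).
  by apply: harm_mono; move: Kk; case: (2 ^ k)%N.
rewrite /harm prednK ?expn_gt0 // {Kk}; elim: k => [|k IH]; first by rewrite big_geq.
rewrite (@big_cat_nat _ _ _ (2 ^ k)) ?expn_gt0 ?leq_exp2l //= -natr1 lerD //.
apply: (@le_trans _ _ (\sum_(2 ^ k <= i < 2 ^ k.+1) (2 ^ k)%:R^-1)).
  rewrite big_nat [leRHS]big_nat; apply: ler_sum => i /andP[ki _].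
  by rewrite lef_pV2 ?posrE ?ltr0n ?ler_nat ?expn_gt0 // (leq_trans _ ki) ?expn_gt0.
rewrite sumr_const_nat expnS mul2n -addnn addnK -[leLHS]mulr_natl mulfV //.
by rewrite pnatr_eq0 -lt0n expn_gt0.
Qed.

Lemma harm_rev k : \sum_(0 <= a < k) (k - a)%:R^-1 = harm k.
Proof.
rewrite /harm big_add1 /= big_nat_rev /= add0n !big_mkord; apply: eq_bigr => i _.
by congr (_%:R^-1); have := ltn_ord i; lia.
Qed.

Lemma harm_shift l K : (l <= K)%N -> \sum_(l <= a < K) (a.+1 - l)%:R^-1 = harm (K - l).
Proof.
move=> lK; rewrite /harm big_add1 /= -{1}[l]add0n big_addn !big_mkord.
by apply: eq_bigr => i _; congr (_%:R^-1); lia.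
Qed.

End Harmonic.

(** * An operator Lipschitz estimate for matrices with gridded spectra *)

Section Schur.
Variables (C : numClosedFieldType) (K : nat).
Local Notation harm := (harm C).

(* The divided differences of [hs] are a Schur multiplier; the kernel [1 / (k - l)]
   is the sum of the nonnegative [om s t] over [k <= s <= K] and [t <= l], which
   turns the multiplier into a nonnegative combination of coordinate projections.
   Its total mass is a harmonic number, whence the logarithm. *)
Definition wt (s t : nat) : C := if (s <= K)%N then (s - t)%:R^-1 else 0.
Definition dwt (s t : nat) : C := wt s t - wt s.+1 t.
Definition om (s t : nat) : C := dwt s t - (if t is t'.+1 then dwt s t' else 0).

(** [om] is a double difference of [wt]: the sum over [t] telescopes to [dwt s l], and the one over
    [s] to [wt k l], since [wt] is cut to zero beyond [K]. *)
Lemma om_sum k l : (l < k)%N -> (k <= K)%N ->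
  \sum_(k <= s < K.+1) \sum_(0 <= t < l.+1) om s t = (k - l)%:R^-1.
Proof.
move=> lk kK; have inner s : \sum_(0 <= t < l.+1) om s t = dwt s l.
  elim: l {lk} => [|l IH]; first by rewrite big_nat1 /om subr0.
  by rewrite big_nat_recr //= IH /om addrC subrK.
under eq_bigr do rewrite inner.
under eq_bigr do rewrite /dwt -opprB.
rewrite sumrN telescope_sumr ?leqW // opprB /wt kK ltnn subr0 //.
Qed.

(** In the interior [om] is a second difference of the convex function [1 / x], namely
    [2 / (n (n + 1) (n + 2))]. On the edges [t = 0] and [s = K] it is a first difference of a
    decreasing function, and in the corner a value of [1 / x]. *)
Lemma om_ge0 s t : (t < s)%N -> (s <= K)%N -> 0 <= om s t.
Proof.
move=> ts sK; rewrite /om /dwt /wt sK.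
have inv_le a b : (0 < a)%N -> (a <= b)%N -> b%:R^-1 <= a%:R^-1 :> C.
  move=> a0 ab; rewrite lef_pV2 ?posrE ?ltr0n ?ler_nat //; exact: leq_trans ab.
case: t ts => [|t] ts.
  by rewrite subr0; case: ifP => _; rewrite ?subr0 ?invr_ge0 // subr_ge0 inv_le //; lia.
case: ifP => _; last by rewrite !subr0 subr_ge0 inv_le //; lia.
have -> : (s - t = (s - t.+1).+1)%N by lia.
have -> : (s.+1 - t.+1 = (s - t.+1).+1)%N by lia.
have -> : (s.+1 - t = (s - t.+1).+2)%N by lia.
have : (0 < s - t.+1)%N by lia.
move: (s - t.+1)%N => n n0.
have e : n%:R^-1 - n.+1%:R^-1 - (n.+1%:R^-1 - n.+2%:R^-1) =
   2 / (n%:R * (n%:R + 1) * (n%:R + 2)) :> C.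
  rewrite -natr1 -[n.+2%:R]natr1 -natr1; field.
  have n1 : 0 < n%:R :> C by rewrite ltr0n.
  by rewrite !gt_eqF // addr_gt0.
by rewrite e divr_ge0 // !mulr_ge0 // addr_ge0.
Qed.

Lemma sum_ind (N a b : nat) (F : nat -> C) : (b <= N)%N ->
  \sum_(i < N) ((a <= i < b)%N)%:R * F i = \sum_(a <= i < b) F i.
Proof.
move=> bN; rewrite -(big_mkord xpredT (fun i => ((a <= i < b)%N)%:R * F i)).
rewrite [RHS]big_nat_cond [RHS](big_nat_widenl _ 0) //=.
rewrite [RHS](big_nat_widen _ _ N) //= [RHS]big_mkcond /=.
apply: eq_bigr => i _; case: ifP; case: (boolP (a <= i < b)%N) => //=; rewrite ?mul1r ?mul0r //.
  by move=> /andP[-> ->].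
Qed.

Let W k l : (l < k)%N -> (k <= K)%N ->
  \sum_(s < K.+1) \sum_(t < K) (k <= s < K.+1)%:R * ((0 <= t < l.+1)%:R * om s t) =
  (k - l)%:R^-1.
Proof.
move=> lk kK; rewrite -om_sum // -(@sum_ind K.+1) //; apply: eq_bigr => s _.
by rewrite -mulr_sumr sum_ind // (leq_trans lk).
Qed.

Variables (m n : nat) (D : 'M[C]_(m, n)) (k : 'I_m -> nat) (l : 'I_n -> nat).
Variables (hs : nat -> C) (D0 e : C).
Hypothesis D0_ge0 : 0 <= D0.
Hypothesis D_le : opn D D0.
Hypothesis k_le : forall i, (k i <= K)%N.
Hypothesis l_le : forall j, (l j <= K)%N.
Hypothesis hs_le : forall j, (j < K)%N -> `|hs j.+1 - hs j| <= e.

(** Only the pairs with [l j < k i] are treated, where the kernel is positive. The opposite pairs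
    are the lower part of the adjoint. *)
Definition schur_lower : 'M[C]_(m, n) := \matrix_(i, j)
  (if (l j < k i)%N then (hs (k i) - hs (l j)) / (k i - l j)%:R * D i j else 0).

(** For fixed [a], [s], [t] the pattern [al a s i * be t a j] is the indicator of a rectangle, so
    Schur multiplication by it is compression of [D] between two coordinate projections and does not
    increase its norm. *)
Let al (a s : nat) i : C := ((a < k i <= s)%N)%:R.
Let be (t a : nat) j : C := ((t <= l j <= a)%N)%:R.
Let co (a s t : nat) : C := ((t <= a < s)%N)%:R * om s t.

Let co_ge0 a s t : (s <= K)%N -> 0 <= co a s t.
Proof.
move=> sK; rewrite /co; case: (boolP (t <= a < s)%N) => [/andP[ta as_]|_].
  by rewrite mul1r om_ge0 // (leq_ltn_trans ta).
by rewrite mul0r.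
Qed.

Let coeff i j :
  \sum_(a < K) \sum_(s < K.+1) \sum_(t < K)
     (hs a.+1 - hs a) * co a s t * (al a s i * be t a j) =
  if (l j < k i)%N then (hs (k i) - hs (l j)) / (k i - l j)%:R else 0.
Proof.
have e1 (a : 'I_K) (s : 'I_K.+1) (t : 'I_K) :
    co a s t * (al a s i * be t a j) = (l j <= a < k i)%:R *
      ((k i <= s < K.+1)%:R * ((0 <= t < (l j).+1)%:R * om s t)).
  have -> : co a s t * (al a s i * be t a j) =
      ((t <= a < s) && ((a < k i <= s) && (t <= l j <= a)))%N%:R * om s t.
    by rewrite /co /al /be mulrAC -!natrM !mulnb.
  rewrite [RHS]mulrA [RHS]mulrA -!natrM !mulnb; congr ((nat_of_bool _)%:R * _).
  by have := ltn_ord s; clear; lia.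
case: ltnP => lk; last first.
  rewrite big1 // => a _; rewrite big1 // => s _; rewrite big1 // => t _.
  rewrite -mulrA e1; suff -> : (l j <= a < k i)%N = false by rewrite mul0r mulr0.
  by apply/negP => /andP[]; lia.
transitivity (\sum_(a < K) (l j <= a < k i)%:R * ((hs a.+1 - hs a) * (k i - l j)%:R^-1)).
  apply: eq_bigr => a _; rewrite -(W lk (k_le i)) mulrA !mulr_sumr.
  apply: eq_bigr => s _; rewrite mulr_sumr; apply: eq_bigr => t _.
  by rewrite -mulrA e1 mulrA (mulrC (_ - _)).
rewrite (@sum_ind K _ _ (fun a => (hs a.+1 - hs a) / (k i - l j)%:R)) //.
rewrite -mulr_suml telescope_sumr //; exact: ltnW.
Qed.

Let e_ge0 : (0 < K)%N -> 0 <= e.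
Proof. by move=> K0; apply: le_trans (hs_le K0). Qed.

Let mask_sum p (f : 'I_p -> bool) (x : 'cV[C]_p) :
  fsq (\col_i ((f i)%:R * x i 0)) = \sum_i (f i)%:R * `|x i 0| ^+ 2.
Proof.
rewrite fsq_cV; apply: eq_bigr => i _; rewrite mxE normrM exprMn.
by case: (f i); rewrite /= ?normr1 ?normr0 ?expr1n ?expr0n ?mul0r.
Qed.

(** For a fixed row the coefficients over [s] and [t] add up to [1 / (k i - a)], and the sum over
    [a] is harmonic. Counting only the mass that reaches one row keeps the total logarithmic. *)
Let al_total (x : 'cV[C]_m) :
  \sum_(a < K) \sum_(s < K.+1) \sum_(t < K) co a s t *
     (\sum_i al a s i * `|x i 0| ^+ 2) <= harm K * fsq x.
Proof.
have -> : \sum_(a < K) \sum_(s < K.+1) \sum_(t < K) co a s t *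
     (\sum_i al a s i * `|x i 0| ^+ 2) =
   \sum_i (\sum_(a < K) \sum_(s < K.+1) \sum_(t < K) co a s t * al a s i) * `|x i 0| ^+ 2.
  under [RHS]eq_bigr do rewrite mulr_suml; rewrite [RHS]exchange_big.
  apply: eq_bigr => a _; under [RHS]eq_bigr do rewrite mulr_suml; rewrite [RHS]exchange_big.
  apply: eq_bigr => s _; under [RHS]eq_bigr do rewrite mulr_suml; rewrite [RHS]exchange_big.
  apply: eq_bigr => t _; rewrite mulr_sumr; apply: eq_bigr => i _; by rewrite mulrA.
rewrite fsq_cV mulr_sumr; apply: ler_sum => i _; rewrite ler_wpM2r ?exprn_ge0 //.
apply: (@le_trans _ _ (\sum_(a < K) (0 <= a < k i)%N%:R * (k i - a)%:R^-1)).
  rewrite le_eqVlt; apply/orP; left; apply/eqP; apply: eq_bigr => a _.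
  case: (ltnP a (k i)) => aki; last first.
    rewrite mul0r big1 // => s _; rewrite big1 // => t _; rewrite /al.
    by rewrite ltnNge aki mulr0.
  rewrite mul1r -(W aki (k_le i)); apply: eq_bigr => s _; apply: eq_bigr => t _.
  rewrite /co /al mulrAC [RHS]mulrA -!natrM !mulnb; congr ((nat_of_bool _)%:R * _).
  by have := ltn_ord s; move: aki; clear; lia.
by rewrite (@sum_ind K _ _ (fun a => (k i - a)%:R^-1)) // harm_rev harm_mono.
Qed.

Let be_total (y : 'cV[C]_n) :
  \sum_(a < K) \sum_(s < K.+1) \sum_(t < K) co a s t *
     (\sum_j be t a j * `|y j 0| ^+ 2) <= harm K * fsq y.
Proof.
have -> : \sum_(a < K) \sum_(s < K.+1) \sum_(t < K) co a s t *
     (\sum_j be t a j * `|y j 0| ^+ 2) =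
   \sum_j (\sum_(a < K) \sum_(s < K.+1) \sum_(t < K) co a s t * be t a j) * `|y j 0| ^+ 2.
  under [RHS]eq_bigr do rewrite mulr_suml; rewrite [RHS]exchange_big.
  apply: eq_bigr => a _; under [RHS]eq_bigr do rewrite mulr_suml; rewrite [RHS]exchange_big.
  apply: eq_bigr => s _; under [RHS]eq_bigr do rewrite mulr_suml; rewrite [RHS]exchange_big.
  apply: eq_bigr => t _; rewrite mulr_sumr; apply: eq_bigr => i _; by rewrite mulrA.
rewrite fsq_cV mulr_sumr; apply: ler_sum => j _; rewrite ler_wpM2r ?exprn_ge0 //.
apply: (@le_trans _ _ (\sum_(a < K) (l j <= a < K)%N%:R * (a.+1 - l j)%:R^-1)).
  rewrite le_eqVlt; apply/orP; left; apply/eqP; apply: eq_bigr => a _.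
  have aK := ltn_ord a; rewrite aK andbT.
  case: (leqP (l j) a) => aki; last first.
    rewrite mul0r big1 // => s _; rewrite big1 // => t _; rewrite /be.
    by rewrite (leqNgt (l j)) aki andbF mulr0.
  have la : (l j < a.+1)%N by [].
  rewrite mul1r -(W la aK); apply: eq_bigr => s _; apply: eq_bigr => t _.
  rewrite /co /be mulrAC [RHS]mulrA -!natrM !mulnb; congr ((nat_of_bool _)%:R * _).
  by have := ltn_ord s; move: la; clear; lia.
by rewrite (@sum_ind K _ _ (fun a => (a.+1 - l j)%:R^-1)) // harm_shift // harm_mono // leq_subr.
Qed.

(** The bilinear form of each compressed piece is at most [D0 / 2] times the masked squares of [x]
    and [y]. These bounds are added with the nonnegative weights [co], and each increment of [hs]
    contributes at most [e]. *)
Lemma opn_schur_lower : opn schur_lower (D0 * e * harm K).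
Proof.
have [K0|] := posnP K.
  have -> : schur_lower = 0.
    by apply/matrixP => i j; rewrite !mxE; have := k_le i; rewrite K0 leqn0 => /eqP ->.
  have -> : harm K = 0 by rewrite K0 /harm big_geq.
  move=> v; rewrite mul0mx mulr0 expr0n mul0r fsq_cV big1 // => i _.
  by rewrite mxE normr0 expr0n.
move=> /e_ge0 e0; have b0 : 0 <= D0 * e * harm K by rewrite !mulr_ge0 ?harm_ge0.
apply: bil_opn => // x y.
pose xa a s : 'cV[C]_m := \col_i (al a s i * x i 0).
pose yb t a : 'cV[C]_n := \col_j (be t a j * y j 0).
have -> : (x^t* *m schur_lower *m y) 0 0 =
    \sum_(a < K) \sum_(s < K.+1) \sum_(t < K) (hs a.+1 - hs a) * co a s t *
      ((xa a s)^t* *m D *m yb t a) 0 0.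
  have expand p q (u : 'cV[C]_p) (M : 'M[C]_(p, q)) (v : 'cV[C]_q) :
      (u^t* *m M *m v) 0 0 = \sum_i \sum_j (u i 0)^* * M i j * v j 0.
    rewrite mxE exchange_big; apply: eq_bigr => j _; rewrite mxE mulr_suml.
    by apply: eq_bigr => i _; rewrite adjE.
  rewrite expand.
  under [RHS]eq_bigr do under eq_bigr do under eq_bigr do rewrite expand mulr_sumr.
  under [RHS]eq_bigr do under eq_bigr do rewrite exchange_big.
  under [RHS]eq_bigr do rewrite exchange_big; rewrite [RHS]exchange_big.
  apply: eq_bigr => i _ /=.
  under [RHS]eq_bigr do under eq_bigr do under eq_bigr do rewrite mulr_sumr.
  under [RHS]eq_bigr do under eq_bigr do rewrite exchange_big.
  under [RHS]eq_bigr do rewrite exchange_big; rewrite [RHS]exchange_big.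
  apply: eq_bigr => j _ /=.
  rewrite mxE (_ : (if _ then _ else _) = (if (l j < k i)%N then
    (hs (k i) - hs (l j)) / (k i - l j)%:R else 0) * D i j); last by case: ifP; rewrite ?mul0r.
  rewrite -coeff !mulr_suml mulr_sumr mulr_suml; apply: eq_bigr => a _.
  rewrite !mulr_suml mulr_sumr mulr_suml; apply: eq_bigr => s _.
  rewrite !mulr_suml mulr_sumr mulr_suml; apply: eq_bigr => t _.
  rewrite !mxE rmorphM /= (_ : (al a s i)^* = al a s i) ?conjC_nat //; ring.
apply: le_trans (ler_norm_sum _ _ _) _.
apply: (@le_trans _ _ (\sum_(a < K) \sum_(s < K.+1) \sum_(t < K) (e * (D0 / 2)) *
   (co a s t * (\sum_i al a s i * `|x i 0| ^+ 2) +
    co a s t * (\sum_j be t a j * `|y j 0| ^+ 2)))).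
  apply: ler_sum => a _; apply: le_trans (ler_norm_sum _ _ _) _.
  apply: ler_sum => s _; apply: le_trans (ler_norm_sum _ _ _) _.
  apply: ler_sum => t _; rewrite 2!normrM (ger0_norm (co_ge0 _ _ _)) ?leq_ord //.
  rewrite -mulrDr; set f := co a s t; set s1 := \sum_i _; set s2 := \sum_j _.
  have f0 : 0 <= f by rewrite co_ge0 ?leq_ord.
  have -> : e * (D0 / 2) * (f * (s1 + s2)) = e * f * (D0 / 2 * (s1 + s2)) by ring.
  apply: ler_pM => //; [exact: mulr_ge0|by rewrite ler_wpM2r // hs_le|].
  by apply: le_trans (opn_bil D0_ge0 D_le _ _) _; rewrite !mask_sum.
under eq_bigr do under eq_bigr do rewrite -mulr_sumr.
under eq_bigr do rewrite -mulr_sumr.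
rewrite -mulr_sumr.
have -> : D0 * e * harm K / 2 * (fsq x + fsq y) =
   e * (D0 / 2) * (harm K * fsq x + harm K * fsq y) by ring.
rewrite ler_wpM2l ?mulr_ge0 // ?invr_ge0 //.
under eq_bigr do under eq_bigr do rewrite big_split /=.
under eq_bigr do rewrite big_split /=.
by rewrite big_split /= lerD ?al_total ?be_total.
Qed.

End Schur.

Section OperatorLipschitz.
Variable C : numClosedFieldType.

(** Functional calculus through a chosen diagonalisation; [fcalc_intertwine] at [X = 1] shows that
    the choice is immaterial. *)
Definition fcalc n (U : 'M[C]_n) (d : 'rV[C]_n) (g : C -> C) : 'M[C]_n :=
  U^t* *m diag_mx (map_mx g d) *m U.

(** In the eigenbases the relation reads [d_i Y i j = Y i j e_j], so [d_i = e_j] wherever [Y i j] is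
    nonzero, and [g] can be applied to both. *)
Lemma fcalc_intertwine m n (U : 'M[C]_m) (V : 'M[C]_n) d e (X : 'M[C]_(m, n)) g :
  U \is unitarymx -> V \is unitarymx ->
  (U^t* *m diag_mx d *m U) *m X = X *m (V^t* *m diag_mx e *m V) ->
  fcalc U d g *m X = X *m fcalc V e g.
Proof.
move=> UU VV; have U1 := unitarymxP UU; have V1 := unitarymxP VV.
have U2 := unitary_adjl UU; have V2 := unitary_adjl VV.
have [Y XY YE] : exists2 Y, X = U^t* *m Y *m V & U *m X *m V^t* = Y.
  by exists (U *m X *m V^t*); rewrite // !mulmxA U2 mul1mx -mulmxA V2 mulmx1.
have key d' e' : (U^t* *m diag_mx d' *m U) *m X = X *m (V^t* *m diag_mx e' *m V) <->
    diag_mx d' *m Y = Y *m diag_mx e'.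
  split=> [h|h].
    have := congr1 (fun M => U *m M *m V^t*) h.
    rewrite !mulmxA U1 mul1mx -(mulmxA (U *m X *m V^t* *m diag_mx e')) V1 mulmx1.
    by rewrite YE -mulmxA -mulmxA (mulmxA U) YE.
  have -> : U^t* *m diag_mx d' *m U *m X = U^t* *m (diag_mx d' *m Y) *m V.
    by rewrite {1}XY !mulmxA -(mulmxA (U^t* *m diag_mx d')) U1 mulmx1.
  by rewrite h [in RHS]XY !mulmxA -(mulmxA (U^t* *m Y) V) V1 mulmx1.
move/key => h; apply/key; apply/matrixP => i j; rewrite diag_mulE mul_diagE !mxE.
have /matrixP/(_ i j) := h; rewrite diag_mulE mul_diagE.
have [->|Y0] := eqVneq (Y i j) 0; first by rewrite !mulr0 !mul0r.
by rewrite mulrC => /(mulfI Y0) ->; rewrite mulrC.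
Qed.

Lemma grid_round (e x : C) K : 0 <= e -> 0 <= x -> x <= K%:R * e ->
  exists k, (k <= K)%N /\ `|x - k%:R * e| <= e.
Proof.
move=> e0 x0; elim: K => [|K IH] xK.
  exists 0%N; split => //; have -> : x = 0 by apply/le_anti; rewrite x0 andbT; move: xK; rewrite mul0r.
  by rewrite mul0r subr0 normr0.
have Ke : 0 <= K%:R * e by rewrite mulr_ge0.
case: (real_leP (ger0_real x0) (ger0_real Ke)) => xKe.
  by have [k [kK h]] := IH xKe; exists k; split => //; apply: leqW.
exists K; split => //; rewrite ger0_norm ?subr_ge0 ?(ltW xKe) //.
by rewrite lerBlDl; move: xK; rewrite -natr1 mulrDl mul1r.
Qed.

Lemma opn_fcalc_diff n (U : 'M[C]_n) (d d' : 'rV[C]_n) g e : 0 <= e ->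
  U \is unitarymx -> (forall i, `|g (d 0 i) - g (d' 0 i)| <= e) ->
  opn (fcalc U d g - fcalc U d' g) e.
Proof.
move=> e0 UU h; rewrite /fcalc -mulmxBl -mulmxBr -raddfB.
by apply: opn_spectral => // i; rewrite !mxE.
Qed.

Lemma fcalc_id n (U : 'M[C]_n) d : fcalc U d id = U^t* *m diag_mx d *m U.
Proof. by congr (_ *m diag_mx _ *m _); apply/rowP => i; rewrite mxE. Qed.

(** Rounding both spectra to multiples of [e] changes the difference of the matrices to at most
    [3 e], and each rounding costs [L e] through [g]: this is the [2] in the constant. Between the
    two bases the remaining difference has entries [(g (d1' i) - g (d2' j)) Wm i j], divided
    differences of [g] times entries of [D]; two triangles, the factor [3] and a harmonic sum of at
    most [k] give [6 k]. *)
Lemma operator_lipschitz n (U V : 'M[C]_n) (d1 d2 : 'rV[C]_n) (g : C -> C)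
    (e L : C) K k :
  U \is unitarymx -> V \is unitarymx -> 0 < e -> 0 <= L -> (K < 2 ^ k)%N ->
  (forall i, 0 <= d1 0 i <= K%:R * e) -> (forall i, 0 <= d2 0 i <= K%:R * e) ->
  (forall x y : C, 0 <= x -> 0 <= y -> `|g x - g y| <= L * `|x - y|) ->
  opn (U^t* *m diag_mx d1 *m U - V^t* *m diag_mx d2 *m V) e ->
  opn (fcalc U d1 g - fcalc V d2 g) ((6 * k + 2)%:R * (L * e)).
Proof.
move=> UU VV e0 L0 Kk d1_le d2_le gL AB.
have U1 := unitarymxP UU; have V1 := unitarymxP VV.
have U2 := unitary_adjl UU; have V2 := unitary_adjl VV.
have e0' := ltW e0.
have [kk kkP] : exists kk : 'I_n -> nat, forall i, (kk i <= K)%N /\ `|d1 0 i - (kk i)%:R * e| <= e.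
  apply: (@fin_all_exists _ (fun=> nat) (fun i j => (j <= K)%N /\ `|d1 0 i - j%:R * e| <= e)) => i.
  by case/andP: (d1_le i); apply: grid_round.
have [ll llP] : exists ll : 'I_n -> nat, forall i, (ll i <= K)%N /\ `|d2 0 i - (ll i)%:R * e| <= e.
  apply: (@fin_all_exists _ (fun=> nat) (fun i j => (j <= K)%N /\ `|d2 0 i - j%:R * e| <= e)) => i.
  by case/andP: (d2_le i); apply: grid_round.
pose d1' : 'rV[C]_n := \row_i ((kk i)%:R * e).
pose d2' : 'rV[C]_n := \row_i ((ll i)%:R * e).
pose hs j := g (j%:R * e).
have hsL j : `|hs j.+1 - hs j| <= L * e.
  apply: le_trans (gL _ _ _ _) _; rewrite ?mulr_ge0 //.
  by rewrite -mulrBl -natr1 addrAC subrr add0r mul1r ger0_norm.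
pose D := U *m (fcalc U d1' id - fcalc V d2' id) *m V^t*.
have D_le : opn D (3 * e).
  rewrite -[3 * e]mulr1 -[3 * e]mul1r; apply: opnM; [by rewrite mul1r mulr_ge0| |].
    apply: opnM => //; first exact: opn_unitary.
    have -> : fcalc U d1' id - fcalc V d2' id =
      - (fcalc U d1 id - fcalc U d1' id) + (fcalc U d1 id - fcalc V d2 id)
       + (fcalc V d2 id - fcalc V d2' id).
      move: (fcalc U d1 id) (fcalc U d1' id) (fcalc V d2 id) (fcalc V d2' id) => m1 m2 m3 m4.
      by rewrite opprB !addrA !subrK.
    have -> : 3 * e = e + e + e by ring.
    apply: opnD; rewrite ?addr_ge0 //; last first.
      by apply: opn_fcalc_diff => // i; rewrite !mxE; case: (llP i).
    apply: opnD => //; last by rewrite !fcalc_id.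
    by apply/opnN/opn_fcalc_diff => // i; rewrite !mxE; case: (kkP i).
  by apply: opn_unitary; rewrite trmxC_unitary.
pose Wm := U *m V^t*.
have FE g' : U *m (fcalc U d1' g' - fcalc V d2' g') *m V^t* =
    \matrix_(i, j) ((g' (d1' 0 i) - g' (d2' 0 j)) * Wm i j).
  have -> : U *m (fcalc U d1' g' - fcalc V d2' g') *m V^t* =
      diag_mx (map_mx g' d1') *m Wm - Wm *m diag_mx (map_mx g' d2').
    rewrite mulmxBr mulmxBl /fcalc /Wm !mulmxA U1 mul1mx; congr (_ - _).
    by rewrite -mulmxA V1 mulmx1.
  have subE (A B : 'M[C]_n) i j : (A - B) i j = A i j - B i j by rewrite !mxE.
  by apply/matrixP => i j; rewrite subE diag_mulE mul_diagE !mxE; ring.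
have DE i j : D i j = ((kk i)%:R - (ll j)%:R) * e * Wm i j.
  by rewrite /D FE !mxE -mulrBl.
have hL : 0 <= L * e by rewrite mulr_ge0.
have einv : opn (e^-1 *: D) 3.
  rewrite (_ : 3 = `|e^-1| * (3 * e)); first exact: opnZ.
  by rewrite ger0_norm ?invr_ge0 //; field; rewrite gt_eqF.
have Z1 := @opn_schur_lower C K n n (e^-1 *: D) kk ll hs 3 (L * e) (ler0n _ 3) einv
   (fun i => (kkP i).1) (fun i => (llP i).1) (fun j _ => hsL j).
have hsL' j : `|(hs j.+1)^* - (hs j)^*| <= L * e by rewrite -rmorphB norm_conjC.
(* The pairs with [kk i < ll j] form the lower part of the adjoint, with conjugated values of [g].
   Pairs with equal grid points contribute zero. *)
have Z2 := @opn_schur_lower C K n n ((e^-1 *: D)^t*) ll kk (fun j => (hs j)^*) 3 (L * e) (ler0n _ 3)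
   (opn_adj (ler0n _ 3) einv) (fun i => (llP i).1) (fun i => (kkP i).1) (fun j _ => hsL' j).
have h0 : 0 <= 3 * (L * e) * harm C K by rewrite !mulr_ge0 ?harm_ge0.
have F1 : opn (U *m (fcalc U d1' g - fcalc V d2' g) *m V^t*) ((6 * k)%:R * (L * e)).
  apply: (@opnW _ _ _ _ (3 * (L * e) * harm C K + 3 * (L * e) * harm C K)).
  - by rewrite addr_ge0.
  - have -> : (6 * k)%:R * (L * e) = 6 * (L * e) * k%:R by rewrite natrM; ring.
    have -> : 3 * (L * e) * harm C K + 3 * (L * e) * harm C K = 6 * (L * e) * harm C K by ring.
    by rewrite ler_wpM2l ?harm_log // mulr_ge0.
  rewrite FE (_ : \matrix_(i, j) _ = schur_lower (e^-1 *: D) kk ll hs +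
     (schur_lower ((e^-1 *: D)^t*) ll kk (fun j => (hs j)^*))^t*).
    by apply: opnD => //; apply: opn_adj.
  apply/matrixP => i j; rewrite [LHS]mxE [RHS]mxE adjE ![schur_lower _ _ _ _ _ _]mxE.
  rewrite adjE [(e^-1 *: D) i j]mxE DE !mxE -/(hs (kk i)) -/(hs (ll j)).
  have e1 : e != 0 by rewrite gt_eqF.
  case: (ltngtP (ll j) (kk i)) => [lk|kl|->].
  - rewrite conjC0 addr0 natrB ?(ltnW lk) //; field.
    by rewrite e1 subr_eq0 eqr_nat gt_eqF.
  - rewrite add0r !rmorphM /= conjCK rmorphB /= !conjCK fmorphV rmorph_nat natrB ?(ltnW kl) //.
    by field; rewrite e1 subr_eq0 eqr_nat gt_eqF.
  - by rewrite conjC0 addr0 subrr mul0r.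
have -> : fcalc U d1 g - fcalc V d2 g =
   (fcalc U d1 g - fcalc U d1' g) + (fcalc U d1' g - fcalc V d2' g)
       - (fcalc V d2 g - fcalc V d2' g).
  move: (fcalc U d1 g) (fcalc U d1' g) (fcalc V d2 g) (fcalc V d2' g) => m1 m2 m3 m4.
  by rewrite opprB !addrA !subrK.
have -> : (6 * k + 2)%:R * (L * e) = L * e + (6 * k)%:R * (L * e) + L * e.
  by rewrite natrD; ring.
have k0 : 0 <= (6 * k)%:R * (L * e) by rewrite mulr_ge0.
apply: opnB => //; first exact: addr_ge0.
  apply: opnD => //.
    apply: opn_fcalc_diff => // i; apply: le_trans (gL _ _ _ _) _.
    - by case/andP: (d1_le i).
    - by rewrite mxE mulr_ge0.
    by rewrite mxE ler_wpM2l //; case: (kkP i).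
  have -> : fcalc U d1' g - fcalc V d2' g =
     U^t* *m (U *m (fcalc U d1' g - fcalc V d2' g) *m V^t*) *m V.
    by rewrite !mulmxA U2 mul1mx -mulmxA V2 mulmx1.
  rewrite -[_ * (L * e)]mulr1 -[_ * (L * e)]mul1r; apply: opnM; last exact: opn_unitary.
    by rewrite mul1r.
  by apply: opnM => //; apply: opn_unitary; rewrite trmxC_unitary.
apply: opn_fcalc_diff => // i; apply: le_trans (gL _ _ _ _) _.
- by case/andP: (d2_le i).
- by rewrite mxE mulr_ge0.
by rewrite mxE ler_wpM2l //; case: (llP i).
Qed.

End OperatorLipschitz.

(** * Diagonalisation by Jacobi rotations *)

Section Jacobi.
Variables (C : numClosedFieldType) (n : nat).
Implicit Types (A G Q : 'M[C]_n).

Definition rowoff A i : C := \sum_(k | k != i) `|A i k| ^+ 2.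
Definition off A : C := \sum_i rowoff A i.

Lemma rowoff_ge0 A i : 0 <= rowoff A i.
Proof. by apply: sumr_ge0 => k _; rewrite exprn_ge0. Qed.

Lemma off_ge0 A : 0 <= off A.
Proof. by apply: sumr_ge0 => k _; rewrite rowoff_ge0. Qed.

Lemma off_fsq A : off A <= fsq A.
Proof.
apply: ler_sum => i _; rewrite [leRHS](bigD1 i) //= lerDr exprn_ge0 //.
Qed.

Lemma fsq_off A : fsq (A - diag_mx (\row_i A i i)) = off A.
Proof.
apply: eq_bigr => i _; rewrite (bigD1 i) //= !mxE eqxx mulr1n subrr normr0 expr0n add0r.
by apply: eq_bigr => k ki; rewrite !mxE eq_sym (negbTE ki) mulr0n subr0.
Qed.

(** The pivot is sought first among the row sums and then within the best row. This needs only [2 n]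
    comparisons and still finds an entry carrying a fraction [1 / n^2] of the off-diagonal mass. *)
Lemma pivot_le A p q : (forall i, rowoff A i <= rowoff A p) ->
  (forall k, k != p -> `|A p k| ^+ 2 <= `|A p q| ^+ 2) ->
  off A <= (n * n)%:R * `|A p q| ^+ 2.
Proof.
move=> hp hq; have nat_sum (x : C) : \sum_(i < n) x = n%:R * x.
  by rewrite sumr_const card_ord mulr_natl.
apply: (@le_trans _ _ (\sum_(i < n) rowoff A p)); first exact: ler_sum.
rewrite nat_sum natrM -mulrA ler_wpM2l // -nat_sum.
apply: (@le_trans _ _ (\sum_(k | k != p) `|A p q| ^+ 2)); first exact: ler_sum.
by rewrite [leRHS](bigD1 p) //= lerDr exprn_ge0.
Qed.

Section Rotation.
Variables (p q : 'I_n) (c s : C).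
Hypothesis pq : p != q.
Hypothesis cR : c^* = c.
Hypothesis cs1 : c ^+ 2 + s * s^* = 1.

Definition givens : 'M[C]_n := \matrix_(i, j)
  (if j == p then (if i == p then c else if i == q then s else 0)
   else if j == q then (if i == p then - s^* else if i == q then c else 0)
   else (i == j)%:R).

Let qp : (q == p) = false. Proof. by rewrite eq_sym (negbTE pq). Qed.

Lemma mul_givens m (M : 'M[C]_(m, n)) i j : (M *m givens) i j =
  if j == p then M i p * c + M i q * s
  else if j == q then - (M i p * s^*) + M i q * c else M i j.
Proof.
rewrite mxE; case: (altP (j =P p)) => jp.
  rewrite (bigD1 p) //= (bigD1 q) ?qp //= big1 ?addr0 => [|k /andP[/negbTE kp /negbTE kq]].
    by rewrite !mxE jp !eqxx qp.
  by rewrite !mxE jp eqxx kp kq mulr0.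
case: (altP (j =P q)) => jq.
  rewrite (bigD1 p) //= (bigD1 q) ?qp //= big1 ?addr0 => [|k /andP[/negbTE kp /negbTE kq]].
    by rewrite !mxE jq qp !eqxx mulrN.
  by rewrite !mxE jq qp eqxx kp kq mulr0.
rewrite (bigD1 j) //= big1 ?addr0 => [|k /negbTE kj].
  by rewrite mxE (negbTE jp) (negbTE jq) eqxx mulr1.
by rewrite mxE (negbTE jp) (negbTE jq) kj mulr0.
Qed.

Lemma adj_givens_mul m (M : 'M[C]_(n, m)) i j : (givens^t* *m M) i j =
  if i == p then c * M p j + s^* * M q j
  else if i == q then - (s * M p j) + c * M q j else M i j.
Proof.
have -> : (givens^t* *m M) i j = ((M^t* *m givens) j i)^*.
  by rewrite -adjE adjM trmxCK.
rewrite mul_givens !adjE; case: ifP => _; last case: ifP => _.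
- by rewrite rmorphD !rmorphM /= !conjCK cR mulrC [_ * s^*]mulrC.
- by rewrite rmorphD rmorphN !rmorphM /= !conjCK cR mulrC [_ * c]mulrC.
- by rewrite conjCK.
Qed.

Lemma givens_unitary : givens \is unitarymx.
Proof.
rewrite -trmxC_unitary; apply/unitarymxP; rewrite trmxCK; apply/matrixP => i j.
rewrite adj_givens_mul !mxE !eqxx qp.
case: (altP (i =P p)) => [->|ip]; last case: (altP (i =P q)) => [->|iq].
- case: (altP (j =P p)) => [->|jp].
    by rewrite eqxx -cs1 expr2 [s^* * s]mulrC.
  case: (altP (j =P q)) => [->|jq].
    by rewrite (negbTE pq) mulrN mulrC addrC subrr.
  by rewrite eq_sym (negbTE jp) eq_sym (negbTE jq) !mulr0 addr0.
- case: (altP (j =P p)) => [->|jp]; first by rewrite qp mulrC addrC subrr.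
  case: (altP (j =P q)) => [->|jq].
    by rewrite eqxx mulrN opprK -cs1 expr2 addrC.
  by rewrite eq_sym (negbTE jp) eq_sym (negbTE jq) !mulr0 oppr0 addr0.
- case: (altP (j =P p)) => [->|jp]; first by rewrite (negbTE ip).
  case: (altP (j =P q)) => [->|jq]; first by rewrite (negbTE iq).
  by [].
Qed.

Lemma mix_norm (x y t : C) : c ^+ 2 + t * t^* = 1 ->
  `|x * c + y * t| ^+ 2 + `|- (x * t^*) + y * c| ^+ 2 = `|x| ^+ 2 + `|y| ^+ 2.
Proof.
move=> ct; rewrite !normCK !rmorphD rmorphN !rmorphM /= !conjCK cR.
rewrite -[RHS]mul1r -ct; ring.
Qed.

Let B A := givens^t* *m A *m givens.

Lemma rowoff_givens A i : i != p -> i != q -> rowoff (B A) i = rowoff A i.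
Proof.
move=> ip iq; rewrite /rowoff (bigD1 p) 1?eq_sym //= (bigD1 q) ?qp ?andbT 1?eq_sym //=.
rewrite [RHS](bigD1 p) 1?eq_sym //= [in RHS](bigD1 q) ?qp ?andbT 1?eq_sym //=.
rewrite !addrA; congr (_ + _).
  rewrite !mul_givens !eqxx qp !adj_givens_mul (negbTE ip) (negbTE iq).
  exact: mix_norm.
apply: eq_bigr => k /andP[/andP[_ /negbTE kp] /negbTE kq].
by rewrite mul_givens kp kq adj_givens_mul (negbTE ip) (negbTE iq).
Qed.

Let rowoff_p A : rowoff A p = `|A p q| ^+ 2 +
  \sum_(k | (k != p) && (k != q)) `|A p k| ^+ 2.
Proof. by rewrite /rowoff (bigD1 q) ?qp. Qed.

Let rowoff_q A : rowoff A q = `|A q p| ^+ 2 +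
  \sum_(k | (k != p) && (k != q)) `|A q k| ^+ 2.
Proof.
rewrite /rowoff (bigD1 p) //=; congr (_ + _); apply: eq_bigl => k; exact: andbC.
Qed.

Let off_pq A : off A = rowoff A p + rowoff A q +
  \sum_(i | (i != p) && (i != q)) rowoff A i.
Proof. by rewrite /off (bigD1 p) //= (bigD1 q) ?qp //= addrA. Qed.

(** The rotation mixes the entries [p] and [q] of every other row isometrically, and likewise the
    rows [p] and [q] outside the pivot block. Only the pivot and its conjugate disappear from the
    sum. *)
Lemma off_givens A : A^t* = A -> (B A) p q = 0 -> off (B A) = off A - 2 * `|A p q| ^+ 2.
Proof.
move=> hA B0.
have hB : (B A)^t* = B A by rewrite /B !adjM trmxCK hA mulmxA.
have B0' : (B A) q p = 0 by rewrite -hB adjE B0 conjC0.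
have Aqp : `|A q p| = `|A p q| by rewrite -{1}hA adjE norm_conjC.
rewrite !off_pq (eq_bigr (fun i => rowoff A i)) => [|i /andP[ip iq]]; last exact: rowoff_givens.
rewrite !rowoff_p !rowoff_q B0 B0' normr0 expr0n !add0r Aqp.
have -> : \sum_(i < n | (i != p) && (i != q)) `|B A p i| ^+ 2 +
          \sum_(i < n | (i != p) && (i != q)) `|B A q i| ^+ 2 =
  \sum_(i < n | (i != p) && (i != q)) `|A p i| ^+ 2 +
  \sum_(i < n | (i != p) && (i != q)) `|A q i| ^+ 2.
  rewrite -!big_split; apply: eq_bigr => k /andP[/negbTE kp /negbTE kq] /=.
  rewrite !mul_givens kp kq !adj_givens_mul !eqxx qp.
  rewrite -(@mix_norm (A p k) (A q k) (s^*)); last by rewrite conjCK [_ * s]mulrC.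
  by rewrite conjCK [c * A p k]mulrC [s^* * _]mulrC [s * _]mulrC [c * A q k]mulrC.
ring.
Qed.

End Rotation.

(** With [dl] half the difference of the two diagonal entries, [ro] is the positive eigenvalue of
    the centred pivot block, [(dl + ro, (A p q)^* )] an eigenvector for it and [nu] the norm of that
    vector. No trigonometric functions are needed. *)
Lemma givens_zero (p q : 'I_n) A (dl ro nu : C) : p != q -> A^t* = A ->
  nu^* = nu -> nu != 0 -> (dl + ro)^* = dl + ro -> 2 * dl = A p p - A q q ->
  ro ^+ 2 = dl ^+ 2 + A p q * (A p q)^* ->
  nu ^+ 2 = (dl + ro) ^+ 2 + A p q * (A p q)^* ->
  let c := (dl + ro) / nu in let s := (A p q)^* / nu in
  [/\ c^* = c, c ^+ 2 + s * s^* = 1 & ((givens p q c s)^t* *m A *m givens p q c s) p q = 0].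
Proof.
move=> pq hA nuR nu0 drR dlE roE nuE c s.
have cR : c^* = c by rewrite /c rmorphM fmorphV /= nuR drR.
have sE : s^* = A p q / nu by rewrite /s rmorphM fmorphV /= nuR conjCK.
have qp : (q == p) = false by rewrite eq_sym (negbTE pq).
have Aqp : A q p = (A p q)^* by rewrite -adjE hA.
split => //.
  rewrite sE /c /s.
  have -> : ((dl + ro) / nu) ^+ 2 + (A p q)^* / nu * (A p q / nu) =
     ((dl + ro) ^+ 2 + A p q * (A p q)^*) / nu ^+ 2 by field.
  by rewrite -nuE divff // expf_neq0.
rewrite mul_givens // !eqxx qp !adj_givens_mul // !eqxx Aqp sE /c.
have -> : A p p = 2 * dl + A q q by rewrite dlE subrK.
have -> : - (((dl + ro) / nu * (2 * dl + A q q) + A p q / nu * (A p q)^*) * (A p q / nu)) +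
  ((dl + ro) / nu * A p q + A p q / nu * A q q) * ((dl + ro) / nu) =
  A p q / nu ^+ 2 * (ro ^+ 2 - (dl ^+ 2 + A p q * (A p q)^*)) by field.
by rewrite roE subrr mulr0.
Qed.

Lemma jacobi_approx G Q e : Q \is unitarymx -> off (Q^t* *m G *m Q) <= e ^+ 2 ->
  opn (Q *m diag_mx (\row_i (Q^t* *m G *m Q) i i) *m Q^t* - G) e.
Proof.
move=> QU; set A := Q^t* *m G *m Q => offA.
have -> : Q *m diag_mx (\row_i A i i) *m Q^t* - G =
    Q *m - (A - diag_mx (\row_i A i i)) *m Q^t*.
  have GE : G = Q *m A *m Q^t*.
    rewrite /A !mulmxA (unitarymxP QU) mul1mx -mulmxA (unitarymxP QU) mulmx1 //.
  by rewrite opprB mulmxBr mulmxBl -GE.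
apply: opn_fsq; rewrite fsqUr; last by rewrite trmxCK unitary_adjl.
rewrite fsqUl; last exact: unitary_adjl.
by rewrite -scaleN1r fsqZ normrN1 expr1n mul1r fsq_off.
Qed.

End Jacobi.

(** Bernoulli gives [(1 + 1 / N)^N >= 2], and the product of the two powers is at most [1]. *)
Lemma half_power (C : numFieldType) N : (0 < N)%N -> (1 - N%:R^-1) ^+ N <= 2^-1 :> C.
Proof.
move=> N0; have N0' : 0 < N%:R :> C by rewrite ltr0n.
have B k : 1 + k%:R * N%:R^-1 <= (1 + N%:R^-1) ^+ k :> C.
  elim: k => [|k IH]; first by rewrite mul0r addr0.
  rewrite exprS; apply: le_trans (ler_wpM2l _ IH); last by rewrite addr_ge0 // invr_ge0 ltW.
  rewrite -subr_ge0 -natr1.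
  have -> : (1 + N%:R^-1) * (1 + k%:R / N%:R) - (1 + (k%:R + 1) / N%:R) =
    k%:R * N%:R^-1 ^+ 2 :> C by ring.
  by rewrite mulr_ge0 ?exprn_ge0 // invr_ge0 ltW.
have x1 : 0 <= 1 - N%:R^-1 :> C by rewrite subr_ge0 invf_le1 // ler1n.
have := B N; rewrite mulfV ?gt_eqF // => B2.
rewrite -(@ler_pM2r _ 2) // mulVf ?pnatr_eq0 //.
apply: (@le_trans _ _ ((1 - N%:R^-1) ^+ N * (1 + N%:R^-1) ^+ N)).
  by rewrite ler_wpM2l ?exprn_ge0.
rewrite -exprMn exprn_ile1 //; first by rewrite mulr_ge0 // addr_ge0 // invr_ge0 ltW.
rewrite -subr_sqr expr1n lerBlDr lerDl exprn_ge0 // invr_ge0 ltW //.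
Qed.

(** * Tail bounds from moments *)

Section Tails.
Variables (C : numClosedFieldType) (T : finType) (p : T -> C).
Hypothesis p_ge0 : forall y, 0 <= p y.
Hypothesis p_sum : \sum_y p y = 1.

Lemma markov c (X : {ffun 'I_c -> T} -> C) (E : {ffun 'I_c -> T} -> bool) (Q : nat) (u v : C) :
  (forall I, 0 <= X I) -> 0 < u -> 0 <= v ->
  (forall I, E I -> (4 * u) ^+ Q <= X I) ->
  \sum_I pw p I * X I <= u ^+ Q * v ->
  \sum_I pw p I * (E I)%:R <= 4^-1 ^+ Q * v.
Proof.
move=> X0 u0 v0 EX sX.
have d0 : 0 < (4 * u) ^+ Q by rewrite exprn_gt0 // mulr_gt0.
rewrite -(ler_pM2r d0) mulrAC -exprMn mulKf ?pnatr_eq0 //; apply: le_trans sX.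
rewrite mulr_suml; apply: ler_sum => I _; rewrite -mulrA ler_wpM2l ?pw_ge0 //.
by case: (boolP (E I)) => [/EX|_]; rewrite ?mul1r ?mul0r.
Qed.

(** The threshold for the square is four times the scale [20 Q rho h / c] of the moments, which
    yields [80] and the geometric factor [4^-Q]. The dimension enters only as [\tr H / h]. *)
Lemma moment_tail m c (x : T -> 'cV[C]_m) (rho h e : C) (Q : nat) :
  let H := \sum_y p y *: (x y *m (x y)^t*) in
  (0 < c)%N -> (0 < Q)%N -> (forall y, fsq (x y) <= rho) -> 0 < h -> 0 <= rho ->
  (forall v : 'cV_m, (v^t* *m H *m v) 0 0 <= h * fsq v) ->
  4 * Q%:R * rho <= c%:R * h -> 0 < e -> 80 * Q%:R * rho * h / c%:R <= e ^+ 2 ->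
  \sum_I pw p I * (~~ `[< opn (emp_dev (c := c) p x I) e >])%:R <= 4^-1 ^+ Q * (\tr H / h).
Proof.
move=> H c0 Q0 xr h0 rho0 Hh Qc e0 Ue.
have u0 : 0 < e ^+ 2 / 4 by rewrite divr_gt0 // exprn_gt0.
have HE : H = \sum_y p y *: (x y *m (x y)^t*) by [].
have trH0 : 0 <= \tr H.
  rewrite /H linear_sum /=; apply: sumr_ge0 => y _.
  by rewrite mxtraceZ mulr_ge0 // -fsq_tr fsq_ge0.
apply: (@markov _ (fun I => \tr (emp_dev p x I ^+ Q.*2)) _ Q (e ^+ 2 / 4)) => //.
- by move=> I; apply: tr_even_ge0.
- by rewrite divr_ge0 // ltW.
- move=> I /asboolPn nop; rewrite mulrC divfK ?pnatr_eq0 // -exprM mul2n.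
  rewrite real_leNgt ?ger0_real ?tr_even_ge0 ?exprn_ge0 ?ltW //.
  apply/negP => lt; apply: nop; apply: (@moment_opn _ _ _ Q) => //; rewrite ?ltW //.
  exact: emp_dev_adj.
apply: le_trans (moment_bound p_ge0 p_sum c0 xr h0 Hh Q0 Qc) _.
rewrite -HE; apply: ler_wpM2r; first by rewrite divr_ge0 // ltW.
have q0 : 0 <= 20 * Q%:R * rho * h / c%:R by rewrite divr_ge0 // !mulr_ge0 // ltW.
rewrite ler_pXn2r ?nnegrE ?(ltW u0) //.
rewrite ler_pdivlMr //; apply: le_trans Ue.
rewrite le_eqVlt; apply/orP; left; apply/eqP; ring.
Qed.

Lemma bernstein_tail n c (Z : T -> 'cV[C]_n) (b vr U : C) (Q : nat) :
  0 <= b -> (forall y, fsq (Z y) <= b ^+ 2) -> \sum_y p y * fsq (Z y) <= vr ->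
  (0 < Q)%N -> 0 < U -> 16 * Q%:R * (c%:R * vr) <= U -> (20 * Q%:R * b) ^+ 2 <= U ->
  \sum_I pw p I * (~~ (fsq (sum_dev (c := c) p Z I) <= 4 * U))%:R <= 4^-1 ^+ Q.
Proof.
move=> b0 Zb Zv Q0 U0 U1 U2; rewrite -[leRHS]mulr1.
apply: (@markov _ (fun I => fsq (sum_dev p Z I) ^+ Q) _ Q U) => //.
- by move=> I; rewrite exprn_ge0 ?fsq_ge0.
- have U4 : 0 <= 4 * U by rewrite mulr_ge0 // ltW.
  move=> I; rewrite -real_ltNge ?ger0_real ?fsq_ge0 // => /ltW lt.
  by rewrite lerXn2r ?nnegrE ?fsq_ge0.
by rewrite mulr1; apply: bernstein_bound p_ge0 p_sum b0 Zb Zv _ _ Q0 U1 U2.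
Qed.
End Tails.

(** * Deterministic error of the approximation *)

Section Deterministic.
Variable C : numClosedFieldType.

Lemma opn_inv m n (M : 'M[C]_(m, n)) b : opn (M *m M^t*) b -> 0 <= b ->
  forall v : 'cV_m, fsq (M^t* *m v) <= b * fsq v.
Proof.
move=> oM b0 v; have := opn_bil b0 oM v v.
have -> : v^t* *m (M *m M^t*) *m v = (M^t* *m v)^t* *m (M^t* *m v).
  by rewrite adjM trmxCK !mulmxA.
have -> : ((M^t* *m v)^t* *m (M^t* *m v)) 0 0 = fsq (M^t* *m v).
  by rewrite fsq_trl /mxtrace big_ord1.
rewrite ger0_norm ?fsq_ge0 // => h; apply: le_trans h _.
by rewrite le_eqVlt; apply/orP; left; apply/eqP; field.
Qed.

(* [g] at the positive matrix [A A^*], times [A], is [g (x^2) x] at the singular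
   values [x] of [A]. *)
Lemma fcalc_svd m n l (A : 'M[C]_(m, n)) (s : 'rV[C]_l) (X : 'M[C]_(m, l)) (Y : 'M[C]_(n, l))
    (U : 'M[C]_m) (d : 'rV[C]_m) (g : C -> C) :
  X^t* \is unitarymx -> Y^t* \is unitarymx -> (forall k, s 0 k \is Num.real) ->
  A = X *m diag_mx s *m Y^t* -> U \is unitarymx -> A *m A^t* = U^t* *m diag_mx d *m U ->
  fcalc U d g *m A = X *m diag_mx (\row_k (g (s 0 k ^+ 2) * s 0 k)) *m Y^t*.
Proof.
move=> XU YU sR AE UU AAE.
have XX : X^t* *m X = 1%:M by move/unitarymxP: XU; rewrite trmxCK.
have YY : Y^t* *m Y = 1%:M by move/unitarymxP: YU; rewrite trmxCK.
have AA : A *m A^t* *m X = X *m diag_mx (\row_k s 0 k ^+ 2).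
  rewrite AE !adjM trmxCK adj_diag // -!mulmxA; congr (X *m _).
  rewrite !mulmxA -[diag_mx s *m Y^t* *m Y]mulmxA YY mulmx1 -!mulmxA XX mulmx1 mulmx_diag.
  by congr diag_mx; apply/rowP => k; rewrite !mxE.
have I1 : (1%:M : 'M[C]_l) \is unitarymx by apply/unitarymxP; rewrite mul1mx trmx1 map_mx1.
have := @fcalc_intertwine _ _ _ U 1%:M d (\row_k s 0 k ^+ 2) X g UU I1.
rewrite -AAE AA /fcalc trmx1 map_mx1 !mulmx1 !mul1mx => /(_ erefl) FX.
rewrite AE !mulmxA FX -[X *m _ *m diag_mx s]mulmxA mulmx_diag.
by congr (_ *m diag_mx _ *m _); apply/rowP => k; rewrite !mxE.
Qed.

Lemma psd_eigen m n (M : 'M[C]_(m, n)) (U : 'M[C]_m) (d : 'rV[C]_m) b :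
  U \is unitarymx -> M *m M^t* = U^t* *m diag_mx d *m U -> 0 <= b -> opn (M *m M^t*) b ->
  forall i, 0 <= d 0 i <= b.
Proof.
move=> UU ME b0 oM i.
have d0 : 0 <= d 0 i.
  have E : (U *m M) *m (U *m M)^t* = diag_mx d.
    rewrite adjM !mulmxA -[U *m M *m M^t*]mulmxA ME !mulmxA.
    by rewrite (unitarymxP UU) mul1mx -mulmxA (unitarymxP UU) mulmx1.
  have := congr1 (fun X : 'M_m => X i i) E; rewrite !mxE eqxx mulr1n => <-.
  by apply: sumr_ge0 => j _; rewrite adjE mul_conjC_ge0.
by rewrite d0 -[d 0 i]ger0_norm //; rewrite ME in oM; apply: opn_eigen b0 UU oM i.
Qed.

Lemma opn_fcalc_sub n (U : 'M[C]_n) (d : 'rV[C]_n) (g h : C -> C) b : 0 <= b ->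
  U \is unitarymx -> (forall i, `|g (d 0 i) - h (d 0 i)| <= b) ->
  opn (fcalc U d g - fcalc U d h) b.
Proof.
move=> b0 UU gh; rewrite /fcalc -mulmxBl -mulmxBr -raddfB /=.
by apply: opn_spectral => // i; rewrite !mxE.
Qed.

(** Four errors are separated: [x4] for [Y] in place of [Z^* A], [x3] for [h] at the diagonalised
    estimate in place of [h] at [Z^* Z], [x2] for the shift, by which [x h x] differs from [g x],
    and [x1] for [g] at [Z Z^*] in place of [A A^*]. The middle ones meet because [Z] carries [h]
    from [Z^* Z] to [Z Z^*]. The conditions [e1, e2 <= a ^+ 2] keep all spectra below [4 a ^+ 2]. *)
Lemma approx_error m n c (A : 'M[C]_(m, n)) (Z : 'M[C]_(m, c)) (Y : 'M[C]_(c, n))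
    (Q : 'M[C]_c) (D : 'rV[C]_c) (U : 'M[C]_m) (d : 'rV[C]_m) (g h : C -> C)
    (a L Lb e1 e2 e3 eta x1 x2 x3 x4 : C) (K1 k1 K2 k2 : nat) :
  0 < a -> 0 <= L -> 0 <= Lb -> 0 < e1 -> 0 < e2 -> 0 <= e3 -> 0 <= eta ->
  opn A a -> opn (Z *m Z^t* - A *m A^t*) e1 ->
  Q \is unitarymx -> (forall i, 0 <= D 0 i) ->
  opn (Q *m diag_mx D *m Q^t* - Z^t* *m Z) (2 * e2) ->
  fsq (Y - Z^t* *m A) <= (2 * e3) ^+ 2 ->
  U \is unitarymx -> A *m A^t* = U^t* *m diag_mx d *m U ->
  (forall x y, 0 <= x -> 0 <= y -> `|g x - g y| <= L * `|x - y|) ->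
  (forall x y, 0 <= x -> 0 <= y -> `|h x - h y| <= Lb * `|x - y|) ->
  (forall x, 0 <= x -> `|h x| <= L) ->
  (forall x, 0 <= x -> `|x * h x - g x| <= x * (Lb * eta)) ->
  e1 <= a ^+ 2 -> e2 <= a ^+ 2 ->
  (K1 < 2 ^ k1)%N -> 2 * a ^+ 2 <= K1%:R * e1 ->
  (K2 < 2 ^ k2)%N -> 4 * a ^+ 2 <= K2%:R * (2 * e2) ->
  (6 * k1 + 2)%:R * (L * e1) * a <= x1 ->
  2 * a ^+ 2 * (Lb * eta) * a <= x2 ->
  2 * a ^+ 2 * ((6 * k2 + 2)%:R * (Lb * (2 * e2))) * a <= x3 ->
  2 * a * L * (2 * e3) <= x4 ->
  opn (Z *m (Q *m diag_mx (map_mx h D) *m Q^t*) *m Y - fcalc U d g *m A) (x4 + x3 + x2 + x1).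
Proof.
move=> a0 L0 Lb0 e10 e20 e30 eta0 oA oZA QU D0 oQD fY UU AE gL hLb hL hg e1a e2a K1k K1e K2k K2e
  X1 X2 X3 X4.
have a0' := ltW a0; have e10' := ltW e10; have e20' := ltW e20.
have aa0 : 0 <= a ^+ 2 by rewrite exprn_ge0.
have aa20 : 0 <= 2 * a ^+ 2 by rewrite mulr_ge0.
have oAA : opn (A *m A^t*) (a ^+ 2) by rewrite expr2; apply: opnM => //; apply: opn_adj.
have oZZ : opn (Z *m Z^t*) (2 * a ^+ 2).
  rewrite -[Z *m _](subrK (A *m A^t*)); apply: opnW (opnD e10' aa0 oZA oAA).
    by rewrite addr_ge0.
  by rewrite mulr_natl mulr2n lerD2r.
(* [|Z|] is bounded by this root, so that two factors give exactly [2 a^2] in [x3]; it is rounded up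
   to [2 a] only in [x4]. *)
pose s := sqrtC (2 * a ^+ 2).
have s0 : 0 <= s by rewrite sqrtC_ge0.
have ss : s * s = 2 * a ^+ 2 by rewrite -expr2 sqrtCK.
have s2a : s <= 2 * a.
  rewrite -(@ler_pXn2r _ 2) ?nnegrE // ?mulr_ge0 // sqrtCK exprMn ler_wpM2r //.
  by rewrite -natrX ler_nat.
have oZt : opn (Z^t*) s by move=> v; rewrite expr2 ss; apply: opn_inv.
have oZ : opn Z s by rewrite -[Z]trmxCK; apply: opn_adj.
have oG : opn (Z^t* *m Z) (2 * a ^+ 2) by rewrite -ss; apply: opnM.
have [V [b [VU _ BE]]] : exists (V : 'M_m) (b : 'rV_m),
    [/\ V \is unitarymx, forall i, b 0 i \is Num.real & Z *m Z^t* = V^t* *m diag_mx b *m V].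
  by apply: herm_spectral; rewrite adjM trmxCK.
have [W [w [WU _ GE]]] : exists (W : 'M_c) (w : 'rV_c),
    [/\ W \is unitarymx, forall i, w 0 i \is Num.real & Z^t* *m Z = W^t* *m diag_mx w *m W].
  by apply: herm_spectral; rewrite adjM trmxCK.
have dB := psd_eigen UU AE aa0 oAA; have bB := psd_eigen VU BE aa20 oZZ.
have wB : forall i, 0 <= w 0 i <= 2 * a ^+ 2.
  by apply: (@psd_eigen _ _ (Z^t*) W) => //; rewrite trmxCK.
have K1a : a ^+ 2 <= K1%:R * e1 by apply: le_trans K1e; rewrite ler_peMl // ler1n.
have T1 : opn (fcalc V b g - fcalc U d g) ((6 * k1 + 2)%:R * (L * e1)).
  apply: (operator_lipschitz (K := K1)) => //; last by rewrite -BE -AE.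
    by move=> i; have /andP[-> /le_trans ->] := bB i.
  by move=> i; have /andP[-> /le_trans ->] := dB i.
have T2 : opn (fcalc V b (fun x => x * h x) - fcalc V b g) (2 * a ^+ 2 * (Lb * eta)).
  apply: opn_fcalc_sub => //; first by rewrite !mulr_ge0.
  move=> i; have /andP[b0 bb] := bB i; apply: le_trans (hg _ b0) _.
  by rewrite ler_wpM2r // mulr_ge0.
have QtU : Q^t* \is unitarymx by rewrite trmxC_unitary.
have NE : Q *m diag_mx (map_mx h D) *m Q^t* = fcalc (Q^t*) D h by rewrite /fcalc trmxCK.
have DB i : 0 <= D 0 i <= 4 * a ^+ 2.
  rewrite D0 -[D 0 i]ger0_norm //; apply: (@opn_eigen _ _ (Q^t*)) => //; first by rewrite mulr_ge0.
  rewrite trmxCK -[Q *m _ *m _](subrK (Z^t* *m Z)).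
  apply: opnW (opnD _ aa20 oQD oG); rewrite ?addr_ge0 ?mulr_ge0 //.
  have -> : 4 * a ^+ 2 = 2 * a ^+ 2 + 2 * a ^+ 2 by ring.
  by rewrite lerD2r ler_wpM2l.
have T3 : opn (Q *m diag_mx (map_mx h D) *m Q^t* - fcalc W w h)
    ((6 * k2 + 2)%:R * (Lb * (2 * e2))).
  rewrite NE; apply: (operator_lipschitz (K := K2)) => //.
  - by rewrite mulr_gt0.
  - by move=> i; have /andP[-> /le_trans ->] := DB i.
  - move=> i; have /andP[-> /le_trans -> //] := wB i; apply: le_trans K2e.
    by rewrite ler_wpM2r // ler_nat.
  - by rewrite trmxCK -GE.
have ZW : Z *m fcalc W w h *m Z^t* = fcalc V b (fun x => x * h x).
  rewrite -(@fcalc_intertwine _ _ _ V W b w Z h) // -?BE -?GE ?mulmxA //.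
  rewrite -mulmxA BE /fcalc !mulmxA -[_ *m V *m V^t*]mulmxA (unitarymxP VU) mulmx1.
  rewrite -[V^t* *m _ *m _]mulmxA mulmx_diag.
  by congr (_ *m diag_mx _ *m _); apply/rowP => i; rewrite !mxE mulrC.
have oN : opn (Q *m diag_mx (map_mx h D) *m Q^t*) L.
  rewrite -{1}[Q]trmxCK; apply: opn_spectral => // i; rewrite mxE; exact: hL.
set N := Q *m _ *m _ in T3 oN *.
have -> : Z *m N *m Y - fcalc U d g *m A = Z *m N *m (Y - Z^t* *m A)
    + Z *m (N - fcalc W w h) *m (Z^t* *m A)
    + (fcalc V b (fun x => x * h x) - fcalc V b g) *m A + (fcalc V b g - fcalc U d g) *m A.
  rewrite -ZW !mulmxBl !mulmxBr !mulmxBl !mulmxA.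
  by rewrite !addrA !subrK.
have e30' : 0 <= 2 * e3 by rewrite mulr_ge0.
have t10 : 0 <= (6 * k1 + 2)%:R * (L * e1) by rewrite !mulr_ge0.
have t20 : 0 <= 2 * a ^+ 2 * (Lb * eta) by rewrite !mulr_ge0.
have t30 : 0 <= (6 * k2 + 2)%:R * (Lb * (2 * e2)) by rewrite !mulr_ge0.
have o4 : opn (Z *m N *m (Y - Z^t* *m A)) x4.
  apply: opnW X4 _; first by rewrite !mulr_ge0.
  apply: opnM (opn_fsq fY); first by rewrite !mulr_ge0.
  by apply: opnM => //; first exact: mulr_ge0; apply: opnW s2a oZ.
have o3 : opn (Z *m (N - fcalc W w h) *m (Z^t* *m A)) x3.
  apply: opnW X3 _; first by rewrite !mulr_ge0.
  have -> : 2 * a ^+ 2 * ((6 * k2 + 2)%:R * (Lb * (2 * e2))) * a =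
      s * ((6 * k2 + 2)%:R * (Lb * (2 * e2))) * (s * a) by rewrite -ss; ring.
  apply: opnM (opnM s0 oZt oA); first by rewrite mulr_ge0.
  exact: opnM.
have o2 : opn ((fcalc V b (fun x => x * h x) - fcalc V b g) *m A) x2.
  by apply: opnW X2 _; [rewrite !mulr_ge0|apply: opnM].
have o1 : opn ((fcalc V b g - fcalc U d g) *m A) x1.
  by apply: opnW X1 _; [rewrite !mulr_ge0|apply: opnM].
have x40 : 0 <= x4 by apply: le_trans X4; rewrite !mulr_ge0.
have x30 : 0 <= x3 by apply: le_trans X3; rewrite !mulr_ge0.
have x20 : 0 <= x2 by apply: le_trans X2; rewrite !mulr_ge0.
have x10 : 0 <= x1 by apply: le_trans X1; rewrite !mulr_ge0.
by do 3 (apply: opnD; rewrite ?addr_ge0 //).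
Qed.
End Deterministic.

(** * Structured programs *)

Local Open Scope nat_scope.

Variant cond := LtI of nat & nat | LtZ of nat & nat.

Definition jump (cd : cond) l :=
  match cd with LtI x y => IJumpLt x y l | LtZ x y => ZJumpLt x y l end.

(* The tag of [CWhile] names the bound on its number of iterations in [cst]. *)
Inductive cmd :=
  | CIns of instr
  | CSeq of cmd & cmd
  | CIf of cond & cmd
  | CWhile of nat & cond & cmd.

Fixpoint csize c :=
  match c with
  | CIns _ => 1%N
  | CSeq a b => (csize a + csize b)%N
  | CIf _ a => (4 + csize a)%N
  | CWhile _ _ a => (3 + (csize a + 1))%N
  end.

(* Registers 6 and 7 are clobbered by the unconditional jumps. *)
Fixpoint compile p c : program :=
  match c with
  | CIns i => [:: i]
  | CSeq a b => compile p a ++ compile (p + csize a) b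
  | CIf cd a =>
      [:: jump cd (p + 4); ISet 6 0; ISet 7 1; IJumpLt 6 7 (p + (4 + csize a))]
        ++ compile (p + 4) a
  | CWhile _ cd a =>
      [:: ISet 6 0; ISet 7 1; IJumpLt 6 7 (p + (3 + csize a))]
        ++ (compile (p + 3) a ++ [:: jump cd (p + 3)])
  end.

Lemma size_compile c p : size (compile p c) = csize c.
Proof.
elim: c p => [i|a IHa b IHb|cd a IHa|t cd a IHa] p //=.
- by rewrite size_cat IHa IHb.
- by rewrite IHa.
- by rewrite size_cat IHa.
Qed.

(** The register [y] that holds the number of iterations also serves as the tag of the loop, so
    [B y] bounds the value of that register. *)
Definition CFor x y c :=
  CSeq (CIns (ISet x 0))
    (CWhile y (LtI x y) (CSeq c (CSeq (CIns (ISet 7 1)) (CIns (IAdd x x 7))))).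

Definition wi (i : instr) : seq nat :=
  match i with
  | ISet x _ | IAdd x _ _ | ISub x _ _ | IMul x _ _ | IGet x _ _ | IRand x _
  | Ask _ (SRow x) | Ask _ (SCol x _) => [:: x]
  | _ => [::]
  end.
Definition wz (i : instr) : seq nat :=
  match i with
  | ZNat z _ | ZImag z | ZAdd z _ _ | ZSub z _ _ | ZMul z _ _ | ZDiv z _ _
  | ZConj z _ | ZSqrt z _ | ZFun z _ | ZGet z _ _
  | Ask _ (QEntry z _ _) | Ask _ (QTilde z _ _) | Ask _ (QRow z _) | Ask _ (QFro z) => [:: z]
  | _ => [::]
  end.
Definition wia (i : instr) : seq nat := if i is IPut b _ _ then [:: b] else [::].
Definition wza (i : instr) : seq nat := if i is ZPut b _ _ then [:: b] else [::].

(** [scr] stands for the locations clobbered by the jumps of the compiled code: the integer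
    registers 6 and 7, and nothing of the other kinds. *)
Fixpoint writes (w : instr -> seq nat) (scr : seq nat) c : seq nat :=
  match c with
  | CIns i => w i
  | CSeq a b => writes w scr a ++ writes w scr b
  | CIf _ a | CWhile _ _ a => scr ++ writes w scr a
  end.
Definition cwi := writes wi [:: 6; 7].
Definition cwz := writes wz [::].
Definition cwia := writes wia [::].
Definition cwza := writes wza [::].

Definition located (P : program) p (code : program) :=
  forall i, (i < size code)%N -> onth P (p + i) = onth code i.

Lemma located_cat P p a b : located P p (a ++ b) <->
  located P p a /\ located P (p + size a) b.
Proof.
split=> [h|[ha hb] i].
  split=> i ia.
    by rewrite h ?size_cat ?ltn_addr // onth_cat ia.
  by rewrite -addnA h ?size_cat ?ltn_add2l // onth_cat ltnNge leq_addr /= addKn.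
rewrite size_cat onth_cat => ib; case: ltnP => ia; first exact: ha.
by rewrite -hb ?ltn_subLR // -addnA subnKC.
Qed.

Lemma located_cons P p x a : located P p (x :: a) ->
  onth P p = Some x /\ located P p.+1 a.
Proof.
move=> h; split; first by have := h 0%N isT; rewrite addn0.
by move=> i ia; rewrite addSnnS; apply: h.
Qed.

Local Open Scope ring_scope.
Local Open Scope complex_scope.
Local Open Scope sesquilinear_scope.

(** * Semantics and costs of the commands *)

Section Logic.
Variable R : realType.
Local Notation C := R[i].

(** A state without program counter and clock, which assertions must not see. *)
Record memory := Memory {
  mi : nat -> nat; mz : nat -> C; mia : nat -> nat -> nat; mza : nat -> nat -> C }.

Definition st p (M : memory) k : state R := State p (mi M) (mz M) (mia M) (mza M) k.

Definition si x v M := Memory (upd (mi M) x v) (mz M) (mia M) (mza M).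
Definition sz z v M := Memory (mi M) (upd (mz M) z v) (mia M) (mza M).
Definition pti b y v M :=
  Memory (mi M) (mz M) (upd (mia M) b (upd (mia M b) y v)) (mza M).
Definition ptz b y v M :=
  Memory (mi M) (mz M) (mia M) (upd (mza M) b (upd (mza M b) y v)).

Variables (m n : nat) (phi : R) (A : 'M[C]_(m, n)).
Variables (acc : SQ phi A) (acc' : SQ phi (A^t*)) (f : R -> C).

Definition ostep m' n' phi' (A' : 'M[C]_(m', n')) (ac : SQ phi' A') o M : option memory :=
  match o with
  | QEntry z x y =>
      if (insub (mi M x), insub (mi M y)) is (Some i, Some j)
      then Some (sz z (A' i j) M) else None
  | QTilde z x y =>
      if (insub (mi M x), insub (mi M y)) is (Some i, Some j)
      then Some (sz z (tilde ac i j) M) else None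
  | QRow z x =>
      if insub (mi M x) is Some i
      then Some (sz z (row_norm (tilde ac) i)%:C M) else None
  | QFro z => Some (sz z (frob_norm (tilde ac))%:C M)
  | _ => None
  end.

Definition dstep (i : instr) (M : memory) : option memory :=
  match i with
  | ISet x k => Some (si x k M)
  | IAdd x y z => Some (si x (mi M y + mi M z)%N M)
  | ISub x y z => Some (si x (mi M y - mi M z)%N M)
  | IMul x y z => Some (si x (mi M y * mi M z)%N M)
  | IGet x b y => Some (si x (mia M b (mi M y)) M)
  | IPut b y x => Some (pti b (mi M y) (mi M x) M)
  | ZNat z x => Some (sz z (mi M x)%:R M)
  | ZImag z => Some (sz z 'i M)
  | ZAdd z u v => Some (sz z (mz M u + mz M v) M)
  | ZSub z u v => Some (sz z (mz M u - mz M v) M)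
  | ZMul z u v => Some (sz z (mz M u * mz M v) M)
  | ZDiv z u v => Some (sz z (mz M u / mz M v) M)
  | ZConj z u => Some (sz z (mz M u)^* M)
  | ZSqrt z u => Some (sz z (Num.sqrt (complex.Re (mz M u)))%:C M)
  | ZFun z u => Some (sz z (f (complex.Re (mz M u))) M)
  | ZGet z b y => Some (sz z (mza M b (mi M y)) M)
  | ZPut b y z => Some (ptz b (mi M y) (mz M z) M)
  | Ask OnMatrix o => ostep acc o M
  | Ask OnAdjoint o => ostep acc' o M
  | _ => None
  end.

Definition ocost m' n' phi' (A' : 'M[C]_(m', n')) (ac : SQ phi' A') o : R :=
  match o with
  | QEntry _ _ _ => cost_q ac
  | QTilde _ _ _ | QRow _ _ => cost_p ac
  | QFro _ => cost_n ac
  | SRow _ | SCol _ _ => cost_s ac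
  end.

Definition icost (i : instr) : R :=
  match i with
  | Ask OnMatrix o => ocost acc o
  | Ask OnAdjoint o => ocost acc' o
  | _ => 0
  end.

Lemma ocost_ge0 m' n' phi' (A' : 'M[C]_(m', n')) (ac : SQ phi' A') o : 0 <= ocost ac o.
Proof. by have [h1 h2 h3 h4] := cost_ge0 ac; case: o. Qed.

Lemma icost_ge0 i : 0 <= icost i.
Proof. by case: i => // -[] o; apply: ocost_ge0. Qed.

Lemma ask_ostep m' n' phi' (A' : 'M[C]_(m', n')) (ac : SQ phi' A') o p M k K M' :
  ostep ac o M = Some M' -> ask ac o (st p M k) K = K (st p.+1 M' (k + 1 + ocost ac o)).
Proof.
case: o => [z x y|z x y|z x|z|x|x y] //=.
- by case: insub => // i; case: insub => // j [<-].
- by case: insub => // i; case: insub => // j [<-].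
- by case: insub => // i [<-].
- by case=> <-.
Qed.

Lemma exec_dstep i p M k K M' : dstep i M = Some M' ->
  exec acc acc' f i (st p M k) K = K (st p.+1 M' (k + 1 + icost i)).
Proof. by case: i => [> [<-] | > [<-] | > [<-] | > [<-] | > [<-] | > [<-] | > | > | > [<-] | > [<-] | > [<-] | > [<-] | > [<-] | > [<-] | > [<-] | > [<-] | > [<-] | > [<-] | > [<-] | > | [] o h] //; apply: ask_ostep. Qed.

Definition holds cd (M : memory) :=
  match cd with
  | LtI x y => (mi M x < mi M y)%N
  | LtZ x y => complex.Re (mz M x) < complex.Re (mz M y)
  end.

Definition scratch M := si 7 1 (si 6 0 M).

Inductive loop (h : memory -> bool) (body : memory -> memory -> R -> Prop) :
    memory -> memory -> R -> Prop :=
  | LoopStop M : ~~ h M -> loop h body M M 1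
  | LoopStep M M1 M2 t1 t2 : h M -> body M M1 t1 -> loop h body M1 M2 t2 ->
      loop h body M M2 (1 + t1 + t2).

(** Time is counted in compiled instructions: three for an unconditional jump, which also leaves its
    trace in [scratch], and one for each test. *)
Fixpoint bs c : memory -> memory -> R -> Prop :=
  match c with
  | CIns i => fun M M' t => dstep i M = Some M' /\ t = 1 + icost i
  | CSeq a b => fun M M' t =>
      exists M1 t1 t2, [/\ bs a M M1 t1, bs b M1 M' t2 & t = t1 + t2]
  | CIf cd a => fun M M' t =>
      if holds cd M then exists2 t1, bs a M M' t1 & t = 1 + t1
      else M' = scratch M /\ t = 4
  | CWhile _ cd a => fun M M' t =>
      exists2 t1, loop (holds cd) (bs a) (scratch M) M' t1 & t = 3 + t1
  end.

Section Program.
Variable P : program.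
Local Notation run := (run acc acc' f P).

Definition steps s s' := exists k, forall N K, run (k + N) s K = run N s' K.

Lemma steps_trans s1 s2 s3 : steps s1 s2 -> steps s2 s3 -> steps s1 s3.
Proof. by move=> [k h] [l g]; exists (k + l)%N => N K; rewrite -addnA h g. Qed.

Lemma steps_ins p M k i M' : onth P p = Some i -> dstep i M = Some M' ->
  steps (st p M k) (st p.+1 M' (k + (1 + icost i))).
Proof. by move=> Pp h; exists 1%N => N K; rewrite /= Pp (exec_dstep _ _ _ h) addrA. Qed.

Lemma steps_jump p M k cd l : onth P p = Some (jump cd l) ->
  steps (st p M k) (st (if holds cd M then l else p.+1) M (k + 1)).
Proof.
move=> Pp; exists 1%N => N K; rewrite /= Pp.
by case: cd Pp => x y _ /=; case: ifP => _; rewrite /goto /Defs.next /st /= ?addr0.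
Qed.

Lemma steps_goto p M k l : located P p [:: ISet 6 0; ISet 7 1; IJumpLt 6 7 l] ->
  steps (st p M k) (st l (scratch M) (k + 3)).
Proof.
move=> /located_cons[h1 /located_cons[h2 /located_cons[h3 _]]].
have s1 := steps_ins k h1 (erefl (Some (si 6 0 M))).
apply: steps_trans s1 _.
have s2 := steps_ins (k + (1 + icost (ISet 6 0))) h2 (erefl (Some (scratch M))).
apply: steps_trans s2 _.
have := @steps_jump p.+2 (scratch M) (k + (1 + icost (ISet 6 0)) + (1 + icost (ISet 7 1))) (LtI 6 7) l h3.
by rewrite /= !addr0 -!addrA (_ : 1 + (1 + 1) = 3).
Qed.

Lemma bs_steps c : forall p M k M' t, located P p (compile p c) -> bs c M M' t ->
  steps (st p M k) (st (p + csize c)%N M' (k + t)).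
Proof.
elim: c => [i|a IHa b IHb|cd a IHa|tg cd a IHa] p M k M' t /=.
- by move=> /located_cons[h _] [d ->]; rewrite addn1; apply: steps_ins.
- move=> /located_cat[]; rewrite size_compile => la lb [M1 [t1 [t2 [h1 h2 ->]]]].
  by rewrite addnA addrA; apply: steps_trans (IHa _ _ _ _ _ la h1) (IHb _ _ _ _ _ lb h2).
- move=> /located_cons[h1 h2].
  have := @steps_jump p M k cd (p + 4)%N h1; case: ifP => cM s1.
    case=> t1 ha ->; apply: steps_trans s1 _; rewrite addrA addnA.
    apply: IHa ha => //; do 3 move: h2 => /located_cons[_ h2].
    have e : (p + 4)%N = p.+4 by rewrite addn4.
    by rewrite e; move: h2; rewrite e.
  case=> -> ->; apply: steps_trans s1 _.
  have l3 : located P p.+1 [:: ISet 6 0; ISet 7 1; IJumpLt 6 7 (p + (4 + csize a))%N].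
    by move: h2; rewrite -[_ :: _ :: _ :: _]/([:: _; _; _] ++ _) => /located_cat[].
  have := @steps_goto p.+1 M (k + 1) _ l3.
  by rewrite -addrA (_ : 1 + 3 = 4) // -[1]/(1%:R) -natrD.
- rewrite -[_ :: _]/([:: _; _; _] ++ _) => /located_cat[l3 /located_cat[]].
  rewrite size_compile /= => la /located_cons[lj _] [t1 lp ->].
  apply: steps_trans (steps_goto M k l3) _.
  have e1 : (p + (3 + csize a) = p + 3 + csize a)%N by lia.
  have e2 : (p + (3 + (csize a + 1)) = (p + 3 + csize a).+1)%N by lia.
  rewrite [k + (3 + t1)]addrA e1 e2; move: (k + 3) => k'; move: lp; move: (scratch M) => M0 lp.
  elim: lp k' => {M0 M' t1} [M0 /negbTE nh|M0 M1 M2 t1 t2 h0 hb _ IH] k'.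
    have := @steps_jump (p + 3 + csize a)%N M0 k' _ _ lj; rewrite nh.
    by [].
  have := @steps_jump (p + 3 + csize a)%N M0 k' _ _ lj; rewrite h0 => s1.
  apply: steps_trans s1 _.
  apply: steps_trans (IHa _ _ _ _ _ la hb) _.
  by have -> : k' + (1 + t1 + t2) = k' + 1 + t1 + t2; [rewrite !addrA|apply: IH].
Qed.

End Program.

Record frame c (M M' : memory) : Prop := Frame {
  frame_i : forall x, x \notin cwi c -> mi M' x = mi M x;
  frame_z : forall x, x \notin cwz c -> mz M' x = mz M x;
  frame_ia : forall x, x \notin cwia c -> mia M' x = mia M x;
  frame_za : forall x, x \notin cwza c -> mza M' x = mza M x }.

Lemma frame_refl c M : frame c M M. Proof. by split. Qed.

Lemma frame_trans c M1 M2 M3 : frame c M1 M2 -> frame c M2 M3 -> frame c M1 M3.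
Proof. by move=> [a b d e] [a' b' d' e']; split=> x h; rewrite ?a' ?b' ?d' ?e' ?a ?b ?d ?e. Qed.

Lemma frame_sub c c' M M' :
  {subset cwi c <= cwi c'} -> {subset cwz c <= cwz c'} ->
  {subset cwia c <= cwia c'} -> {subset cwza c <= cwza c'} ->
  frame c M M' -> frame c' M M'.
Proof.
move=> h1 h2 h3 h4 [a b d e]; split=> x h.
- by apply: a; apply: contraNN h => /h1.
- by apply: b; apply: contraNN h => /h2.
- by apply: d; apply: contraNN h => /h3.
- by apply: e; apply: contraNN h => /h4.
Qed.

Lemma dstep_frame i M M' : dstep i M = Some M' -> frame (CIns i) M M'.
Proof.
have I1 x v (c : cmd) : cwi c = [:: x] -> frame c M (si x v M).
  by move=> e; split=> //= y; rewrite e inE /upd => /negbTE ->.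
have Z1 x v (c : cmd) : cwz c = [:: x] -> frame c M (sz x v M).
  by move=> e; split=> //= y; rewrite e inE /upd => /negbTE ->.
have PI x y v (c : cmd) : cwia c = [:: x] -> frame c M (pti x y v M).
  by move=> e; split=> //= b; rewrite e inE /upd => /negbTE ->.
have PZ x y v (c : cmd) : cwza c = [:: x] -> frame c M (ptz x y v M).
  by move=> e; split=> //= b; rewrite e inE /upd => /negbTE ->.
have AS m' n' phi' (A' : 'M[C]_(m', n')) (ac : SQ phi' A') o sd :
    ostep ac o M = Some M' -> frame (CIns (Ask sd o)) M M'.
  case: o => [z x y|z x y|z x|z|x|x y] //=.
  - by case: insub => // ?; case: insub => // ? [<-]; apply: Z1.
  - by case: insub => // ?; case: insub => // ? [<-]; apply: Z1.
  - by case: insub => // ? [<-]; apply: Z1.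
  - by case=> <-; apply: Z1.
by case: i => [> [<-] | > [<-] | > [<-] | > [<-] | > [<-] | > [<-] | > | > | > [<-] | > [<-] | > [<-] | > [<-] | > [<-] | > [<-] | > [<-] | > [<-] | > [<-] | > [<-] | > [<-] | > | [] o h] //;
  first [exact: I1|exact: Z1|exact: PI|exact: PZ|exact: AS h].
Qed.

Lemma scratch_frame c M : {subset [:: 6; 7] <= cwi c} -> frame c M (scratch M).
Proof.
move=> h; split=> // x xc; rewrite /scratch /= /upd.
have [x7|_] := eqVneq x 7%N; first by move: xc; rewrite x7 h.
by have [x6|//] := eqVneq x 6%N; move: xc; rewrite x6 h.
Qed.

Lemma bs_frame c M M' t : bs c M M' t -> frame c M M'.
Proof.
elim: c M M' t => [i|a IHa b IHb|cd a IHa|tg cd a IHa] M M' t /=.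
- by case=> /dstep_frame.
- case=> M1 [t1 [t2 [/IHa ha /IHb hb _]]].
  by apply: (@frame_trans _ _ M1); [apply: frame_sub ha|apply: frame_sub hb];
    move=> x; rewrite mem_cat => ->; rewrite ?orbT.
- case: ifP => _; last by case=> -> _; apply: scratch_frame => x; rewrite mem_cat => ->.
  case=> t1 /IHa ha _; apply: frame_sub ha => x; rewrite ?mem_cat => ->; rewrite ?orbT //.
- case=> t1 lp _.
  apply: (@frame_trans _ _ (scratch M)); first by apply: scratch_frame => x; rewrite mem_cat => ->.
  elim: lp => [M0 _|M0 M1 M2 t0 t2 _ /IHa ha _]; first exact: frame_refl.
  apply: frame_trans; apply: frame_sub ha => x; rewrite ?mem_cat => ->; rewrite ?orbT //.
Qed.

Variable B : nat -> R.

(** A cost bound read off the text alone, with [B tg] in place of the number of iterations. The [4]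
    of a loop is the initial jump and the last, failing test. *)
Fixpoint cst c : R :=
  match c with
  | CIns i => 1 + icost i
  | CSeq a b => cst a + cst b
  | CIf _ a => 4 + cst a
  | CWhile tg _ a => 4 + B tg * (1 + cst a)
  end.

Hypothesis B_ge0 : forall x, 0 <= B x.

Lemma cst_ge0 c : 0 <= cst c.
Proof.
elim: c => [i|a IHa b IHb|cd a IHa|tg cd a IHa] /=; rewrite ?addr_ge0 ?icost_ge0 //.
by rewrite mulr_ge0 // addr_ge0.
Qed.

(** * Total correctness of the deterministic commands *)

(** Total correctness together with the time bound. What is left unchanged need not be stated:
    [hoareW] recovers it from the execution. *)
Definition hoare c M (Q : memory -> Prop) :=
  exists M' t, [/\ bs c M M' t, t <= cst c & Q M'].

Lemma hoareW c M (Q Q' : memory -> Prop) :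
  hoare c M Q -> (forall M', frame c M M' -> Q M' -> Q' M') -> hoare c M Q'.
Proof. by move=> [M' [t [h1 h2 h3]]] w; exists M', t; split=> //; apply: w (bs_frame h1) h3. Qed.

Lemma hoare_ins i M M' (Q : memory -> Prop) : dstep i M = Some M' -> Q M' -> hoare (CIns i) M Q.
Proof. by move=> h q; exists M', (1 + icost i). Qed.

Lemma hoare_seq a b M Q : hoare a M (fun M' => hoare b M' Q) -> hoare (CSeq a b) M Q.
Proof.
move=> [M1 [t1 [h1 l1 [M2 [t2 [h2 l2 q]]]]]]; exists M2, (t1 + t2); split=> //=.
  by exists M1, t1, t2.
exact: lerD.
Qed.

Lemma hoare_if cd a M (Q : memory -> Prop) :
  (holds cd M -> hoare a M Q) -> (~~ holds cd M -> Q (scratch M)) -> hoare (CIf cd a) M Q.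
Proof.
move=> ht hf; case: (boolP (holds cd M)) => h.
  have [M1 [t1 [h1 l1 q]]] := ht h; exists M1, (1 + t1); split=> //=.
    by rewrite h; exists t1.
  by apply: lerD l1 => //; rewrite ler1n.
exists (scratch M), 4; split=> /=; rewrite ?(negbTE h) //; last exact: hf.
by rewrite lerDl cst_ge0.
Qed.

(** Termination is part of the step: whenever the test succeeds, the iteration count must still be
    below [N]. The frame of the whole loop is available at every iteration. *)
Lemma hoare_while tg cd a (N : nat) (Inv : nat -> memory -> Prop) M Q :
  N%:R <= B tg -> Inv 0%N (scratch M) ->
  (forall j M', frame (CWhile tg cd a) M M' -> Inv j M' ->
     if holds cd M' then (j < N)%N /\ hoare a M' (Inv j.+1) else Q M') ->
  hoare (CWhile tg cd a) M Q.
Proof.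
move=> NB I0 step; set c := CWhile _ _ _ in step *.
suff /(_ N 0%N (scratch M)) [] : forall d j M', frame c M M' -> Inv j M' -> (N = j + d)%N ->
   exists M2 t, [/\ loop (holds cd) (bs a) M' M2 t,
      t <= 1 + d%:R * (1 + cst a) & Q M2].
- by apply: scratch_frame => x; rewrite mem_cat => ->.
- exact: I0.
- by [].
- move=> M2 [t [lp tl q]]; exists M2, (3 + t); split=> //=; first by exists t.
  apply: le_trans (lerD (lexx 3) tl) _; rewrite addrA -[1]/(1%:R) -natrD lerD2l.
  by rewrite ler_wpM2r // addr_ge0 ?cst_ge0.
elim=> [|d IH] j M' fr ij Nj; have := step _ _ fr ij.
  case: ifP => h; first by rewrite Nj addn0 ltnn => -[].
  move=> q; exists M', 1; split=> //; last by rewrite mul0r addr0.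
  by apply: LoopStop; rewrite h.
case: ifP => h; last first.
  move=> q; exists M', 1; split=> //; first by apply: LoopStop; rewrite h.
  by rewrite lerDl mulr_ge0 // addr_ge0 ?cst_ge0.
case=> _ [M1 [t1 [h1 l1 i1]]].
have fr1 : frame c M M1.
  apply: frame_trans fr _; apply: frame_sub (bs_frame h1) => x; rewrite ?mem_cat => ->; rewrite ?orbT //.
have [M2 [t2 [lp l2 q]]] := IH _ _ fr1 i1 (eq_trans Nj (addnS _ _)).
exists M2, (1 + t1 + t2); split=> //; first exact: LoopStep lp.
have -> : d.+1%:R * (1 + cst a) = d%:R * (1 + cst a) + (1 + cst a).
  by rewrite -natr1 mulrDl mul1r.
by rewrite addrA [leRHS]addrC; apply: lerD => //; rewrite lerD2l.
Qed.

Definition inc x (M : memory) := si x (mi M x + 1)%N (si 7 1 M).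

Lemma hoare_for x y a (Inv : nat -> memory -> Prop) M Q :
  x \notin [:: y; 6; 7] -> y \notin [:: 6; 7] -> x \notin cwi a -> y \notin cwi a ->
  (mi M y)%:R <= B y -> Inv 0%N (scratch (si x 0 M)) ->
  (forall j M', frame (CFor x y a) M M' -> (j < mi M y)%N -> mi M' x = j -> mi M' y = mi M y ->
     Inv j M' -> hoare a M' (fun M'' => Inv j.+1 (inc x M''))) ->
  (forall M', frame (CFor x y a) M M' -> mi M' y = mi M y -> Inv (mi M y) M' -> Q M') ->
  hoare (CFor x y a) M Q.
Proof.
rewrite !inE !negb_or => /and3P[xy x6 x7] /andP[y6 y7] xa ya yB I0 step fin.
have fr0 c M' : frame (CSeq (CIns (ISet x 0)) c) (si x 0 M) M' ->
    frame (CSeq (CIns (ISet x 0)) c) M M'.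
  apply: frame_trans; split=> //= z; rewrite /cwi /= inE /upd negb_or => /andP[/negbTE ->] //.
apply: hoare_seq; apply: (@hoare_ins _ _ (si x 0 M)) => //.
pose J j (M' : memory) := [/\ mi M' x = j, mi M' y = mi M y, (j <= mi M y)%N & Inv j M'].
apply: (@hoare_while _ _ _ (mi M y) J) => //.
  split=> //=; rewrite /upd ?(negbTE x7) ?(negbTE x6) ?eqxx //.
  by rewrite (negbTE y7) (negbTE y6) eq_sym (negbTE xy).
move=> j M' fr [jx jy jle ij] /=.
have fr' : frame (CFor x y a) M M'.
  apply: fr0; apply: frame_sub fr => z; rewrite ?mem_cat => ->; rewrite ?orbT //.
rewrite jx jy; case: ltnP => jY; last first.
  have ej : j = mi M y by apply/eqP; rewrite eqn_leq jle jY.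
  by apply: (fin _ fr' jy); rewrite -ej.
split=> //; apply: hoare_seq; apply: hoareW (step _ _ fr' jY jx jy ij) _ => M1 fr1 i1.
apply: hoare_seq; apply: (@hoare_ins _ _ (si 7 1 M1)) => //.
apply: (@hoare_ins _ _ (inc x M1)).
  by rewrite /= /upd (negbTE x7) /inc.
split=> //=; rewrite /upd ?eqxx.
- by rewrite (frame_i fr1 xa) jx addn1.
- by rewrite eq_sym (negbTE xy) (negbTE y7) (frame_i fr1 ya).
Qed.

(** * Randomised commands *)

Section Random.
Variable P : program.
Local Notation run := (run acc acc' f P).

(* Running from [st p M k] leads to the position [p'], the outcome [o] having
   weight [w o].  Runs of weight zero may get stuck. *)
Definition reach p M k (O : finType) (w : O -> R) p' (Post : O -> memory -> R -> Prop) :=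
  exists n0 (fin : O -> memory) (tm : O -> R) (kk : O -> nat),
    (forall o, w o != 0 -> Post o (fin o) (tm o)) /\
    forall N K, run (n0 + N) (st p M k) K =
      \sum_o w o * run (kk o + N) (st p' (fin o) (tm o)) K.

Lemma reach_steps p M k p1 M1 k1 (O : finType) (w : O -> R) p' Post :
  steps P (st p M k) (st p1 M1 k1) -> reach p1 M1 k1 w p' Post -> reach p M k w p' Post.
Proof.
move=> [j hj] [n0 [fin [tm [kk [h e]]]]]; exists (j + n0)%N, fin, tm, kk; split=> // N K.
by rewrite -addnA hj e.
Qed.

Lemma reach_ret p M k (Post : unit -> memory -> R -> Prop) :
  Post tt M k -> reach p M k (fun=> 1) p Post.
Proof.
move=> h; exists 0%N, (fun=> M), (fun=> k), (fun=> 0%N); split=> [[] //|N K].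
by rewrite (big_pred1 tt) => [|[]]; rewrite ?mul1r.
Qed.

Lemma reachW p M k (O : finType) (w : O -> R) p' (Post Post' : O -> memory -> R -> Prop) :
  reach p M k w p' Post -> (forall o M' k', w o != 0 -> Post o M' k' -> Post' o M' k') ->
  reach p M k w p' Post'.
Proof.
move=> [n0 [fin [tm [kk [h e]]]]] W; exists n0, fin, tm, kk; split=> // o wo.
exact/W/h.
Qed.

Lemma reach_bij p M k (O O' : finType) (h : O' -> O) (w : O -> R) (w' : O' -> R) p' Post :
  bijective h -> (forall o, w' o = w (h o)) ->
  reach p M k w p' Post -> reach p M k w' p' (fun o => Post (h o)).
Proof.
move=> bh ww [n0 [fin [tm [kk [q e]]]]].
exists n0, (fin \o h), (tm \o h), (kk \o h); split=> [o|N K].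
  by rewrite ww; apply: q.
by rewrite e (reindex h) /=; [apply: eq_bigr => o _; rewrite ww|apply: onW_bij].
Qed.

(** The continuation is only known to run from outcomes of nonzero weight; for the others arbitrary
    data is chosen, which their weight zero annihilates. *)
Lemma reach_bind p M k (O O2 : finType) (w : O -> R) (w2 : O -> O2 -> R) p1 p2
    (Post1 : O -> memory -> R -> Prop) (Post2 : O -> O2 -> memory -> R -> Prop) :
  reach p M k w p1 Post1 ->
  (forall o M' k', w o != 0 -> Post1 o M' k' -> reach p1 M' k' (w2 o) p2 (Post2 o)) ->
  reach p M k (fun x : O * O2 => w x.1 * w2 x.1 x.2) p2 (fun x => Post2 x.1 x.2).
Proof.
move=> [n0 [fin [tm [kk [h e]]]]] H.
pose D := (nat * (O2 -> memory) * (O2 -> R) * (O2 -> nat))%type.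
have : forall o, exists d : D, w o != 0 ->
    (forall o2, w2 o o2 != 0 -> Post2 o o2 (d.1.1.2 o2) (d.1.2 o2)) /\
    forall N K, run (d.1.1.1 + N) (st p1 (fin o) (tm o)) K =
      \sum_o2 w2 o o2 * run (d.2 o2 + N) (st p2 (d.1.1.2 o2) (d.1.2 o2)) K.
  move=> o; case: (eqVneq (w o) 0) => wo; first by exists (0%N, fun=> M, fun=> k, fun=> 0%N).
  have [n1 [fin1 [tm1 [kk1 [h1 e1]]]]] := H o _ _ wo (h o wo).
  by exists (n1, fin1, tm1, kk1).
case/choice => d hd.
(* The branches need different numbers of instructions; all receive the maximum, and the surplus is
   recorded as remaining fuel. *)
pose mx := \max_o (d o).1.1.1.
exists (n0 + mx)%N, (fun x => (d x.1).1.1.2 x.2), (fun x => (d x.1).1.2 x.2),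
  (fun x => (d x.1).2 x.2 + (mx - (d x.1).1.1.1 + kk x.1))%N; split.
  move=> [o o2] /=; rewrite mulf_eq0 negb_or => /andP[wo wo2].
  by have [hp _] := hd o wo; apply: hp.
move=> N K; rewrite -addnA e -(pair_bigA _ (fun o o2 => w o * w2 o o2 *
  run ((d o).2 o2 + (mx - (d o).1.1.1 + kk o) + N) (st p2 ((d o).1.1.2 o2) ((d o).1.2 o2)) K)) /=.
apply: eq_bigr => o _; case: (eqVneq (w o) 0) => wo.
  by rewrite wo mul0r big1 // => o2 _; rewrite !mul0r.
have [_ he] := hd o wo.
have -> : (kk o + (mx + N) = (d o).1.1.1 + (mx - (d o).1.1.1 + kk o + N))%N.
  have := @leq_bigmax_cond _ xpredT (fun o => (d o).1.1.1) o isT; rewrite -/mx; lia.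
rewrite he mulr_sumr; apply: eq_bigr => o2 _; rewrite mulrA; congr (_ * run _ _ _); lia.
Qed.

End Random.

Definition hoareR c M (O : finType) (w : O -> R) (Post : O -> memory -> Prop) :=
  forall P p k, located P p (compile p c) ->
    reach P p M k w (p + csize c)%N
      (fun o M' k' => [/\ Post o M', frame c M M' & k' <= k + cst c]).

Lemma hoareR_W c M (O : finType) (w : O -> R) (Post Post' : O -> memory -> Prop) :
  hoareR c M w Post -> (forall o M', w o != 0 -> frame c M M' -> Post o M' -> Post' o M') ->
  hoareR c M w Post'.
Proof.
move=> h W P p k lc; apply: reachW (h P p k lc) _ => o M' k' wo [h1 h2 h3].
by split=> //; apply: W.
Qed.

Lemma hoareR_det c M (Q : memory -> Prop) : hoare c M Q ->
  hoareR c M (fun _ : unit => 1) (fun=> Q).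
Proof.
move=> [M' [t [h1 h2 h3]]] P p k lc.
apply: reach_steps (bs_steps k lc h1) _; apply: reach_ret; split=> //.
- exact: bs_frame h1.
- by rewrite lerD2l.
Qed.

Lemma frame_seql a b M M' : frame a M M' -> frame (CSeq a b) M M'.
Proof. by apply: frame_sub => x; rewrite mem_cat => ->. Qed.

Lemma frame_seqr a b M M' : frame b M M' -> frame (CSeq a b) M M'.
Proof. by apply: frame_sub => x; rewrite mem_cat orbC => ->. Qed.

Lemma hoareR_seq a b M (O O2 : finType) (w : O -> R) (w2 : O -> O2 -> R) Post1
    (Post2 : O -> O2 -> memory -> Prop) :
  hoareR a M w Post1 ->
  (forall o M', w o != 0 -> frame a M M' -> Post1 o M' -> hoareR b M' (w2 o) (Post2 o)) ->
  hoareR (CSeq a b) M (fun x : O * O2 => w x.1 * w2 x.1 x.2) (fun x => Post2 x.1 x.2).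
Proof.
move=> ha hb P p k /located_cat[]; rewrite size_compile => la lb.
apply: (@reach_bind _ _ _ _ _ _ _ _ _ _ _ (fun o o2 M' k' =>
  [/\ Post2 o o2 M', frame (CSeq a b) M M' & k' <= k + cst (CSeq a b)]) (ha P p k la)).
move=> o M' k' wo [p1 f1 t1]; rewrite /= addnA.
apply: reachW (hb o M' wo f1 p1 P _ k' lb) _ => o2 M2 k2 _ [p2 f2 t2]; split=> //.
- exact: frame_trans (frame_seql b f1) (frame_seqr a f2).
- by apply: le_trans t2 _; rewrite addrA lerD2r.
Qed.

Lemma hoareR_post a b M (O : finType) (w : O -> R) Post1 (Post2 : O -> memory -> Prop) :
  hoareR a M w Post1 ->
  (forall o M', w o != 0 -> frame a M M' -> Post1 o M' -> hoare b M' (Post2 o)) ->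
  hoareR (CSeq a b) M w Post2.
Proof.
move=> ha hb P p k lc.
have hs := @hoareR_seq a b M O unit w (fun _ _ => 1) Post1 (fun o _ => Post2 o) ha
  (fun o M' wo fr p1 => hoareR_det (hb o M' wo fr p1)) P p k lc.
have bij : bijective (fun o : O => (o, tt)) by exists fst => [|[? []]].
by apply: (reach_bij bij _ hs) => o; rewrite mulr1.
Qed.

Lemma hoareR_pre a b M (Q : memory -> Prop) (O : finType) (w : O -> R) (Post : O -> memory -> Prop) :
  hoare a M Q -> (forall M', frame a M M' -> Q M' -> hoareR b M' w Post) ->
  hoareR (CSeq a b) M w Post.
Proof.
move=> ha hb P p k lc.
have hs := @hoareR_seq a b M unit O (fun=> 1) (fun=> w) (fun=> Q) (fun=> Post) (hoareR_det ha)
  (fun o M' _ fr q => hb M' fr q) P p k lc.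
have bij : bijective (fun o : O => (tt, o)) by exists snd => [|[[] ?]].
by apply: (reach_bij bij _ hs) => o; rewrite mul1r.
Qed.

Lemma hoareR_ask i M (O : finType) (w : O -> R) (fin : O -> memory) :
  (forall o, frame (CIns i) M (fin o)) ->
  (forall p k K, exec acc acc' f i (st p M k) K =
    \sum_o w o * K (st p.+1 (fin o) (k + 1 + icost i))) ->
  hoareR (CIns i) M w (fun o M' => M' = fin o).
Proof.
move=> fr ex P p k /located_cons[Pp _]; exists 1%N, fin, (fun=> k + 1 + icost i), (fun=> 0%N).
split=> [o _|N K]; first by rewrite /= addrA; split.
by rewrite /= Pp ex addn1.
Qed.

Lemma hoareR_srow_matrix x M : hoareR (CIns (Ask OnMatrix (SRow x))) M
  (fun i => row_norm (tilde acc) i ^+ 2 / frob_norm (tilde acc) ^+ 2)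
  (fun i M' => M' = si x i M).
Proof.
apply: hoareR_ask => [o|p k K] //=.
by split=> //= y; rewrite inE /upd => /negbTE ->.
Qed.

Lemma hoareR_srow_adjoint x M : hoareR (CIns (Ask OnAdjoint (SRow x))) M
  (fun i => row_norm (tilde acc') i ^+ 2 / frob_norm (tilde acc') ^+ 2)
  (fun i M' => M' = si x i M).
Proof.
apply: hoareR_ask => [o|p k K] //=.
by split=> //= y; rewrite inE /upd => /negbTE ->.
Qed.

Lemma hoareR_scol_adjoint x y M (i : 'I_n) : mi M y = i :> nat ->
  hoareR (CIns (Ask OnAdjoint (SCol x y))) M
    (fun j => Normc.normc (tilde acc' i j) ^+ 2 / row_norm (tilde acc') i ^+ 2)
    (fun j M' => M' = si x j M).
Proof.
move=> Mi; apply: hoareR_ask => [o|p k K] /=.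
  by split=> //= z; rewrite inE /upd => /negbTE ->.
by rewrite Mi valK.
Qed.

Lemma hoareR_rand x y M Y : mi M y = Y -> hoareR (CIns (IRand x y)) M
  (fun _ : 'I_Y => Y%:R^-1) (fun i M' => M' = si x i M).
Proof.
move=> <-; apply: hoareR_ask => [o|p k K] /=.
  by split=> //= z; rewrite inE /upd => /negbTE ->.
by [].
Qed.

(** The invariant is indexed by the samples drawn so far. As every iteration has the same law [q],
    the outcomes are independent families with product weight. *)
Lemma hoareR_for x y a Y (T : finType) (q : T -> R) (Inv : seq T -> memory -> Prop) M :
  x \notin [:: y; 6; 7] -> y \notin [:: 6; 7] -> x \notin cwi a -> y \notin cwi a ->
  mi M y = Y -> Y%:R <= B y -> Inv [::] (scratch (si x 0 M)) ->
  (forall v M', frame (CFor x y a) M M' -> (size v < Y)%N -> mi M' x = size v -> mi M' y = Y ->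
     Inv v M' -> hoareR a M' q (fun o M'' => Inv (rcons v o) (inc x M''))) ->
  hoareR (CFor x y a) M (fun o : {ffun 'I_Y -> T} => \prod_t q (o t))
    (fun o M' => mi M' y = Y /\ Inv [seq o i | i <- enum 'I_Y] M').
Proof.
rewrite !inE !negb_or => /and3P[xy x6 x7] /andP[y6 y7] xa ya MY YB I0 step P p k.
set c := CFor x y a.
rewrite [compile p c]/= => /located_cons[l0 l1].
have {l1} [l1 l2] : located P p.+1 [:: ISet 6 0; ISet 7 1; IJumpLt 6 7 (p + 1 + (3 + (csize a + 2)))] /\
  located P (p + 4) (compile (p + 4) (CSeq a (CSeq (CIns (ISet 7 1)) (CIns (IAdd x x 7)))) ++
     [:: IJumpLt x y (p + 4)]).
  move: l1; rewrite -[_ :: _ :: _ :: _]/([:: _; _; _] ++ _) => /located_cat[l1 l2].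
  have e : (p + 1 + 3 = p + 4)%N by lia.
  have e' : (p.+1 + 3 = p + 4)%N by lia.
  by move: l2; rewrite /= e e' => l2; split.
have [lb /located_cons[lj _]] := (located_cat _ _ _ _).1 l2.
rewrite size_compile in lj.
set body := CSeq a _ in l2 lb lj.
pose pt := (p + 4 + csize body)%N.
have e1 : (p + 1 + (3 + (csize a + 2)) = pt)%N by rewrite /pt /=; lia.
have e2 : (p + csize c = pt.+1)%N by rewrite /pt /=; lia.
rewrite e1 in l1; rewrite e2.
have s0 := steps_ins k l0 (erefl (Some (si x 0 M))).
apply: reach_steps s0 _; have s1 := steps_goto (si x 0 M) (k + (1 + icost (ISet x 0))) l1.
apply: reach_steps s1 _.
pose W := 1 + cst body.
have W0 : 0 <= W by rewrite addr_ge0 ?cst_ge0.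
(* Induction on the number [d] of iterations still to come, with tuples as outcomes, since these
   split into head and tail; the passage to finite functions is a bijection at the end. *)
have claim d : forall v M' k', frame c M M' -> (size v + d = Y)%N -> mi M' x = size v ->
    mi M' y = Y -> Inv v M' ->
    reach P pt M' k' (fun o : d.-tuple T => \prod_(z <- o) q z) pt.+1
      (fun o M'' k'' => [/\ mi M'' y = Y /\ Inv (v ++ o) M'', frame c M M'' & k'' <= k' + 1 + d%:R * W]).
  elim: d => [|d IH] v M' k' fr sv vx vy iv.
    have := @steps_jump P pt M' k' (LtI x y) (p + 4)%N lj.
    rewrite /= vx vy -{1}sv addn0 ltnn => sj; apply: reach_steps sj _.
    have bij : bijective (fun _ : 0.-tuple T => tt).
      by exists (fun=> [tuple]) => [t|[]] //; apply: val_inj; case: t => [[|? ?] ?].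
    have rr := @reach_ret P pt.+1 M' (k' + 1) (fun _ M'' k'' => [/\ mi M'' y = Y /\ Inv v M'',
      frame c M M'' & k'' <= k' + 1 + 0%:R * W]).
    apply: reachW (reach_bij bij _ (rr _)) _ => [o||o M'' k'' _].
    - by rewrite tuple0 big_nil.
    - by rewrite mul0r addr0.
    - by rewrite tuple0 cats0.
  have := @steps_jump P pt M' k' (LtI x y) (p + 4)%N lj.
  have vY : (size v < Y)%N by rewrite -sv addnS ltnS leq_addr.
  rewrite /= vx vy vY => sj; apply: reach_steps sj _.
  have hb : hoareR body M' q (fun o M'' =>
      [/\ mi M'' y = Y, mi M'' x = (size v).+1 & Inv (rcons v o) M'']).
    apply: hoareR_post (step v M' fr vY vx vy iv) _ => o M1 _ fr1 i1.
    apply: hoare_seq; apply: (@hoare_ins _ _ (si 7 1 M1)) => //.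
    apply: (@hoare_ins _ _ (inc x M1)); first by rewrite /= /upd (negbTE x7) /inc.
    split=> //=; rewrite /upd ?eqxx.
    - by rewrite eq_sym (negbTE xy) (negbTE y7) (frame_i fr1 ya).
    - by rewrite (frame_i fr1 xa) vx addn1.
  have bd := @reach_bind P (p + 4)%N M' (k' + 1) T (d.-tuple T : finType) q
    (fun _ (o : d.-tuple T) => \prod_(z <- o) q z) pt pt.+1 _
    (fun o o2 M'' k'' => [/\ mi M'' y = Y /\ Inv (v ++ o :: o2) M'', frame c M M'' &
       k'' <= k' + 1 + d.+1%:R * W]) (hb P (p + 4)%N (k' + 1) lb).
  have bij : bijective (fun t : d.+1.-tuple T => (thead t, [tuple of behead t])).
    exists (fun x : T * d.-tuple T => [tuple of x.1 :: x.2]) => [t|[z t]].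
      by rewrite -tuple_eta.
    by rewrite theadE; congr (_, _); apply: val_inj.
  apply: reachW (reach_bij bij _ (bd _)) _ => [o|o M1 k1 _ [[y1 x1 i1] f1 t1]|o M1 k1 _].
  - by rewrite {1}(tuple_eta o) /= big_cons.
  - have frM1 : frame c M M1.
      by apply: frame_trans fr _; apply: frame_sub f1 => z; rewrite ?mem_cat => ->; rewrite ?orbT.
    apply: reachW (IH (rcons v o) M1 k1 frM1 _ _ y1 i1) _ => [||o2 M2 k2 _ [q1 q2 q3]].
    + by rewrite size_rcons addSnnS.
    + by rewrite size_rcons.
    split=> //; first by rewrite -cat_rcons.
    apply: le_trans q3 _; rewrite -natr1 mulrDl mul1r addrA [leRHS]addrAC lerD2r.
    by rewrite /W (addrC 1 (cst body)) addrA lerD2r.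
  - by have -> : v ++ o = v ++ thead o :: behead o by rewrite {1}(tuple_eta o).
have frM : frame c M (scratch (si x 0 M)).
  split=> //= z; rewrite /cwi /= !inE /upd => zn; case: ifP => [/eqP e|_].
    by move: zn; rewrite e eqxx !orbT.
  case: ifP => [/eqP e|_]; first by move: zn; rewrite e eqxx !orbT.
  by case: ifP => [/eqP e|//]; move: zn; rewrite e eqxx.
have cl := claim Y [::] (scratch (si x 0 M)) (k + (1 + icost (ISet x 0)) + 3) frM (erefl _) _ _ I0.
have bij : bijective (fun o : {ffun 'I_Y -> T} => [tuple o i | i < Y]).
  exists (fun t : Y.-tuple T => [ffun i => tnth t i]) => [o|t].
    by apply/ffunP => i; rewrite ffunE tnth_mktuple.
  by apply: eq_from_tnth => i; rewrite tnth_mktuple ffunE.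
apply: reachW (reach_bij bij _ (cl _ _)) _ => [o|||o M1 k1 _ [h1 h2 h3]].
- by rewrite big_tuple; apply: eq_bigr => i _; rewrite tnth_mktuple.
- by rewrite /= /upd (negbTE x7) (negbTE x6) eqxx.
- by rewrite /= /upd (negbTE y7) (negbTE y6) eq_sym (negbTE xy).
split=> //.
have YW : Y%:R * W <= B y * W by rewrite ler_wpM2r.
apply: le_trans h3 _; rewrite -[cst c]/(1 + icost (ISet x 0) + (4 + B y * W)).
by clear -YW; lra.
Qed.

Definition pure (i : instr) : bool :=
  match i with
  | IRand _ _ | IJumpLt _ _ _ | ZJumpLt _ _ _ | Ask _ _ => false
  | _ => true
  end.

Definition pstep (M : memory) (i : instr) : memory := odflt M (dstep i M).

Lemma dstep_pure i M : pure i -> dstep i M = Some (pstep M i).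
Proof. by case: i. Qed.

End Logic.

Fixpoint blk (s : seq instr) : cmd :=
  match s with
  | [::] => CIns (ISet 7 0)
  | [:: i] => CIns i
  | i :: s' => CSeq (CIns i) (blk s')
  end.

Lemma hoare_blk (R : realType) m n (phi : R) (A : 'M[R[i]]_(m, n)) (acc : SQ phi A)
    (acc' : SQ phi (A^t*)) (f : R -> R[i]) (B : nat -> R) s M (Q : memory R -> Prop) :
  (forall x, 0 <= B x) -> all pure s -> (0 < size s)%N ->
  Q (foldl (pstep acc acc' f) M s) -> hoare acc acc' f B (blk s) M Q.
Proof.
move=> B0; elim: s M => // i [|j s] IH M /= /andP[pi ps] _ q.
  exact: (hoare_ins _ (dstep_pure _ _ _ _ pi)).
apply: hoare_seq; apply: (hoare_ins _ (dstep_pure _ _ _ _ pi)).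
exact: IH.
Qed.

(** * The program *)

Local Open Scope nat_scope.
Declare Scope cmd_scope.
Notation "a ;; b" := (CSeq a b) (at level 61, right associativity) : cmd_scope.
Local Open Scope cmd_scope.
#[local] Arguments upd T h x v y /.
#[local] Arguments blk : simpl never.

(* Integer registers: 0-3 the inputs m, n, r, c; 8 = 1; 9 the failure parameter
   [2 + log2 (1 / delta)]; 10 the scale [ell]; 11 the size of the inner sample;
   12 = c * c; 13 the number of rounds of Jacobi rotations; 14 = 0.
   Complex registers: 0-5 the inputs; 6, 7 = |A~|_F and its square; 8 = 1; 9 = 0;
   10 = (L a^3 + Lbar a^5) / eps; 11 = |A~|_F^2 / a^2; 14 the shift [eta];
   15 the truncation threshold.
   Arrays: 0, 1, 2 the output; 3 the current row of [C]; 4 the estimate of [C^* C],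
   then its rotated versions; 5 the matrix [S C]; 6 its truncation flags; 7 the
   accumulated rotation; 8 the squared norms of the off-diagonal parts of the rows
   of 4; 9 the values of [x |-> g x / x] at the shifted diagonal of 4; 10 the core
   [Q h(D) Q^*]. *)
Definition load_constants : cmd :=
  CIns (Ask OnMatrix (QFro 6)) ;;
  blk [:: ZMul 7 6 6; ISet 8 1; ZNat 8 8; ISet 14 0; ZNat 9 14;
    ZMul 20 5 5; ZMul 21 20 5; ZMul 22 21 20; ZMul 23 1 21; ZMul 24 2 22;
    ZAdd 23 23 24; ZDiv 10 23 3; ZDiv 11 7 20; ZAdd 21 8 10; ZMul 13 11 21;
    ZAdd 20 4 9; ISet 9 2].

Definition find_scale : cmd :=
  blk [:: ZAdd 20 8 9; ISet 10 1] ;;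
  CWhile 101 (LtZ 20 13) (blk [:: ZAdd 20 20 20; IAdd 10 10 8]).

Definition set_target : cmd :=
  blk [:: ISet 21 64; ZNat 21 21; ZMul 21 21 21; ZMul 21 21 21; ISet 22 160; ZNat 22 22;
    ZMul 21 21 22; IAdd 23 9 10; ZNat 22 23; ZMul 21 21 22; ZMul 21 21 11;
    ZMul 22 10 10; ZMul 21 21 22; ZNat 22 10; ZMul 22 22 22; ZMul 21 21 22;
    ZAdd 20 8 9; ISet 11 1].

Definition set_parameters : cmd :=
  blk [:: IMul 12 3 3; ISet 21 4; IMul 13 21 10; ISet 21 24; IAdd 13 13 21;
    ZMul 20 5 5; ISet 20 16; ZNat 21 20; ZMul 21 21 10; ZDiv 14 20 21;
    ZNat 20 9; ZDiv 15 7 20].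

Definition prelude : cmd :=
  load_constants ;;
  CWhile 100 (LtZ 20 8) (blk [:: ZAdd 20 20 20; IAdd 9 9 8]) ;;
  find_scale ;;
  set_target ;;
  CWhile 102 (LtZ 20 21) (blk [:: ZAdd 20 20 20; IAdd 11 11 11]) ;;
  set_parameters.

Definition sketch_body (sd : side) (reg arr : nat) : cmd :=
  CIns (Ask sd (SRow 21)) ;;
  CIns (Ask sd (QRow 20 21)) ;;
  blk [:: ZMul 21 20 20; ZDiv 21 21 7; ZNat 22 reg; ZMul 21 22 21; ZSqrt 21 21;
    ZDiv 21 8 21; IPut arr 20 21; ZPut arr 20 21].

Definition read_row : cmd :=
  CIns (IGet 25 1 24) ;;
  CIns (Ask OnMatrix (QEntry 23 23 25)) ;;
  blk [:: ZGet 24 1 24; ZMul 23 23 24; ZPut 3 24 23; ZConj 24 23; ZMul 24 23 24; ZAdd 22 22 24].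

Definition rank_one : cmd :=
  blk [:: IMul 26 24 3; IAdd 26 26 25; ZGet 24 3 24; ZConj 24 24; ZGet 25 3 25;
    ZMul 24 24 25; ZMul 24 24 23; ZGet 25 4 26; ZAdd 25 25 24; ZPut 4 26 25].

Definition inner_update : cmd :=
  CIns (Ask OnAdjoint (QTilde 20 22 23)) ;;
  CIns (ZAdd 22 9 9) ;;
  CFor 24 3 read_row ;;
  blk [:: ZGet 23 3 21; ZConj 24 23; ZMul 23 23 24; ZGet 24 1 21; ZMul 24 24 24;
    ZDiv 23 23 24; ZMul 23 23 7; ZConj 24 20; ZMul 24 20 24; ZDiv 23 23 24;
    ZDiv 23 23 22; ZNat 24 11; ZDiv 23 23 24] ;;
  CFor 24 3 (CFor 25 3 rank_one).

Definition inner_body : cmd :=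
  (CIns (IRand 21 3) ;; CIns (IGet 22 1 21) ;; CIns (Ask OnAdjoint (SCol 23 22))) ;;
  inner_update.

Definition cross_entry : cmd :=
  CIns (IGet 25 1 24) ;;
  CIns (Ask OnMatrix (QEntry 23 21 25)) ;;
  blk [:: ZGet 24 1 24; ZMul 23 23 24; ZMul 23 23 20; IMul 26 20 3; IAdd 26 26 24;
    ZPut 5 26 23; ZConj 24 23; ZMul 24 23 24; ZAdd 22 22 24].

Definition cross_row : cmd :=
  blk [:: IGet 21 0 20; ZGet 20 0 20; ZAdd 22 9 9] ;;
  CFor 24 3 cross_entry ;;
  CIns (ZAdd 23 8 9) ;;
  CIf (LtZ 15 22) (CIns (ZAdd 23 9 9)) ;;
  CIns (ZPut 6 20 23).

(** The diagonal term is added with the others and subtracted at the end, which is harmless in exact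
    arithmetic. *)
Definition row_sum (x : nat) : cmd :=
  blk [:: IAdd 31 x 14; ZAdd 20 9 9] ;;
  CFor 25 3 (blk [:: IMul 26 31 3; IAdd 26 26 25; ZGet 21 4 26; ZConj 22 21; ZMul 21 21 22;
    ZAdd 20 20 21]) ;;
  blk [:: IMul 26 31 3; IAdd 26 26 31; ZGet 21 4 26; ZConj 22 21; ZMul 21 21 22; ZSub 20 20 21;
    ZPut 8 31 20].

Definition keep_max (y : nat) : cmd :=
  CIf (LtZ 23 21) (blk [:: ZAdd 23 21 9; IAdd y 24 14]).

Definition best_row : cmd :=
  blk [:: ISet 29 0; ZAdd 23 9 9] ;;
  CFor 24 3 (CIns (ZGet 21 8 24) ;; keep_max 29).

(** The two tests with strict inequalities serve to skip the diagonal entry. *)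
Definition best_col : cmd :=
  blk [:: IAdd 30 29 14; ZAdd 23 9 9] ;;
  CFor 24 3
    (blk [:: IMul 26 29 3; IAdd 26 26 24; ZGet 21 4 26; ZConj 22 21; ZMul 21 21 22] ;;
     CIf (LtI 24 29) (keep_max 30) ;;
     CIf (LtI 29 24) (keep_max 30)).

Definition angle : cmd :=
  blk [:: IMul 26 29 3; IAdd 26 26 29; ZGet 30 4 26; IMul 26 29 3; IAdd 26 26 30; ZGet 31 4 26;
    IMul 26 30 3; IAdd 26 26 30; ZGet 32 4 26; ZAdd 33 8 8; ZSub 34 30 32; ZDiv 34 34 33;
    ZConj 35 31; ZMul 36 31 35; ZMul 37 34 34; ZAdd 37 37 36; ZSqrt 37 37; ZAdd 37 34 37;
    ZMul 38 37 37; ZAdd 38 38 36; ZSqrt 38 38; ZDiv 39 37 38; ZDiv 40 35 38; ZConj 41 40].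

(* Column [p] becomes [c col_p + s col_q], column [q] becomes [c col_q - s^* col_p]. *)
Definition rotate_cols (b : nat) : cmd :=
  CFor 24 3 (blk [:: IMul 25 24 3; IAdd 26 25 29; IAdd 25 25 30; ZGet 20 b 26; ZGet 21 b 25;
    ZMul 22 20 39; ZMul 23 21 40; ZAdd 22 22 23; ZPut b 26 22;
    ZMul 22 21 39; ZMul 23 20 41; ZSub 22 22 23; ZPut b 25 22]).

Definition rotate_rows : cmd :=
  CFor 24 3 (blk [:: IMul 25 29 3; IAdd 26 25 24; IMul 25 30 3; IAdd 25 25 24;
    ZGet 20 4 26; ZGet 21 4 25;
    ZMul 22 20 39; ZMul 23 21 41; ZAdd 22 22 23; ZPut 4 26 22;
    ZMul 22 21 39; ZMul 23 20 40; ZSub 22 22 23; ZPut 4 25 22]).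

(** Only the two rotated rows get new row sums, the others being invariant, so a step takes time
    linear in [c]. The guard excludes a zero pivot, for which the angle would be undefined. *)
Definition jacobi_step : cmd :=
  best_row ;; best_col ;;
  CIf (LtZ 9 23)
    (angle ;; rotate_cols 4 ;; rotate_cols 7 ;; rotate_rows ;; row_sum 29 ;; row_sum 30).

Definition jacobi : cmd :=
  CFor 24 3 (blk [:: IMul 26 24 3; IAdd 26 26 24; ZPut 7 26 8]) ;;
  CFor 24 3 (row_sum 24) ;;
  CFor 27 13 (CFor 28 12 jacobi_step).

Definition spectral_values : cmd :=
  CFor 24 3 (blk [:: IMul 26 24 3; IAdd 26 26 24; ZGet 20 4 26; ZAdd 20 20 14; ZSqrt 21 20;
    ZFun 22 21; ZDiv 22 22 21; ZDiv 22 22 20; ZPut 9 24 22]).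

Definition core_matrix : cmd :=
  CFor 20 3 (CFor 24 3
    (CIns (ZAdd 20 9 9) ;;
     CFor 25 3 (blk [:: IMul 26 20 3; IAdd 26 26 25; ZGet 21 7 26; ZGet 22 9 25; ZMul 21 21 22;
       IMul 26 24 3; IAdd 26 26 25; ZGet 22 7 26; ZConj 22 22; ZMul 21 21 22; ZAdd 20 20 21]) ;;
     blk [:: IMul 26 20 3; IAdd 26 26 24; ZPut 10 26 20])).

Definition output_matrix : cmd :=
  CFor 20 3 (CFor 24 2
    (CIns (ZAdd 20 9 9) ;;
     CFor 25 3 (blk [:: IMul 26 20 3; IAdd 26 26 25; ZGet 21 10 26;
       IMul 26 24 3; IAdd 26 26 25; ZGet 22 5 26; ZConj 22 22; ZMul 21 21 22; ZAdd 20 20 21]) ;;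
     blk [:: ZGet 21 6 24; ZMul 20 20 21; IMul 26 20 2; IAdd 26 26 24; ZPut 2 26 20])).

Definition finish : cmd :=
  CFor 20 2 cross_row ;; jacobi ;; spectral_values ;; core_matrix ;; output_matrix.

(** The bracketing of the three sampling loops is that of the product type [outcome]. *)
Definition svt_cmd : cmd :=
  prelude ;;
  ((CFor 20 3 (sketch_body OnAdjoint 3 1) ;;
    CFor 20 2 (sketch_body OnMatrix 2 0)) ;;
   CFor 20 11 inner_body) ;;
  finish.

Local Open Scope ring_scope.
Local Open Scope complex_scope.
Local Open Scope sesquilinear_scope.

Lemma index_eq c (i j i' j' : nat) : (j < c)%N -> (j' < c)%N ->
  (i * c + j == i' * c + j')%N = (i == i') && (j == j').
Proof.
move=> jc jc'; apply/eqP/andP => [e|[/eqP-> /eqP->]] //.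
have ei := congr1 (divn^~ c) e; have ej := congr1 (modn^~ c) e.
have c0 : (0 < c)%N by apply: leq_ltn_trans jc.
rewrite /= !divnMDl // !divn_small // !addn0 in ei.
by rewrite /= !modnMDl !modn_small // in ej; rewrite ei ej.
Qed.

(** * Correctness of a Jacobi step *)

Section Verify.
Variables (R : realType) (m n : nat) (phi : R) (A : 'M[R[i]]_(m, n)).
Variables (acc : SQ phi A) (acc' : SQ phi (A^t*)) (f : R -> R[i]) (B : nat -> R).
Hypothesis B_ge0 : forall x, 0 <= B x.
Local Notation H := (hoare acc acc' f B).
Local Notation memory := (memory R).
Implicit Types (M : memory).

Section Jacobi.
Variable c : nat.
Hypothesis Bc : c%:R <= B 3.

Record consts M : Prop := Consts {
  k_c : mi M 3 = c; k_8 : mi M 8 = 1%N; k_14 : mi M 14 = 0%N;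
  k_z8 : mz M 8 = 1; k_z9 : mz M 9 = 0 }.

Lemma consts_frame d M M' : frame d M M' ->
  all (fun x => x \notin cwi d) [:: 3; 8; 14]%N -> all (fun x => x \notin cwz d) [:: 8; 9]%N ->
  consts M -> consts M'.
Proof.
move=> fr /and4P[h1 h2 h3 _] /and3P[h4 h5 _] [k1 k2 k3 k4 k5].
by split; rewrite ?(frame_i fr) ?(frame_z fr).
Qed.

Definition marr M b (p q : nat) (X : 'M[R[i]]_(p, q)) :=
  forall (i : 'I_p) (j : 'I_q), mza M b (i * q + j)%N = X i j.

Lemma rotate_cols_ok (b : nat) (X : 'M[R[i]]_c) (p q : 'I_c) (cs sn : R[i]) M :
  p != q ->
  consts M -> mi M 29 = p -> mi M 30 = q -> mz M 39 = cs -> mz M 40 = sn -> mz M 41 = sn^* ->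
  marr M b X ->
  H (rotate_cols b) M (fun M' => marr M' b (\matrix_(i, j)
     (if j == p then X i p * cs + X i q * sn
      else if j == q then X i q * cs - X i p * sn^* else X i j))).
Proof.
move=> pq kM Mp Mq Mcs Msn Msb MX; set Y := \matrix_(i, j) _.
apply: (@hoare_for _ _ _ _ _ _ _ _ _ B_ge0 _ _ _ (fun k M' => forall i j : 'I_c,
   mza M' b (i * c + j)%N = if (i < k)%N then Y i j else X i j)) => //.
- by rewrite (k_c kM).
- move=> k M' fr kc M'24 M'3 I; rewrite (k_c kM) in kc M'3.
  have e29 : mi M' 29 = p by rewrite (frame_i fr).
  have e30 : mi M' 30 = q by rewrite (frame_i fr).
  have e39 : mz M' 39 = cs by rewrite (frame_z fr).
  have e40 : mz M' 40 = sn by rewrite (frame_z fr).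
  have e41 : mz M' 41 = sn^* by rewrite (frame_z fr).
  apply: hoare_blk => // i j; pose io := Ordinal kc.
  have Ep : mza M' b (k * c + p)%N = X io p by rewrite (I io p) ltnn.
  have Eq : mza M' b (k * c + q)%N = X io q by rewrite (I io q) ltnn.
  rewrite /= /upd /= !eqxx M'24 M'3 e29 e30 Ep Eq e39 e40 e41 !index_eq // I ltnS.
  case: (ltngtP i k) => //= ik; have -> : i = io by apply: val_inj.
  rewrite mxE -!(inj_eq val_inj) /=; case: (val j =P val q) => [->|_].
    by rewrite eq_sym (negbTE (pq : val p != val q)).
  by case: (val j =P val p).
- by move=> M' fr M3 I i j; rewrite I (k_c kM) ltn_ord.
Qed.

Lemma rotate_rows_ok (X : 'M[R[i]]_c) (p q : 'I_c) (cs sn : R[i]) M :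
  p != q ->
  consts M -> mi M 29 = p -> mi M 30 = q -> mz M 39 = cs -> mz M 40 = sn -> mz M 41 = sn^* ->
  marr M 4 X ->
  H rotate_rows M (fun M' => marr M' 4 (\matrix_(i, j)
     (if i == p then X p j * cs + X q j * sn^*
      else if i == q then X q j * cs - X p j * sn else X i j))).
Proof.
move=> pq kM Mp Mq Mcs Msn Msb MX; set Y := \matrix_(i, j) _.
apply: (@hoare_for _ _ _ _ _ _ _ _ _ B_ge0 _ _ _ (fun k M' => forall i j : 'I_c,
   mza M' 4 (i * c + j)%N = if (j < k)%N then Y i j else X i j)) => //.
- by rewrite (k_c kM).
- move=> k M' fr kc M'24 M'3 I; rewrite (k_c kM) in kc M'3.
  have e29 : mi M' 29 = p by rewrite (frame_i fr).
  have e30 : mi M' 30 = q by rewrite (frame_i fr).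
  have e39 : mz M' 39 = cs by rewrite (frame_z fr).
  have e40 : mz M' 40 = sn by rewrite (frame_z fr).
  have e41 : mz M' 41 = sn^* by rewrite (frame_z fr).
  apply: hoare_blk => // i j; pose jo := Ordinal kc.
  have Ep : mza M' 4 (p * c + k)%N = X p jo by rewrite (I p jo) ltnn.
  have Eq : mza M' 4 (q * c + k)%N = X q jo by rewrite (I q jo) ltnn.
  rewrite /= /upd /= M'24 M'3 e29 e30 Ep Eq e39 e40 e41 !index_eq // I ltnS.
  case: (ltngtP j k) => //= jk; rewrite ?andbF ?andbT //.
  have -> : j = jo by apply: val_inj.
  rewrite mxE -!(inj_eq val_inj) /=; case: (val i =P val q) => [->|_].
    by rewrite eq_sym (negbTE (pq : val p != val q)).
  by case: (val i =P val p).
- by move=> M' fr M3 I i j; rewrite I (k_c kM) ltn_ord.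
Qed.

Lemma conjcE (x : R[i]) : x^*%C = Num.conj x. Proof. by []. Qed.

Lemma sum_ltS (V : nmodType) (F : 'I_c -> V) (k : 'I_c) :
  \sum_(j < c | (j < k.+1)%N) F j = \sum_(j < c | (j < k)%N) F j + F k.
Proof.
rewrite (bigD1 k) //= addrC; congr (_ + _); apply: eq_bigl => j.
by rewrite ltnS ltn_neqAle andbC.
Qed.

Lemma sum_lt0 (V : nmodType) (F : 'I_c -> V) : \sum_(j < c | (j < 0)%N) F j = 0.
Proof. by rewrite big_pred0. Qed.

Lemma sum_ltn (V : nmodType) (F : 'I_c -> V) : \sum_(j < c | (j < c)%N) F j = \sum_j F j.
Proof. by apply: eq_bigl => j; rewrite ltn_ord. Qed.

Lemma row_sum_ok x (X : 'M[R[i]]_c) (i : 'I_c) M :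
  consts M -> mi M x = i -> marr M 4 X ->
  H (row_sum x) M (fun M' => forall k, mza M' 8 k = if k == i then rowoff X i else mza M 8 k).
Proof.
move=> kM Mx MX.
apply: hoare_seq; apply: hoare_blk => //.
set M0 := foldl _ _ _.
have kM0 : consts M0 by case: kM => *; split.
have M031 : mi M0 31 = i by rewrite /= (k_14 kM) addn0.
have M020 : mz M0 20 = 0 by rewrite /= (k_z9 kM) addr0.
have M04 : mza M0 4 = mza M 4 by [].
have M08 : mza M0 8 = mza M 8 by [].
clearbody M0.
pose Inv k M' := mz M' 20 = \sum_(j < c | (j < k)%N) `|X i j| ^+ 2.
apply: hoare_seq; apply: (@hoare_for _ _ _ _ _ _ _ _ _ B_ge0 _ _ _ Inv) => //.
- by rewrite (k_c kM0).
- by rewrite /Inv /= M020 sum_lt0.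
- move=> k M' fr kc M'25 M'3 I; rewrite (k_c kM0) in kc M'3.
  have e31 : mi M' 31 = i by rewrite (frame_i fr).
  have ea : mza M' 4 (i * c + k)%N = X i (Ordinal kc) by rewrite (frame_za fr) // M04 -MX.
  apply: hoare_blk => //; rewrite /Inv (@sum_ltS _ _ (Ordinal kc)) /=.
  by rewrite I M'25 M'3 e31 ea normCK.
- move=> M' fr M'3 I; rewrite (k_c kM0) in I M'3.
  have e31 : mi M' 31 = i by rewrite (frame_i fr).
  have ea : mza M' 4 (i * c + i)%N = X i i by rewrite (frame_za fr) // M04 -MX.
  have e8 : mza M' 8 = mza M 8 by rewrite (frame_za fr).
  apply: hoare_blk => // k /=; rewrite e8 M'3 e31 ea; case: ifP => // _.
  rewrite I sum_ltn /rowoff (bigD1 i) //= -normCK addrC addrK //.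
Qed.

Lemma ltRe (x y : R[i]) : 0 <= x -> 0 <= y ->
  (complex.Re x < complex.Re y) = (x < y).
Proof. by move=> x0 y0; rewrite ltcE !ger0_Im ?eqxx. Qed.

Lemma best_row_ok (V : 'I_c -> R[i]) M : (0 < c)%N -> (forall i, 0 <= V i) ->
  consts M -> (forall i : 'I_c, mza M 8 i = V i) ->
  H best_row M (fun M' => exists2 p : 'I_c, mi M' 29 = p & forall i, V i <= V p).
Proof.
move=> c0 V0 kM MV; apply: hoare_seq; apply: hoare_blk => //.
set M0 := foldl _ _ _.
have kM0 : consts M0 by case: kM => *; split.
have M029 : mi M0 29 = Ordinal c0 by [].
have M023 : mz M0 23 = 0 by rewrite /= (k_z9 kM) addr0.
have M08 : mza M0 8 = mza M 8 by [].
clearbody M0.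
pose Inv k M' := exists p : 'I_c, [/\ mi M' 29 = p, 0 <= mz M' 23, mz M' 23 <= V p &
  forall j : 'I_c, (j < k)%N -> V j <= mz M' 23].
apply: (@hoare_for _ _ _ _ _ _ _ _ _ B_ge0 _ _ _ Inv) => //.
- by rewrite (k_c kM0).
- by exists (Ordinal c0); split; rewrite /= ?M023.
- move=> k M' fr kc M'24 M'3 [p [I1 I2 I3 I4]]; rewrite (k_c kM0) in kc M'3.
  have ea : mza M' 8 k = V (Ordinal kc) by rewrite (frame_za fr) // M08 -MV.
  have e9 : mz M' 9 = 0 by rewrite (frame_z fr) // (k_z9 kM0).
  have e14 : mi M' 14 = 0%N by rewrite (frame_i fr) // (k_14 kM0).
  apply: hoare_seq; apply: hoare_ins => //; apply: (hoare_if B_ge0) => //=; rewrite M'24 ea ltRe //.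
    move=> lt; apply: hoare_blk => //; exists (Ordinal kc).
    split; rewrite /= ?e9 ?addr0 ?M'24 ?e14 ?addn0 //.
    move=> j; rewrite ltnS leq_eqVlt => /orP[/eqP jk|jk].
      by rewrite (_ : j = Ordinal kc) //; apply: val_inj.
    by apply: le_trans (I4 j jk) _; apply: ltW.
  rewrite -real_leNgt ?ger0_real // => le; exists p; split => //=.
  move=> j; rewrite ltnS leq_eqVlt => /orP[/eqP jk|jk]; last exact: I4.
  by rewrite (_ : j = Ordinal kc) //; apply: val_inj.
- move=> M' fr _ [p [I1 I2 I3 I4]]; exists p => // i.
  by apply: le_trans I3; apply: I4; rewrite (k_c kM0) ltn_ord.
Qed.

Lemma best_col_ok (X : 'M[R[i]]_c) (p : 'I_c) M :
  consts M -> mi M 29 = p -> marr M 4 X ->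
  H best_col M (fun M' => exists q : 'I_c, [/\ mi M' 30 = q, 0 <= mz M' 23,
    forall j, j != p -> `|X p j| ^+ 2 <= mz M' 23 &
    mz M' 23 = 0 \/ p != q /\ mz M' 23 = `|X p q| ^+ 2]).
Proof.
move=> kM Mp MX; apply: hoare_seq; apply: hoare_blk => //.
set M0 := foldl _ _ _.
have kM0 : consts M0 by case: kM => *; split.
have M029 : mi M0 29 = p by [].
have M030 : mi M0 30 = p by rewrite /= Mp (k_14 kM) addn0.
have M023 : mz M0 23 = 0 by rewrite /= (k_z9 kM) addr0.
have M04 : mza M0 4 = mza M 4 by [].
clearbody M0.
pose V j := `|X p j| ^+ 2.
have V0 j : 0 <= V j by rewrite exprn_ge0.
pose Inv k M' := exists q : 'I_c, [/\ mi M' 30 = q, 0 <= mz M' 23,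
    forall j : 'I_c, (j < k)%N -> j != p -> V j <= mz M' 23 &
    mz M' 23 = 0 \/ p != q /\ mz M' 23 = V q].
have keep (k : 'I_c) M' : k != p -> mi M' 24 = k -> mi M' 14 = 0%N -> mz M' 9 = 0 ->
   mz M' 21 = V k -> Inv k M' ->
   H (keep_max 30) M' (fun M'' => [/\ Inv k.+1 M'', mi M'' 24 = k & mi M'' 29 = mi M' 29]).
  move=> kp e24 e14 e9 e21 [q [I1 I2 I3 I4]]; apply: (hoare_if B_ge0) => //=; rewrite e21 ltRe //.
    move=> lt; apply: hoare_blk => //; split=> //; exists k.
    split; rewrite /= ?e24 ?e14 ?addn0 ?e21 ?e9 ?addr0 //.
      move=> j; rewrite ltnS leq_eqVlt => /orP[/eqP jk _|jk jp].
        by rewrite (_ : j = k) //; apply: val_inj.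
      by apply: le_trans (I3 j jk jp) _; apply: ltW.
    by right; split=> //; rewrite eq_sym.
  rewrite -real_leNgt ?ger0_real // => le; split=> //; exists q; split => //=.
  move=> j; rewrite ltnS leq_eqVlt => /orP[/eqP jk _|jk]; last exact: I3.
  by rewrite (_ : j = k) //; apply: val_inj.
apply: (@hoare_for _ _ _ _ _ _ _ _ _ B_ge0 _ _ _ Inv) => //.
- by rewrite (k_c kM0).
- by exists p; split; rewrite /= ?M023 //; left.
- move=> k M' fr kc M'24 M'3 I; rewrite (k_c kM0) in kc M'3.
  have e29 : mi M' 29 = p by rewrite (frame_i fr).
  have ea : mza M' 4 (p * c + k)%N = X p (Ordinal kc) by rewrite (frame_za fr) // M04 -MX.
  have e9 : mz M' 9 = 0 by rewrite (frame_z fr) // (k_z9 kM0).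
  have e14 : mi M' 14 = 0%N by rewrite (frame_i fr) // (k_14 kM0).
  apply: hoare_seq; apply: hoare_blk => //.
  set M1 := foldl _ _ _.
  have f21 : mz M1 21 = V (Ordinal kc) by rewrite /= e29 M'3 M'24 ea /V normCK.
  have f24 : mi M1 24 = Ordinal kc by [].
  have f29 : mi M1 29 = p by [].
  have f14 : mi M1 14 = 0%N by [].
  have f9 : mz M1 9 = 0 by [].
  have I1 : Inv k M1 by [].
  clearbody M1; apply: hoare_seq; apply: (hoare_if B_ge0) => /= [lt|nlt].
    apply: hoareW (keep (Ordinal kc) M1 _ f24 f14 f9 f21 I1) _.
      by apply/eqP => e; move: lt; rewrite f24 f29 -e ltnn.
    move=> M2 fr2 [I2 g24 g29]; apply: (hoare_if B_ge0) => /= [|_]; last exact: I2.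
    by rewrite g29 g24 => lt2; move: lt; rewrite f24 f29 in lt2 *; rewrite ltnNge (ltnW lt2).
  apply: (hoare_if B_ge0) => /= [lt|nlt2].
    apply: hoareW (keep (Ordinal kc) (scratch M1) _ f24 f14 f9 f21 I1) _.
      by apply/eqP => e; move: lt; rewrite f24 f29 -e ltnn.
    by move=> M2 fr2 [I2 _ _].
  have kp : Ordinal kc = p.
    apply: val_inj; apply/eqP; rewrite eqn_leq /=; rewrite f24 f29 /= -!leqNgt in nlt nlt2.
    by rewrite nlt nlt2.
  have [q [J1 J2 J3 J4]] := I1; exists q; split=> //= j.
  rewrite ltnS leq_eqVlt => /orP[/eqP jk /eqP jp|jk]; last exact: J3.
  by case: jp; rewrite -kp; apply: val_inj.
- move=> M' fr _ [q [I1 I2 I3 I4]]; exists q; split=> // j jp.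
  by apply: I3 => //; rewrite (k_c kM0) ltn_ord.
Qed.

Lemma sqrtRe_sq (x : R[i]) : 0 <= x -> (Num.sqrt (complex.Re x))%:C ^+ 2 = x.
Proof.
move=> x0; have xR : (complex.Re x)%:C = x by rewrite RRe_real // ger0_real.
by rewrite -rmorphXn sqr_sqrtr /= ?xR // -ler0c xR.
Qed.

Lemma realC_conj (x : R) : Num.conj x%:C = x%:C.
Proof. by rewrite -conjcE conjc_real. Qed.

Lemma angle_ok (X : 'M[R[i]]_c) (p q : 'I_c) M : p != q -> X^t* = X -> X p q != 0 ->
  consts M -> mi M 29 = p -> mi M 30 = q -> marr M 4 X ->
  H angle M (fun M' => exists cs sn,
    [/\ mz M' 39 = cs, mz M' 40 = sn, mz M' 41 = sn^*, cs^* = cs & cs ^+ 2 + sn * sn^* = 1] /\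
    ((givens p q cs sn)^t* *m X *m givens p q cs sn) p q = 0).
Proof.
move=> pq hX Xpq kM Mp Mq MX.
have M3 := k_c kM.
have epp : mza M 4 (p * c + p)%N = X p p by rewrite -MX.
have epq : mza M 4 (p * c + q)%N = X p q by rewrite -MX.
have eqq : mza M 4 (q * c + q)%N = X q q by rewrite -MX.
pose dl := (X p p - X q q) / (1 + 1).
pose bb := X p q * Num.conj (X p q).
pose ro : R[i] := (Num.sqrt (complex.Re (dl * dl + bb)))%:C.
pose nu : R[i] := (Num.sqrt (complex.Re ((dl + ro) * (dl + ro) + bb)))%:C.
have diagR i : Num.conj (X i i) = X i i by rewrite -adjE hX.
have dlR : Num.conj dl = dl by rewrite rmorphM rmorphB /= !diagR fmorphV /= rmorphD /= conjC1.
have bb0 : 0 < bb by rewrite mul_conjC_gt0.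
have dl2 : 0 <= dl * dl by rewrite -{2}dlR mul_conjC_ge0.
have roE : ro ^+ 2 = dl ^+ 2 + bb by rewrite sqrtRe_sq ?expr2 // addr_ge0 // ltW.
have roR : Num.conj ro = ro by rewrite realC_conj.
have tR : Num.conj (dl + ro) = dl + ro by rewrite rmorphD /= dlR roR.
have t2 : 0 <= (dl + ro) * (dl + ro) by rewrite -{2}tR mul_conjC_ge0.
have nuE : nu ^+ 2 = (dl + ro) ^+ 2 + bb by rewrite sqrtRe_sq ?expr2 // addr_ge0 // ltW.
have nuR : Num.conj nu = nu by rewrite realC_conj.
have nu0 : nu != 0.
  apply/eqP => e; move: nuE; rewrite e expr0n /= => /eqP; rewrite eq_sym gt_eqF //.
  by rewrite ltr_wpDl // expr2.
have dlE : 2 * dl = X p p - X q q by rewrite /dl -[1 + 1]/(2 : R[i]) mulrC divfK ?pnatr_eq0.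
have [h1 h2 h3] := givens_zero pq hX nuR nu0 tR dlE roE nuE.
apply: hoare_blk => //; exists ((dl + ro) / nu), (Num.conj (X p q) / nu); split=> //.
by split=> //; rewrite /= Mp Mq M3 epp epq eqq (k_z8 kM).
Qed.

(** The row sums in array 8 belong to the invariant because they are updated, not recomputed. *)
Definition jinv (G : 'M[R[i]]_c) x M := exists Q : 'M[R[i]]_c,
  [/\ Q \is unitarymx, marr M 7 Q, marr M 4 (Q^t* *m G *m Q),
    forall i : 'I_c, mza M 8 i = rowoff (Q^t* *m G *m Q) i & off (Q^t* *m G *m Q) <= x].

(** The pivot carries at least the fraction [1 / c^2] of the off-diagonal mass, and the rotation
    removes twice its square, of which one half is used. *)
Lemma jacobi_step_ok (G : 'M[R[i]]_c) x M : (0 < c)%N -> G^t* = G ->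
  consts M -> jinv G x M -> 0 <= x ->
  H jacobi_step M (fun M' => jinv G ((1 - (c * c)%:R^-1) * x) M').
Proof.
move=> c0 hG kM [Q [QU M7 M4 M8 offx]] x0.
set X := Q^t* *m G *m Q in M4 M8 offx.
have hX : X^t* = X by rewrite !adjM trmxCK hG mulmxA.
have cc0 : 0 < (c * c)%:R :> R[i] by rewrite ltr0n muln_gt0 c0.
have cc1 : 0 <= 1 - (c * c)%:R^-1 :> R[i] by rewrite subr_ge0 invf_le1 // ler1n muln_gt0 c0.
apply: hoare_seq; apply: hoareW (best_row_ok c0 (rowoff_ge0 X) kM M8) _.
move=> M1 fr1 [p M1p pmax].
have kM1 : consts M1 by apply: (consts_frame fr1 _ _ kM).
have M14 : marr M1 4 X by move=> i j; rewrite (frame_za fr1).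
apply: hoare_seq; apply: hoareW (best_col_ok kM1 M1p M14) _.
move=> M2 fr2 [q [M2q z0 qmax zq]].
have kM2 : consts M2 by apply: (consts_frame fr2 _ _ kM1).
have M2p : mi M2 29 = p by rewrite (frame_i fr2).
have M24 : marr M2 4 X by move=> i j; rewrite (frame_za fr2).
have M27 : marr M2 7 Q by move=> i j; rewrite (frame_za fr2) // (frame_za fr1).
have M28 (i : 'I_c) : mza M2 8 i = rowoff X i by rewrite (frame_za fr2) // (frame_za fr1).
have zlt : (complex.Re (mz M2 9) < complex.Re (mz M2 23)) = (0 < mz M2 23).
  by rewrite (k_z9 kM2) ltRe.
apply: (hoare_if B_ge0) => /=; rewrite zlt; last first.
  move=> nz.
  have z00 : mz M2 23 = 0.
    by apply/le_anti; rewrite z0 andbT; rewrite -real_leNgt ?ger0_real // in nz.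
  (* The best row has the largest off-diagonal sum, so if all its off-diagonal entries vanish then
     [X] is diagonal already. *)
  have off0 : off X = 0.
    apply/le_anti; rewrite off_ge0 andbT.
    have := @pivot_le _ _ X p p pmax; rewrite z00 in qmax.
    move=> _; apply: le_trans (ler_sum _ (fun i _ => pmax i)) _.
    rewrite /= sumr_const -mulr_natl.
    have -> : rowoff X p = 0; last by rewrite mulr0.
    by apply/le_anti; rewrite rowoff_ge0 andbT; apply: sumr_le0.
  by exists Q; split=> //; rewrite -/X off0 mulr_ge0.
move=> zpos; case: zq => [z00|[pq zE]]; first by rewrite z00 ltxx in zpos.
have Xpq : X p q != 0.
  by apply/eqP => e; move: zpos; rewrite zE e normr0 expr0n ltxx.
apply: hoare_seq; apply: hoareW (angle_ok pq hX Xpq kM2 M2p M2q M24) _.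
move=> M3 fr3 [cs [sn [[e39 e40 e41 csR cs1] zero]]].
set J := givens p q cs sn in zero.
have JU : J \is unitarymx by apply: givens_unitary.
have kM3 : consts M3 by apply: (consts_frame fr3 _ _ kM2).
have M3p : mi M3 29 = p by rewrite (frame_i fr3).
have M3q : mi M3 30 = q by rewrite (frame_i fr3).
have M34 : marr M3 4 X by move=> i j; rewrite (frame_za fr3).
apply: hoare_seq; apply: hoareW (rotate_cols_ok pq kM3 M3p M3q e39 e40 e41 M34) _.
move=> M4' fr4 M44.
have kM4 : consts M4' by apply: (consts_frame fr4 _ _ kM3).
have M4p : mi M4' 29 = p by rewrite (frame_i fr4).
have M4q : mi M4' 30 = q by rewrite (frame_i fr4).
have M47 : marr M4' 7 Q by move=> i j; rewrite (frame_za fr4) // (frame_za fr3).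
have f39 : mz M4' 39 = cs by rewrite (frame_z fr4).
have f40 : mz M4' 40 = sn by rewrite (frame_z fr4).
have f41 : mz M4' 41 = sn^* by rewrite (frame_z fr4).
have colE (Y : 'M[R[i]]_c) : (\matrix_(i, j) (if j == p then Y i p * cs + Y i q * sn
   else if j == q then Y i q * cs - Y i p * sn^* else Y i j)) = Y *m J.
  by apply/matrixP => i j; rewrite mul_givens // mxE [_ - _]addrC.
rewrite colE in M44.
apply: hoare_seq; apply: hoareW (rotate_cols_ok pq kM4 M4p M4q f39 f40 f41 M47) _.
move=> M5 fr5; rewrite colE => M57.
have kM5 : consts M5 by apply: (consts_frame fr5 _ _ kM4).
have M5p : mi M5 29 = p by rewrite (frame_i fr5).
have M5q : mi M5 30 = q by rewrite (frame_i fr5).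
have M54 : marr M5 4 (X *m J) by move=> i j; rewrite (frame_za fr5).
have g39 : mz M5 39 = cs by rewrite (frame_z fr5).
have g40 : mz M5 40 = sn by rewrite (frame_z fr5).
have g41 : mz M5 41 = sn^* by rewrite (frame_z fr5).
apply: hoare_seq; apply: hoareW (rotate_rows_ok pq kM5 M5p M5q g39 g40 g41 M54) _.
move=> M6 fr6 M64.
pose X' := J^t* *m X *m J.
have rowE : (\matrix_(i, j) (if i == p then (X *m J) p j * cs + (X *m J) q j * sn^*
     else if i == q then (X *m J) q j * cs - (X *m J) p j * sn else (X *m J) i j)) = X'.
  apply/matrixP => i j; rewrite /X' -mulmxA adj_givens_mul // mxE.
  by case: ifP => _; [rewrite mulrC [_ * sn^*]mulrC|rewrite addrC mulrC [_ * cs]mulrC].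
rewrite rowE in M64.
have kM6 : consts M6 by apply: (consts_frame fr6 _ _ kM5).
have M6p : mi M6 29 = p by rewrite (frame_i fr6).
have M6q : mi M6 30 = q by rewrite (frame_i fr6).
apply: hoare_seq; apply: hoareW (row_sum_ok kM6 M6p M64) _ => M7' fr7 M78.
have kM7 : consts M7' by apply: (consts_frame fr7 _ _ kM6).
have M7q : mi M7' 30 = q by rewrite (frame_i fr7).
have e68 : mza M6 8 = mza M2 8.
  by rewrite (frame_za fr6) // (frame_za fr5) // (frame_za fr4) // (frame_za fr3).
have M74 : marr M7' 4 X' by move=> i j; rewrite (frame_za fr7).
apply: hoareW (row_sum_ok kM7 M7q M74) _ => M8' fr8 M88.
have X'E : (Q *m J)^t* *m G *m (Q *m J) = X' by rewrite adjM /X' /X !mulmxA.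
exists (Q *m J); rewrite X'E; split.
- exact: mul_unitarymx QU JU.
- by move=> i j; rewrite (frame_za fr8) // (frame_za fr7) // (frame_za fr6) // M57.
- by move=> i j; rewrite (frame_za fr8).
- move=> i; rewrite M88; case: (val i =P val q) => [/val_inj -> //|/eqP iq].
  rewrite M78; case: (val i =P val p) => [/val_inj -> //|/eqP ip].
  rewrite e68 M28.
  by rewrite -(rowoff_givens pq csR cs1 X ip iq).
rewrite /X' off_givens //.
have piv := pivot_le pmax (fun k kp => le_trans (qmax k kp) (eq_ind _ (fun z => z <= _) (lexx _) _ (esym zE))).
have sm : (c * c)%:R^-1 * off X <= `|X p q| ^+ 2.
  by rewrite mulrC ler_pdivrMr // mulrC.
apply: (@le_trans _ _ ((1 - (c * c)%:R^-1) * off X)); last by rewrite ler_wpM2l.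
rewrite mulrBl mul1r lerD2l lerN2; apply: le_trans sm _.
by rewrite ler_peMl ?exprn_ge0 // ler1n.
Qed.

End Jacobi.
End Verify.

Local Open Scope ring_scope.
Local Open Scope complex_scope.
Local Open Scope sesquilinear_scope.

(** * Correctness of the computation after the sampling *)

Section Core.
Variables (R : realType) (m n : nat) (phi : R) (A : 'M[R[i]]_(m, n)).
Variables (acc : SQ phi A) (acc' : SQ phi (A^t*)) (f : R -> R[i]) (B : nat -> R).
Hypothesis B_ge0 : forall x, 0 <= B x.
Local Notation H := (hoare acc acc' f B).
Local Notation memory := (memory R).
Implicit Types (M : memory).
Variable c : nat.
Hypothesis Bc : c%:R <= B 3.
Hypothesis c0 : (0 < c)%N.
Local Notation consts := (consts c).

Lemma hoare_pure i M (Q : memory -> Prop) : pure i -> Q (pstep acc acc' f M i) ->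
  H (CIns i) M Q.
Proof. by move=> pi; apply: hoare_ins; apply: dstep_pure. Qed.

(** A round consists of [c * c] rotations, each with factor at most [1 - 1 / c^2], and so halves the
    off-diagonal mass. The number of rounds therefore depends on the accuracy only. *)
Lemma jacobi_ok (G : 'M[R[i]]_c) e M : G^t* = G ->
  consts M -> mi M 12 = (c * c)%N -> mi M 13 = e -> (c * c)%:R <= B 12 -> e%:R <= B 13 ->
  (forall k, mza M 7 k = 0) -> marr M 4 G ->
  H jacobi M (fun M' => exists Q : 'M[R[i]]_c,
    [/\ Q \is unitarymx, marr M' 7 Q, marr M' 4 (Q^t* *m G *m Q) &
      off (Q^t* *m G *m Q) <= 2^-1 ^+ e * off G]).
Proof.
move=> hG kM M12 M13 Bcc Be M7 M4.
have G0 := off_ge0 G.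
pose I1 k M' := forall i j : 'I_c, mza M' 7 (i * c + j)%N = ((i == j) && (i < k)%N)%:R.
apply: hoare_seq; apply: (hoare_for B_ge0 (Inv := I1)) => //.
- by rewrite (k_c kM).
- by move=> i j; rewrite /= M7 ltn0 andbF.
- move=> k M' fr kc M'24 M'3 I; rewrite (k_c kM) in kc M'3.
  have e8 : mz M' 8 = 1 by rewrite (frame_z fr) // (k_z8 kM).
  apply: hoare_blk => // i j; rewrite /= M'24 M'3 e8 I index_eq // ltnS.
  rewrite -(inj_eq val_inj) /=; case: (ltngtP i k) => [ik|ik|->] //=.
  by rewrite andbT eq_sym andbF; case: eqP.
move=> M1 fr1 _ IM1; rewrite (k_c kM) in IM1.
have kM1 := consts_frame fr1 isT isT kM.
have M14 : marr M1 4 G by move=> i j; rewrite (frame_za fr1).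
have M112 : mi M1 12 = (c * c)%N by rewrite (frame_i fr1).
have M113 : mi M1 13 = e by rewrite (frame_i fr1).

pose I2 k M' := (forall i : 'I_c, (i < k)%N -> mza M' 8 i = rowoff G i).
apply: hoare_seq; apply: (hoare_for B_ge0 (Inv := I2)) => //.
- by rewrite (k_c kM1).
- move=> k M' fr kc M'24 M'3 I; rewrite (k_c kM1) in kc M'3.
  have kM' := consts_frame fr isT isT kM1.
  have M'4 : marr M' 4 G by move=> i j; rewrite (frame_za fr).
  have RS := (row_sum_ok acc acc' f B_ge0 Bc (i := Ordinal kc) kM' M'24 M'4).
  apply: hoareW RS _ => M'' fr' h i ik.
  rewrite /= h; case: (i =P k :> nat) => [e1|/eqP ne].
    by rewrite -[Ordinal kc]/(Ordinal kc); congr (rowoff _ _); apply: val_inj.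
  by apply: I; rewrite ltn_neqAle ne -ltnS.
move=> M2 fr2 _ IM2; rewrite (k_c kM1) in IM2.
have kM2 := consts_frame fr2 isT isT kM1.
have M212 : mi M2 12 = (c * c)%N by rewrite (frame_i fr2).
have M213 : mi M2 13 = e by rewrite (frame_i fr2).
have J0 : jinv G (off G) M2.
  exists 1%:M; rewrite trmx1 map_mx1 mul1mx mulmx1; split=> //.
  - by apply/unitarymxP; rewrite mul1mx trmx1 map_mx1.
  - by move=> i j; rewrite (frame_za fr2) // IM1 ltn_ord andbT mxE.
  - by move=> i j; rewrite (frame_za fr2) // M14.
  - by move=> i; apply: IM2.
have jW x y M' : x <= y -> jinv G x M' -> jinv G y M'.
  by move=> xy [Q [h1 h2 h3 h4 h5]]; exists Q; split=> //; apply: le_trans h5 xy.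
apply: (hoare_for B_ge0 (Inv := fun k => jinv G (2^-1 ^+ k * off G))) => //.
- by rewrite M213.
- by apply: jW J0; rewrite expr0 mul1r.
- move=> k M' fr ke M'27 M'13 I; rewrite M213 in ke M'13.
  have kM' := consts_frame fr isT isT kM2.
  have M'12 : mi M' 12 = (c * c)%N by rewrite (frame_i fr).
  pose x := 2^-1 ^+ k * off G.
  have x0 : 0 <= x by rewrite mulr_ge0 // exprn_ge0 // invr_ge0.
  have cc0 : (0 < c * c)%N by rewrite muln_gt0 c0.
  have cc1 : 0 <= 1 - (c * c)%:R^-1 :> R[i].
    by rewrite subr_ge0 invf_le1 ?ler1n // ltr0n.
  apply: (hoare_for B_ge0 (Inv := fun k => jinv G ((1 - (c * c)%:R^-1) ^+ k * x))) => //.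
  + by rewrite M'12.
  + by apply: jW I; rewrite expr0 mul1r.
  + move=> l M'' fr' lc M''28 M''12 J.
    have kM'' := consts_frame fr' isT isT kM'.
    apply: hoareW (jacobi_step_ok acc acc' f B_ge0 Bc c0 hG kM'' J _) _.
      by rewrite mulr_ge0 // exprn_ge0.
    by move=> M3 fr3 J3; rewrite exprS -mulrA.
  move=> M'' fr' M''12; rewrite M'12 => J.
  apply: jW J; rewrite exprS -mulrA ler_wpM2r //; exact: half_power.
by move=> M' fr _; rewrite M213 => -[Q [h1 h2 h3 _ h5]]; exists Q.
Qed.

(** This is [g (x + eta) / (x + eta)] as the machine evaluates it, [f] being the only function at
    its disposal. *)
Definition hval (eta x : R[i]) : R[i] :=
  f (Num.sqrt (complex.Re (x + eta))) / (Num.sqrt (complex.Re (x + eta)))%:C / (x + eta).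

Lemma spectral_values_ok (X : 'M[R[i]]_c) (eta : R[i]) M :
  consts M -> mz M 14 = eta -> marr M 4 X ->
  H spectral_values M (fun M' => forall i : 'I_c, mza M' 9 i = hval eta (X i i)).
Proof.
move=> kM Me MX.
apply: (hoare_for B_ge0 (Inv := fun k M' => forall i : 'I_c, (i < k)%N ->
  mza M' 9 i = hval eta (X i i))) => //.
- by rewrite (k_c kM).
- move=> k M' fr kc M'24 M'3 I; rewrite (k_c kM) in kc M'3.
  have e14 : mz M' 14 = eta by rewrite (frame_z fr).
  have ea : mza M' 4 (k * c + k)%N = X (Ordinal kc) (Ordinal kc) by rewrite (frame_za fr) // -MX.
  apply: hoare_blk => // i /=; rewrite ltnS M'24 M'3 ea e14.
  case: (i =P k :> nat) => [e1 _|/eqP ne ik].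
    by rewrite (_ : i = Ordinal kc) //; apply: val_inj.
  by apply: I; rewrite ltn_neqAle ne.
by move=> M' fr M'3 I i; apply: I; rewrite (k_c kM).
Qed.

Lemma core_matrix_ok (Q : 'M[R[i]]_c) (h : 'I_c -> R[i]) M :
  consts M -> marr M 7 Q -> (forall i : 'I_c, mza M 9 i = h i) ->
  H core_matrix M (fun M' => marr M' 10 (Q *m diag_mx (\row_i h i) *m Q^t*)).
Proof.
move=> kM MQ Mh; set N := Q *m _ *m _.
have NE i j : N i j = \sum_k Q i k * h k * Num.conj (Q j k).
  by rewrite /N !mxE; apply: eq_bigr => k _; rewrite mul_mx_diag !mxE.
apply: (hoare_for B_ge0 (Inv := fun k M' => forall i j : 'I_c, (i < k)%N ->
  mza M' 10 (i * c + j)%N = N i j)) => //.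
- by rewrite (k_c kM).
- move=> i M1 fr1 ic M1i M13 I; rewrite (k_c kM) in ic M13.
  have kM1 := consts_frame fr1 isT isT kM.
  apply: (hoare_for B_ge0 (Inv := fun k M' => forall i' j : 'I_c,
    (i' < i)%N || (i' == i :> nat) && (j < k)%N -> mza M' 10 (i' * c + j)%N = N i' j)) => //.
  + by rewrite M13.
  + by move=> i' j /=; rewrite ltn0 andbF orbF => /I.
  + move=> j M2 fr2 jc M2j M23 J; rewrite M13 in jc M23.
    have kM2 := consts_frame fr2 isT isT kM1.
    have M2i : mi M2 20 = i by rewrite (frame_i fr2).
    have M2z9 := k_z9 kM2.
    apply: hoare_seq; apply: hoare_pure => //; set M3 := pstep _ _ _ _ _.
    have kM3 : consts M3 by case: kM2 => *; split.
    have e7 : marr M3 7 Q by move=> a b /=; rewrite (frame_za fr2) // (frame_za fr1) //.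
    have e9 (a : 'I_c) : mza M3 9 a = h a by rewrite /= (frame_za fr2) // (frame_za fr1).
    have J3 : forall i' j' : 'I_c,
      (i' < i)%N || (i' == i :> nat) && (j' < j)%N -> mza M3 10 (i' * c + j')%N = N i' j' by [].
    have M3i : mi M3 20 = i by [].
    have M3j : mi M3 24 = j by [].
    have M3z : mz M3 20 = 0 by rewrite /= M2z9 addr0.
    clearbody M3; clear J.
    pose io := Ordinal ic; pose jo := Ordinal jc.
    apply: hoare_seq; apply: (hoare_for B_ge0 (Inv := fun k M' => mz M' 20 =
       \sum_(k' < c | (k' < k)%N) Q io k' * h k' * Num.conj (Q jo k'))) => //.
    * by rewrite (k_c kM3).
    * by rewrite /= sum_lt0.
    * move=> k M4 fr4 kc M4k M43 S; rewrite (k_c kM3) in kc M43.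
      have f7 : marr M4 7 Q by move=> a b; rewrite (frame_za fr4).
      have f9 (a : 'I_c) : mza M4 9 a = h a by rewrite (frame_za fr4).
      have M4i : mi M4 20 = i by rewrite (frame_i fr4).
      have M4j : mi M4 24 = j by rewrite (frame_i fr4).
      apply: hoare_blk => //; rewrite (@sum_ltS _ _ _ (Ordinal kc)) /=.
      by rewrite S M4i M4j M4k M43 (f7 io (Ordinal kc)) (f7 jo (Ordinal kc)) (f9 (Ordinal kc)).
    * move=> M4 fr4 M43 S; rewrite (k_c kM3) in M43 S.
      have M4i : mi M4 20 = i by rewrite (frame_i fr4).
      have M4j : mi M4 24 = j by rewrite (frame_i fr4).
      apply: hoare_blk => // i' j' hij; rewrite /= M4i M4j M43 index_eq //.
      rewrite (frame_za fr4) // S sum_ltn.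
      case: (i' =P i :> nat) hij => [ei|ni] /=; last by rewrite orbF => hi; apply: J3; rewrite hi.
      rewrite ei ltnn /= ltnS; case: (j' =P j :> nat) => [ej|/eqP nj] hj.
        by rewrite NE; apply: eq_bigr => k _; rewrite (_ : i' = io) 1?(_ : j' = jo) //; apply: val_inj.
      by rewrite -ei; apply: J3; rewrite ei eqxx /= (ltn_neqAle j') nj hj orbT.
  + move=> M2 fr2 M23 J i' j; rewrite ltnS leq_eqVlt => h'.
    by apply: J; rewrite M13 ltn_ord andbT orbC.
by move=> M' fr M'3 I i j; apply: I; rewrite (k_c kM).
Qed.
Variable r : nat.
Hypothesis Br : r%:R <= B 2.

Lemma output_matrix_ok (N : 'M[R[i]]_c) (W : 'M[R[i]]_(r, c)) (fl : 'I_r -> R[i]) M :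
  consts M -> mi M 2 = r -> marr M 10 N -> marr M 5 W -> (forall s : 'I_r, mza M 6 s = fl s) ->
  H output_matrix M (fun M' => marr M' 2 (N *m W^t* *m diag_mx (\row_s fl s))).
Proof.
move=> kM M2 MN MW Mf; set X := N *m _ *m _.
have XE i j : X i j = (\sum_k N i k * Num.conj (W j k)) * fl j.
  by rewrite /X mul_mx_diag !mxE; congr (_ * _); apply: eq_bigr => k _; rewrite !mxE.
apply: (hoare_for B_ge0 (Inv := fun k M' => forall (i : 'I_c) (j : 'I_r), (i < k)%N ->
  mza M' 2 (i * r + j)%N = X i j)) => //.
- by rewrite (k_c kM).
- move=> i M1 fr1 ic M1i M13 I; rewrite (k_c kM) in ic M13.
  have kM1 := consts_frame fr1 isT isT kM.
  have M12 : mi M1 2 = r by rewrite (frame_i fr1).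
  apply: (hoare_for B_ge0 (Inv := fun k M' => forall (i' : 'I_c) (j : 'I_r),
    (i' < i)%N || (i' == i :> nat) && (j < k)%N -> mza M' 2 (i' * r + j)%N = X i' j)) => //.
  + by rewrite M12.
  + by move=> i' j /=; rewrite ltn0 andbF orbF => /I.
  + move=> j M2' fr2 jr M2j M22 J; rewrite M12 in jr M22.
    have kM2 := consts_frame fr2 isT isT kM1.
    have M2i : mi M2' 20 = i by rewrite (frame_i fr2).
    have M2z9 := k_z9 kM2.
    apply: hoare_seq; apply: hoare_pure => //; set M3 := pstep _ _ _ _ _.
    have kM3 : consts M3 by case: kM2 => *; split.
    have e10 : marr M3 10 N by move=> a b /=; rewrite (frame_za fr2) // (frame_za fr1) //.
    have e5 : marr M3 5 W by move=> a b /=; rewrite (frame_za fr2) // (frame_za fr1) //.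
    have e6 (a : 'I_r) : mza M3 6 a = fl a by rewrite /= (frame_za fr2) // (frame_za fr1).
    have J3 : forall (i' : 'I_c) (j' : 'I_r),
      (i' < i)%N || (i' == i :> nat) && (j' < j)%N -> mza M3 2 (i' * r + j')%N = X i' j' by [].
    have M3i : mi M3 20 = i by [].
    have M3j : mi M3 24 = j by [].
    have M32 : mi M3 2 = r by [].
    have M3z : mz M3 20 = 0 by rewrite /= M2z9 addr0.
    clearbody M3; clear J.
    pose io := Ordinal ic; pose jo := Ordinal jr.
    apply: hoare_seq; apply: (hoare_for B_ge0 (Inv := fun k M' => mz M' 20 =
       \sum_(k' < c | (k' < k)%N) N io k' * Num.conj (W jo k'))) => //.
    * by rewrite (k_c kM3).
    * by rewrite /= sum_lt0.
    * move=> k M4 fr4 kc M4k M43 S; rewrite (k_c kM3) in kc M43.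
      have f10 : marr M4 10 N by move=> a b; rewrite (frame_za fr4).
      have f5 : marr M4 5 W by move=> a b; rewrite (frame_za fr4).
      have M4i : mi M4 20 = i by rewrite (frame_i fr4).
      have M4j : mi M4 24 = j by rewrite (frame_i fr4).
      apply: hoare_blk => //; rewrite (@sum_ltS _ _ _ (Ordinal kc)) /=.
      by rewrite S M4i M4j M4k M43 (f10 io (Ordinal kc)) (f5 jo (Ordinal kc)).
    * move=> M4 fr4 M43 S; rewrite (k_c kM3) in M43 S.
      have M4i : mi M4 20 = i by rewrite (frame_i fr4).
      have M4j : mi M4 24 = j by rewrite (frame_i fr4).
      have M42 : mi M4 2 = r by rewrite (frame_i fr4).
      have f6 : mza M4 6 j = fl jo by rewrite (frame_za fr4) // -e6.
      apply: hoare_blk => // i' j' hij; rewrite /= M4i M4j M42 f6 index_eq //.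
      rewrite (frame_za fr4) // S sum_ltn.
      case: (i' =P i :> nat) hij => [ei|ni] /=; last by rewrite orbF => hi; apply: J3; rewrite hi.
      rewrite ei ltnn /= ltnS; case: (j' =P j :> nat) => [ej|/eqP nj] hj.
        rewrite XE (_ : j' = jo); last exact: val_inj.
        by congr (_ * _); apply: eq_bigr => k _; rewrite (_ : i' = io) //; apply: val_inj.
      by rewrite -ei; apply: J3; rewrite ei eqxx /= (ltn_neqAle j') nj hj orbT.
  + move=> M2' fr2 M23 J i' j; rewrite ltnS leq_eqVlt => h'.
    by apply: J; rewrite M12 ltn_ord andbT orbC.
by move=> M' fr M'3 I i j; apply: I; rewrite (k_c kM).
Qed.

(* This is [S A T]. *)
Definition crossmx (J : 'I_c -> 'I_n) (tau : 'I_c -> R[i]) (I : 'I_r -> 'I_m)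
    (sg : 'I_r -> R[i]) : 'M[R[i]]_(r, c) :=
  \matrix_(s, t) (A (I s) (J t) * tau t * sg s).

Definition flag (theta : R[i]) (W : 'M[R[i]]_(r, c)) (s : 'I_r) : R[i] :=
  if complex.Re theta < complex.Re (\sum_t `|W s t| ^+ 2) then 0 else 1.

Lemma cross_row_ok (J : 'I_c -> 'I_n) tau (I : 'I_r -> 'I_m) sg (theta : R[i]) M :
  consts M -> mi M 2 = r -> mz M 15 = theta ->
  (forall t : 'I_c, mia M 1 t = J t) -> (forall t : 'I_c, mza M 1 t = tau t) ->
  (forall s : 'I_r, mia M 0 s = I s) -> (forall s : 'I_r, mza M 0 s = sg s) ->
  H (CFor 20 2 cross_row) M (fun M' => marr M' 5 (crossmx J tau I sg) /\
    forall s : 'I_r, mza M' 6 s = flag theta (crossmx J tau I sg) s).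
Proof.
move=> kM M2 Mth MJ Mt MI Ms; set W := crossmx J tau I sg.
apply: (hoare_for B_ge0 (Inv := fun k M' => forall s : 'I_r, (s < k)%N ->
  (forall t : 'I_c, mza M' 5 (s * c + t)%N = W s t) /\ mza M' 6 s = flag theta W s)) => //.
- by rewrite M2.
- move=> s M1 fr1 sr M1s M12 Inv; rewrite M2 in sr M12.
  pose so := Ordinal sr.
  have kM1 := consts_frame fr1 isT isT kM.
  have M1th : mz M1 15 = theta by rewrite (frame_z fr1).
  have M1I : mia M1 0 s = I so by rewrite (frame_ia fr1) // -MI.
  have M1sg : mza M1 0 s = sg so by rewrite (frame_za fr1) // -Ms.
  have M1J (t : 'I_c) : mia M1 1 t = J t by rewrite (frame_ia fr1) // -MJ.
  have M1t (t : 'I_c) : mza M1 1 t = tau t by rewrite (frame_za fr1) // -Mt.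
  apply: hoare_seq; apply: hoare_blk => //; set M3 := foldl _ _ _.
  have kM3 : consts M3 by case: kM1 => *; split.
  have M321 : mi M3 21 = I so by rewrite /= M1s.
  have M320 : mi M3 20 = s by [].
  have M3z20 : mz M3 20 = sg so by rewrite /= M1s.
  have M3z22 : mz M3 22 = 0 by rewrite /= (k_z9 kM1) addr0.
  have M3th : mz M3 15 = theta by [].
  have M3J (t : 'I_c) : mia M3 1 t = J t by exact: M1J.
  have M3t (t : 'I_c) : mza M3 1 t = tau t by exact: M1t.
  have Inv3 : forall s : 'I_r, (s < M1.(mi) 20)%N ->
    (forall t : 'I_c, mza M3 5 (s * c + t)%N = W s t) /\ mza M3 6 s = flag theta W s by rewrite M1s.
  rewrite M1s in Inv3; clearbody M3; clear Inv.
  pose L k M' := [/\ mz M' 22 = \sum_(t < c | (t < k)%N) `|W so t| ^+ 2,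
    forall t : 'I_c, (t < k)%N -> mza M' 5 (s * c + t)%N = W so t &
    forall (s' : 'I_r) (t : 'I_c), (s' < s)%N -> mza M' 5 (s' * c + t)%N = W s' t].
  apply: hoare_seq; apply: (hoare_for B_ge0 (Inv := L)) => //.
  + by rewrite (k_c kM3).
  + split; rewrite /= ?sum_lt0 //.
    by move=> s' t s's; have [h _] := Inv3 s' s's; apply: h.
  + move=> t M4 fr4 tc M4t M43 [S1 S2 S3]; rewrite (k_c kM3) in tc M43.
    pose t_o := Ordinal tc.
    have e20 : mi M4 20 = s by rewrite (frame_i fr4).
    have e21 : mi M4 21 = I so by rewrite (frame_i fr4).
    have ez : mz M4 20 = sg so by rewrite (frame_z fr4).
    have eJ : mia M4 1 t = J t_o by rewrite (frame_ia fr4) // -M3J.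
    have eT : mza M4 1 t = tau t_o by rewrite (frame_za fr4) // -M3t.
    apply: hoare_seq; apply: hoare_pure => //; set M5 := pstep _ _ _ _ _.
    apply: hoare_seq; apply: (@hoare_ins _ _ _ _ _ _ _ _ _ _ _ (sz 23 (A (I so) (J t_o)) M5)).
      by rewrite /= M4t eJ e21 !valK.
    have WE : W so t_o = A (I so) (J t_o) * tau t_o * sg so by rewrite mxE.
    apply: hoare_blk => //; split; rewrite /=.
    * by rewrite (@sum_ltS _ _ _ t_o) S1 M4t eT ez -WE normCK.
    * move=> t'; rewrite e20 M43 M4t eT ez -WE ltnS index_eq // eqxx /=.
      case: (t' =P t :> nat) => [et _|/eqP ne lt]; first by rewrite (_ : t' = t_o) //; apply: val_inj.
      by apply: S2; rewrite ltn_neqAle ne.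
    * move=> s' t' s's; rewrite e20 M43 M4t index_eq //.
      by rewrite ltn_eqF //=; apply: S3.
  + move=> M4 fr4 M43 [S1 S2 S3]; rewrite (k_c kM3) in M43 S1 S2 S3.
    rewrite sum_ltn in S1.
    have kM4 := consts_frame fr4 isT isT kM3.
    have e20 : mi M4 20 = s by rewrite (frame_i fr4).
    have eth : mz M4 15 = theta by rewrite (frame_z fr4).
    have e6 : mza M4 6 = mza M3 6 by rewrite (frame_za fr4).
    have fin M' : mi M' 20 = s -> mza M' 6 = mza M4 6 -> mza M' 5 = mza M4 5 ->
       mz M' 23 = flag theta W so -> forall s0 : 'I_r, (s0 < s.+1)%N ->
       (forall t : 'I_c, mza (inc 20 (pstep acc acc' f M' (ZPut 6 20 23))) 5 (s0 * c + t)%N = W s0 t)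
       /\ mza (inc 20 (pstep acc acc' f M' (ZPut 6 20 23))) 6 s0 = flag theta W s0.
      move=> h1 h2 h3 h4 s0; rewrite ltnS /= h1 h2 h3 h4.
      case: (s0 =P s :> nat) => [es _|/eqP ne le].
        have -> : s0 = so by apply: val_inj.
        by split=> // t; apply: S2.
      have lt : (s0 < s)%N by rewrite ltn_neqAle ne.
      by split=> [t|]; [apply: S3|rewrite e6; have [_ ->] := Inv3 s0 lt].
    apply: hoare_seq; apply: hoare_pure => //.
    apply: hoare_seq; apply: (hoare_if B_ge0) => /= hh.
      apply: hoare_pure => //; apply: hoare_pure => //.
      apply: (fin (pstep acc acc' f (pstep acc acc' f M4 (ZAdd 23 8 9)) (ZAdd 23 9 9))) => //=.
      by rewrite (k_z9 kM4) addr0 /flag -S1; move: hh; rewrite eth => ->.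
    apply: hoare_pure => //; apply: (fin (scratch (pstep acc acc' f M4 (ZAdd 23 8 9)))) => //=.
    by rewrite (k_z8 kM4) (k_z9 kM4) addr0 /flag -S1; move: hh; rewrite eth => /negbTE ->.
- move=> M' fr M'2; rewrite M2 => Inv; split.
    by move=> s t; have [h _] := Inv s (ltn_ord s); apply: h.
  by move=> s; have [_ h] := Inv s (ltn_ord s).
Qed.

Definition core_out (eta : R[i]) (X Q : 'M[R[i]]_c) : 'M[R[i]]_c :=
  Q *m diag_mx (\row_i hval eta (X i i)) *m Q^t*.

Lemma finish_ok J tau I sg (theta eta : R[i]) (G : 'M[R[i]]_c) e M :
  let W := crossmx J tau I sg in G^t* = G ->
  consts M -> mi M 2 = r -> mz M 15 = theta -> mz M 14 = eta ->
  mi M 12 = (c * c)%N -> mi M 13 = e -> (c * c)%:R <= B 12 -> e%:R <= B 13 ->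
  (forall k, mza M 7 k = 0) -> marr M 4 G ->
  (forall t : 'I_c, mia M 1 t = J t) -> (forall t : 'I_c, mza M 1 t = tau t) ->
  (forall s : 'I_r, mia M 0 s = I s) -> (forall s : 'I_r, mza M 0 s = sg s) ->
  H finish M (fun M' => exists Q : 'M[R[i]]_c, let X := Q^t* *m G *m Q in
    [/\ Q \is unitarymx, off X <= 2^-1 ^+ e * off G &
     marr M' 2 (core_out eta X Q *m W^t* *m diag_mx (\row_s flag theta W s))]).
Proof.
move=> W hG kM M2 Mth Meta M12 M13 Bcc Be M7 M4 MJ Mt MI Ms.
apply: hoare_seq; apply: hoareW (cross_row_ok kM M2 Mth MJ Mt MI Ms) _.
move=> M1 fr1 [M15 M16]; rewrite -/W in M15 M16.
have kM1 := consts_frame fr1 isT isT kM.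
have h12 : mi M1 12 = (c * c)%N by rewrite (frame_i fr1).
have h13 : mi M1 13 = e by rewrite (frame_i fr1).
have h7 k : mza M1 7 k = 0 by rewrite (frame_za fr1).
have h4 : marr M1 4 G by move=> i j; rewrite (frame_za fr1).
apply: hoare_seq; apply: hoareW (jacobi_ok hG kM1 h12 h13 Bcc Be h7 h4) _.
move=> M2' fr2 [Q [QU Q7 Q4 offQ]].
have kM2 := consts_frame fr2 isT isT kM1.
have g14 : mz M2' 14 = eta by rewrite (frame_z fr2) // (frame_z fr1).
apply: hoare_seq; apply: hoareW (spectral_values_ok kM2 g14 Q4) _ => M3 fr3 M39.
have kM3 := consts_frame fr3 isT isT kM2.
have M37 : marr M3 7 Q by move=> i j; rewrite (frame_za fr3).
apply: hoare_seq; apply: hoareW (core_matrix_ok kM3 M37 M39) _ => M4' fr4 M410.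
have kM4 := consts_frame fr4 isT isT kM3.
have k2 : mi M4' 2 = r by rewrite (frame_i fr4) // (frame_i fr3) // (frame_i fr2) // (frame_i fr1).
have k5 : marr M4' 5 W.
  by move=> i j; rewrite (frame_za fr4) // (frame_za fr3) // (frame_za fr2).
have k6 (s : 'I_r) : mza M4' 6 s = flag theta W s.
  by rewrite (frame_za fr4) // (frame_za fr3) // (frame_za fr2).
apply: hoareW (output_matrix_ok kM4 k2 M410 k5 k6) _ => M5 fr5 M52.
by exists Q.
Qed.

End Core.

(** * Correctness of the sampling loops *)

Section Sampling.
Variables (R : realType) (m n : nat) (phi : R) (A : 'M[R[i]]_(m, n)).
Variables (acc : SQ phi A) (acc' : SQ phi (A^t*)) (f : R -> R[i]) (B : nat -> R).
Hypothesis B_ge0 : forall x, 0 <= B x.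
Local Notation H := (hoare acc acc' f B).
Local Notation HR := (hoareR acc acc' f B).
Local Notation memory := (memory R).
Implicit Types (M : memory).

Definition weight (k : nat) (p : R) : R[i] := ((Num.sqrt (k%:R * p))^-1)%:C.

Lemma weightE k (x Phi : R) :
  1 / (Num.sqrt (complex.Re (k%:R * (x%:C * x%:C / Phi%:C))))%:C = weight k (x ^+ 2 / Phi).
Proof.
have -> : k%:R * (x%:C * x%:C / Phi%:C) = (k%:R * (x ^+ 2 / Phi))%:C :> R[i].
  by rewrite rmorphM fmorph_div rmorphXn rmorph_nat expr2.
by rewrite div1r /weight fmorphV.
Qed.

Lemma enum_nth (T U : Type) N (g : T -> U) (x : U) (o : 'I_N -> T) (i : 'I_N) :
  nth x [seq g z | z <- [seq o j | j <- enum 'I_N]] i = g (o i).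
Proof.
by rewrite -map_comp (nth_map i) ?size_enum_ord //= nth_ord_enum.
Qed.

Lemma sketch_ok (sd : side) (reg arr N Y : nat) (q rn : 'I_N -> R) (Phi : R) M :
  reg \in [:: 2; 3]%N -> mi M reg = Y -> Y%:R <= B reg ->
  (forall M', HR (CIns (Ask sd (SRow 21))) M' q (fun i M'' => M'' = si 21 i M')) ->
  (forall M' i, mi M' 21 = nat_of_ord i ->
     dstep acc acc' f (Ask sd (QRow 20 21)) M' = Some (sz 20 (rn i)%:C M')) ->
  mz M 7 = Phi%:C -> mz M 8 = 1 ->
  HR (CFor 20 reg (sketch_body sd reg arr)) M (fun o : {ffun 'I_Y -> 'I_N} => \prod_t q (o t))
    (fun o M' => (forall t : 'I_Y, mia M' arr t = o t) /\
       forall t : 'I_Y, mza M' arr t = weight Y (rn (o t) ^+ 2 / Phi)).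
Proof.
move=> rg MY YB hS hQ M7 M8.
pose Inv (v : seq 'I_N) M' := forall k, (k < size v)%N ->
   mia M' arr k = nth 0%N [seq nat_of_ord i | i <- v] k /\
   mza M' arr k = nth 0 [seq weight Y (rn i ^+ 2 / Phi) | i <- v] k.
have F : HR (CFor 20 reg (sketch_body sd reg arr)) M (fun o : {ffun 'I_Y -> 'I_N} =>
    \prod_t q (o t)) (fun o M' => mi M' reg = Y /\ Inv [seq o i | i <- enum 'I_Y] M').
  apply: (@hoareR_for R m n phi A acc acc' f B B_ge0) => //.
  - by move: rg; rewrite !inE => /orP[] /eqP ->.
  - by move: rg; rewrite !inE => /orP[] /eqP ->.
  - by case: sd {hS hQ}; move: rg; rewrite !inE => /orP[] /eqP ->.
  move=> v M1 fr vY M1v M1Y I.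
  have e7 : mz M1 7 = Phi%:C by rewrite (frame_z fr) //; case: sd {hS hQ fr}.
  have e8 : mz M1 8 = 1 by rewrite (frame_z fr) //; case: sd {hS hQ fr}.
  apply: (hoareR_post (hS M1)) => i M2 _ _ ->.
  apply: hoare_seq; apply: (hoare_ins _ (hQ (si 21 i M1) i erefl)).
  apply: hoare_blk => // k; rewrite size_rcons ltnS.
  have regN : mi (si 21 i M1) reg = Y.
    by move: rg M1Y; rewrite !inE /= => /orP[] /eqP ->.
  have regN' : (reg == 21%N) = false by move: rg; rewrite !inE => /orP[] /eqP ->.
  rewrite /= !eqxx M1v /= !map_rcons !nth_rcons !size_map regN' M1Y e7 e8.
  case: ltngtP => // ks _; first exact: I.
  by rewrite weightE.
apply: (hoareR_W F) => o M' _ _ [_ I].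
have szt (t : 'I_Y) : (t < size [seq o i | i <- enum 'I_Y])%N by rewrite size_map size_enum_ord.
split=> t; have [h1 h2] := I t (szt t).
  by rewrite h1 (enum_nth (@nat_of_ord N)).
by rewrite h2 (enum_nth (fun i => weight Y (rn i ^+ 2 / Phi))).
Qed.

End Sampling.

Section Inner.
Variables (R : realType) (m n : nat) (phi : R) (A : 'M[R[i]]_(m, n)).
Variables (acc : SQ phi A) (acc' : SQ phi (A^t*)) (f : R -> R[i]) (B : nat -> R).
Hypothesis B_ge0 : forall x, 0 <= B x.
Local Notation H := (hoare acc acc' f B).
Local Notation HR := (hoareR acc acc' f B).
Local Notation memory := (memory R).
Implicit Types (M : memory).
Variable c : nat.
Hypothesis Bc : c%:R <= B 3.
Local Notation consts := (consts c).
Variables (J : 'I_c -> 'I_n) (tau : 'I_c -> R[i]).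

Definition sample_row (i : 'I_m) : 'rV[R[i]]_c := \row_t (A i (J t) * tau t).

(* The importance weight that makes [inner_weight y *: x^* x] an unbiased
   estimator of [C^* C], [x] being the row of [C] picked by the sample [y]. *)
Definition inner_weight (Phi : R[i]) (y : 'I_c * 'I_m) : R[i] :=
  let x := sample_row y.2 in
  x 0 y.1 * Num.conj (x 0 y.1) / (tau y.1 * tau y.1) * Phi
    / (tilde acc' (J y.1) y.2 * Num.conj (tilde acc' (J y.1) y.2))
    / \sum_t `|x 0 t| ^+ 2.

Definition inner_term (Phi : R[i]) (r' : nat) (y : 'I_c * 'I_m) : 'M[R[i]]_c :=
  (inner_weight Phi y / r'%:R) *: ((sample_row y.2)^t* *m sample_row y.2).

(** A uniform column of the sketch, then a row index drawn from it. Uniform is the right choice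
    because the weights [tau] give all oversampled columns the same squared norm, the [c]-th part of
    the total. *)
Definition inner_prob (y : 'I_c * 'I_m) : R :=
  c%:R^-1 * (Normc.normc (tilde acc' (J y.1) y.2) ^+ 2 / row_norm (tilde acc') (J y.1) ^+ 2).

Lemma inner_update_ok (Phi : R[i]) r' (y : 'I_c * 'I_m) (G : 'M[R[i]]_c) M :
  consts M -> mi M 11 = r' -> mz M 7 = Phi ->
  (forall t : 'I_c, mia M 1 t = J t) -> (forall t : 'I_c, mza M 1 t = tau t) ->
  mi M 21 = y.1 -> mi M 22 = J y.1 -> mi M 23 = y.2 -> marr M 4 G ->
  H inner_update M (fun M' => marr M' 4 (G + inner_term Phi r' y)).
Proof.
case: y => y1 y2 /= kM M11 M7 MJ Mt M21 M22 M23 M4.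
set x := sample_row y2.
apply: hoare_seq; apply: (@hoare_ins _ _ _ _ _ _ _ _ _ _ _ (sz 20 (tilde acc' (J y1) y2) M)).
  by rewrite /= M22 M23 !valK.
apply: hoare_seq; apply: hoare_pure => //; set M0 := pstep _ _ _ _ _.
have kM0 : consts M0 by case: kM => *; split.
have M0z : mz M0 22 = 0 by rewrite /= (k_z9 kM) addr0.
have M020 : mz M0 20 = tilde acc' (J y1) y2 by [].
have M07 : mz M0 7 = Phi by [].
have M0J (t : 'I_c) : mia M0 1 t = J t by exact: MJ.
have M0t (t : 'I_c) : mza M0 1 t = tau t by exact: Mt.
have M021 : mi M0 21 = y1 by [].
have M023 : mi M0 23 = y2 by [].
have M011 : mi M0 11 = r' by [].
have M04 : marr M0 4 G by exact: M4.
clearbody M0; clear M kM M11 M7 MJ Mt M21 M22 M23 M4.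
apply: hoare_seq; apply: (hoare_for B_ge0 (Inv := fun k M' =>
   mz M' 22 = \sum_(t < c | (t < k)%N) `|x 0 t| ^+ 2 /\
   forall t : 'I_c, (t < k)%N -> mza M' 3 t = x 0 t)) => //.
- by rewrite (k_c kM0).
- by split=> //=; rewrite M0z sum_lt0.
- move=> k M1 fr kc M1k M13 [I1 I2]; rewrite (k_c kM0) in kc M13; pose ko := Ordinal kc.
  have e1 : mia M1 1 k = J ko by rewrite (frame_ia fr) // -M0J.
  have e2 : mza M1 1 k = tau ko by rewrite (frame_za fr) // -M0t.
  have e3 : mi M1 23 = y2 by rewrite (frame_i fr).
  apply: hoare_seq; apply: hoare_pure => //; set M2 := pstep _ _ _ _ _.
  apply: hoare_seq; apply: (@hoare_ins _ _ _ _ _ _ _ _ _ _ _ (sz 23 (A y2 (J ko)) M2)).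
    by rewrite /= M1k e1 e3 !valK.
  have xE : x 0 ko = A y2 (J ko) * tau ko by rewrite mxE.
  apply: hoare_blk => //; split; rewrite /= M1k e2 -?xE.
    by rewrite (@sum_ltS _ _ _ ko) I1 normCK.
  move=> t; rewrite ltnS; case: (t =P k :> nat) => [et _|/eqP ne lt].
    by rewrite (_ : t = ko) //; apply: val_inj.
  by apply: I2; rewrite ltn_neqAle ne.
move=> M1 fr1 _; rewrite (k_c kM0) sum_ltn => -[I1 I2].
have kM1 := consts_frame fr1 isT isT kM0.
have f20 : mz M1 20 = tilde acc' (J y1) y2 by rewrite (frame_z fr1).
have f7 : mz M1 7 = Phi by rewrite (frame_z fr1).
have f21 : mi M1 21 = y1 by rewrite (frame_i fr1).
have f11 : mi M1 11 = r' by rewrite (frame_i fr1).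
have f3 (t : 'I_c) : mza M1 3 t = x 0 t by apply: I2.
have f1 : mza M1 1 y1 = tau y1 by rewrite (frame_za fr1).
have f4 : marr M1 4 G by move=> i j; rewrite (frame_za fr1).
clear I2; apply: hoare_seq; apply: hoare_blk => //; set M2 := foldl _ _ _.
have kM2 : consts M2 by case: kM1 => *; split.
pose w := inner_weight Phi (y1, y2) / r'%:R.
have gw : mz M2 23 = w by rewrite /= f21 f3 f1 f7 f20 I1 f11.
have g3 (t : 'I_c) : mza M2 3 t = x 0 t by exact: f3.
have g4 : marr M2 4 G by exact: f4.
clearbody M2.
pose K := inner_term Phi r' (y1, y2).
have KE i j : K i j = Num.conj (x 0 i) * x 0 j * w.
  by rewrite /K /inner_term mxE -/w mulrC !mxE big_ord1 !mxE.
apply: (hoare_for B_ge0 (Inv := fun k M' => forall i j : 'I_c,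
  mza M' 4 (i * c + j)%N = G i j + (if (i < k)%N then K i j else 0))) => //.
- by rewrite (k_c kM2).
- by move=> i j /=; rewrite addr0 g4.
- move=> i M3 fr3 ic M3i M33 I; rewrite (k_c kM2) in ic M33; pose io := Ordinal ic.
  have kM3 := consts_frame fr3 isT isT kM2.
  apply: (hoare_for B_ge0 (Inv := fun k M' => forall i' j : 'I_c,
    mza M' 4 (i' * c + j)%N = G i' j +
      (if (i' < i)%N || (i' == i :> nat) && (j < k)%N then K i' j else 0))) => //.
  + by rewrite M33.
  + by move=> i' j /=; rewrite ltn0 andbF orbF I.
  + move=> j M4 fr4 jc M4j M43 I'; rewrite M33 in jc M43; pose jo := Ordinal jc.
    have M4i : mi M4 24 = i by rewrite (frame_i fr4).
    have h3 (t : 'I_c) : mza M4 3 t = x 0 t by rewrite (frame_za fr4) // (frame_za fr3).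
    have hw : mz M4 23 = w by rewrite (frame_z fr4) // (frame_z fr3).
    apply: hoare_blk => // i' j'; rewrite /= M4i M4j M43 hw (h3 io) (h3 jo).
    rewrite index_eq // ltnS (I' io jo) /= ltnn eqxx ltnn addr0 I'.
    case: (i' =P i :> nat) => [ei|] /=; last by rewrite orbF.
    have -> : i' = io by apply: val_inj.
    rewrite /= ltnn /=; case: (ltngtP j' j) => //= ej.
    by rewrite (_ : j' = jo) ?KE //; apply: val_inj.
  + move=> M4 fr4 M43 I' i' j; by rewrite I' M33 ltn_ord andbT ltnS [in RHS]leq_eqVlt orbC.
- by move=> M3 fr3 _; rewrite (k_c kM2) => I i j; rewrite I ltn_ord [RHS]mxE.
Qed.

Lemma inner_ok (Phi : R[i]) r' M :
  consts M -> mi M 11 = r' -> r'%:R <= B 11 -> mz M 7 = Phi ->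
  (forall t : 'I_c, mia M 1 t = J t) -> (forall t : 'I_c, mza M 1 t = tau t) ->
  (forall k, mza M 4 k = 0) ->
  HR (CFor 20 11 inner_body) M (fun o : {ffun 'I_r' -> 'I_c * 'I_m} => \prod_u inner_prob (o u))
    (fun o M' => marr M' 4 (\sum_u inner_term Phi r' (o u))).
Proof.
move=> kM M11 Br M7 MJ Mt M4.
pose Inv (v : seq ('I_c * 'I_m)) M' := marr M' 4 (\sum_(y <- v) inner_term Phi r' y).
have F : HR (CFor 20 11 inner_body) M (fun o : {ffun 'I_r' -> 'I_c * 'I_m} =>
    \prod_u inner_prob (o u))
    (fun o M' => mi M' 11 = r' /\ Inv [seq o i | i <- enum 'I_r'] M').
  apply: (@hoareR_for R m n phi A acc acc' f B B_ge0) => //.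
    by move=> i j; rewrite /= big_nil mxE M4.
  move=> v M1 fr vY M1v M111 I.
  have kM1 := consts_frame fr isT isT kM.
  have e7 : mz M1 7 = Phi by rewrite (frame_z fr).
  have eJ (t : 'I_c) : mia M1 1 t = J t by rewrite (frame_ia fr).
  have eT (t : 'I_c) : mza M1 1 t = tau t by rewrite (frame_za fr).
  pose P1 (y : 'I_c * 'I_m) M' := [/\ mi M' 21 = y.1, mi M' 22 = J y.1 & mi M' 23 = y.2].
  have S1 : HR (CIns (IRand 21 3) ;; CIns (IGet 22 1 21) ;; CIns (Ask OnAdjoint (SCol 23 22)))
     M1 inner_prob P1.
    pose w1 (t : 'I_c) : R := c%:R^-1.
    pose w2 (t : 'I_c) (i : 'I_m) : R :=
      Normc.normc (tilde acc' (J t) i) ^+ 2 / row_norm (tilde acc') (J t) ^+ 2.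
    have S0 := hoareR_seq (w := w1) (w2 := w2) (Post2 := fun t i M' => P1 (t, i) M')
      (hoareR_rand acc acc' f B (x := 21%N) (k_c kM1)).
    apply: hoareR_W (S0 _ _) _ => [t M2 _ _ ->|[] //].
    apply: (@hoareR_pre _ _ _ _ _ _ _ _ B _ _ _ (fun M' => M' = si 22 (J t) (si 21 t M1))).
      by apply: hoare_pure => //; rewrite /pstep /= eJ.
    have e22 : mi (si 22 (J t) (si 21 t M1)) 22 = J t by [].
    move=> M3 _ ->; apply: hoareR_W (hoareR_scol_adjoint acc acc' f B (x := 23%N) e22) _.
    by move=> i M4' _ _ ->.
  apply: (hoareR_post S1) => y M2 _ fr2 [h1 h2 h3].
  have kM2 := consts_frame fr2 isT isT kM1.
  have g11 : mi M2 11 = r' by rewrite (frame_i fr2).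
  have g7 : mz M2 7 = Phi by rewrite (frame_z fr2).
  have gJ (t : 'I_c) : mia M2 1 t = J t by rewrite (frame_ia fr2).
  have gT (t : 'I_c) : mza M2 1 t = tau t by rewrite (frame_za fr2).
  have g4 : marr M2 4 (\sum_(y <- v) inner_term Phi r' y) by move=> i j; rewrite (frame_za fr2).
  apply: hoareW (inner_update_ok kM2 g11 g7 gJ gT h1 h2 h3 g4) _ => M3 fr3 h4 i j.
  by rewrite /= h4 -cats1 big_cat big_seq1.
apply: (hoareR_W F) => o M' _ _ [_ I] i j.
by rewrite I big_map big_enum.
Qed.
End Inner.

(** * Parameters found by doubling *)

Section Doubling.
Variable R : realType.

Lemma doubling_ex (x y : R) : exists k, (0 < x) ==> (y <= 2 ^+ k * x).
Proof.
case: (ltP 0 x) => x0; last by exists 0%N.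
exists (Num.bound (y / x)); apply/implyP => _; rewrite -ler_pdivrMr //.
exact/ltW/upper_nthrootP.
Qed.

(** The number of iterations of a loop that doubles [x] until it reaches [y]. The guard in
    [doubling_ex] makes this total, with value [0] for [x <= 0]. *)
Definition doublings (x y : R) : nat := ex_minn (doubling_ex x y).

Lemma doublings_ge x y : 0 < x -> y <= 2 ^+ doublings x y * x.
Proof. by move=> x0; rewrite /doublings; case: ex_minnP => k /implyP /(_ x0). Qed.

Lemma doublings_min x y k : 0 < x -> (k < doublings x y)%N -> 2 ^+ k * x < y.
Proof.
move=> x0; rewrite /doublings; case: ex_minnP => l _ h kl.
by rewrite ltNge; apply/negP => le; have := h k; rewrite x0 /= le leqNgt kl => /(_ isT).
Qed.

Lemma doublings_lt x y k : 0 < x -> (2 ^+ k * x < y) = (k < doublings x y)%N.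
Proof.
move=> x0; apply/idP/idP => [lt|]; last exact: doublings_min.
rewrite ltnNge; apply/negP => le; move: lt; rewrite ltNge => /negP; apply.
apply: le_trans (doublings_ge y x0) _; rewrite ler_pM2r // -!natrX ler_nat.
by rewrite leq_exp2l.
Qed.
End Doubling.

Section Constants.
Variable R : realType.

(** An exponent for geometric tails: the doublings bring [4^-depth] below [delta], and the two extra
    units divide it by [16], enough for a share [delta / 4] per bad event. *)
Definition depth (delta : R) : nat := (2 + doublings delta 1)%N.
Definition scale (T : R) : nat := (1 + doublings 1 T)%N.
(* The constant is [160 * 4096^2], from the tolerance [a^2 / (4096 sigma ell)]
   demanded of the estimate of [C^* C]. *)
Definition inner_target (dd ell : nat) (sigma psi : R) : R :=
  64 ^+ 4 * 160 * (dd + ell)%:R * psi * (sigma * sigma) * (ell%:R * ell%:R).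
Definition inner_size (T : R) : nat := (2 ^ doublings 1 T)%N.
End Constants.

Lemma shiftE (R : realType) (x y : R) : (x ^+ 2 / (16 * y))%:C = x%:C * x%:C / (16 * y%:C).
Proof.
rewrite fmorph_div rmorphXn expr2; congr (_ / _).
by rewrite rmorphM rmorph_nat.
Qed.

(** * The whole program *)

Section Whole.
Variables (R : realType) (m n : nat) (phi : R) (A : 'M[R[i]]_(m, n)).
Variables (acc : SQ phi A) (acc' : SQ phi (A^t*)) (f : R -> R[i]) (B : nat -> R).
Hypothesis B_ge0 : forall x, 0 <= B x.
Local Notation H := (hoare acc acc' f B).
Local Notation HR := (hoareR acc acc' f B).
Local Notation memory := (memory R).
Implicit Types (M : memory).
Variables (r c : nat) (L Lbar eps delta a : R).
Hypothesis delta0 : 0 < delta.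

Let Phi := frob_norm (tilde acc) ^+ 2.
(** [L a^3] and [Lbar a^5] are the effects on the result of a relative error of order one in a Gram
    matrix, through [g] and through [gbar]; divided by [eps] they tell by how much that error must
    be reduced. *)
Definition rate : R := (L * a ^+ 3 + Lbar * a ^+ 5) / eps.
(** The stable rank of [A] inflated by the oversampling factor [phi]. *)
Definition stable_rank : R := Phi / a ^+ 2.
Definition p_depth := depth delta.
Definition p_scale := scale (stable_rank * (1 + rate)).
Definition p_target := inner_target p_depth p_scale rate stable_rank.
Definition p_inner := inner_size p_target.
Definition p_rounds := (4 * p_scale + 24)%N.

Lemma doubling_loop tg u p q s x y (P : nat -> memory -> Prop) M Q :
  u != 20%N -> 0 < x -> (doublings x y)%:R <= B tg ->
  mz M 20 = x%:C -> mz M u = y%:C -> P 0%N (scratch M) ->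
  (forall k M', P k M' -> P k.+1 (si p (mi M' q + mi M' s)%N (sz 20 (mz M' 20 + mz M' 20) M'))) ->
  (forall M', frame (CWhile tg (LtZ 20 u) (blk [:: ZAdd 20 20 20; IAdd p q s])) M M' ->
     P (doublings x y) M' -> Q M') ->
  H (CWhile tg (LtZ 20 u) (blk [:: ZAdd 20 20 20; IAdd p q s])) M Q.
Proof.
move=> u20 x0 Btg M20 Mu P0 PS fin.
pose I k M' := [/\ (k <= doublings x y)%N, mz M' 20 = (2 ^+ k * x)%:C & P k M'].
apply: (hoare_while B_ge0 (N := doublings x y) (Inv := I)) => //.
  by split=> //=; rewrite M20 mul1r.
move=> k M' fr [k1 k2 k3].
have M'u : mz M' u = y%:C by rewrite (frame_z fr) // /cwz /= inE.
rewrite /= k2 M'u /= doublings_lt //; case: ltnP => kD.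
  split=> //; apply: hoare_blk => //; split=> //; last exact: PS.
  by rewrite /= k2 -rmorphD exprS -mulrA mulr_natl mulr2n.
by apply: fin => //; rewrite (_ : doublings x y = k) //; apply/eqP; rewrite eqn_leq kD.
Qed.

Definition M0 : memory := Memory (nth 0%N [:: m; n; r; c])
  (nth 0 [:: phi%:C; L%:C; Lbar%:C; eps%:C; delta%:C; a%:C])
  (fun _ _ => 0%N) (fun _ _ => 0).

Lemma load_constants_ok :
  H load_constants M0 (fun M => consts c M /\ [/\ mi M 2 = r & mi M 9 = 2%N] /\
    [/\ mz M 5 = a%:C, mz M 7 = Phi%:C, mz M 10 = rate%:C & mz M 11 = stable_rank%:C] /\
    [/\ mz M 13 = (stable_rank * (1 + rate))%:C & mz M 20 = delta%:C]).
Proof.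
pose x0 := frob_norm (tilde acc).
apply: hoare_seq; apply: (@hoare_ins _ _ _ _ _ _ _ _ _ _ _ (sz 6 x0%:C M0)) => //.
apply: hoare_blk => //; set M1 := foldl _ _ _.
have e10 : rate = (L * (a * a * a) + Lbar * (a * a * a * (a * a))) / eps.
  by rewrite /rate; congr (_ / _); ring.
split; first by split.
split; first by [].
split; split; first by [].
- by rewrite /= /Phi -rmorphM expr2.
- by rewrite /= e10 fmorph_div rmorphD !rmorphM.
- by rewrite /= /stable_rank /Phi fmorph_div !expr2 !rmorphM.
- have -> : stable_rank * (1 + rate) =
      x0 * x0 / (a * a) * (1 + (L * (a * a * a) + Lbar * (a * a * a * (a * a))) / eps).
    by rewrite e10 /stable_rank /Phi; congr (_ / _ * (1 + _ / _)); ring.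
  by rewrite /= rmorphM rmorphD rmorph1 !fmorph_div rmorphD !rmorphM.
- by rewrite /= addr0.
Qed.

Lemma find_scale_ok M : consts c M -> mz M 13 = (stable_rank * (1 + rate))%:C ->
  p_scale%:R <= B 101 -> H find_scale M (fun M' => mi M' 10 = p_scale).
Proof.
move=> kM f13 B101; apply: hoare_seq; apply: hoare_blk => //; set M3 := foldl _ _ _.
have kM3 : consts c M3 by case: kM => *; split.
have f20 : mz M3 20 = 1%:C by rewrite /= (k_z8 kM) (k_z9 kM) addr0 rmorph1.
have {}f13 : mz M3 13 = (stable_rank * (1 + rate))%:C by [].
have e10 : mi M3 10 = 1%N by [].
clearbody M3.
apply: (doubling_loop (x := 1) (y := stable_rank * (1 + rate))
  (P := fun k M => mi M 10 = (1 + k)%N /\ mi M 8 = 1%N)) => //.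
- by apply: le_trans B101; rewrite ler_nat leq_addl.
- by split; rewrite /= ?e10 // (k_8 kM3).
- by move=> k M1 [h1 h2]; split=> //=; rewrite h1 h2; lia.
by move=> M4 _ [].
Qed.

Lemma set_target_ok M : consts c M -> mi M 9 = p_depth -> mi M 10 = p_scale ->
  mz M 10 = rate%:C -> mz M 11 = stable_rank%:C ->
  H set_target M (fun M' => [/\ mz M' 20 = 1%:C, mi M' 11 = 1%N & mz M' 21 = p_target%:C]).
Proof.
move=> kM e9 e10 f10 f11; apply: hoare_blk => //; split=> //.
  by rewrite /= (k_z8 kM) (k_z9 kM) addr0 rmorph1.
rewrite /= e9 e10 f10 f11 /p_target /inner_target !rmorphM !rmorph_nat.
by rewrite !exprS expr0 mulr1 !mulrA.
Qed.

Lemma set_parameters_ok M : consts c M -> mi M 9 = p_depth -> mi M 10 = p_scale ->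
  mz M 5 = a%:C -> mz M 7 = Phi%:C -> mz M 10 = rate%:C ->
  H set_parameters M (fun M' => consts c M' /\
    [/\ mi M' 12 = (c * c)%N & mi M' 13 = p_rounds] /\
    [/\ mz M' 14 = (a ^+ 2 / (16 * rate))%:C & mz M' 15 = (Phi / p_depth%:R)%:C]).
Proof.
move=> kM e9 e10 z5 z7 z10; have e3 := k_c kM; apply: hoare_blk => //.
split; first by case: kM => *; split.
split; split=> /=.
- by rewrite e3.
- by rewrite e10.
- by rewrite z5 z10 -shiftE.
- by rewrite z7 e9 fmorph_div rmorph_nat.
Qed.

Lemma prelude_ok : p_depth%:R <= B 100 -> p_scale%:R <= B 101 -> p_inner%:R <= B 102 ->
  H prelude M0 (fun M => consts c M /\
    [/\ mi M 2 = r, mi M 11 = p_inner, mi M 12 = (c * c)%N & mi M 13 = p_rounds] /\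
    [/\ mz M 7 = Phi%:C, mz M 14 = (a ^+ 2 / (16 * rate))%:C &
        mz M 15 = (Phi / p_depth%:R)%:C]).
Proof.
move=> B100 B101 B102; apply: hoare_seq; apply: hoareW load_constants_ok _.
move=> M1 fr1 [kM1 [[e2 e9] [[z5 z7 z10 z11] [z13 z20]]]].
apply: hoare_seq; apply: (doubling_loop (x := delta) (y := 1)
  (P := fun k M => mi M 9 = (2 + k)%N /\ mi M 8 = 1%N)) => //.
- by apply: le_trans B100; rewrite ler_nat leq_addl.
- by rewrite (k_z8 kM1) rmorph1.
- by split; rewrite /= ?e9 // (k_8 kM1).
- by move=> k M [h1 h2]; split=> //=; rewrite h1 h2; lia.
move=> M2 fr2 [h9 _]; have kM2 := consts_frame fr2 isT isT kM1.
have f13 : mz M2 13 = (stable_rank * (1 + rate))%:C by rewrite (frame_z fr2).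
apply: hoare_seq; apply: hoareW (find_scale_ok kM2 f13 B101) _ => M4 fr4 h10.
have kM4 := consts_frame fr4 isT isT kM2.
have g9 : mi M4 9 = p_depth by rewrite (frame_i fr4) // h9.
have g10 : mz M4 10 = rate%:C by rewrite (frame_z fr4) // (frame_z fr2).
have g11 : mz M4 11 = stable_rank%:C by rewrite (frame_z fr4) // (frame_z fr2).
have g5 : mz M4 5 = a%:C by rewrite (frame_z fr4) // (frame_z fr2).
have g7 : mz M4 7 = Phi%:C by rewrite (frame_z fr4) // (frame_z fr2).
have g2 : mi M4 2 = r by rewrite (frame_i fr4) // (frame_i fr2).
apply: hoare_seq; apply: hoareW (set_target_ok kM4 g9 h10 g10 g11) _ => M5 fr5 [h20 h11 h21].
have kM5 := consts_frame fr5 isT isT kM4.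
apply: hoare_seq; apply: (doubling_loop (x := 1) (y := p_target)
  (P := fun k M => mi M 11 = (2 ^ k)%N)) => //.
- by apply: le_trans B102; rewrite ler_nat ltnW // ltn_expl.
- by move=> k M h1 /=; rewrite h1 expnS mul2n addnn.
move=> M6 fr6 j11; have kM6 := consts_frame fr6 isT isT kM5.
have j9 : mi M6 9 = p_depth by rewrite (frame_i fr6) // (frame_i fr5).
have j10 : mi M6 10 = p_scale by rewrite (frame_i fr6) // (frame_i fr5).
have j2 : mi M6 2 = r by rewrite (frame_i fr6) // (frame_i fr5).
have jz5 : mz M6 5 = a%:C by rewrite (frame_z fr6) // (frame_z fr5).
have jz7 : mz M6 7 = Phi%:C by rewrite (frame_z fr6) // (frame_z fr5).
have jz10 : mz M6 10 = rate%:C by rewrite (frame_z fr6) // (frame_z fr5).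
apply: hoareW (set_parameters_ok kM6 j9 j10 jz5 jz7 jz10) _.
move=> M7 fr7 [kM7 [[h12 h13] [h14 h15]]]; split=> //; split; split=> //.
- by rewrite (frame_i fr7).
- by rewrite (frame_i fr7).
- by rewrite (frame_z fr7).
Qed.

(* The recorded samples of the whole program: the columns of [T], the rows of
   [S], and the samples behind the estimate of [C^* C]. *)
Definition outcome : finType :=
  ({ffun 'I_c -> 'I_n} * {ffun 'I_r -> 'I_m} * {ffun 'I_p_inner -> 'I_c * 'I_m})%type.

Definition row_prob (i : 'I_m) : R := row_norm (tilde acc) i ^+ 2 / Phi.
Definition col_prob (j : 'I_n) : R := row_norm (tilde acc') j ^+ 2 / Phi.

Definition outcome_prob (o : outcome) : R :=
  (\prod_t col_prob (o.1.1 t)) * (\prod_s row_prob (o.1.2 s))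
  * \prod_u inner_prob acc' (o.1.1 : 'I_c -> 'I_n) (o.2 u).

Lemma row_probE i : row_prob i = row_norm (tilde acc) i ^+ 2 / frob_norm (tilde acc) ^+ 2.
Proof. by []. Qed.

Lemma col_probE j : col_prob j = row_norm (tilde acc') j ^+ 2 / frob_norm (tilde acc) ^+ 2.
Proof. by []. Qed.

Lemma outcome_probE o : outcome_prob o =
  (\prod_t col_prob (o.1.1 t)) * (\prod_s row_prob (o.1.2 s))
  * \prod_u inner_prob acc' (o.1.1 : 'I_c -> 'I_n) (o.2 u).
Proof. by []. Qed.

Definition col_wt (J : {ffun 'I_c -> 'I_n}) (t : 'I_c) : R[i] := weight c (col_prob (J t)).
Definition row_wt (I : {ffun 'I_r -> 'I_m}) (s : 'I_r) : R[i] := weight r (row_prob (I s)).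

Definition gram_est (J : {ffun 'I_c -> 'I_n}) (K : {ffun 'I_p_inner -> 'I_c * 'I_m}) : 'M[R[i]]_c :=
  \sum_u inner_term acc' J (col_wt J) Phi%:C p_inner (K u).

Definition out_ok (o : outcome) M : Prop :=
  [/\ (forall t : 'I_c, mia M 1 t = o.1.1 t) /\ (forall t : 'I_c, mza M 1 t = col_wt o.1.1 t),
      (forall s : 'I_r, mia M 0 s = o.1.2 s) /\ (forall s : 'I_r, mza M 0 s = row_wt o.1.2 s) &
      exists Q : 'M[R[i]]_c, let G := gram_est o.1.1 o.2 in let X := Q^t* *m G *m Q in
        let W := crossmx A o.1.1 (col_wt o.1.1) o.1.2 (row_wt o.1.2) in
        [/\ Q \is unitarymx, off X <= 2^-1 ^+ p_rounds * off G &
          marr M 2 (core_out f (a ^+ 2 / (16 * rate))%:C X Q *m W^t*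
             *m diag_mx (\row_s flag (Phi / p_depth%:R)%:C W s))]].

Hypothesis tilde_frob' : frob_norm (tilde acc') ^+ 2 = Phi.
Hypothesis c0 : (0 < c)%N.
Hypothesis Br : r%:R <= B 2.
Hypothesis Bc : c%:R <= B 3.
Hypothesis Bi : p_inner%:R <= B 11.
Hypothesis Bcc : (c * c)%:R <= B 12.
Hypothesis Be : p_rounds%:R <= B 13.
Hypothesis B100 : p_depth%:R <= B 100.
Hypothesis B101 : p_scale%:R <= B 101.
Hypothesis B102 : p_inner%:R <= B 102.

Lemma gram_est_herm J K : (gram_est J K)^t* = gram_est J K.
Proof.
rewrite /gram_est adj_sum; apply: eq_bigr => u _.
rewrite /inner_term adj_scale adjM trmxCK; congr (_ *: _).
apply/CrealP; rewrite rpredM ?rpredV ?realn // /inner_weight.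
have cR z : z * Num.conj z \is Num.real :> bool by rewrite ger0_real // mul_conjC_ge0.
have tR t : col_wt J t \is Num.real by apply/CrealP; apply: realC_conj.
have PR : Phi%:C \is Num.real by apply/CrealP; apply: realC_conj.
have sR : \sum_t `|sample_row A J (col_wt J) (K u).2 0 t| ^+ 2 \is Num.real.
  by apply: rpred_sum => t _; rewrite rpredX // normr_real.
have VR (z : R[i]) : z \is Num.real -> z^-1 \is Num.real by rewrite realV.
apply: realM; last exact: VR.
apply: realM; last exact/VR/cR.
apply: realM => //; apply: realM; first exact: cR.
by apply/VR/realM.
Qed.

Lemma svt_cmd_ok : HR svt_cmd M0 outcome_prob out_ok.
Proof.
apply: hoareR_pre (prelude_ok B100 B101 B102) _ => M1 fr1 [kM1 [[e2 e11 e12 e13] [z7 z14 z15]]].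
have z7M M : mz M 7 = mz M1 7 -> mz M 7 = Phi%:C by rewrite z7.
pose P1 (J : {ffun 'I_c -> 'I_n}) M :=
  (forall t : 'I_c, mia M 1 t = J t) /\ (forall t : 'I_c, mza M 1 t = col_wt J t).
pose P2 (I : {ffun 'I_r -> 'I_m}) M :=
  (forall s : 'I_r, mia M 0 s = I s) /\ (forall s : 'I_r, mza M 0 s = row_wt I s).
have S1 : HR (CFor 20 3 (sketch_body OnAdjoint 3 1)) M1
    (fun o : {ffun 'I_c -> 'I_n} => \prod_t col_prob (o t)) P1.
  apply: (sketch_ok B_ge0 (q := col_prob) (rn := row_norm (tilde acc'))) => //.
  - by rewrite (k_c kM1).
  - move=> M; rewrite /col_prob -tilde_frob'; exact: hoareR_srow_adjoint.
  - by move=> M i /= ->; rewrite valK.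
  - exact: k_z8 kM1.
have S2 M : frame (CFor 20 3 (sketch_body OnAdjoint 3 1)) M1 M ->
    HR (CFor 20 2 (sketch_body OnMatrix 2 0)) M
    (fun o : {ffun 'I_r -> 'I_m} => \prod_t row_prob (o t)) P2.
  move=> fr; apply: (sketch_ok B_ge0 (q := row_prob) (rn := row_norm (tilde acc))) => //.
  - by rewrite (frame_i fr).
  - move=> M'; exact: hoareR_srow_matrix.
  - by move=> M' i /= ->; rewrite valK.
  - by rewrite (frame_z fr).
  - by rewrite (frame_z fr) // (k_z8 kM1).
have S12 : HR (CFor 20 3 (sketch_body OnAdjoint 3 1) ;; CFor 20 2 (sketch_body OnMatrix 2 0)) M1
   (fun o : {ffun 'I_c -> 'I_n} * {ffun 'I_r -> 'I_m} =>
      (\prod_t col_prob (o.1 t)) * (\prod_s row_prob (o.2 s)))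
   (fun o M => P1 o.1 M /\ P2 o.2 M).
  apply: (hoareR_seq (w2 := fun _ (I : {ffun 'I_r -> 'I_m}) => \prod_s row_prob (I s))
    (Post2 := fun J I M => P1 J M /\ P2 I M) S1) => J M _ fr [h1 h2].
  apply: hoareR_W (S2 M fr) _ => I M' _ fr' p2; split=> //.
  by split=> t; rewrite ?(frame_ia fr') ?(frame_za fr').
apply: (hoareR_post (Post1 := fun (o : outcome) M =>
    [/\ P1 o.1.1 M, P2 o.1.2 M & marr M 4 (gram_est o.1.1 o.2)])).
  have S3 := hoareR_seq (w2 := fun (JI : {ffun 'I_c -> 'I_n} * {ffun 'I_r -> 'I_m})
      (K : {ffun 'I_p_inner -> 'I_c * 'I_m}) =>
      \prod_u inner_prob acc' (JI.1 : 'I_c -> 'I_n) (K u))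
    (Post2 := fun JI K M => [/\ P1 JI.1 M, P2 JI.2 M & marr M 4 (gram_est JI.1 K)]) S12.
  apply: hoareR_W (S3 _ _) _ => [[J I] M _ fr [/= [p1 p1'] [p2 p2']]|[] //].
  have kM := consts_frame fr isT isT kM1.
  have IO : HR (CFor 20 11 inner_body) M
     (fun K : {ffun 'I_p_inner -> 'I_c * 'I_m} => \prod_u inner_prob acc' J (K u))
     (fun K M' => marr M' 4 (gram_est J K)).
    apply: inner_ok => //.
    - by rewrite (frame_i fr).
    - by rewrite (frame_z fr).
    - by move=> k; rewrite (frame_za fr) // (frame_za fr1).
  apply: hoareR_W IO _ => K M' _ fr' h4; split=> //.
  - by split=> t; rewrite ?(frame_ia fr') ?(frame_za fr').
  - by split=> t; rewrite ?(frame_ia fr') ?(frame_za fr').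
move=> [[J I] K] M _ fr [/= [p1 p1'] [p2 p2'] h4].
have kM := consts_frame fr isT isT kM1.
have F := finish_ok acc acc' f B_ge0 Bc c0 Br (e := p_rounds) (theta := (Phi / p_depth%:R)%:C)
  (eta := (a ^+ 2 / (16 * rate))%:C) (gram_est_herm J K) kM _ _ _ _ _ Bcc Be _ h4 p1 p1' p2 p2'.
apply: hoareW (F _ _ _ _ _ _) _ => //.
- by rewrite (frame_i fr).
- by rewrite (frame_z fr).
- by rewrite (frame_z fr).
- by rewrite (frame_i fr).
- by rewrite (frame_i fr).
- by move=> k; rewrite (frame_za fr) // (frame_za fr1).
move=> M' fr' [Q [h1 h2 h3]]; split=> /=.
- by split=> t; rewrite ?(frame_ia fr') ?(frame_za fr').
- by split=> t; rewrite ?(frame_ia fr') ?(frame_za fr').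
- by exists Q.
Qed.
End Whole.

Lemma frob_sqr (R : realType) m n (A : 'M[R[i]]_(m, n)) :
  frob_norm A ^+ 2 = \sum_i \sum_j Normc.normc (A i j) ^+ 2.
Proof. rewrite sqr_sqrtr //; apply: sumr_ge0 => i _; apply: sumr_ge0 => j _; exact: sqr_ge0. Qed.

Lemma row_norm_sqr (R : realType) m n (A : 'M[R[i]]_(m, n)) i :
  row_norm A i ^+ 2 = \sum_j Normc.normc (A i j) ^+ 2.
Proof. by rewrite frob_sqr big_ord1; apply: eq_bigr => j _; rewrite mxE. Qed.

Lemma sum_prod (R : comPzRingType) (T : finType) N (q : T -> R) :
  \sum_y q y = 1 -> \sum_(o : {ffun 'I_N -> T}) \prod_t q (o t) = 1.
Proof.
move=> q1; rewrite -(bigA_distr_bigA (fun _ => q)) /=.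
by rewrite big1 // => t _; rewrite q1.
Qed.

(** A positive probability makes the single possible entry of each row nonzero, so the sampled index
    can be read off the matrix. This turns the law of the outcomes into the law of the sketch. *)
Lemma sampling_inj (R : realType) r m (p : 'I_m -> R) (I I' : {ffun 'I_r -> 'I_m}) :
  (forall i, 0 <= p i) -> (forall t, p (I t) != 0) ->
  sampling_mx p I = sampling_mx p I' -> I = I'.
Proof.
move=> p0 pI e; apply/ffunP => t; apply/eqP/negPn/negP => ne.
have := congr1 (fun X : 'M_(r, m) => X t (I t)) e; rewrite !mxE eqxx (negbTE ne) => /eqP.
have w0 : 0 < Num.sqrt (r%:R * p (I t)).
  rewrite sqrtr_gt0 mulr_gt0 ?ltr0n ?(leq_ltn_trans _ (ltn_ord t)) //.
  by rewrite lt_neqAle p0 eq_sym pI.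
by rewrite fmorph_eq0 invr_eq0 gt_eqF.
Qed.

(** * Law of the final state *)

Section Law.
Variables (R : realType) (m n : nat) (phi : R) (A : 'M[R[i]]_(m, n)).
Variables (acc : SQ phi A) (acc' : SQ phi (A^t*)) (f : R -> R[i]).
Variables (r c : nat) (L Lbar eps delta a : R).
Hypothesis delta0 : 0 < delta.
Hypothesis Phi0 : 0 < frob_norm (tilde acc) ^+ 2.
Hypothesis tilde_frob' : frob_norm (tilde acc') ^+ 2 = frob_norm (tilde acc) ^+ 2.
Hypothesis c0 : (0 < c)%N.
Hypothesis r0 : (0 < r)%N.

Local Notation Phi := (frob_norm (tilde acc) ^+ 2).
Local Notation p_inner := (p_inner acc L Lbar eps delta a).
Local Notation p_scale := (p_scale acc L Lbar eps a).
Local Notation outcome := (outcome acc r c L Lbar eps delta a).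
Local Notation outcome_prob := (@outcome_prob R m n phi A acc acc' r c L Lbar eps delta a).
Local Notation row_prob := (row_prob acc).
Local Notation col_prob := (col_prob acc acc').

(** The keys are the registers that bound the counted loops and the tags 100 to 102 of the loops of
    the prelude. *)
Definition budget (x : nat) : R :=
  match x with
  | 2 => r%:R | 3 => c%:R | 11 => p_inner%:R | 12 => (c * c)%:R
  | 13 => (p_rounds acc L Lbar eps a)%:R
  | 100 => (p_depth delta)%:R | 101 => p_scale%:R | 102 => p_inner%:R
  | _ => 0
  end.

Lemma budget_ge0 x : 0 <= budget x.
Proof. by rewrite /budget; do 103 (case: x => [|x]; first by rewrite ?ler0n). Qed.

Let time : R := cst acc acc' budget svt_cmd.

Lemma law_of_program : exists N (fin : outcome -> state R),
  (forall o, outcome_prob o != 0 ->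
     (exists M, [/\ out_ok acc' f o M, iarr (fin o) = mia M & zarr (fin o) = mza M]) /\
     clock (fin o) <= time) /\
  forall E, pr_from acc acc' f (compile 0 svt_cmd)
     (init_state m n r c phi L Lbar eps delta a) N E =
     \sum_o outcome_prob o * `[< E (fin o) >]%:R.
Proof.
have S := svt_cmd_ok f budget_ge0 delta0 tilde_frob' c0 (lexx r%:R : r%:R <= budget 2)
  (lexx _ : c%:R <= budget 3) (lexx _ : p_inner%:R <= budget 11)
  (lexx _ : (c * c)%:R <= budget 12) (lexx _ : (p_rounds acc L Lbar eps a)%:R <= budget 13)
  (lexx _ : (p_depth delta)%:R <= budget 100) (lexx _ : p_scale%:R <= budget 101)
  (lexx _ : p_inner%:R <= budget 102).
have [n0 [fin [tm [kk [h e]]]]] := S _ 0%N 0 (fun i _ => erefl).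
(* One more unit of fuel is needed for [run] to notice that the program counter has left the
   program. *)
exists (n0 + 1)%N, (fun o => st (0 + csize svt_cmd) (fin o) (tm o)); split.
  move=> o wo; have [h1 h2 h3] := h o wo; rewrite add0r in h3; split=> //.
  by exists (fin o).
move=> E; rewrite /pr_from -[init_state _ _ _ _ _ _ _ _ _ _]/(st 0 (M0 m n phi r c L Lbar eps delta a) 0) e.
apply: eq_bigr => o _; rewrite addn1.
set P := compile 0 svt_cmd; set s := st _ _ _.
have Ps : onth P (pc s) = None by apply: onth_default; rewrite /P size_compile.
by clearbody P s; rewrite /= Ps.
Qed.

Lemma normc_ge0 (z : R[i]) : 0 <= Normc.normc z. Proof. by case: z => x y; rewrite sqrtr_ge0. Qed.

Lemma row_prob_ge0 i : 0 <= row_prob i.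
Proof. by rewrite divr_ge0 ?sqr_ge0. Qed.

Lemma col_prob_ge0 j : 0 <= col_prob j.
Proof. by rewrite divr_ge0 ?sqr_ge0. Qed.

Lemma sum_row_norm p q (X : 'M[R[i]]_(p, q)) : \sum_i row_norm X i ^+ 2 = frob_norm X ^+ 2.
Proof. by rewrite frob_sqr; apply: eq_bigr => i _; rewrite row_norm_sqr. Qed.

Lemma sum_row_prob : \sum_i row_prob i = 1.
Proof. by rewrite -mulr_suml sum_row_norm divff // gt_eqF. Qed.

Lemma sum_col_prob : \sum_j col_prob j = 1.
Proof. by rewrite -mulr_suml sum_row_norm tilde_frob' divff // gt_eqF. Qed.

Lemma inner_prob_ge0 (J : 'I_c -> 'I_n) y : 0 <= inner_prob acc' J y.
Proof. by rewrite mulr_ge0 ?invr_ge0 ?ler0n // divr_ge0 ?sqr_ge0. Qed.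

Lemma sum_inner_prob (J : 'I_c -> 'I_n) : (forall t, col_prob (J t) != 0) ->
  \sum_y inner_prob acc' J y = 1.
Proof.
move=> J0; rewrite -(pair_bigA _ (fun t i => inner_prob acc' J (t, i))) /=.
rewrite (eq_bigr (fun=> c%:R^-1)) => [|t _].
  by rewrite sumr_const card_ord -[_ *+ c]mulr_natl divff // pnatr_eq0 -lt0n.
rewrite /inner_prob /= -mulr_sumr -mulr_suml -row_norm_sqr divff ?mulr1 //.
by apply: contra (J0 t) => /eqP; rewrite /col_prob => ->; rewrite mul0r.
Qed.

Lemma col_prob_neq0 (J : {ffun 'I_c -> 'I_n}) :
  \prod_t col_prob (J t) != 0 -> forall t, col_prob (J t) != 0.
Proof. by move=> h t; apply: contra h => /eqP e; rewrite (bigD1 t) //= e mul0r. Qed.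

Lemma outcome_prob_ge0 o : 0 <= outcome_prob o.
Proof.
by rewrite !mulr_ge0 // prodr_ge0 // => *; rewrite ?row_prob_ge0 ?col_prob_ge0 ?inner_prob_ge0.
Qed.

(** The weights of the second sample sum to one only if all sampled columns have nonzero
    probability; the remaining [J] have weight zero and drop out on both sides. *)
Lemma sum_outcome (g : {ffun 'I_c -> 'I_n} -> {ffun 'I_r -> 'I_m} -> R) :
  \sum_o outcome_prob o * g o.1.1 o.1.2 =
  \sum_(J : {ffun 'I_c -> 'I_n}) (\prod_t col_prob (J t)) *
    \sum_(I : {ffun 'I_r -> 'I_m}) (\prod_s row_prob (I s)) * g J I.
Proof.
rewrite -(pair_bigA _ (fun JI K => outcome_prob (JI, K) * g JI.1 JI.2)) /=.
rewrite -(pair_bigA _ (fun J I => \sum_K outcome_prob (J, I, K) * g J I)) /=.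
apply: eq_bigr => J _; rewrite mulr_sumr; apply: eq_bigr => I _.
rewrite -mulr_suml /outcome_prob /= -mulr_sumr !mulrA; congr (_ * _).
have [->|pJ] := eqVneq (\prod_t col_prob (J t)) 0; first by rewrite !mul0r.
by rewrite sum_prod ?mulr1 //; apply/sum_inner_prob/col_prob_neq0.
Qed.

Lemma sum_outcome_prob : \sum_o outcome_prob o = 1.
Proof.
have := sum_outcome (fun _ _ => 1); rewrite (eq_bigr outcome_prob) => [->|o _]; last by rewrite mulr1.
rewrite (eq_bigr (fun J : {ffun 'I_c -> 'I_n} => \prod_t col_prob (J t))) ?sum_prod ?sum_col_prob //.
move=> J _; rewrite (eq_bigr (fun I : {ffun 'I_r -> 'I_m} => \prod_s row_prob (I s))).
  by rewrite sum_prod ?mulr1 ?sum_row_prob.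
by move=> I _; rewrite mulr1.
Qed.

Lemma out_S_ok (o : outcome) (s : state R) M : out_ok acc' f o M -> iarr s = mia M -> zarr s = mza M ->
  out_S r m s = sampling_mx row_prob o.1.2.
Proof.
move=> [_ [hI hw] _] eI ew; apply/matrixP => t i; rewrite !mxE eI ew hI hw.
by rewrite -(inj_eq val_inj) /=; case: eqP => // /val_inj ->.
Qed.

Lemma out_T_ok (o : outcome) (s : state R) M : out_ok acc' f o M -> iarr s = mia M -> zarr s = mza M ->
  (out_T n c s)^T = sampling_mx col_prob o.1.1.
Proof.
move=> [[hI hw] _ _] eI ew; apply/matrixP => t i; rewrite !mxE eI ew hI hw.
by rewrite -(inj_eq val_inj) /=; case: eqP => // /val_inj ->.
Qed.

Section Samplings.
Variable fin : outcome -> state R.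
Hypothesis fin_ok : forall o, outcome_prob o != 0 ->
  exists M, [/\ out_ok acc' f o M, iarr (fin o) = mia M & zarr (fin o) = mza M].
Local Notation Pr := (fun E : state R -> Prop => \sum_o outcome_prob o * `[< E (fin o) >]%:R).

Lemma row_sampling_S : row_sampling Pr (@out_S R r m).
Proof.
exists row_prob; split; [exact: row_prob_ge0|exact: sum_row_prob|move=> I].
rewrite (eq_bigr (fun o => outcome_prob o * (o.1.2 == I)%:R)) => [|o _].
  rewrite (sum_outcome (fun _ I' => (I' == I)%:R)) -mulr_suml.
  rewrite sum_prod ?sum_col_prob // mul1r (bigD1 I) //= eqxx mulr1 [X in _ + X]big1 ?addr0 //.
  by move=> I' /negbTE ->; rewrite mulr0.
have [->|po] := eqVneq (outcome_prob o) 0; first by rewrite !mul0r.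
have [M [h1 h2 h3]] := fin_ok po; rewrite (out_S_ok h1 h2 h3); congr (_ * (nat_of_bool _)%:R).
have pI t : row_prob (o.1.2 t) != 0.
  apply: contra po => /eqP e.
  by rewrite outcome_probE [X in _ * X * _](bigD1 t) //= e mul0r mulr0 mul0r.
by apply/idP/eqP => [/asboolP e|->]; [exact: (sampling_inj row_prob_ge0 pI e)|exact/asboolP].
Qed.

Lemma row_sampling_T : row_sampling Pr (fun s => (@out_T R n c s)^T).
Proof.
exists col_prob; split; [exact: col_prob_ge0|exact: sum_col_prob|move=> I].
rewrite (eq_bigr (fun o => outcome_prob o * (o.1.1 == I)%:R)) => [|o _].
  rewrite (sum_outcome (fun J _ => (J == I)%:R)) (bigD1 I) //= [X in _ + X]big1 ?addr0.
    by rewrite -mulr_suml sum_prod ?sum_row_prob // eqxx !mulr1.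
  by move=> J /negbTE ->; rewrite -mulr_suml !mulr0.
have [->|po] := eqVneq (outcome_prob o) 0; first by rewrite !mul0r.
have [M [h1 h2 h3]] := fin_ok po; rewrite (out_T_ok h1 h2 h3); congr (_ * (nat_of_bool _)%:R).
have pJ t : col_prob (o.1.1 t) != 0.
  by apply: col_prob_neq0; apply: contra po => /eqP e; rewrite outcome_probE e !mul0r.
by apply/idP/eqP => [/asboolP e|->]; [exact: (sampling_inj col_prob_ge0 pJ e)|exact/asboolP].
Qed.
End Samplings.
End Law.

(** * Failure probability *)

Section Norms.
Variable R : realType.
Local Notation C := R[i].

Lemma norm_normc (z : C) : `|z| = (Normc.normc z)%:C. Proof. by []. Qed.

Lemma normc_sq0 (z : C) : Normc.normc z ^+ 2 <= 0 -> z = 0.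
Proof.
move=> h; apply/eqP; rewrite -normr_eq0 -sqrf_eq0 norm_normc -rmorphXn.
by rewrite (_ : _ ^+ 2 = 0) // ; apply/le_anti; rewrite h sqr_ge0.
Qed.

Lemma fsqE m n (M : 'M[C]_(m, n)) : fsq M = (frob_norm M ^+ 2)%:C.
Proof.
rewrite frob_sqr rmorph_sum; apply: eq_bigr => i _; rewrite rmorph_sum.
by apply: eq_bigr => j _; rewrite norm_normc rmorphXn.
Qed.

Lemma frob_ge0 m n (M : 'M[C]_(m, n)) : 0 <= frob_norm M.
Proof. exact: sqrtr_ge0. Qed.

Lemma frob_opn m n (M : 'M[C]_(m, n)) b : 0 <= b ->
  opn M b%:C <-> forall v : 'cV_n, frob_norm (M *m v) <= b * frob_norm v.
Proof.
move=> b0; split=> h v; have := h v.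
  rewrite !fsqE -!rmorphXn -rmorphM lecR -exprMn ler_pXn2r ?nnegrE ?frob_ge0 //.
  by rewrite mulr_ge0 ?frob_ge0.
move=> h'; rewrite !fsqE -!rmorphXn -rmorphM lecR -exprMn.
by rewrite ler_pXn2r ?nnegrE ?frob_ge0 // mulr_ge0 ?frob_ge0.
Qed.

Lemma frobZ m n (k : R) (M : 'M[C]_(m, n)) : 0 <= k -> frob_norm (k%:C *: M) = k * frob_norm M.
Proof.
move=> k0; apply/eqP; rewrite -(@eqrXn2 _ 2) ?mulr_ge0 ?frob_ge0 // exprMn.
apply/eqP/(@complexI R).
have e1 := fsqE (k%:C *: M); have e2 := fsqE M.
by rewrite -e1 fsqZ e2 norm_normc /= expr0n addr0 sqrtr_sqr ger0_norm // -rmorphXn -rmorphM.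
Qed.

Lemma frob0 m n : frob_norm (0 : 'M[C]_(m, n)) = 0.
Proof. by have := frobZ (0 : 'M[C]_(m, n)) (lexx 0); rewrite scaler0 mul0r. Qed.

Lemma spec_sup m n (M : 'M[C]_(m, n)) :
  has_sup [set x | exists2 v : 'cV[C]_n, frob_norm v <= 1 & x = frob_norm (M *m v)]%classic.
Proof.
split; first by exists (frob_norm (M *m (0 : 'cV_n))), 0; rewrite // frob0 ler01.
exists (frob_norm M) => x [v v1 ->].
have oF : opn M (frob_norm M)%:C by apply: opn_fsq; rewrite fsqE rmorphXn.
apply: le_trans ((frob_opn _ (frob_ge0 M)).1 oF v) _.
by rewrite ler_piMr ?frob_ge0.
Qed.

Lemma spec_ge0 m n (M : 'M[C]_(m, n)) : 0 <= spec_norm M.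
Proof.
apply: le_trans (frob_ge0 (M *m (0 : 'cV_n))) _.
by apply: sup_upper_bound (spec_sup M) _ _; exists 0; rewrite // frob0 ler01.
Qed.

Lemma spec_opn m n (M : 'M[C]_(m, n)) : opn M (spec_norm M)%:C.
Proof.
apply/frob_opn => [|v]; first exact: spec_ge0.
have [v0|v0] := eqVneq (frob_norm v) 0.
  rewrite v0 mulr0; have := fsqE v; rewrite v0 expr0n /= => e.
  by rewrite (@fsq0_eq0 _ _ _ v) ?mulmx0 ?frob0 // e.
have vp : 0 < frob_norm v by rewrite lt_neqAle eq_sym v0 frob_ge0.
have vi : 0 <= (frob_norm v)^-1 by rewrite invr_ge0 frob_ge0.
rewrite -ler_pdivrMr // mulrC -frobZ // scalemxAr.
apply: sup_upper_bound (spec_sup M) _ _; exists ((frob_norm v)^-1%:C *: v) => //.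
by rewrite frobZ // mulVf.
Qed.

Lemma spec_le m n (M : 'M[C]_(m, n)) b : 0 <= b -> opn M b%:C -> spec_norm M <= b.
Proof.
move=> b0 oM; apply: ge_sup; first by have [] := spec_sup M.
move=> x [v v1 ->]; apply: le_trans ((frob_opn _ b0).1 oM v) _.
by rewrite ler_piMr.
Qed.

Lemma spec_frob m n (M : 'M[C]_(m, n)) : spec_norm M <= frob_norm M.
Proof. by apply: spec_le (frob_ge0 M) _; apply: opn_fsq; rewrite fsqE rmorphXn. Qed.

Lemma frob_adj m n (M : 'M[C]_(m, n)) : frob_norm (M^t*) ^+ 2 = frob_norm M ^+ 2.
Proof. by apply: (@complexI R); rewrite -!fsqE fsq_adj. Qed.
End Norms.

Section Transfer.
Variable R : realType.

Lemma moment_condC (Q c : nat) (x y : R) :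
  (4 * Q%:R * x%:C <= c%:R * y%:C :> R[i]) = (4 * Q%:R * x <= c%:R * y).
Proof. by rewrite -lecR !rmorphM !rmorph_nat. Qed.

Lemma moment_boundC (Q c : nat) (x y e : R) :
  (80 * Q%:R * x%:C * y%:C / c%:R <= e%:C ^+ 2 :> R[i]) = (80 * Q%:R * x * y / c%:R <= e ^+ 2).
Proof. by rewrite -lecR fmorph_div !rmorphM !rmorph_nat. Qed.
Lemma tailC (Q : nat) (x y : R) :
  4^-1 ^+ Q * (x%:C / y%:C) = (4^-1 ^+ Q * (x / y))%:C :> R[i].
Proof. by rewrite [RHS]rmorphM fmorph_div rmorphXn fmorphV rmorph_nat. Qed.
End Transfer.

(** * Failure of the two Gram estimates *)

Section Events.
Variables (R : realType) (m n : nat) (phi : R) (A : 'M[R[i]]_(m, n)).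
Variables (acc : SQ phi A) (acc' : SQ phi (A^t*)).
Local Notation C := R[i].
Local Notation Phi := (frob_norm (tilde acc) ^+ 2).
Hypothesis Phi0 : 0 < Phi.
Hypothesis tilde_frob' : frob_norm (tilde acc') ^+ 2 = Phi.
Local Notation row_prob := (row_prob acc).
Local Notation col_prob := (col_prob acc acc').

Lemma colsq_le j : \sum_i Normc.normc (A i j) ^+ 2 <= col_prob j * Phi.
Proof.
rewrite col_probE divfK ?gt_eqF // row_norm_sqr; apply: ler_sum => i _.
rewrite ler_pXn2r ?nnegrE ?normc_ge0 //; apply: le_trans (tilde_ge acc' j i).
by rewrite -lecR -!norm_normc adjE norm_conjC.
Qed.

Lemma rowsq_le i : \sum_j Normc.normc (A i j) ^+ 2 <= row_prob i * Phi.
Proof.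
rewrite row_probE divfK ?gt_eqF // row_norm_sqr; apply: ler_sum => j _.
by rewrite ler_pXn2r ?nnegrE ?normc_ge0 // tilde_ge.
Qed.

Lemma col_prob0 i j : col_prob j = 0 -> A i j = 0.
Proof.
move=> p0; have := colsq_le j; rewrite p0 mul0r => h.
apply: normc_sq0; apply: le_trans h; rewrite (bigD1 i) //= lerDl; apply: sumr_ge0 => k _; exact: sqr_ge0.
Qed.

Definition prob (T : finType) (p : T -> R) k (E : {ffun 'I_k -> T} -> bool) : R :=
  \sum_(I : {ffun 'I_k -> T}) (\prod_t p (I t)) * (E I)%:R.

Lemma probC (T : finType) (p : T -> R) k (E : {ffun 'I_k -> T} -> bool) :
  (prob p E)%:C = \sum_I pw (fun y => (p y)%:C) I * (E I)%:R.
Proof.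
rewrite /prob rmorph_sum; apply: eq_bigr => I _; rewrite rmorphM rmorph_nat; congr (_ * _).
by rewrite rmorph_prod.
Qed.

Definition isw (p : R) : R[i] := ((Num.sqrt p)^-1)%:C.

Lemma isw_sq p : 0 <= p -> p != 0 -> p%:C * isw p ^+ 2 = 1.
Proof.
move=> p0 pn; rewrite /isw -rmorphXn -rmorphM exprVn sqr_sqrtr //.
by rewrite divff // rmorph1.
Qed.

Lemma isw_conj p : Num.conj (isw p) = isw p. Proof. exact: realC_conj. Qed.

Definition sketch_col c (J : 'I_c -> 'I_n) : 'M[C]_(m, c) :=
  \matrix_(i, t) (A i (J t) * weight c (col_prob (J t))).

(** Normalised so that the mean of the outer products is [A A^*]. At probability zero [isw] is zero,
    correctly, as [col_prob0] shows that such a column of [A] vanishes. *)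
Definition wcol j : 'cV[C]_m := isw (col_prob j) *: col j A.

Lemma weight_isw c p : (0 < c)%N -> weight c p = isw c%:R * isw p.
Proof. by move=> c0; rewrite /weight /isw sqrtrM ?ler0n // invfM rmorphM. Qed.

Lemma isw_nat c : (0 < c)%N -> isw c%:R * isw c%:R = c%:R^-1.
Proof.
move=> c0; rewrite /isw -rmorphM -invfM -expr2 sqr_sqrtr ?ler0n //.
by rewrite fmorphV rmorph_nat.
Qed.

Lemma sum_wcol : \sum_j (col_prob j)%:C *: (wcol j *m (wcol j)^t*) = A *m A^t*.
Proof.
apply/matrixP => i k; rewrite summxE !mxE; apply: eq_bigr => j _.
rewrite /wcol !mxE big_ord1 !mxE.
have [p0|pn] := eqVneq (col_prob j) 0.
  by rewrite !(col_prob0 _ p0) !mul0r !mulr0 !mul0r mulr0.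
rewrite [Num.conj (_ * _)]rmorphM /= isw_conj -[in RHS](mul1r (A i j)) -(isw_sq (col_prob_ge0 _ _ _) pn).
ring.
Qed.

Lemma emp_wcol c (J : {ffun 'I_c -> 'I_n}) : (0 < c)%N ->
  emp_dev (fun j => (col_prob j)%:C) wcol J =
  sketch_col J *m (sketch_col J)^t* - A *m A^t*.
Proof.
move=> c0; rewrite /emp_dev sum_wcol; congr (_ - _).
apply/matrixP => i k; rewrite !mxE summxE mulr_sumr; apply: eq_bigr => t _.
rewrite !mxE big_ord1 !mxE weight_isw // !rmorphM /= !isw_conj -isw_nat //.
ring.
Qed.

Lemma fsq_wcol j : fsq (wcol j) <= Phi%:C.
Proof.
have [p0|pn] := eqVneq (col_prob j) 0.
  rewrite (_ : wcol j = 0) ?fsqE ?frob0 ?expr0n ?lecR ?ltW //.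
  by apply/matrixP => i k; rewrite !mxE (col_prob0 _ p0) mulr0.
have pp : 0 < (col_prob j)%:C :> C by rewrite ltcR lt_neqAle eq_sym pn col_prob_ge0.
rewrite /wcol fsqZ -(ler_pM2l pp) mulrA.
have -> : (col_prob j)%:C * `|isw (col_prob j)| ^+ 2 = 1.
  by rewrite normCK isw_conj -expr2 isw_sq ?col_prob_ge0.
rewrite mul1r fsqE -rmorphM lecR frob_sqr; apply: le_trans (colsq_le j).
by apply: ler_sum => i _; rewrite big_ord1 mxE.
Qed.

(** An instance of [moment_tail] with [rho = Phi], since sampling by squared norms bounds every
    normalised column by the same constant, with [h = a^2], and with intrinsic dimension
    [F^2 / a^2]. *)
Lemma event_gram c (e a F : R) (Q : nat) : (0 < c)%N -> (0 < Q)%N -> 0 < a -> 0 < e ->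
  opn A a%:C -> frob_norm A = F -> 4 * Q%:R * Phi <= c%:R * a ^+ 2 ->
  80 * Q%:R * Phi * a ^+ 2 / c%:R <= e ^+ 2 ->
  prob col_prob (fun J : {ffun 'I_c -> 'I_n} =>
    ~~ `[< opn (sketch_col J *m (sketch_col J)^t* - A *m A^t*) e%:C >])
  <= 4^-1 ^+ Q * (F ^+ 2 / a ^+ 2).
Proof.
move=> c0 Q0 a0 e0 oA FE Qc Ue; rewrite -lecR probC.
have p0 (j : 'I_n) : 0 <= (col_prob j)%:C :> C by rewrite lecR col_prob_ge0.
have p1 : \sum_(j < n) (col_prob j)%:C = 1 :> C.
  by rewrite -rmorph_sum sum_col_prob // rmorph1.
rewrite (eq_bigr (fun J : {ffun 'I_c -> 'I_n} => pw (fun y => (col_prob y)%:C) J *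
  (~~ `[< opn (emp_dev (fun j => (col_prob j)%:C) wcol J) e%:C >])%:R)); last first.
  by move=> J _; rewrite emp_wcol.
have MT := @moment_tail C _ _ p0 p1 m c wcol Phi%:C (a ^+ 2)%:C e%:C Q c0 Q0 fsq_wcol.
rewrite sum_wcol -fsq_tr fsqE FE in MT.
apply: le_trans (MT _ _ _ _ _ _) _.
- by rewrite ltcR exprn_gt0.
- by rewrite lecR ltW.
- move=> v; have -> : v^t* *m (A *m A^t*) *m v = (A^t* *m v)^t* *m (A^t* *m v).
    by rewrite adjM trmxCK !mulmxA.
  have -> : ((A^t* *m v)^t* *m (A^t* *m v)) 0 0 = fsq (A^t* *m v).
    by rewrite fsq_trl /mxtrace big_ord1.
  by rewrite rmorphXn; apply: opn_adj; rewrite ?lecR ?ltW.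
- by rewrite moment_condC.
- by rewrite ltcR.
- by rewrite moment_boundC.
- by rewrite tailC.
Qed.

Lemma fsq_sketch_col c (J : 'I_c -> 'I_n) : (0 < c)%N -> fsq (sketch_col J) <= Phi%:C.
Proof.
move=> c0; rewrite /fsq exchange_big /=.
have cC : (0 : C) < c%:R by rewrite ltr0n.
have -> : Phi%:C = \sum_(t < c) (Phi%:C / c%:R) :> C.
  by rewrite sumr_const card_ord -[_ *+ c]mulr_natr divfK ?gt_eqF.
apply: ler_sum => t _; have := fsq_wcol (J t); rewrite /fsq => h.
have -> : \sum_i `|sketch_col J i t| ^+ 2 = (\sum_i \sum_j `|wcol (J t) i j| ^+ 2) / c%:R.
  rewrite mulr_suml; apply: eq_bigr => i _; rewrite big_ord1 !mxE weight_isw // -isw_nat //.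
  by rewrite !normCK !rmorphM /= !isw_conj; ring.
by rewrite ler_pM2r ?invr_gt0.
Qed.

Lemma opn_sq_mul c (M : 'M[C]_(m, c)) h : opn (M *m M^t*) h -> 0 <= h ->
  forall v : 'cV_c, fsq (M *m v) <= h * fsq v.
Proof.
move=> oM h0 v; have s0 : 0 <= sqrtC h by rewrite sqrtC_ge0.
have oMt : opn (M^t*) (sqrtC h) by move=> u; rewrite sqrtCK; apply: opn_inv.
by have := opn_adj s0 oMt v; rewrite trmxCK sqrtCK.
Qed.

Section InnerSample.
Variables (c : nat) (J : 'I_c -> 'I_n).
Hypothesis c0 : (0 < c)%N.
Hypothesis J0 : forall t, col_prob (J t) != 0.
Local Notation tau := (fun t => weight c (col_prob (J t))).
Local Notation Z := (sketch_col J).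
Local Notation W := (inner_weight acc' J tau Phi%:C).
Local Notation q := (inner_prob acc' J).

Lemma sample_rowE i : sample_row A J tau i = row i Z.
Proof. by apply/rowP => t; rewrite !mxE. Qed.

Lemma tau_sq t : tau t * tau t = (c%:R * (col_prob (J t))%:C)^-1.
Proof.
rewrite -expr2 /weight -rmorphXn exprVn sqr_sqrtr; last by rewrite mulr_ge0 ?ler0n ?col_prob_ge0.
by rewrite fmorphV [X in X^-1]rmorphM rmorph_nat.
Qed.

Lemma tau_neq0 t : tau t != 0.
Proof.
apply/negP => /eqP e; have := tau_sq t; rewrite /= e mul0r => /esym/eqP.
rewrite invr_eq0 mulf_eq0 pnatr_eq0 -leqn0 leqNgt c0 /= fmorph_eq0.
by rewrite (negbTE (J0 t)).
Qed.

Lemma tau_conj t : Num.conj (tau t) = tau t. Proof. exact: realC_conj. Qed.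

Lemma fsq_row i : \sum_t `|row i Z 0 t| ^+ 2 = fsq (row i Z).
Proof. by rewrite /fsq big_ord1. Qed.

Lemma inner_weight_ge0 y : 0 <= W y.
Proof.
have P0 : 0 <= Phi%:C :> C by rewrite lecR ltW.
have t0 : 0 <= tau y.1 * tau y.1.
  by rewrite tau_sq invr_ge0 mulr_ge0 ?ler0n // lecR col_prob_ge0.
rewrite /inner_weight; apply: divr_ge0; last by apply: sumr_ge0 => t _; rewrite exprn_ge0.
apply: divr_ge0; last exact: mul_conjC_ge0.
by apply: mulr_ge0 => //; apply: divr_ge0 => //; apply: mul_conjC_ge0.
Qed.

Lemma tilde0 t i : tilde acc' (J t) i = 0 -> A i (J t) = 0.
Proof.
move=> e; apply: normc_sq0; have := tilde_ge acc' (J t) i.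
rewrite e Normc.normc0 => h; have /le_anti h2 : 0 <= Normc.normc (A i (J t)) <= 0.
  by rewrite normc_ge0 /=; move: h; rewrite -!lecR -!norm_normc adjE norm_conjC.
by rewrite -h2 expr0n.
Qed.

(** The squared norm of the row cancels against the last denominator of the weight, and the squared
    [tau] against that in the sampled entry; the remaining ratio of [A] to its oversampled version
    is at most one. *)
Lemma inner_weight_fsq y : W y * fsq (row y.2 Z) <= Phi%:C.
Proof.
case: y => t i /=; have [x0|xn] := eqVneq (fsq (row i Z)) 0.
  by rewrite x0 mulr0 lecR ltW.
rewrite /inner_weight /= sample_rowE fsq_row divfK //.
have [a0|an] := eqVneq (tilde acc' (J t) i) 0.
  by rewrite a0 mul0r invr0 mulr0 lecR ltW.
have P0 : 0 <= Phi%:C :> C by rewrite lecR ltW.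
have tn := tau_neq0 t.
rewrite !mxE rmorphM /= tau_conj.
have -> : A i (J t) * tau t * (Num.conj (A i (J t)) * tau t) / (tau t * tau t) * Phi%:C /
   (tilde acc' (J t) i * Num.conj (tilde acc' (J t) i)) =
   (A i (J t) * Num.conj (A i (J t))) /
   (tilde acc' (J t) i * Num.conj (tilde acc' (J t) i)) * Phi%:C.
  have an' : Num.conj (tilde acc' (J t) i) != 0 by rewrite conjC_eq0.
  move: (weight c _) tn (tilde acc' (J t) i) an (Num.conj (tilde acc' (J t) i)) an' => x xn' y yn z zn.
  by field; rewrite xn' yn zn.
rewrite ler_piMl // ler_pdivrMr ?mul_conjC_gt0 // mul1r -!normCK.
rewrite ler_pXn2r ?nnegrE //; have := tilde_ge acc' (J t) i.
by rewrite -lecR -!norm_normc adjE norm_conjC.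
Qed.

(** Summed over [t] the right side is [1]: all the ways to reach a given nonzero row together count
    it once, which makes the estimate unbiased. *)
Lemma inner_prob_weight t i :
  (q (t, i))%:C * W (t, i) = `|row i Z 0 t| ^+ 2 / fsq (row i Z).
Proof.
rewrite /inner_weight /= sample_rowE fsq_row /inner_prob /=.
have [a0|an] := eqVneq (tilde acc' (J t) i) 0.
  rewrite a0 Normc.normc0 expr0n /= mul0r mulr0 mul0r !mxE (tilde0 a0) mul0r normr0 expr0n.
  by rewrite mul0r.
rewrite normCK tau_sq !mxE.
have -> : (c%:R^-1 * (Normc.normc (tilde acc' (J t) i) ^+ 2 / row_norm (tilde acc') (J t) ^+ 2))%:C
  = c%:R^-1 * (tilde acc' (J t) i * Num.conj (tilde acc' (J t) i)
     / ((col_prob (J t))%:C * Phi%:C)).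
  rewrite -normCK norm_normc [LHS]rmorphM fmorphV rmorph_nat; congr (_ * _).
  rewrite fmorph_div rmorphXn; congr (_ / _).
  by rewrite -rmorphM col_probE divfK ?gt_eqF.
have Pn : Phi%:C != 0 :> C by rewrite fmorph_eq0 gt_eqF.
have pn : (col_prob (J t))%:C != 0 :> C by rewrite fmorph_eq0 J0.
have cn : c%:R != 0 :> C by rewrite pnatr_eq0 -lt0n.
have [->|xn] := eqVneq (fsq (row i Z)) 0; first by rewrite invr0 !mulr0.
move: (Phi%:C) Pn ((col_prob (J t))%:C) pn (fsq _) xn => P Pn p pn x xn.
have an' : Num.conj (tilde acc' (J t) i) != 0 by rewrite conjC_eq0.
move: (Num.conj (A i (J t) * _)) (tilde acc' (J t) i) an (Num.conj (tilde acc' (J t) i)) an' =>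
  w y yn z zn.
rewrite invrK; move: (weight _ _) (c%:R : C) cn => v k kn.
by field; rewrite yn zn pn Pn xn kn.
Qed.

(** The root of the weight turns the weighted estimate into an average of outer products, the form
    required by [moment_tail]. *)
Definition wrow (y : 'I_c * 'I_m) : 'cV[C]_c := sqrtC (W y) *: (row y.2 Z)^t*.

Lemma wrow_outer y : wrow y *m (wrow y)^t* = W y *: ((row y.2 Z)^t* *m row y.2 Z).
Proof.
have s0 : 0 <= sqrtC (W y) by rewrite sqrtC_ge0 inner_weight_ge0.
rewrite /wrow adj_scale trmxCK -scalemxAl -scalemxAr scalerA; congr (_ *: _).
by rewrite (CrealP (ger0_real s0)) -expr2 sqrtCK.
Qed.

Lemma sum_wrow : \sum_y (q y)%:C *: (wrow y *m (wrow y)^t*) = Z^t* *m Z.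
Proof.
apply/matrixP => j k; rewrite summxE !mxE.
rewrite -(pair_bigA _ (fun t i => ((q (t, i))%:C *: (wrow (t, i) *m (wrow (t, i))^t*)) j k)) /=.
rewrite exchange_big; apply: eq_bigr => i _ /=.
rewrite (eq_bigr (fun t => `|row i Z 0 t| ^+ 2 / fsq (row i Z) *
   ((row i Z)^t* *m row i Z) j k)) => [|t _]; last first.
  by rewrite wrow_outer scalerA inner_prob_weight mxE.
rewrite -mulr_suml -mulr_suml fsq_row mxE big_ord1.
have [x0|xn] := eqVneq (fsq (row i Z)) 0; last by rewrite divff // mul1r !mxE.
have r0 : row i Z = 0 by apply: fsq0_eq0; rewrite x0.
have z0 b : Z i b = 0 by have := congr1 (fun v : 'rV_c => v 0 b) r0; rewrite !mxE.
by rewrite x0 mul0r mul0r (z0 k) mulr0.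
Qed.

Lemma emp_wrow r' (K : {ffun 'I_r' -> 'I_c * 'I_m}) :
  emp_dev (fun y => (q y)%:C) wrow K =
  \sum_u inner_term acc' J tau Phi%:C r' (K u) - Z^t* *m Z.
Proof.
rewrite /emp_dev sum_wrow; congr (_ - _); rewrite scaler_sumr; apply: eq_bigr => u _.
by rewrite wrow_outer scalerA /inner_term sample_rowE mulrC.
Qed.

Lemma fsq_wrow y : fsq (wrow y) <= Phi%:C.
Proof.
rewrite /wrow fsqZ fsq_adj ger0_norm ?sqrtC_ge0 ?inner_weight_ge0 // sqrtCK.
exact: inner_weight_fsq.
Qed.

Lemma event_inner r' (e h : R) (Q : nat) : (0 < r')%N -> (0 < Q)%N -> 0 < h -> 0 < e ->
  opn (Z *m Z^t*) h%:C -> 4 * Q%:R * Phi <= r'%:R * h ->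
  80 * Q%:R * Phi * h / r'%:R <= e ^+ 2 ->
  prob q (fun K : {ffun 'I_r' -> 'I_c * 'I_m} =>
    ~~ `[< opn (\sum_u inner_term acc' J tau Phi%:C r' (K u) - Z^t* *m Z) e%:C >])
  <= 4^-1 ^+ Q * (Phi / h).
Proof.
move=> r0 Q0 h0 e0 oZ Qc Ue; rewrite -lecR probC.
have h0' : 0 < h%:C :> C by rewrite ltcR.
have p0 y : 0 <= (q y)%:C :> C by rewrite lecR inner_prob_ge0.
have p1 : \sum_y (q y)%:C = 1 :> C.
  by rewrite -rmorph_sum (sum_inner_prob c0 J0) rmorph1.
rewrite (eq_bigr (fun K : {ffun 'I_r' -> 'I_c * 'I_m} => pw (fun y => (q y)%:C) K *
  (~~ `[< opn (emp_dev (fun y => (q y)%:C) wrow K) e%:C >])%:R)); last first.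
  by move=> K _; rewrite emp_wrow.
have MT := @moment_tail C _ _ p0 p1 c r' wrow Phi%:C h%:C e%:C Q r0 Q0 fsq_wrow.
rewrite sum_wrow -fsq_trl in MT.
apply: le_trans (MT _ _ _ _ _ _) _ => //.
- by rewrite lecR ltW.
- move=> v; have -> : v^t* *m (Z^t* *m Z) *m v = (Z *m v)^t* *m (Z *m v).
    by rewrite adjM !mulmxA.
  have -> : ((Z *m v)^t* *m (Z *m v)) 0 0 = fsq (Z *m v).
    by rewrite fsq_trl /mxtrace big_ord1.
  by apply: opn_sq_mul => //; rewrite ltW.
- by rewrite moment_condC.
- by rewrite ltcR.
- by rewrite moment_boundC.
rewrite -tailC ler_wpM2l ?exprn_ge0 ?invr_ge0 // ler_pM2r ?invr_gt0 //.
exact: fsq_sketch_col.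
Qed.
End InnerSample.
End Events.

Section FrobeniusSquare.
Variable C : numClosedFieldType.

Lemma fsq_mxvec m n (M : 'M[C]_(m, n)) : fsq ((mxvec M)^T) = fsq M.
Proof.
rewrite /fsq (reindex _ (curry_mxvec_bij _ _)) /=.
rewrite [RHS]pair_bigA; apply: eq_bigr => -[i j] _ /=.
by rewrite big_ord1 mxE mxvecE.
Qed.

Lemma fsqM m n p (M : 'M[C]_(m, n)) (N : 'M[C]_(n, p)) : fsq (M *m N) <= fsq M * fsq N.
Proof.
have -> : fsq N = \sum_j fsq (col j N).
  rewrite /fsq exchange_big; apply: eq_bigr => j _; apply: eq_bigr => i _.
  by rewrite big_ord1 mxE.
have -> : fsq M = \sum_i fsq ((row i M)^t*).
  by apply: eq_bigr => i _; rewrite fsq_adj /fsq big_ord1; apply: eq_bigr => j _; rewrite mxE.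
rewrite mulr_suml; apply: ler_sum => i _; rewrite mulr_sumr; apply: ler_sum => j _.
apply: le_trans (inner_sq_le _ _); rewrite trmxCK.
by rewrite !mxE (eq_bigr (fun k => row i M 0 k * col j N k 0)) // => k _; rewrite !mxE.
Qed.

Lemma fsq_outer m n (u : 'rV[C]_m) (v : 'rV[C]_n) : fsq (u^t* *m v) = fsq u * fsq v.
Proof.
rewrite /fsq !big_ord1 mulr_suml; apply: eq_bigr => i _; rewrite mulr_sumr.
by apply: eq_bigr => j _; rewrite !mxE big_ord1 !mxE normrM norm_conjC exprMn.
Qed.

Lemma fsq_add_le m n (M N : 'M[C]_(m, n)) b : fsq M <= b ^+ 2 -> fsq N <= b ^+ 2 ->
  fsq (M + N) <= (2 * b) ^+ 2.
Proof.
move=> hM hN; apply: (@le_trans _ _ (2 * fsq M + 2 * fsq N)); last first.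
  have -> : (2 * b) ^+ 2 = 2 * b ^+ 2 + 2 * b ^+ 2 by ring.
  by apply: lerD; rewrite ler_wpM2l.
rewrite /fsq !mulr_sumr -big_split; apply: ler_sum => i _.
rewrite /= !mulr_sumr -big_split; apply: ler_sum => j _; rewrite mxE /= !normCK.
rewrite -subr_ge0 !rmorphD /=.
set x := M i j; set y := N i j.
have -> : 2 * (x * x^*) + 2 * (y * y^*) - (x + y) * (x^* + y^*) = (x - y) * (x - y)^*.
  by rewrite rmorphB /=; ring.
exact: mul_conjC_ge0.
Qed.
End FrobeniusSquare.

(** * The truncated estimate of the cross product *)

Section CrossEvent.
Variables (R : realType) (m n c r Q : nat) (A : 'M[R[i]]_(m, n)) (Z : 'M[R[i]]_(m, c)).
Variables (p : 'I_m -> R) (Phi : R).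
Local Notation C := R[i].
Hypothesis Phi0 : 0 < Phi.
Hypothesis p0 : forall i, 0 <= p i.
Hypothesis p1 : \sum_i p i = 1.
Hypothesis arp : forall i, frob_norm (row i A) ^+ 2 <= p i * Phi.
Hypothesis r0 : (0 < r)%N.
Hypothesis Q0 : (0 < Q)%N.
Hypothesis ZPhi : fsq Z <= Phi%:C.

(** With this threshold the squared contributions of the largest summand, of the variance and of the
    bias are all of order [Q Phi^2 / r]. *)
Let theta : R := Phi / Q%:R.
Let zr i : R := frob_norm (row i Z) ^+ 2.
Let ar i : R := frob_norm (row i A) ^+ 2.
Let good i := zr i / (r%:R * p i) <= theta.
Let k i : R := (good i)%:R / (r%:R * p i).

Let rp : (0 : R) < r%:R. Proof. by rewrite ltr0n. Qed.
Let Qp : (0 : R) < Q%:R. Proof. by rewrite ltr0n. Qed.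
Let theta0 : 0 < theta. Proof. by rewrite divr_gt0. Qed.
Let zr0 i : 0 <= zr i. Proof. exact: sqr_ge0. Qed.
Let ar0 i : 0 <= ar i. Proof. exact: sqr_ge0. Qed.

Let row0 i : p i = 0 -> row i A = 0.
Proof.
move=> e; apply: fsq0_eq0; rewrite fsqE lecR; apply: le_trans (arp i) _.
by rewrite e mul0r.
Qed.

Let sum_zr : \sum_i zr i <= Phi.
Proof.
rewrite -lecR; apply: le_trans ZPhi; rewrite rmorph_sum /=; apply: ler_sum => i _.
by rewrite /zr -fsqE /fsq big_ord1; apply: ler_sum => j _; rewrite mxE.
Qed.

(** The matrix summand as a vector: its Euclidean norm is the Frobenius norm, and the vector
    inequality applies without any dimension factor. *)
Definition vrow i : 'cV[C]_(c * n) := (mxvec ((k i)%:C *: ((row i Z)^t* *m row i A)))^T.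

Lemma fsq_vrow i : fsq (vrow i) = (k i ^+ 2 * (zr i * ar i))%:C.
Proof.
rewrite /vrow fsq_mxvec fsqZ fsq_outer !fsqE /zr /ar.
move: (k i) (frob_norm (row i Z) ^+ 2) (frob_norm (row i A) ^+ 2) => x y z.
have xR : x%:C \is Num.real by apply/CrealP; apply: realC_conj.
by rewrite real_normK // -rmorphXn -!rmorphM.
Qed.

(** One factor, [zr i / (r p i)], is bounded by truncation, the other, [ar i / (r p i)], by the
    sampling probabilities. The latter say nothing about [zr i]. *)
Lemma vrow_bound i : k i ^+ 2 * (zr i * ar i) <= theta * (Phi / r%:R).
Proof.
have tP : 0 <= theta * (Phi / r%:R) by rewrite mulr_ge0 ?divr_ge0 // ltW.
rewrite /k; case: (boolP (good i)) => g; last by rewrite mul0r expr0n mul0r.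
have [->|pn] := eqVneq (p i) 0; first by rewrite mulr0 invr0 mulr0 expr0n mul0r.
have pp : 0 < p i by rewrite lt_neqAle eq_sym pn p0.
rewrite [true%:R](_ : _ = 1) //.
have -> : (1 / (r%:R * p i)) ^+ 2 * (zr i * ar i) =
    (zr i / (r%:R * p i)) * (ar i / (r%:R * p i)).
  by field; rewrite pn gt_eqF.
have rpi : 0 < r%:R * p i by rewrite mulr_gt0.
apply: (ler_pM _ _ g); rewrite ?(divr_ge0 _ (ltW rpi)) //.
rewrite ler_pdivrMr // mulrA divfK ?gt_eqF // [Phi * p i]mulrC; exact: arp.
Qed.

Lemma vrow_var : \sum_i p i * (k i ^+ 2 * (zr i * ar i)) <= Phi * Phi / r%:R ^+ 2.
Proof.
have PP0 : 0 <= Phi / r%:R ^+ 2 by rewrite divr_ge0 ?exprn_ge0 // ltW.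
rewrite -mulrA; apply: le_trans (ler_wpM2r PP0 sum_zr).
rewrite mulr_suml; apply: ler_sum => i _.
have zP : 0 <= zr i * (Phi / r%:R ^+ 2) by rewrite mulr_ge0 // divr_ge0 ?exprn_ge0 ?ltW.
rewrite /k; case: (boolP (good i)) => g; last by rewrite mul0r expr0n mul0r mulr0.
have [->|pn] := eqVneq (p i) 0; first by rewrite mul0r.
have pp : 0 < p i by rewrite lt_neqAle eq_sym pn p0.
rewrite [true%:R](_ : _ = 1) //.
have -> : p i * ((1 / (r%:R * p i)) ^+ 2 * (zr i * ar i)) =
   zr i * (ar i / p i / r%:R ^+ 2) by field; rewrite pn gt_eqF.
rewrite ler_wpM2l // ler_pM2r ?invr_gt0 ?exprn_gt0 //.
rewrite ler_pdivrMr // [Phi * p i]mulrC; exact: arp.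
Qed.

Definition cross_est (I : {ffun 'I_r -> 'I_m}) : 'M[C]_(c, n) :=
  \sum_s (k (I s))%:C *: ((row (I s) Z)^t* *m row (I s) A).

Lemma cross_dev I : exists2 D : 'M[C]_(c, n),
  cross_est I - Z^t* *m A = D - \sum_(i | ~~ good i) (row i Z)^t* *m row i A &
  fsq D = fsq (sum_dev (fun i => (p i)%:C) vrow I).
Proof.
pose mu : 'M[C]_(c, n) := \sum_i (p i)%:C *: ((k i)%:C *: ((row i Z)^t* *m row i A)).
have rmu : r%:R *: mu = \sum_(i | good i) (row i Z)^t* *m row i A.
  rewrite scaler_sumr [RHS]big_mkcond; apply: eq_bigr => i _ /=.
  have [e|pn] := eqVneq (p i) 0.
    by rewrite row0 // mulmx0 !scaler0 if_same.
  rewrite !scalerA /k; case: (good i); last by rewrite mul0r mulr0 scale0r.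
  rewrite mul1r [X in X *: _](_ : _ = 1) ?scale1r //.
  rewrite -(rmorph_nat (real_complex R)) -!rmorphM divff ?rmorph1 // mulf_neq0 //.
  by rewrite gt_eqF.
exists (cross_est I - r%:R *: mu).
  rewrite rmu -addrA -opprD; congr (_ - _).
  have -> : Z^t* *m A = \sum_i (row i Z)^t* *m row i A.
    apply/matrixP => j l; rewrite summxE !mxE; apply: eq_bigr => i _.
    by rewrite !mxE big_ord1 !mxE.
  by rewrite (bigID good).
rewrite -fsq_mxvec; congr fsq.
rewrite /sum_dev sumrB /cross_est raddfB /= raddfB /=; congr (_ - _).
  by rewrite !raddf_sum.
have -> : (mxvec (r%:R *: mu))^T = r%:R *: (mxvec mu)^T by rewrite linearZ /= linearZ.
have -> : (mxvec mu)^T = \sum_i (p i)%:C *: vrow i.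
  rewrite /mu !raddf_sum; apply: eq_bigr => i _.
  by rewrite /= linearZ /= linearZ.
by rewrite [RHS]sumr_const card_ord scaler_nat.
Qed.

(** A discarded row of [Z] is long compared with its probability, so the row of [A] is short
    compared with it: [ar i <= zr i Q / r]. Hence the discarded part of [A] has squared norm at most
    [Phi Q / r]. *)
Lemma cross_bias : fsq (\sum_(i | ~~ good i) (row i Z)^t* *m row i A) <= (Phi ^+ 2 * Q%:R / r%:R)%:C.
Proof.
pose bd : 'rV[C]_m := \row_i (~~ good i)%:R.
have -> : \sum_(i | ~~ good i) (row i Z)^t* *m row i A = Z^t* *m (diag_mx bd *m A).
  apply/matrixP => j l; rewrite big_mkcond summxE !mxE; apply: eq_bigr => i _.
  rewrite diag_mulE [bd _ _]mxE; case: (good i) => /=; first by rewrite !mxE mul0r mulr0.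
  by rewrite !mxE big_ord1 !mxE mul1r.
apply: le_trans (fsqM _ _) _; rewrite fsq_adj.
have -> : (Phi ^+ 2 * Q%:R / r%:R)%:C = Phi%:C * (Phi * Q%:R / r%:R)%:C :> C.
  by rewrite -rmorphM; congr (_ %:C); rewrite expr2 -!mulrA.
apply: ler_pM => //; rewrite ?fsq_ge0 //.
have -> : fsq (diag_mx bd *m A) = (\sum_i (~~ good i)%:R * ar i)%:C.
  rewrite rmorph_sum /=; apply: eq_bigr => i _; rewrite rmorphM rmorph_nat /ar /= -fsqE /fsq big_ord1 mulr_sumr.
  apply: eq_bigr => j _; rewrite diag_mulE !mxE; case: (good i) => /=.
    by rewrite !mul0r normr0 expr0n.
  by rewrite !mul1r.
rewrite lecR; apply: (@le_trans _ _ (\sum_i zr i * (Q%:R / r%:R))); last first.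
  by rewrite -mulr_suml -mulrA ler_wpM2r // divr_ge0 // ltW.
apply: ler_sum => i _; case: (boolP (good i)) => g /=.
  by rewrite mul0r mulr_ge0 ?divr_ge0 // ltW.
have {g} : theta < zr i / (r%:R * p i) by rewrite ltNge.
have [->|pn] := eqVneq (p i) 0; first by rewrite mulr0 invr0 mulr0 ltNge ltW.
have pp : 0 < p i by rewrite lt_neqAle eq_sym pn p0.
rewrite ltr_pdivlMr ?mulr_gt0 // /theta => /ltW h.
rewrite mul1r; apply: le_trans (arp i) _.
have -> : p i * Phi = Phi / Q%:R * (r%:R * p i) * (Q%:R / r%:R).
  by field; rewrite !gt_eqF.
by rewrite ler_wpM2r // divr_ge0 // ltW.
Qed.

(** [U = 400 Q Phi^2 / r] is exactly the squared [20 Q b] of [bernstein_tail], and [1600] is four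
    times that. Fluctuation and bias contribute [e] each. *)
Lemma event_cross (e : R) : 0 <= e -> 1600 * Q%:R * Phi ^+ 2 / r%:R <= e ^+ 2 ->
  prob p (fun I : {ffun 'I_r -> 'I_m} => ~~ (fsq (cross_est I - Z^t* *m A) <= (2 * e%:C) ^+ 2))
  <= 4^-1 ^+ Q.
Proof.
move=> e0 re.
pose b : R := Phi / Num.sqrt (Q%:R * r%:R).
pose U : R := 400 * Q%:R * Phi ^+ 2 / r%:R.
have qr0 : 0 < Q%:R * r%:R :> R by rewrite mulr_gt0.
have bb : b ^+ 2 = theta * (Phi / r%:R).
  rewrite /b exprMn exprVn sqr_sqrtr ?ltW // /theta.
  by field; rewrite !gt_eqF.
have U0 : 0 < U by rewrite divr_gt0 // !mulr_gt0 // exprn_gt0.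
rewrite -lecR probC.
have pC0 i : 0 <= (p i)%:C :> C by rewrite lecR.
have pC1 : \sum_i (p i)%:C = 1 :> C by rewrite -rmorph_sum p1 rmorph1.
have BT := @bernstein_tail C _ _ pC0 pC1 _ r vrow b%:C (Phi * Phi / r%:R ^+ 2)%:C U%:C Q.
apply: (@le_trans _ _ (\sum_I pw (fun y => (p y)%:C) I *
   (~~ (fsq (sum_dev (c := r) (fun i => (p i)%:C) vrow I) <= 4 * U%:C))%:R)); last first.
  have -> : (4^-1 ^+ Q)%:C = 4^-1 ^+ Q :> C by rewrite rmorphXn fmorphV rmorph_nat.
  apply: BT => //.
  - by rewrite lecR divr_ge0 ?sqrtr_ge0 // ltW.
  - by move=> i; rewrite fsq_vrow -rmorphXn lecR bb vrow_bound.
  - rewrite (eq_bigr (fun i => (p i * (k i ^+ 2 * (zr i * ar i)))%:C)) => [|i _].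
      by rewrite -rmorph_sum lecR vrow_var.
    by rewrite fsq_vrow [RHS]rmorphM.
  - by rewrite ltcR.
  - have -> : 16 * Q%:R * (r%:R * (Phi * Phi / r%:R ^+ 2)%:C) =
       (16 * Q%:R * (r%:R * (Phi * Phi / r%:R ^+ 2)))%:C :> C.
      by move: (Phi * Phi / _) => x; rewrite !rmorphM !rmorph_nat.
    rewrite lecR /U.
    have -> : 16 * Q%:R * (r%:R * (Phi * Phi / r%:R ^+ 2)) = 16 * (Q%:R * Phi ^+ 2 / r%:R).
      by field; rewrite gt_eqF.
    rewrite -!mulrA ler_wpM2r ?ler_nat // !mulr_ge0 ?invr_ge0 ?exprn_ge0 //; exact: ltW.
  - have -> x : 20 * Q%:R * x%:C = (20 * Q%:R * x)%:C :> C by rewrite !rmorphM !rmorph_nat.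
    rewrite -rmorphXn lecR exprMn bb /U le_eqVlt; apply/orP; left; apply/eqP.
    by rewrite /theta; field; rewrite !gt_eqF.
apply: ler_sum => I _; apply: ler_wpM2l; first exact: pw_ge0.
rewrite ler_nat; case: (boolP (fsq (sum_dev _ _ _) <= _)) => /= h; last exact: leq_b1.
rewrite leqn0 eqb0 negbK.
have [D -> DE] := cross_dev I; apply: fsq_add_le.
  rewrite DE; apply: le_trans h _.
  have -> x : 4 * x%:C = (4 * x)%:C :> C by rewrite rmorphM rmorph_nat.
  rewrite -rmorphXn lecR; apply: le_trans re; rewrite le_eqVlt; apply/orP; left; apply/eqP.
  by rewrite /U; field; rewrite gt_eqF.
rewrite -scaleN1r fsqZ normrN1 expr1n mul1r; apply: le_trans cross_bias _.
rewrite -rmorphXn lecR; apply: le_trans re.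
have x0 : 0 <= Phi ^+ 2 * Q%:R / r%:R by rewrite divr_ge0 ?mulr_ge0 ?exprn_ge0 // ltW.
have -> : 1600 * Q%:R * Phi ^+ 2 / r%:R = 1600 * (Phi ^+ 2 * Q%:R / r%:R) by ring.
by rewrite ler_peMl // ler1n.
Qed.
End CrossEvent.

(** * Consequences of the two Lipschitz conditions *)

Section Function.
Variables (R : realType) (f : R -> R[i]) (g0 : R[i]) (L Lbar : R).
Local Notation C := R[i].
Local Notation g := (gfun f g0).
Hypothesis gL : lipschitz_in [set x | 0 <= x]%classic g L.
Hypothesis gLbar : lipschitz_in [set x | 0 < x]%classic (fun x => g x / x%:C) Lbar.

Lemma lipschitz_ge0 : 0 <= Lbar.
Proof.
have := gLbar (ltr01 : [set x | 0 < x]%classic 1) (ltr0n _ 2 : [set x | 0 < x]%classic 2).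
move=> h; apply: le_trans (normc_ge0 _) _; apply: le_trans h _.
by rewrite (_ : 1 - 2 = -1) ?normrN1 ?mulr1 //; ring.
Qed.

Let gC x y : 0 <= x -> 0 <= y -> `|g x - g y| <= L%:C * (`|x - y|)%:C.
Proof. by move=> x0 y0; rewrite norm_normc -rmorphM lecR; apply: gL. Qed.

Let gbC x y : 0 < x -> 0 < y -> `|g x / x%:C - g y / y%:C| <= Lbar%:C * (`|x - y|)%:C.
Proof. by move=> x0 y0; rewrite norm_normc -rmorphM lecR; apply: gLbar. Qed.

Lemma small_eq0 (z : C) (K : R) : (forall x, 0 < x -> x <= 1 -> `|z| <= (K * x)%:C) -> z = 0.
Proof.
move=> h; have [K0|K0] := leP K 0.
  apply/eqP; rewrite -normr_le0; apply: le_trans (h 1 ltr01 (lexx _)) _.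
  by rewrite mulr1 lecR.
apply/eqP/negPn/negP => z0; pose t := Normc.normc z.
have t0 : 0 < t by rewrite -ltcR -norm_normc normr_gt0.
have K1 : 0 < 1 + 2 * K by rewrite addr_gt0 // mulr_gt0.
pose x := Num.min 1 (t / (2 * K)).
have x0 : 0 < x by rewrite lt_min ltr01 divr_gt0 // mulr_gt0.
have := h x x0 (_ : x <= 1); rewrite ge_min lexx => /(_ isT).
rewrite norm_normc -/t lecR => tx.
have : K * x <= t / 2.
  apply: (@le_trans _ _ (K * (t / (2 * K)))); last first.
    by rewrite le_eqVlt; apply/orP; left; apply/eqP; field; rewrite gt_eqF.
  by rewrite ler_pM2l // ge_min lexx orbT.
move=> /(le_trans tx) h2; lra.
Qed.

(** Being Lipschitz, [g x / x] stays bounded as [x] tends to [0], so [g x] tends to [0], while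
    continuity of [g] makes [g0] its limit. *)
Lemma g0_eq0 : g0 = 0.
Proof.
apply: (@small_eq0 _ (L + (Normc.normc (g 1) + Lbar))) => x x0 x1.
have gx : `|g x| <= ((Normc.normc (g 1) + Lbar) * x)%:C.
  have h := gbC x0 ltr01; rewrite rmorph1 divr1 in h.
  have xC : 0 < x%:C :> C by rewrite ltcR.
  have e : g x = (g x / x%:C) * x%:C by rewrite divfK ?gt_eqF.
  rewrite e normrM (gtr0_norm xC) rmorphM ler_pM2r // rmorphD /= -norm_normc.
  rewrite -[g x / _](subrK (g 1)); apply: le_trans (ler_normD _ _) _.
  rewrite [leRHS]addrC lerD2r; apply: le_trans h _; rewrite -rmorphM lecR ler_piMr ?lipschitz_ge0 //.
  rewrite distrC ger0_norm; lra.
have h := gC (lexx 0) (ltW x0); rewrite {1}/gfun eqxx sub0r normrN (ger0_norm (ltW x0)) in h.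
apply: (@le_trans _ _ `|(g0 - g x) + g x|); first by rewrite subrK.
apply: le_trans (ler_normD _ _) _.
by rewrite mulrDl rmorphD /=; apply: lerD gx; rewrite rmorphM.
Qed.

Lemma g_at0 : g 0 = 0.
Proof. by rewrite /gfun eqxx g0_eq0. Qed.

Lemma gbar_bound x : 0 < x -> `|g x / x%:C| <= L%:C.
Proof.
move=> x0; have xC : 0 < x%:C :> C by rewrite ltcR.
rewrite normf_div (gtr0_norm xC) ler_pdivrMr //.
have := gC (ltW x0) (lexx 0); rewrite subr0 (gtr0_norm x0).
by rewrite g_at0 subr0.
Qed.

Definition gC_fun (z : C) : C := g (complex.Re z).

Lemma nonneg_real (z : C) : 0 <= z -> exists2 x : R, 0 <= x & z = x%:C.
Proof.
move=> z0; exists (complex.Re z); last by rewrite RRe_real // ger0_real.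
by rewrite -lecR RRe_real // ger0_real.
Qed.

Lemma gC_lip (x y : C) : 0 <= x -> 0 <= y -> `|gC_fun x - gC_fun y| <= L%:C * `|x - y|.
Proof.
move=> /nonneg_real[s s0 ->] /nonneg_real[t t0 ->]; apply: le_trans (gC s0 t0) _.
by rewrite -rmorphB normc_def /= expr0n addr0 sqrtr_sqr.
Qed.

Section Shift.
Variable eta : R.
Hypothesis eta0 : 0 < eta.

Lemma hvalE (x : R) : 0 <= x -> hval f eta%:C x%:C = g (x + eta) / (x + eta)%:C.
Proof.
move=> x0; have xe : 0 < x + eta by rewrite ltr_wpDl.
by rewrite /hval -rmorphD /= /gfun gt_eqF.
Qed.

Lemma h_lip (x y : C) : 0 <= x -> 0 <= y ->
  `|hval f eta%:C x - hval f eta%:C y| <= Lbar%:C * `|x - y|.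
Proof.
move=> /nonneg_real[s s0 ->] /nonneg_real[t t0 ->]; rewrite !hvalE //.
apply: le_trans (gbC _ _) _; rewrite ?ltr_wpDl //.
rewrite -rmorphB normc_def /= expr0n addr0 sqrtr_sqr.
by rewrite (_ : s + eta - (t + eta) = s - t) //; ring.
Qed.

Lemma h_bound (x : C) : 0 <= x -> `|hval f eta%:C x| <= L%:C.
Proof. by move=> /nonneg_real[s s0 ->]; rewrite hvalE // gbar_bound // ltr_wpDl. Qed.

(** The difference is [x] times the change of [gbar] between [x] and [x + eta]. *)
Lemma h_shift (x : C) : 0 <= x ->
  `|x * hval f eta%:C x - gC_fun x| <= x * (Lbar%:C * eta%:C).
Proof.
move=> /nonneg_real[s s0 ->]; rewrite hvalE // /gC_fun /=.
have [->|sn] := eqVneq s 0.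
  by rewrite !mul0r g_at0 subr0 normr0.
have sp : 0 < s by rewrite lt_neqAle eq_sym sn.
have sC : 0 < s%:C :> C by rewrite ltcR.
have -> : s%:C * (g (s + eta) / (s + eta)%:C) - g s =
   s%:C * (g (s + eta) / (s + eta)%:C - g s / s%:C).
  by rewrite mulrBr [s%:C * (g s / _)]mulrC divfK ?gt_eqF.
rewrite normrM (gtr0_norm sC) ler_pM2l //.
apply: le_trans (gbC _ sp) _; first by rewrite ltr_wpDl.
by rewrite addrAC subrr add0r (gtr0_norm eta0).
Qed.
End Shift.

Section Error.
Variables (m n c l : nat) (A : 'M[C]_(m, n)) (Z : 'M[C]_(m, c)) (Y : 'M[C]_(c, n)).
Variables (Q X : 'M[C]_c) (sigma : 'I_l -> R) (U : 'M[C]_(m, l)) (V : 'M[C]_(n, l)).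
Variables (a e1 e2 e3 eta x1 x2 x3 x4 : R) (K1 k1 K2 k2 : nat).
Hypothesis f0 : f 0 = 0.

Lemma svd_scale (s : R) : 0 <= s -> gC_fun (s%:C ^+ 2) * s%:C = f s.
Proof.
move=> s0; rewrite -rmorphXn /gC_fun /= /gfun sqrf_eq0; case: eqP => [->|/eqP sn].
  by rewrite mulr0 f0.
by rewrite sqrtr_sqr ger0_norm // divfK // fmorph_eq0.
Qed.

Lemma dyad_sumE (k : 'I_l -> C) : dyad_sum k U V = U *m diag_mx (\row_j k j) *m V^t*.
Proof.
apply/matrixP => i j; rewrite /dyad_sum summxE mul_mx_diag !mxE; apply: eq_bigr => t _.
by rewrite !mxE big_ord1 !mxE mulrA [k t * _]mulrC.
Qed.

Lemma svt_error :
  0 < a -> 0 <= L -> 0 <= Lbar -> 0 < e1 -> 0 < e2 -> 0 <= e3 -> 0 < eta ->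
  opn A a%:C -> opn (Z *m Z^t* - A *m A^t*) e1%:C ->
  Q \is unitarymx -> (forall i, 0 <= X i i) ->
  opn (Q *m diag_mx (\row_i X i i) *m Q^t* - Z^t* *m Z) (2 * e2%:C) ->
  fsq (Y - Z^t* *m A) <= (2 * e3%:C) ^+ 2 ->
  is_svd A sigma U V -> e1 <= a ^+ 2 -> e2 <= a ^+ 2 ->
  (K1 < 2 ^ k1)%N -> 2 * a ^+ 2 <= K1%:R * e1 ->
  (K2 < 2 ^ k2)%N -> 4 * a ^+ 2 <= K2%:R * (2 * e2) ->
  (6 * k1 + 2)%:R * (L * e1) * a <= x1 ->
  2 * a ^+ 2 * (Lbar * eta) * a <= x2 ->
  2 * a ^+ 2 * ((6 * k2 + 2)%:R * (Lbar * (2 * e2))) * a <= x3 ->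
  2 * a * L * (2 * e3) <= x4 ->
  spec_norm (Z *m (core_out f eta%:C X Q *m Y) + g0 *: A - svt f sigma U V) <= x4 + x3 + x2 + x1.
Proof.
move=> a0 L0 Lb0 e10 e20 e30 eta0 oA oZ QU X0 oQ fY [s0 UU VU AE] e1a e2a K1k K1e K2k K2e X1 X2 X3 X4.
have e10' := ltW e10; have e20' := ltW e20; have a0' := ltW a0; have eta0' := ltW eta0.
have x10 : 0 <= x1 by apply: le_trans X1; rewrite !mulr_ge0.
have x20 : 0 <= x2 by apply: le_trans X2; rewrite !mulr_ge0 ?exprn_ge0.
have x30 : 0 <= x3 by apply: le_trans X3; rewrite !mulr_ge0 ?exprn_ge0.
have x40 : 0 <= x4 by apply: le_trans X4; rewrite !mulr_ge0.
have [W [d [WU _ AW]]] : exists (W : 'M_m) (d : 'rV_m),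
    [/\ W \is unitarymx, forall i, d 0 i \is Num.real & A *m A^t* = W^t* *m diag_mx d *m W].
  by apply: herm_spectral; rewrite adjM trmxCK.
have sR k : (\row_j (sigma j)%:C : 'rV[C]_l) 0 k \is Num.real.
  by rewrite mxE; apply/CrealP; apply: realC_conj.
have FA : fcalc W d gC_fun *m A = svt f sigma U V.
  rewrite (fcalc_svd gC_fun UU VU sR _ WU AW); last by rewrite {1}AE dyad_sumE.
  rewrite /svt dyad_sumE.
  have -> // : \row_k (gC_fun ((\row_j (sigma j)%:C) 0 k ^+ 2) * (\row_j (sigma j)%:C) 0 k) =
      \row_k f (sigma k) :> 'rV[C]_l.
  by apply/rowP => k; rewrite !mxE svd_scale.
apply: spec_le; first by rewrite !addr_ge0.
rewrite g0_eq0 scale0r addr0 -FA mulmxA /core_out.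
have -> : \row_i hval f eta%:C (X i i) = map_mx (hval f eta%:C) (\row_i X i i).
  by apply/rowP => i; rewrite !mxE.
rewrite !rmorphD /=.
apply: (@approx_error C m n c A Z Y Q _ W d gC_fun _ a%:C L%:C Lbar%:C e1%:C e2%:C e3%:C eta%:C
  x1%:C x2%:C x3%:C x4%:C K1 k1 K2 k2) => //; rewrite ?lecR ?ltcR //.
- by move=> i; rewrite mxE.
- exact: gC_lip.
- exact: h_lip.
- exact: h_bound.
- exact: h_shift.
- by rewrite -rmorphXn lecR.
- by rewrite -rmorphXn lecR.
- by move: K1e; rewrite -lecR !(rmorph_nat, rmorphXn, rmorphM).
- by move: K2e; rewrite -lecR !(rmorph_nat, rmorphXn, rmorphM).
- by move: X1; rewrite -lecR !(rmorph_nat, rmorphXn, rmorphM).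
- by move: X2; rewrite -lecR !(rmorph_nat, rmorphXn, rmorphM).
- by move: X3; rewrite -lecR !(rmorph_nat, rmorphXn, rmorphM).
- by move: X4; rewrite -lecR !(rmorph_nat, rmorphXn, rmorphM).
Qed.
End Error.
End Function.

Lemma fsq_sum_le (C : numClosedFieldType) m n N (M : 'I_N -> 'M[C]_(m, n)) b :
  0 <= b -> (forall u, fsq (M u) <= b ^+ 2) -> fsq (\sum_u M u) <= (N%:R * b) ^+ 2.
Proof.
move=> b0 Mb; apply: (@le_trans _ _ (\sum_u N%:R * fsq (M u))); last first.
  rewrite -mulr_sumr exprMn [N%:R ^+ 2]expr2 -mulrA ler_wpM2l ?ler0n //.
  apply: le_trans (ler_sum _ (fun u _ => Mb u)) _.
  by rewrite sumr_const card_ord mulr_natl.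
rewrite -mulr_sumr /fsq [X in _ * X]exchange_big mulr_sumr; apply: ler_sum => i _ /=.
rewrite [X in _ * X]exchange_big mulr_sumr; apply: ler_sum => j _ /=; rewrite summxE.
pose one : 'cV[C]_N := const_mx 1; pose v : 'cV[C]_N := \col_u M u i j.
have -> : \sum_u M u i j = (one^t* *m v) 0 0.
  rewrite mxE; apply: eq_bigr => u _.
  by rewrite adjE [one _ _]mxE [v _ _]mxE conjC1 mul1r.
apply: le_trans (inner_sq_le one v) _; rewrite /fsq.
rewrite (eq_bigr (fun=> 1)) => [|u _]; last by rewrite big_ord1 mxE normr1 expr1n.
rewrite sumr_const card_ord ler_wpM2l ?ler0n //.
by apply: ler_sum => u _; rewrite big_ord1 mxE.
Qed.

(** * Union bound and assembly of the error *)

Section Outcomes.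
Variables (R : realType) (m n : nat) (phi : R) (A : 'M[R[i]]_(m, n)).
Variables (acc : SQ phi A) (acc' : SQ phi (A^t*)) (f : R -> R[i]).
Variables (r c : nat) (L Lbar eps delta a : R).
Hypothesis delta0 : 0 < delta.
Local Notation C := R[i].
Local Notation Phi := (frob_norm (tilde acc) ^+ 2).
Hypothesis Phi0 : 0 < Phi.
Hypothesis tilde_frob' : frob_norm (tilde acc') ^+ 2 = Phi.
Hypothesis c0 : (0 < c)%N.
Hypothesis r0 : (0 < r)%N.

Local Notation p_inner := (p_inner acc L Lbar eps delta a).
Local Notation p_rounds := (p_rounds acc L Lbar eps a).
Local Notation dd := (p_depth delta).
Local Notation outcome := (outcome acc r c L Lbar eps delta a).
Local Notation outcome_prob := (@outcome_prob R m n phi A acc acc' r c L Lbar eps delta a).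
Local Notation row_prob := (row_prob acc).
Local Notation col_prob := (col_prob acc acc').

Lemma sum_outcome_inner (g : {ffun 'I_c -> 'I_n} -> {ffun 'I_p_inner -> 'I_c * 'I_m} -> R) :
  \sum_o outcome_prob o * g o.1.1 o.2 =
  \sum_(J : {ffun 'I_c -> 'I_n}) (\prod_t col_prob (J t)) *
    \sum_(K : {ffun 'I_p_inner -> 'I_c * 'I_m}) (\prod_u inner_prob acc' J (K u)) * g J K.
Proof.
rewrite -(pair_bigA _ (fun JI K => outcome_prob (JI, K) * g JI.1 K)) /=.
rewrite -(pair_bigA _ (fun J I => \sum_K outcome_prob (J, I, K) * g J K)) /=.
apply: eq_bigr => J _; rewrite -[RHS]mul1r -[X in _ = X * _](sum_prod r (sum_row_prob Phi0)) mulr_suml.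
apply: eq_bigr => I _; rewrite !mulr_sumr; apply: eq_bigr => K _.
rewrite outcome_probE /=; ring.
Qed.

(** The second and third bad events are bounded conditionally on column samples [J] that are not bad
    themselves and have nonzero probabilities, so they are first intersected with the complement of
    [b1]. *)
Lemma outcome_union (E : outcome -> bool) (b1 : {ffun 'I_c -> 'I_n} -> bool)
    (b2 : {ffun 'I_c -> 'I_n} -> {ffun 'I_p_inner -> 'I_c * 'I_m} -> bool)
    (b3 : {ffun 'I_c -> 'I_n} -> {ffun 'I_r -> 'I_m} -> bool) (beta : R) :
  (forall o, outcome_prob o != 0 -> E o -> [|| b1 o.1.1, b2 o.1.1 o.2 | b3 o.1.1 o.1.2]) ->
  prob col_prob b1 <= beta ->
  (forall J : {ffun 'I_c -> 'I_n}, (forall t, col_prob (J t) != 0) -> ~~ b1 J ->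
    prob (inner_prob acc' J) (b2 J) <= beta) ->
  (forall J : {ffun 'I_c -> 'I_n}, (forall t, col_prob (J t) != 0) -> ~~ b1 J ->
    prob row_prob (b3 J) <= beta) ->
  \sum_o outcome_prob o * (E o)%:R <= 3 * beta.
Proof.
move=> Eb h1 h2 h3.
have pJ0 (J : {ffun 'I_c -> 'I_n}) : 0 <= \prod_t col_prob (J t).
  by apply: prodr_ge0 => t _; apply: col_prob_ge0.
have beta0 : 0 <= beta.
  apply: le_trans h1; apply: sumr_ge0 => J _; by rewrite mulr_ge0 ?ler0n.
pose g1 (J : {ffun 'I_c -> 'I_n}) (I : {ffun 'I_r -> 'I_m}) : R := (b1 J)%:R.
pose g2 J K : R := (~~ b1 J && b2 J K)%:R.
pose g3 J I : R := (~~ b1 J && b3 J I)%:R.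
apply: (@le_trans _ _ (\sum_o outcome_prob o * g1 o.1.1 o.1.2 +
   \sum_o outcome_prob o * g2 o.1.1 o.2 + \sum_o outcome_prob o * g3 o.1.1 o.1.2)).
  rewrite -!big_split; apply: ler_sum => o _; rewrite /= -!mulrDr.
  have [->|po] := eqVneq (outcome_prob o) 0; first by rewrite !mul0r.
  apply: ler_wpM2l; first exact: outcome_prob_ge0.
  rewrite /g1 /g2 /g3 -!natrD ler_nat.
  by case: (boolP (E o)) => // /(Eb o po); case: (b1 _); case: (b2 _ _); case: (b3 _ _).
rewrite (sum_outcome acc acc' L Lbar eps delta a c0 g1) (sum_outcome_inner g2).
rewrite (sum_outcome acc acc' L Lbar eps delta a c0 g3).
have cond (x : {ffun 'I_c -> 'I_n} -> R) : (forall J : {ffun 'I_c -> 'I_n},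
   (forall t, col_prob (J t) != 0) -> x J <= beta) ->
   \sum_(J : {ffun 'I_c -> 'I_n}) (\prod_t col_prob (J t)) * x J <= beta.
  move=> hx; rewrite -[beta]mul1r -[X in _ <= X * _](sum_prod c (sum_col_prob Phi0 tilde_frob')) mulr_suml.
  apply: ler_sum => J _; have [->|pJ] := eqVneq (\prod_t col_prob (J t)) 0; first by rewrite !mul0r.
  by apply: ler_wpM2l => //; apply/hx/col_prob_neq0.
have -> : 3 * beta = beta + beta + beta by ring.
apply: lerD; first apply: lerD.
- apply: le_trans h1; apply: ler_sum => J _; rewrite /g1 -mulr_suml.
  by rewrite sum_prod ?mul1r ?sum_row_prob.
- apply: cond => J J0; rewrite /g2; case: (boolP (b1 J)) => nb /=; last exact: h2.
  by rewrite big1 // => K _; rewrite mulr0.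
- apply: cond => J J0; rewrite /g3; case: (boolP (b1 J)) => nb /=; last exact: h3.
  by rewrite big1 // => K _; rewrite mulr0.
Qed.
End Outcomes.

Lemma three_quarters (R : realFieldType) (x : R) : 0 < x -> 3 * (x / 4) < x.
Proof. by move=> x0; lra. Qed.

Lemma half_le (R : realFieldType) (x : R) : 0 < x -> x / 8 + x / 8 + x / 8 + x / 8 <= x.
Proof. by move=> x0; lra. Qed.

Section Link.
Variables (R : realType) (m n : nat) (phi : R) (A : 'M[R[i]]_(m, n)).
Variables (acc : SQ phi A) (acc' : SQ phi (A^t*)).
Variables (r c : nat).
Local Notation C := R[i].
Local Notation Phi := (frob_norm (tilde acc) ^+ 2).
Hypothesis Phi0 : 0 < Phi.
Local Notation row_prob := (row_prob acc).
Local Notation col_prob := (col_prob acc acc').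

Lemma weight_sq N (p : R) : 0 <= p -> weight N p * weight N p = ((N%:R * p)^-1)%:C.
Proof. by move=> p0; rewrite /weight -rmorphM -invfM -expr2 sqr_sqrtr // mulr_ge0. Qed.

Lemma weight_conj N (p : R) : Num.conj (weight N p) = weight N p.
Proof. exact: realC_conj. Qed.

Lemma sketch_colE (J : {ffun 'I_c -> 'I_n}) : A *m (sampling_mx col_prob J)^T = sketch_col acc acc' J.
Proof.
apply/matrixP => i t; rewrite !mxE (bigD1 (J t)) //= !mxE eqxx big1 ?addr0 // => j jt.
by rewrite !mxE (negbTE jt) mulr0.
Qed.

Lemma sketch_rowE (I : {ffun 'I_r -> 'I_m}) s j :
  (sampling_mx row_prob I *m A) s j = weight r (row_prob (I s)) * A (I s) j.
Proof.
rewrite !mxE (bigD1 (I s)) //= !mxE eqxx big1 ?addr0 // => i ji.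
by rewrite !mxE (negbTE ji) mul0r.
Qed.

Lemma crossE (J : {ffun 'I_c -> 'I_n}) (I : {ffun 'I_r -> 'I_m}) s t :
  crossmx A J (col_wt acc acc' J) I (row_wt acc I) s t =
  sketch_col acc acc' J (I s) t * weight r (row_prob (I s)).
Proof. by rewrite !mxE. Qed.

Lemma cross_flag (Q : nat) (J : {ffun 'I_c -> 'I_n}) (I : {ffun 'I_r -> 'I_m}) s :
  flag (Phi / Q%:R)%:C (crossmx A J (col_wt acc acc' J) I (row_wt acc I)) s =
  ((frob_norm (row (I s) (sketch_col acc acc' J)) ^+ 2 / (r%:R * row_prob (I s)) <= Phi / Q%:R)%R)%:R.
Proof.
rewrite /flag; set W := crossmx _ _ _ _ _; set Z := sketch_col _ _ _.
have -> : \sum_t `|W s t| ^+ 2 = (frob_norm (row (I s) Z) ^+ 2 / (r%:R * row_prob (I s)))%:C.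
  rewrite rmorphM /= -fsqE -weight_sq ?row_prob_ge0 // /fsq big_ord1 mulr_suml.
  apply: eq_bigr => t _; rewrite /W crossE -/Z !mxE !normCK rmorphM /= weight_conj; ring.
by rewrite /= leNgt; case: (_ < _).
Qed.

Lemma cross_estE (Q : nat) (J : {ffun 'I_c -> 'I_n}) (I : {ffun 'I_r -> 'I_m}) :
  let W := crossmx A J (col_wt acc acc' J) I (row_wt acc I) in
  W^t* *m diag_mx (\row_s flag (Phi / Q%:R)%:C W s) *m (sampling_mx row_prob I *m A) =
  cross_est Q A (sketch_col acc acc' J) row_prob Phi I.
Proof.
move=> W; apply/matrixP => t j; rewrite /cross_est summxE mxE; apply: eq_bigr => s _.
have -> : (W^t* *m diag_mx (\row_s flag (Phi / Q%:R)%:C W s)) t s =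
    Num.conj (W s t) * flag (Phi / Q%:R)%:C W s.
  by rewrite mul_mx_diag mxE adjE [(\row__ _) _ _]mxE.
have kE (b : bool) : ((b%:R / (r%:R * row_prob (I s)))%:C : C) =
    b%:R * (weight r (row_prob (I s)) * weight r (row_prob (I s))).
  by rewrite weight_sq ?row_prob_ge0 // rmorphM rmorph_nat.
rewrite sketch_rowE cross_flag /W crossE rmorphM /= weight_conj.
by rewrite [RHS]mxE kE [(_ *m _) _ _]mxE big_ord1 adjE ![row _ _ _ _]mxE; ring.
Qed.

Section Gram.
Hypothesis c0 : (0 < c)%N.
Variable J : {ffun 'I_c -> 'I_n}.
Hypothesis J0 : forall t, col_prob (J t) != 0.
Variables (N : nat) (K : {ffun 'I_N -> 'I_c * 'I_m}).
Hypothesis N0 : (0 < N)%N.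
Local Notation G := (\sum_u inner_term acc' J (col_wt acc acc' J) Phi%:C N (K u)).
Local Notation w := (wrow acc acc' J).

Lemma inner_termE y :
  inner_term acc' J (col_wt acc acc' J) Phi%:C N y = N%:R^-1 *: (w y *m (w y)^t*).
Proof. by rewrite wrow_outer // scalerA /inner_term -sample_rowE mulrC. Qed.

(** As a sum of outer products with nonnegative weights, [G] is positive, so [h] is evaluated only
    where its Lipschitz bound holds. *)
Lemma gram_diag_ge0 (Q : 'M[C]_c) i : 0 <= (Q^t* *m G *m Q) i i.
Proof.
rewrite mulmx_sumr mulmx_suml summxE; apply: sumr_ge0 => u _.
rewrite inner_termE -scalemxAr -scalemxAl mxE mulr_ge0 ?invr_ge0 ?ler0n //.
have -> : Q^t* *m (w (K u) *m (w (K u))^t*) *m Q = (Q^t* *m w (K u)) *m (Q^t* *m w (K u))^t*.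
  by rewrite adjM trmxCK !mulmxA.
by rewrite mxE big_ord1 adjE mul_conjC_ge0.
Qed.

(** This uses no probability beyond [J0], since every term is bounded; it is the off-diagonal mass
    from which the Jacobi rounds start. *)
Lemma fsq_gram : fsq G <= Phi%:C ^+ 2.
Proof.
have NC : (0 : C) < N%:R by rewrite ltr0n.
have P0 : 0 <= Phi%:C :> C by rewrite lecR ltW.
have b0 : 0 <= Phi%:C / N%:R :> C by rewrite divr_ge0 // ltW.
apply: le_trans (fsq_sum_le b0 _) _ => [u|]; last by rewrite mulrC divfK // gt_eqF.
rewrite inner_termE fsqZ -{1}[w _]trmxCK.
have := fsq_outer ((w (K u))^t*) ((w (K u))^t*); rewrite !fsq_adj trmxCK => ->.
rewrite ger0_norm ?invr_ge0 ?ler0n // exprMn mulrC ler_pM2r ?exprn_gt0 ?invr_gt0 //.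
by rewrite expr2; apply: ler_pM; rewrite ?fsq_ge0 ?fsq_wrow.
Qed.
End Gram.
End Link.

Section Outcome.
Variables (R : realType) (m n : nat) (phi : R) (A : 'M[R[i]]_(m, n)).
Variables (acc : SQ phi A) (acc' : SQ phi (A^t*)) (f : R -> R[i]) (g0 : R[i]).
Variables (r c : nat) (L Lbar eps delta : R).
Variables (l : nat) (sigma : 'I_l -> R) (U : 'M[R[i]]_(m, l)) (V : 'M[R[i]]_(n, l)).
Local Notation C := R[i].
Local Notation a := (spec_norm A).
Local Notation F := (frob_norm A).
Local Notation Phi := (frob_norm (tilde acc) ^+ 2).
Hypothesis delta0 : 0 < delta.
Hypothesis Phi0 : 0 < Phi.
Hypothesis tilde_frob' : frob_norm (tilde acc') ^+ 2 = Phi.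
Hypothesis c0 : (0 < c)%N.
Hypothesis r0 : (0 < r)%N.
Hypothesis f0 : f 0 = 0.
Hypothesis gL : lipschitz_in [set x | 0 <= x]%classic (gfun f g0) L.
Hypothesis gLbar : lipschitz_in [set x | 0 < x]%classic (fun x => gfun f g0 x / x%:C) Lbar.
Hypothesis svdA : is_svd A sigma U V.
Local Notation rate := (rate L Lbar eps a).
Local Notation p_inner := (p_inner acc L Lbar eps delta a).
Local Notation p_rounds := (p_rounds acc L Lbar eps a).
Local Notation dd := (p_depth delta).
Local Notation outcome := (outcome acc r c L Lbar eps delta a).
Local Notation outcome_prob := (@outcome_prob R m n phi A acc acc' r c L Lbar eps delta a).
Local Notation row_prob := (row_prob acc).
Local Notation col_prob := (col_prob acc acc').
Local Notation Z := (sketch_col acc acc').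

Variables (e1 e2 e3 : R) (K1 k1 K2 k2 Q1 : nat).
Hypothesis a0 : 0 < a.
Hypothesis L0 : 0 <= L.
Hypothesis rate0 : 0 < rate.
Hypothesis e10 : 0 < e1.
Hypothesis e20 : 0 < e2.
Hypothesis e30 : 0 <= e3.
Hypothesis e1a : e1 <= a ^+ 2.
Hypothesis e2a : e2 <= a ^+ 2.
Hypothesis offs : 2^-1 ^+ p_rounds * Phi ^+ 2 <= e2 ^+ 2.
Hypothesis K1k : (K1 < 2 ^ k1)%N.
Hypothesis K1e : 2 * a ^+ 2 <= K1%:R * e1.
Hypothesis K2k : (K2 < 2 ^ k2)%N.
Hypothesis K2e : 4 * a ^+ 2 <= K2%:R * (2 * e2).
Hypothesis X1 : (6 * k1 + 2)%:R * (L * e1) * a <= eps / 8.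
Hypothesis X2 : 2 * a ^+ 2 * (Lbar * (a ^+ 2 / (16 * rate))) * a <= eps / 8.
Hypothesis X3 : 2 * a ^+ 2 * ((6 * k2 + 2)%:R * (Lbar * (2 * e2))) * a <= eps / 8.
Hypothesis X4 : 2 * a * L * (2 * e3) <= eps / 8.
Hypothesis eps0 : 0 < eps.

Lemma p_inner_gt0 : (0 < p_inner)%N.
Proof.
have pos k : (0 < 2 ^ k)%N by rewrite expn_gt0.
exact: pos.
Qed.

Definition bad_gram (J : {ffun 'I_c -> 'I_n}) : bool :=
  ~~ `[< opn (Z J *m (Z J)^t* - A *m A^t*) e1%:C >].
Definition bad_inner (J : {ffun 'I_c -> 'I_n}) (K : {ffun 'I_p_inner -> 'I_c * 'I_m}) : bool :=
  ~~ `[< opn (\sum_u inner_term acc' J (fun t => weight c (col_prob (J t))) Phi%:C p_inner (K u)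
              - (Z J)^t* *m Z J) e2%:C >].
Definition bad_cross (J : {ffun 'I_c -> 'I_n}) (I : {ffun 'I_r -> 'I_m}) : bool :=
  ~~ (fsq (cross_est dd A (Z J) row_prob Phi I - (Z J)^t* *m A) <= (2 * e3%:C) ^+ 2).

Lemma outcome_error (o : outcome) (s : state R) M : outcome_prob o != 0 ->
  out_ok acc' f o M -> iarr s = mia M -> zarr s = mza M ->
  ~~ bad_gram o.1.1 -> ~~ bad_inner o.1.1 o.2 -> ~~ bad_cross o.1.1 o.1.2 ->
  spec_norm (A *m out_T n c s *m out_M c r s *m (out_S r m s *m A) + g0 *: A - svt f sigma U V)
    <= eps.
Proof.
move=> po ok eI ez; rewrite !negbK => /asboolP b1 /asboolP b2 b3.
have S := out_S_ok ok eI ez; have T := out_T_ok ok eI ez.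
have J0 t : col_prob (o.1.1 t) != 0.
  by apply: col_prob_neq0; apply: contra po => /eqP e; rewrite outcome_probE e !mul0r.
have -> : A *m out_T n c s = Z o.1.1 by rewrite -[out_T _ _ _]trmxK T sketch_colE.
rewrite S; case: ok => _ _ [Q [QU offX M2]].
set G := gram_est acc' _ _ in offX M2; set X := Q^t* *m G *m Q in offX M2.
have -> : out_M c r s = core_out f (a ^+ 2 / (16 * rate))%:C X Q *m
    (crossmx A o.1.1 (col_wt acc acc' o.1.1) o.1.2 (row_wt acc o.1.2))^t* *m
    diag_mx (\row_s flag (Phi / dd%:R)%:C
      (crossmx A o.1.1 (col_wt acc acc' o.1.1) o.1.2 (row_wt acc o.1.2)) s).
  by apply/matrixP => i j; rewrite !mxE ez M2 !mxE.
have assoc p (co : 'M[C]_c) (W : 'M[C]_(c, r)) (D : 'M[C]_r) (Y : 'M[C]_(r, n)) (B : 'M[C]_(p, c)) :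
    B *m (co *m W *m D) *m Y = B *m (co *m (W *m D *m Y)) by rewrite !mulmxA.
rewrite assoc cross_estE //.
have oQ : opn (Q *m diag_mx (\row_i X i i) *m Q^t* - G) e2%:C.
  apply: jacobi_approx => //; apply: le_trans offX _.
  apply: le_trans (ler_wpM2l _ (le_trans (off_fsq _) (fsq_gram Phi0 c0 J0 o.2 p_inner_gt0))) _.
    by rewrite exprn_ge0 // invr_ge0.
  by move: offs; rewrite -lecR !(rmorphXn, rmorphM, fmorphV, rmorph_nat).
(* One [e2] for the rotations that are stopped early, one for the sampling. *)
have oQZ : opn (Q *m diag_mx (\row_i X i i) *m Q^t* - (Z o.1.1)^t* *m Z o.1.1) (2 * e2%:C).
  rewrite -[Q *m _ *m _](subrK G) -addrA.
  have e2C : 0 <= e2%:C :> C by rewrite lecR ltW.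
  have -> : 2 * e2%:C = e2%:C + e2%:C :> C by ring.
  exact: (opnD e2C e2C oQ b2).
have Lb0 := lipschitz_ge0 gLbar.
have eta0 : 0 < a ^+ 2 / (16 * rate) by rewrite divr_gt0 ?exprn_gt0 // mulr_gt0.
have X0 i : 0 <= X i i by apply: gram_diag_ge0.
have E := svt_error gL gLbar f0 a0 L0 Lb0 e10 e20 e30 eta0 (spec_opn A) b1 QU
  X0 oQZ b3 svdA e1a e2a K1k K1e K2k K2e X1 X2 X3 X4.
by apply: le_trans E _; apply: half_le.
Qed.

Hypothesis Q1c : 4 * Q1%:R * Phi <= c%:R * a ^+ 2.
Hypothesis Q1e : 80 * Q1%:R * Phi * a ^+ 2 / c%:R <= e1 ^+ 2.
Hypothesis Q1d : 4^-1 ^+ Q1 * (F ^+ 2 / a ^+ 2) <= delta / 4.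
Hypothesis Q1_gt0 : (0 < Q1)%N.
Variable Q2 : nat.
Hypothesis Q2_gt0 : (0 < Q2)%N.
Hypothesis Q2c : 4 * Q2%:R * Phi <= p_inner%:R * (2 * a ^+ 2).
Hypothesis Q2e : 80 * Q2%:R * Phi * (2 * a ^+ 2) / p_inner%:R <= e2 ^+ 2.
Hypothesis Q2d : 4^-1 ^+ Q2 * (Phi / (2 * a ^+ 2)) <= delta / 4.
Hypothesis d3e : 1600 * dd%:R * Phi ^+ 2 / r%:R <= e3 ^+ 2.
Hypothesis d3d : 4^-1 ^+ dd <= delta / 4 :> R.

Lemma failure_bound (fin : outcome -> state R) :
  (forall o, outcome_prob o != 0 ->
     exists M, [/\ out_ok acc' f o M, iarr (fin o) = mia M & zarr (fin o) = mza M]) ->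
  \sum_o outcome_prob o * `[< eps < spec_norm (A *m out_T n c (fin o) *m out_M c r (fin o)
     *m (out_S r m (fin o) *m A) + g0 *: A - svt f sigma U V) >]%:R < delta.
Proof.
move=> fin_ok; apply: (@le_lt_trans _ _ (3 * (delta / 4))); last exact: three_quarters.
apply: (@outcome_union _ _ _ _ _ _ acc' _ _ _ _ _ _ _ Phi0 tilde_frob' c0 _
   bad_gram bad_inner bad_cross).
- move=> o po /asboolP lt; have [M [h1 h2 h3]] := fin_ok o po.
  apply/negPn/negP; rewrite !negb_or => /and3P[b1 b2 b3].
  by have := outcome_error po h1 h2 h3 b1 b2 b3; rewrite leNgt lt.
- by apply: le_trans Q1d; apply: event_gram => //; apply: spec_opn.
- move=> J J0 nb; apply: le_trans Q2d; apply: event_inner => //; rewrite ?p_inner_gt0 //.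
    by rewrite mulr_gt0 // exprn_gt0.
  move: nb; rewrite /bad_gram negbK => /asboolP oZ.
  rewrite -[Z J *m _](subrK (A *m A^t*)).
  have a20 : 0 <= a ^+ 2 by rewrite exprn_ge0 // ltW.
  have oA : opn (A *m A^t*) (a ^+ 2)%:C.
    have aC : 0 <= a%:C :> C by rewrite lecR ltW.
    by rewrite expr2 rmorphM; apply: opnM (spec_opn A) (opn_adj aC (spec_opn A)).
  have e1C : 0 <= e1%:C :> C by rewrite lecR ltW.
  have aaC : 0 <= (a ^+ 2)%:C :> C by rewrite lecR.
  have := opnD e1C aaC oZ oA; rewrite -rmorphD; apply: opnW.
    by rewrite lecR addr_ge0 // ltW.
  by rewrite lecR mulr_natl mulr2n lerD2r.
- move=> J J0 nb; apply: le_trans d3d; apply: event_cross => //.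
  + by move=> i; apply: row_prob_ge0.
  + exact: sum_row_prob.
  + move=> i; apply: le_trans (rowsq_le Phi0 i); rewrite frob_sqr big_ord1.
    by apply: ler_sum => j _; rewrite mxE.
  + exact: fsq_sketch_col.
Qed.
End Outcome.

(** * Choice of the parameters *)

Section Scales.
Variable R : realType.
Implicit Types (x y s psi a eps : R).

Lemma scale_ge T : T <= 2 ^+ (scale T).-1 :> R.
Proof. by have := doublings_ge T (ltr01 : 0 < 1 :> R); rewrite mulr1. Qed.

Lemma scale_gt0 T : (0 < scale (T : R))%N. Proof. by []. Qed.

Lemma nat_le_pow (l : nat) : l%:R <= 2 ^+ l :> R.
Proof. by rewrite -natrX ler_nat ltnW // ltn_expl. Qed.

Lemma ln2_ge : 2^-1 <= ln 2 :> R.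
Proof.
have h : expR (- 2^-1) >= 2^-1 :> R by apply: le_trans (expR_ge1Dx _); lra.
rewrite -[leLHS]expRK ler_ln ?posrE ?expR_gt0 //.
by rewrite -[leLHS]invrK -expRN -[leRHS]invrK lef_pV2 ?posrE ?invr_gt0 ?expR_gt0 // invrK.
Qed.

Lemma doublings_log x y : 0 < x -> x <= y -> (doublings x y)%:R <= 1 + 2 * ln (y / x).
Proof.
move=> x0 xy; have y0 : 0 < y by apply: lt_le_trans xy.
have yx1 : 1 <= y / x by rewrite ler_pdivlMr // mul1r.
have ln0 : 0 <= ln (y / x) by rewrite ln_ge0.
case E : (doublings x y) => [|w]; first by rewrite addr_ge0 // mulr_ge0.
have := @doublings_min _ x y w x0; rewrite E ltnSn => /(_ isT) lt.
have : 2 ^+ w < y / x by rewrite ltr_pdivlMr.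
move=> /ltW; rewrite -ler_ln ?posrE ?exprn_gt0 ?divr_gt0 // lnXn // => h.
have h2 := ln2_ge; have w0 : 0 <= w%:R :> R by [].
rewrite -natr1; have : w%:R * 2^-1 <= w%:R * ln 2 :> R by rewrite ler_wpM2l.
move: h; rewrite -mulr_natl; lra.
Qed.

Section Scale.
Variables (psi s : R).
Hypothesis psi1 : 1 <= psi.
Hypothesis s1 : 1 <= s.
Local Notation l := (scale (psi * (1 + s))).

Let psi0 : 0 < psi. Proof. exact: lt_le_trans ltr01 psi1. Qed.
Let s0 : 0 < s. Proof. exact: lt_le_trans ltr01 s1. Qed.

Lemma scale_bound : 2 * (psi * (1 + s)) <= 2 ^+ l.
Proof.
have := scale_ge (psi * (1 + s)); rewrite /scale add1n /= exprS => h.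
by rewrite ler_pM2l.
Qed.

Lemma scale_psi : psi * s <= 2 ^+ l.
Proof.
apply: le_trans scale_bound; have : 0 <= psi * s by rewrite mulr_ge0 ?ltW.
by move: psi0; rewrite mulrDr mulr1; lra.
Qed.

(** This is what the scale is made for: the inverse tolerance, even times the stable rank, is at
    most [4096 * 4^l], so grids and rounds have lengths or exponents linear in [l]. *)
Lemma scale_prod : psi * s * l%:R <= 4 ^+ l.
Proof.
have -> : 4 ^+ l = 2 ^+ l * 2 ^+ l :> R by rewrite -exprMn; congr (_ ^+ _); ring.
apply: ler_pM => //; [by rewrite mulr_ge0 ?ltW|exact: scale_psi|exact: nat_le_pow].
Qed.

Lemma scale_s : s * l%:R <= 4 ^+ l.
Proof.
by apply: le_trans scale_prod; rewrite ler_wpM2r // ler_peMl // ltW.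
Qed.

Lemma scale_psi4 : psi <= 4 ^+ l.
Proof.
apply: le_trans scale_prod; rewrite -mulrA ler_peMr //; first exact: ltW.
have l1 : 1 <= l%:R :> R by rewrite ler1n.
exact: mulr_ege1.
Qed.

Variable a : R.
Hypothesis a0 : 0 < a.
Local Notation e := (a ^+ 2 / (4096 * s * l%:R)).

Let l1 : 1 <= l%:R :> R. Proof. by rewrite ler1n. Qed.
Let sl1 : 1 <= s * l%:R. Proof. exact: mulr_ege1. Qed.
Let sl0 : 0 < s * l%:R. Proof. exact: lt_le_trans ltr01 sl1. Qed.

Lemma tol_gt0 : 0 < e.
Proof. by rewrite divr_gt0 ?exprn_gt0 // -mulrA mulr_gt0. Qed.

Lemma tol_le : e <= a ^+ 2.
Proof.
rewrite ler_pdivrMr; last by rewrite -mulrA mulr_gt0.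
rewrite ler_peMr ?exprn_ge0 ?(ltW a0) // -mulrA.
by move: sl1; lra.
Qed.

Lemma grid_exp : (2 ^ (13 + 2 * l) < 2 ^ (2 * l + 14))%N.
Proof. by rewrite ltn_exp2l //; lia. Qed.

(** [2^13] is [2 * 4096], and [4^l] absorbs the factor [s l] of the tolerance. *)
Lemma grid_ge : 2 * a ^+ 2 <= (2 ^ (13 + 2 * l))%:R * e.
Proof.
rewrite mulrA ler_pdivlMr; last by rewrite -mulrA mulr_gt0.
have -> : (2 ^ (13 + 2 * l))%:R = 8192 * 4 ^+ l :> R.
  rewrite natrX exprD exprM; congr (_ * _); first by ring.
  by congr (_ ^+ _); ring.
have h := scale_s; have aa : 0 < a ^+ 2 by rewrite exprn_gt0.
have : a ^+ 2 * (s * l%:R) <= a ^+ 2 * 4 ^+ l by rewrite ler_pM2l.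
by move: (a ^+ 2) (4 ^+ l) => A P h2; lra.
Qed.

Lemma scale_factor : (6 * (2 * l + 14) + 2)%:R <= 98 * l%:R :> R.
Proof. by rewrite -natrM ler_nat; have := scale_gt0 (psi * (1 + s)); lia. Qed.

(** Of the exponent, [24] pays for the square of [4096] and [4 l] for the square of
    [psi s l <= 4^l]. *)
Lemma jacobi_rounds : 2^-1 ^+ (4 * l + 24) * (psi * a ^+ 2) ^+ 2 <= e ^+ 2.
Proof.
have h := scale_prod; have p0 : 0 <= psi * s * l%:R by rewrite !mulr_ge0 // ltW.
have sl : s * l%:R != 0 by rewrite gt_eqF.
have -> : e ^+ 2 = (a ^+ 2) ^+ 2 / (2 ^+ 24 * (s * l%:R) ^+ 2).
  have -> : 2 ^+ 24 = 4096 ^+ 2 :> R by ring.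
  by rewrite -(mulrA 4096); move: (s * l%:R) sl => y y0; field.
rewrite ler_pdivlMr; last by rewrite mulr_gt0 ?exprn_gt0.
rewrite exprVn -mulrA ler_pdivrMl ?exprn_gt0 //.
have -> : (psi * a ^+ 2) ^+ 2 * (2 ^+ 24 * (s * l%:R) ^+ 2) =
   2 ^+ 24 * (psi * s * l%:R) ^+ 2 * (a ^+ 2) ^+ 2 by ring.
rewrite ler_wpM2r ?sqr_ge0 //.
have -> : 2 ^+ (4 * l + 24) = 2 ^+ 24 * (4 ^+ l) ^+ 2 :> R.
  have -> : 4 ^+ l = 2 ^+ (2 * l) :> R by rewrite exprM; congr (_ ^+ _); ring.
  by rewrite -exprM -exprD addnC mulnAC.
by rewrite ler_wpM2l ?exprn_ge0 // lerXn2r ?nnegrE ?exprn_ge0.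
Qed.
End Scale.

Lemma depth_small (delta : R) : 0 < delta -> 4^-1 ^+ depth delta <= delta / 4.
Proof.
move=> d0; rewrite /depth exprD; set D := doublings delta 1.
have h : 1 <= 2 ^+ D * delta := doublings_ge 1 d0.
have h2 : 2^-1 ^+ D <= delta by rewrite exprVn -[leLHS]mulr1 ler_pdivrMl ?exprn_gt0.
have h3 : 4^-1 ^+ D <= 2^-1 ^+ D :> R by rewrite lerXn2r ?nnegrE ?invr_ge0 //; lra.
have -> : 4^-1 ^+ 2 = 16^-1 :> R by field.
by move: h2 h3; move: (4^-1 ^+ D) (2^-1 ^+ D) => x y; lra.
Qed.

Lemma depth_log (delta : R) : 0 < delta -> delta < 1 -> (depth delta)%:R <= 5 * log_inv delta.
Proof.
move=> d0 d1; have h := doublings_log d0 (ltW d1); rewrite div1r in h.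
have h1 : 1 <= log_inv delta by rewrite le_max lexx.
have h2 : ln delta^-1 <= log_inv delta by rewrite le_max lexx orbT.
by move: h h1 h2; rewrite /depth natrD; lra.
Qed.

Lemma scale_log (T X : R) : 1 <= T -> T <= 4 * X -> (scale T)%:R <= 6 * (1 + ln (1 + X)).
Proof.
move=> T1 TX; have T0 : 0 < T by apply: lt_le_trans T1.
have X0 : 0 < 1 + X by move: T0 TX; lra.
have h := doublings_log ltr01 T1; rewrite divr1 in h.
have h2 : ln 2 <= 1 :> R by have := @le_ln1Dx R 1 (ltac:(lra)); rewrite -natr1.
have h3 : ln T <= ln 2 + ln 2 + ln (1 + X).
  rewrite -!lnM ?posrE ?mulr_gt0 // ler_ln ?posrE ?mulr_gt0 //.
  by move: TX; lra.
have h4 : 0 <= ln (1 + X) by rewrite ln_ge0 //; move: T0 TX; lra.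
by move: h h2 h3 h4; rewrite /scale natrD; lra.
Qed.

Section Bounds.
Variables (a L Lbar eps : R).
Hypothesis a0 : 0 < a.
Hypothesis L0 : 0 < L.
Hypothesis Lb0 : 0 <= Lbar.
Hypothesis eps0 : 0 < eps.
Variables (k l : nat).
Hypothesis kl : k%:R <= 98 * l%:R :> R.
Hypothesis l0 : (0 < l)%N.
Local Notation la := (L * a ^+ 3 / eps).
Local Notation s := (rate L Lbar eps a).

Let l1 : 0 < l%:R :> R. Proof. by rewrite ltr0n. Qed.

(** The [4096] of the tolerances is chosen here: its eighth part [512] must exceed [98], and also
    [4 * 98]. *)
Lemma small_k (c x : R) : 0 <= x -> 0 <= c -> c * 98 <= 512 -> c * k%:R * (x / (4096 * l%:R)) <= x / 8.
Proof.
move=> x0 c0 c98; have -> : c * k%:R * (x / (4096 * l%:R)) = c * k%:R * x / (4096 * l%:R) by ring.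
rewrite ler_pdivrMr ?mulr_gt0 //.
have -> : x / 8 * (4096 * l%:R) = 512 * l%:R * x by field.
rewrite ler_wpM2r //; apply: le_trans (ler_wpM2l c0 kl) _.
by rewrite mulrA ler_pM2r.
Qed.

Lemma error_left : k%:R * (L * (a ^+ 2 / (4096 * la * l%:R))) * a <= eps / 8.
Proof.
have := @small_k 1 eps (ltW eps0) ler01; rewrite !mul1r => h.
apply: le_trans (h _); last by lra.
by rewrite le_eqVlt; apply/orP; left; apply/eqP; field; rewrite !gt_eqF.
Qed.

Lemma lambda_gt0 : 0 < la. Proof. by rewrite divr_gt0 ?mulr_gt0 ?exprn_gt0. Qed.

Lemma rate_ge : la <= s.
Proof. by rewrite /rate mulrDl lerDl divr_ge0 ?mulr_ge0 ?exprn_ge0 // ltW. Qed.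

Lemma rate_gt0 : 0 < s. Proof. exact: lt_le_trans lambda_gt0 rate_ge. Qed.

(** [Lbar a^5 / eps] is one of the two summands of the rate. This makes both the shift and the inner
    tolerance, which are divided by [s], small enough for [Lbar]. *)
Lemma mu_le : Lbar * a ^+ 5 / s <= eps.
Proof.
rewrite ler_pdivrMr ?rate_gt0 // /rate [leRHS]mulrC divfK ?gt_eqF // lerDr.
by rewrite mulr_ge0 ?exprn_ge0 // ltW.
Qed.

Lemma error_shift : 2 * a ^+ 2 * (Lbar * (a ^+ 2 / (16 * s))) * a <= eps / 8.
Proof.
have h := mu_le; have s0 := rate_gt0.
have -> : 2 * a ^+ 2 * (Lbar * (a ^+ 2 / (16 * s))) * a = Lbar * a ^+ 5 / s / 8.
  by move: s s0 => y y0; field; rewrite gt_eqF.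
by rewrite ler_pM2r // invr_gt0.
Qed.

Lemma error_core : 2 * a ^+ 2 * (k%:R * (Lbar * (2 * (a ^+ 2 / (4096 * s * l%:R))))) * a <= eps / 8.
Proof.
have h := mu_le; have s0 := rate_gt0.
have -> : 2 * a ^+ 2 * (k%:R * (Lbar * (2 * (a ^+ 2 / (4096 * s * l%:R))))) * a =
    4 * k%:R * (Lbar * a ^+ 5 / s / (4096 * l%:R)).
  by move: s s0 => y y0; field; rewrite !gt_eqF.
apply: le_trans (small_k _ _ _) _ => //; last by rewrite ler_pM2r // invr_gt0.
- by rewrite divr_ge0 ?(ltW s0) // mulr_ge0 // exprn_ge0 // ltW.
- lra.
Qed.

Lemma error_cross : 2 * a * L * (2 * (eps / (32 * L * a))) <= eps / 8.
Proof. by rewrite le_eqVlt; apply/orP; left; apply/eqP; field; rewrite !gt_eqF. Qed.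
End Bounds.

Section Counts.
Variables (a Phi : R).
Hypothesis a0 : 0 < a.
Hypothesis Phi0 : 0 < Phi.
Local Notation psi := (Phi / a ^+ 2).

(** The size demanded by the tolerance exceeds by far the one under which the moment recursion
    closes, because [s l >= 1]. *)
Lemma count_low (Q l c s : R) : 0 <= Q -> 1 <= s * l -> 80 * 2 ^+ 24 * Q * psi * (s * l) ^+ 2 <= c ->
  4 * Q * Phi <= c * a ^+ 2.
Proof.
move=> Q0 sl h; have a20 : 0 < a ^+ 2 by rewrite exprn_gt0.
apply: le_trans (ler_wpM2r (ltW a20) h).
have -> : 80 * 2 ^+ 24 * Q * psi * (s * l) ^+ 2 * a ^+ 2 =
    80 * 2 ^+ 24 * (Q * Phi) * (s * l) ^+ 2 by field; rewrite gt_eqF.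
have h2 : 1 <= (s * l) ^+ 2 by rewrite exprn_ege1.
have QP : 0 <= Q * Phi by rewrite mulr_ge0 // ltW.
apply: (@le_trans _ _ (80 * 2 ^+ 24 * (Q * Phi))); last first.
  by rewrite ler_peMr // mulr_ge0 // mulr_ge0 // exprn_ge0.
rewrite -(mulrA 4) ler_wpM2r //.
have : 1 <= 2 ^+ 24 :> R by rewrite exprn_ege1 // ler1n.
by move: (2 ^+ 24) => x; lra.
Qed.

Lemma count_high (Q l c s : R) : 0 < c -> 0 < s * l -> 80 * 2 ^+ 24 * Q * psi * (s * l) ^+ 2 <= c ->
  80 * Q * Phi * a ^+ 2 / c <= (a ^+ 2 / (4096 * s * l)) ^+ 2.
Proof.
move=> c0 sl h; rewrite ler_pdivrMr // -(mulrA 4096).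
apply: le_trans (ler_wpM2l (sqr_ge0 _) h).
rewrite le_eqVlt; apply/orP; left; apply/eqP.
have -> : 2 ^+ 24 = 4096 ^+ 2 :> R by ring.
by move: (s * l) sl => y y0; field; rewrite !gt_eqF.
Qed.
End Counts.
End Scales.

(** * Running time *)

Section Cost.
Variables (R : realType) (m n : nat) (phi : R) (A : 'M[R[i]]_(m, n)).
Variables (acc : SQ phi A) (acc' : SQ phi (A^t*)) (B : nat -> R).
Local Notation cost := (cst acc acc' B).
Local Notation c := (B 3).
Local Notation r := (B 2).
Local Notation N := (B 11).
Local Notation e := (B 13).
Local Notation q := (cost_q acc).
Local Notation sp := (cost_s acc + cost_p acc).
Local Notation sp' := (cost_s acc' + cost_p acc').
Hypothesis c1 : 1 <= c.
Hypothesis r1 : 1 <= r.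
Hypothesis N1 : 1 <= N.
Hypothesis e1 : 1 <= e.
Hypothesis B12 : B 12 = c * c.
Hypothesis B100 : 0 <= B 100.
Hypothesis B101 : 0 <= B 101.
Hypothesis B102 : 0 <= B 102.

Let q0 : 0 <= q. Proof. by case: (cost_ge0 acc). Qed.
Let s0 : 0 <= cost_s acc. Proof. by case: (cost_ge0 acc). Qed.
Let p0 : 0 <= cost_p acc. Proof. by case: (cost_ge0 acc). Qed.
Let nu0 : 0 <= cost_n acc. Proof. by case: (cost_ge0 acc). Qed.
Let s'0 : 0 <= cost_s acc'. Proof. by case: (cost_ge0 acc'). Qed.
Let p'0 : 0 <= cost_p acc'. Proof. by case: (cost_ge0 acc'). Qed.
Let c0 : 0 <= c. Proof. exact: le_trans ler01 c1. Qed.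
Let r0 : 0 <= r. Proof. exact: le_trans ler01 r1. Qed.
Let N0 : 0 <= N. Proof. exact: le_trans ler01 N1. Qed.
Let e0 : 0 <= e. Proof. exact: le_trans ler01 e1. Qed.
Let cc1 : 1 <= c * c. Proof. exact: mulr_ege1. Qed.
Let cc0 : 0 <= c * c. Proof. exact: le_trans ler01 cc1. Qed.
Let cc_c : c <= c * c. Proof. by rewrite ler_peMr. Qed.

Lemma cst_for x y a : cost (CFor x y a) = 5 + B y * (3 + cost a).
Proof. by rewrite /CFor /=; ring. Qed.

(** The overhead of a counted loop, five instructions once and three per iteration, is absorbed into
    the constant because both factors are at least one. *)
Lemma cst_for_le x y a K K' t : 1 <= B y -> 1 <= t -> K + 8 <= K' -> cost a <= K * t ->
  cost (CFor x y a) <= K' * (B y * t).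
Proof.
move=> By t1 KK h; have Bt : 0 <= B y * t by rewrite mulr_ge0 // (le_trans ler01).
apply: le_trans (ler_wpM2r Bt KK); rewrite cst_for.
have By0 : 0 <= B y by apply: le_trans By.
have : B y * cost a <= B y * (K * t) by rewrite ler_wpM2l.
have : 1 <= B y * t by rewrite mulr_ege1.
have : B y <= B y * t by rewrite ler_peMr.
rewrite mulrDr mulrDl (mulrCA K).
by move: (B y * (K * t)) (B y * cost a) (B y * t) => x1 x2 x3; lra.
Qed.

Definition silent (s : seq instr) : bool :=
  (0 < size s)%N && all (fun i => if i is Ask _ _ then false else true) s.

Lemma cst_blk s : silent s -> cost (blk s) = (size s)%:R.
Proof.
case: s => // i s; rewrite /silent /=.
elim: s i => [|j s IH] i /= /andP[i0 s0']; first by case: i i0 => //=; rewrite addr0.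
rewrite (IH j s0') -[in RHS]natr1 addrC; congr (_ + _).
by case: i i0 => //=; rewrite addr0.
Qed.

Lemma cst_seq a b : cost (CSeq a b) = cost a + cost b. Proof. by []. Qed.
Lemma cst_ins i : cost (CIns i) = 1 + icost acc acc' i. Proof. by []. Qed.
Lemma cst_if cd a : cost (CIf cd a) = 4 + cost a. Proof. by []. Qed.
Lemma cst_while tg cd a : cost (CWhile tg cd a) = 4 + B tg * (1 + cost a). Proof. by []. Qed.

Opaque blk cst CFor.

Lemma cst_load : cost load_constants = 18 + cost_n acc.
Proof. rewrite /load_constants !(cst_blk, cst_seq, cst_ins) //=. lra. Qed.

Lemma cst_prelude : cost prelude <= 200 + cost_n acc + 10 * (B 100 + B 101 + B 102).
Proof.
rewrite /prelude /find_scale /set_target /set_parameters !(cst_load, cst_blk, cst_while, cst_seq) //=.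
by move: B100 B101 B102; lra.
Qed.

Lemma cst_sketch_col : cost (CFor 20 3 (sketch_body OnAdjoint 3 1)) <= 30 * (c * (1 + sp')).
Proof.
have h : cost (sketch_body OnAdjoint 3 1) <= 20 * (1 + sp').
  by rewrite /sketch_body !(cst_blk, cst_seq, cst_ins) //=; move: s'0 p'0; lra.
apply: cst_for_le c1 _ _ h; [by move: s'0 p'0; lra|lra].
Qed.

Lemma cst_sketch_row : cost (CFor 20 2 (sketch_body OnMatrix 2 0)) <= 30 * (r * (1 + sp)).
Proof.
have h : cost (sketch_body OnMatrix 2 0) <= 20 * (1 + sp).
  by rewrite /sketch_body !(cst_blk, cst_seq, cst_ins) //=; move: s0 p0; lra.
apply: cst_for_le r1 _ _ h; [by move: s0 p0; lra|lra].
Qed.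

Lemma cst_inner : cost (CFor 20 11 inner_body) <= 100 * (N * (sp' + c * q + c * c)).
Proof.
have q1 : 1 <= 1 + q by rewrite lerDl.
have h1 : cost (CFor 24 3 read_row) <= 16 * (c * (1 + q)).
  apply: (@cst_for_le _ _ _ 8) => //; first by lra.
  by rewrite /read_row !(cst_blk, cst_seq, cst_ins) //=; move: q0; lra.
have h2 : cost (CFor 24 3 (CFor 25 3 rank_one)) <= 30 * (c * (c * 1)).
  have h : cost (CFor 25 3 rank_one) <= 22 * (c * 1).
    by apply: (@cst_for_le _ _ _ 14) => //; rewrite ?cst_blk //=; lra.
  by apply: (@cst_for_le _ _ _ 22) => //; rewrite ?mulr1 //; lra.
have sp'0 : 0 <= sp' by rewrite addr_ge0.
have cq0 : 0 <= c * q by rewrite mulr_ge0.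
apply: (@cst_for_le _ _ _ 92) => //; [by move: sp'0 cq0 cc1; lra|lra|].
have h : cost inner_body = 18 + sp' + cost (CFor 24 3 read_row) + cost (CFor 24 3 (CFor 25 3 rank_one)).
  rewrite /inner_body /inner_update; move: (CFor 24 3 read_row) (CFor 24 3 (CFor 25 3 rank_one)) => X Y.
  by rewrite !(cst_blk, cst_seq, cst_ins) //=; lra.
by move: h1 h2 cc_c cc1; rewrite h mulr1 mulrDr mulr1; lra.
Qed.

Lemma cst_cross : cost (CFor 20 2 cross_row) <= 100 * (r * (c * (1 + q))).
Proof.
have q1 : 1 <= 1 + q by rewrite lerDl.
have h1 : cost (CFor 24 3 cross_entry) <= 20 * (c * (1 + q)).
  apply: (@cst_for_le _ _ _ 12) => //; first by lra.
  by rewrite /cross_entry !(cst_blk, cst_seq, cst_ins) //=; move: q0; lra.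
have cq : 1 <= c * (1 + q) by rewrite mulr_ege1.
apply: (@cst_for_le _ _ _ 92) => //; first by lra.
move: h1; rewrite /cross_row; move: (CFor 24 3 _) => X h1.
rewrite !(cst_blk, cst_if, cst_seq, cst_ins) //=.
by move: h1 cq; lra.
Qed.

Lemma cst_row_sum x : cost (row_sum x) <= 40 * c.
Proof.
have h : cost (CFor 25 3 (blk [:: IMul 26 31 3; IAdd 26 26 25; ZGet 21 4 26; ZConj 22 21;
    ZMul 21 21 22; ZAdd 20 20 21])) <= 14 * (c * 1).
  by apply: (@cst_for_le _ _ _ 6) => //; rewrite ?cst_blk //=; lra.
rewrite /row_sum (cst_seq (blk _)) (cst_seq (CFor _ _ _)) !cst_blk //=.
by move: h c1; rewrite mulr1; lra.
Qed.

Lemma cst_best_row : cost best_row <= 30 * c.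
Proof.
have h : cost (CFor 24 3 (CSeq (CIns (ZGet 21 8 24)) (keep_max 29))) <= 18 * (c * 1).
  apply: (@cst_for_le _ _ _ 10) => //; first by lra.
  by rewrite /keep_max !(cst_blk, cst_if, cst_seq, cst_ins) //=; lra.
rewrite /best_row (cst_seq (blk _)) cst_blk //=.
by move: h c1; rewrite mulr1; lra.
Qed.

Lemma cst_best_col : cost best_col <= 40 * c.
Proof.
have h : cost (CFor 24 3
    (CSeq (blk [:: IMul 26 29 3; IAdd 26 26 24; ZGet 21 4 26; ZConj 22 21; ZMul 21 21 22])
     (CSeq (CIf (LtI 24 29) (keep_max 30)) (CIf (LtI 29 24) (keep_max 30))))) <= 34 * (c * 1).
  apply: (@cst_for_le _ _ _ 26) => //; first by lra.
  by rewrite /keep_max !(cst_blk, cst_if, cst_seq) //=; lra.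
rewrite /best_col (cst_seq (blk _)) cst_blk //=.
by move: h c1; rewrite mulr1; lra.
Qed.

Lemma cst_rotate_cols b : cost (rotate_cols b) <= 30 * c.
Proof.
have -> : 30 * c = 30 * (c * 1) by rewrite mulr1.
by apply: (@cst_for_le _ _ _ 22) => //; rewrite ?cst_blk //=; lra.
Qed.

Lemma cst_rotate_rows : cost rotate_rows <= 30 * c.
Proof.
have -> : 30 * c = 30 * (c * 1) by rewrite mulr1.
by apply: (@cst_for_le _ _ _ 22) => //; rewrite ?cst_blk //=; lra.
Qed.

Lemma cst_jacobi_step : cost jacobi_step <= 300 * c.
Proof.
rewrite /jacobi_step !(cst_seq best_row, cst_seq best_col, cst_if, cst_seq angle,
  cst_seq (rotate_cols _), cst_seq rotate_rows, cst_seq (row_sum _)).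
have ha : cost angle = 24 by rewrite cst_blk.
move: ha cst_best_row cst_best_col (cst_rotate_cols 4) (cst_rotate_cols 7) cst_rotate_rows
  (cst_row_sum 29) (cst_row_sum 30) c1.
by lra.
Qed.

Lemma cst_jacobi : cost jacobi <= 400 * (e * (c * c * c)).
Proof.
have h1 : cost (CFor 24 3 (blk [:: IMul 26 24 3; IAdd 26 26 24; ZPut 7 26 8])) <= 11 * (c * 1).
  by apply: (@cst_for_le _ _ _ 3) => //; rewrite ?cst_blk //=; lra.
have h2 : cost (CFor 24 3 (row_sum 24)) <= 48 * (c * c).
  by apply: (@cst_for_le _ _ _ 40) => //; [lra|apply: cst_row_sum].
have h3 : cost (CFor 27 13 (CFor 28 12 jacobi_step)) <= 316 * (e * (c * c * c)).
  have ccc : 1 <= c * c * c by rewrite mulr_ege1.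
  apply: (@cst_for_le _ _ _ 308) => //; first by lra.
  rewrite -{1}B12; apply: (@cst_for_le _ _ _ 300) => //; [by rewrite B12|lra|].
  exact: cst_jacobi_step.
have h4 : c * c <= e * (c * c * c).
  apply: (@le_trans _ _ (c * c * c)); first by rewrite ler_peMr.
  by rewrite ler_peMl // mulr_ge0.
rewrite /jacobi (cst_seq (CFor _ _ _)) (cst_seq (CFor _ _ _)).
move: h1 h2 h3 h4 cc_c cc0; rewrite mulr1.
by lra.
Qed.

Lemma cst_spectral : cost spectral_values <= 20 * c.
Proof.
have -> : 20 * c = 20 * (c * 1) by rewrite mulr1.
by apply: (@cst_for_le _ _ _ 12) => //; rewrite ?cst_blk //=; lra.
Qed.

Lemma cst_core : cost core_matrix <= 60 * (c * (c * c)).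
Proof.
rewrite /core_matrix; apply: (@cst_for_le _ _ _ 52) => //; first by lra.
apply: (@cst_for_le _ _ _ 44) => //; first by lra.
have h : cost (CFor 25 3 (blk [:: IMul 26 20 3; IAdd 26 26 25; ZGet 21 7 26; ZGet 22 9 25;
   ZMul 21 21 22; IMul 26 24 3; IAdd 26 26 25; ZGet 22 7 26; ZConj 22 22; ZMul 21 21 22;
   ZAdd 20 20 21])) <= 19 * (c * 1).
  by apply: (@cst_for_le _ _ _ 11) => //; rewrite ?cst_blk //=; lra.
rewrite (cst_seq (CIns _)) (cst_seq (CFor _ _ _)) cst_ins [cost (blk [:: _; _; _])]cst_blk //=.
by move: h c1; rewrite mulr1; lra.
Qed.

Lemma cst_output : cost output_matrix <= 60 * (c * (r * c)).
Proof.
rewrite /output_matrix; apply: (@cst_for_le _ _ _ 52) => //; [exact: mulr_ege1|lra|].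
apply: (@cst_for_le _ _ _ 44) => //; first by lra.
have h : cost (CFor 25 3 (blk [:: IMul 26 20 3; IAdd 26 26 25; ZGet 21 10 26;
       IMul 26 24 3; IAdd 26 26 25; ZGet 22 5 26; ZConj 22 22; ZMul 21 21 22; ZAdd 20 20 21]))
    <= 17 * (c * 1).
  by apply: (@cst_for_le _ _ _ 9) => //; rewrite ?cst_blk //=; lra.
rewrite (cst_seq (CIns _)) (cst_seq (CFor _ _ _)) cst_ins
  [cost (blk [:: _; _; _; _; _])]cst_blk //=.
by move: h c1; rewrite mulr1; lra.
Qed.

Lemma cst_svt : cost svt_cmd <= 200 + cost_n acc + 10 * (B 100 + B 101 + B 102)
  + 30 * (c * (1 + sp')) + 30 * (r * (1 + sp)) + 100 * (N * (sp' + c * q + c * c))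
  + 100 * (r * (c * (1 + q))) + 400 * (e * (c * c * c)) + 20 * c + 60 * (c * (c * c))
  + 60 * (c * (r * c)).
Proof.
rewrite /svt_cmd /finish (cst_seq prelude) (cst_seq (CSeq _ _)) (cst_seq (CSeq _ _))
  (cst_seq (CFor _ _ _)) (cst_seq (CFor _ _ _)) (cst_seq jacobi) (cst_seq spectral_values)
  (cst_seq core_matrix).
move: cst_prelude cst_sketch_col cst_sketch_row cst_inner cst_cross cst_jacobi cst_spectral
  cst_core cst_output.
by lra.
Qed.
End Cost.

Section Time.
Variable R : realFieldType.
Variables (c r N e x y q s s' p p' nu Xc Xs H : R).
Hypothesis c1 : 0 <= c.
Hypothesis r1 : 0 <= r.
Hypothesis N1 : 0 <= N.
Hypothesis e1 : 0 <= e.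
Hypothesis Xc1 : 1 <= Xc.
Hypothesis XcXs : Xc <= Xs.
Hypothesis H1 : 1 <= H.
Hypothesis cH : c <= H * Xc.
Hypothesis rH : r <= H * Xs.
Hypothesis NH : N <= H * Xs.
Hypothesis eH : e <= 168 * H.
Hypothesis xyN : x + y <= N.
Hypothesis q0 : 0 <= q.
Hypothesis s0 : 0 <= s.
Hypothesis s'0 : 0 <= s'.
Hypothesis p0 : 0 <= p.
Hypothesis p'0 : 0 <= p'.
Hypothesis nu0 : 0 <= nu.
Local Notation Z := (H ^+ 4).
Local Notation V := (Xs * Xc ^+ 2).
Local Notation Q := (Xs * Xc * q).

Let H0 : 0 <= H. Proof. exact: le_trans ler01 H1. Qed.
Let Xc0 : 0 <= Xc. Proof. exact: le_trans ler01 Xc1. Qed.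
Let Xs1 : 1 <= Xs. Proof. exact: le_trans Xc1 XcXs. Qed.
Let Xs0 : 0 <= Xs. Proof. exact: le_trans ler01 Xs1. Qed.

Let HZ k : (k <= 4)%N -> H ^+ k <= Z.
Proof. by move=> h; apply: ler_weXn2l. Qed.

Let up k (u v : R) : (k <= 4)%N -> 0 <= v -> u <= H ^+ k * v -> u <= Z * v.
Proof. by move=> h v0 h2; apply: le_trans h2 _; rewrite ler_wpM2r // HZ. Qed.

Let rN z t : 0 <= t -> z <= H * Xs -> z * t <= Z * (Xs * t).
Proof.
move=> t0 zH; apply: (@up 1) => //; first by rewrite mulr_ge0.
by rewrite expr1 mulrA ler_wpM2r.
Qed.

Let XcV : Xc * Xc <= V. Proof. by rewrite expr2 mulrA ler_wpM2r // ler_peMl. Qed.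

(** [H] is a common constant and polylogarithmic factor. The power four comes from the rotations,
    three sizes times the number of rounds, and these also dominate the constant, since
    [400 * 168 = 67200]. *)
Lemma time_algebra :
  200 + nu + 10 * (x + y + N) + 30 * (c * (1 + (s' + p'))) + 30 * (r * (1 + (s + p)))
  + 100 * (N * (s' + p' + c * q + c * c)) + 100 * (r * (c * (1 + q)))
  + 400 * (e * (c * c * c)) + 20 * c + 60 * (c * (c * c)) + 60 * (c * (r * c))
  <= 70 * 1000 * Z * (Xs * (s + s' + p + p') + Q + V + nu).
Proof.
have V1 : 1 <= V by rewrite mulr_ege1 // exprn_ege1.
have V0 : 0 <= V := le_trans ler01 V1.
have XsV : Xs <= V by rewrite ler_peMr // exprn_ege1.
have Z1 : 1 <= Z by rewrite exprn_ege1.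
have Z0 : 0 <= Z := le_trans ler01 Z1.
have Q0 : 0 <= Q by rewrite !mulr_ge0.
have ZV1 : 1 <= Z * V by rewrite mulr_ege1.
have cXs : c <= H * Xs by apply: le_trans cH _; rewrite ler_wpM2l.
have ZXV : Z * Xs <= Z * V by rewrite ler_wpM2l.
have lin z : z <= H * Xs -> z <= Z * V.
  by move=> h; have := rN ler01 h; rewrite !mulr1 => h2; apply: le_trans ZXV.
have a1 := lin _ NH; have a2 := lin _ cXs; have a3 := lin _ rH.
have sp0 : 0 <= s + p by rewrite addr_ge0.
have sp'0 : 0 <= s' + p' by rewrite addr_ge0.
have b1 := rN sp'0 cXs; have b2 := rN sp0 rH; have b3 := rN sp'0 NH.
have two z : 0 <= z -> z <= H * Xs -> z * c <= Z * V /\ z * (c * q) <= Z * Q.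
  move=> z0 zH; have zc : z * c <= H ^+ 2 * (Xs * Xc).
    have -> : H ^+ 2 * (Xs * Xc) = H * Xs * (H * Xc) by ring.
    by apply: ler_pM.
  have h2 := HZ (ltac:(done) : (2 <= 4)%N).
  split.
    apply: le_trans zc _; apply: ler_pM; rewrite ?exprn_ge0 ?mulr_ge0 //.
    by rewrite ler_wpM2l // expr2 ler_peMr.
  rewrite [leLHS]mulrA [leRHS]mulrA.
  rewrite ler_wpM2r //; apply: le_trans zc _.
  by rewrite ler_wpM2r // mulr_ge0.
have [c2 c3] := two _ N1 NH; have [c4 c5] := two _ r1 rH.
have three z : 0 <= z -> z <= H * Xs -> z * (c * c) <= H ^+ 3 * V.
  move=> z0 zH; have -> : H ^+ 3 * V = H * Xs * ((H * Xc) * (H * Xc)) by ring.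
  by do 2?[apply: ler_pM => //]; rewrite mulr_ge0.
have u3 z : 0 <= z -> z <= H * Xs -> z * (c * c) <= Z * V.
  by move=> z0 zH; apply: (@up 3) => //; apply: three.
have d1 := u3 _ N1 NH; have d2 := u3 _ c1 cXs; have d3 := u3 _ r1 rH.
have ec : e * (c * c * c) <= 168 * (Z * V).
  have -> : 168 * (Z * V) = 168 * H * (H ^+ 3 * V) by ring.
  apply: ler_pM => //; first by rewrite !mulr_ge0.
  by rewrite -mulrA; apply: three.
have n1 : nu <= Z * nu by rewrite ler_peMl.
have n0 : 0 <= Z * nu by rewrite mulr_ge0.
have zq : 0 <= Z * Q by rewrite mulr_ge0.
have zs : 0 <= Z * (Xs * (s + p)) by rewrite !mulr_ge0.
have zs' : 0 <= Z * (Xs * (s' + p')) by rewrite !mulr_ge0.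
have -> : 70 * 1000 * Z * (Xs * (s + s' + p + p') + Q + V + nu) =
  70 * 1000 * (Z * (Xs * (s + p)) + Z * (Xs * (s' + p')) + Z * Q + Z * V + Z * nu) by ring.
have -> : N * (s' + p' + c * q + c * c) = N * (s' + p') + N * (c * q) + N * (c * c) by ring.
have -> : r * (c * (1 + q)) = r * c + r * (c * q) by ring.
have -> : c * (1 + (s' + p')) = c + c * (s' + p') by ring.
have -> : r * (1 + (s + p)) = r + r * (s + p) by ring.
have -> : c * (r * c) = r * (c * c) by ring.
move: a1 a2 a3 b1 b2 b3 c2 c3 c4 c5 d1 d2 d3 ec n1 n0 zq zs zs' ZV1 xyN nu0.
move: (Z * V) (Z * Q) (Z * nu) (Z * (Xs * (s + p))) (Z * (Xs * (s' + p'))) (N * (s' + p'))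
  (N * (c * q)) (N * (c * c)) (r * (c * q)) (r * c) (c * (s' + p')) (r * (s + p)) (r * (c * c))
  (e * _) (c * (c * c)) => *; lra.
Qed.
End Time.

Lemma mulr3_ge0 (R : numDomainType) (x y z : R) : 0 <= x -> 0 <= y -> 0 <= z -> 0 <= x * y * z.
Proof. by move=> x0 y0 z0; rewrite !mulr_ge0. Qed.

Lemma count_ge0 (R : numDomainType) : 0 <= 2 ^+ 24 * (480 * 216) :> R.
Proof. by rewrite mulr_ge0 ?exprn_ge0 // mulr_ge0. Qed.

Section Scaling.
Variable R : realType.
Variables (phi a F L Lbar eps delta : R).
Hypothesis phi1 : 1 <= phi.
Hypothesis a0 : 0 < a.
Hypothesis aF : a <= F.
Hypothesis L0 : 0 < L.
Hypothesis Lb0 : 0 <= Lbar.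
Hypothesis eps0 : 0 < eps.
Hypothesis epsL : eps <= L * a ^+ 3.
Hypothesis delta0 : 0 < delta.
Hypothesis delta1 : delta < 1.
Local Notation d := (log_inv delta).
Local Notation psi := (phi * F ^+ 2 / a ^+ 2).
Local Notation la := (L * a ^+ 3 / eps).
Local Notation s := (rate L Lbar eps a).
Local Notation Xc := (col_bound phi L a F eps d).
Local Notation Xr := (row_bound phi L a F eps d).
Let mu := Lbar * a ^+ 5 / eps.
(** The size of the second sample up to constants and logarithms. In terms of it the time bound
    factors, as [time_boundE] shows. *)
Definition inner_bound := mu ^+ 2 * phi * psi * d + Xr.
Local Notation Xs := inner_bound.

Lemma log_inv_ge1 : 1 <= d. Proof. by rewrite /log_inv le_max lexx. Qed.
Lemma lambda_ge1 : 1 <= la. Proof. by rewrite ler_pdivlMr // mul1r. Qed.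

Lemma phi_psi : phi <= psi.
Proof.
have phi0 : 0 <= phi := le_trans ler01 phi1.
have F0 : 0 <= F := ltW (lt_le_trans a0 aF).
by rewrite -mulrA ler_peMr // ler_pdivlMr ?exprn_gt0 // mul1r lerXn2r // nnegrE ltW.
Qed.

Lemma psi_ge1 : 1 <= psi. Proof. exact: le_trans phi_psi. Qed.
Lemma rate_ge1 : 1 <= s. Proof. exact: le_trans lambda_ge1 (rate_ge L a0 Lb0 eps0). Qed.

Lemma col_boundE : Xc = la ^+ 2 * phi * psi * d.
Proof. by rewrite /col_bound; field; rewrite !gt_eqF. Qed.

Lemma row_boundE : Xr = la ^+ 2 * psi ^+ 2 * d.
Proof. by rewrite /row_bound; field; rewrite !gt_eqF. Qed.

Lemma time_boundE cs cs' cp cp' q nu :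
  time_bound phi L Lbar a F eps d cs cs' cp cp' q nu =
  Xs * (cs + cs' + cp + cp') + Xs * Xc * q + Xs * Xc ^+ 2 + nu.
Proof.
by rewrite /time_bound /inner_bound /mu /row_bound /col_bound; field; rewrite !gt_eqF.
Qed.

Let dla : 1 <= la ^+ 2. Proof. by rewrite exprn_ege1 // lambda_ge1. Qed.
Let d1 := log_inv_ge1.
Let psi1 := psi_ge1.

Lemma col_bound_ge : psi * la ^+ 2 <= Xc.
Proof.
rewrite col_boundE; have -> : la ^+ 2 * phi * psi * d = psi * la ^+ 2 * (phi * d) by ring.
rewrite ler_peMr ?mulr_ege1 // mulr_ge0 //; first exact: le_trans ler01 psi1.
exact: le_trans ler01 dla.
Qed.

Lemma col_bound_ge1 : 1 <= Xc.
Proof. by apply: le_trans col_bound_ge; rewrite mulr_ege1. Qed.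

Lemma col_row : Xc <= Xr.
Proof.
have la0 : 0 <= la ^+ 2 := le_trans ler01 dla.
have p0 : 0 <= psi := le_trans ler01 psi1.
rewrite col_boundE row_boundE; move: la0 p0 phi_psi (le_trans ler01 d1).
move: (la ^+ 2) psi d => x y z x0 y0 py z0.
by rewrite ler_wpM2r // expr2 mulrA ler_wpM2r // ler_wpM2l.
Qed.

Let psi0 : 0 <= psi. Proof. exact: le_trans ler01 psi1. Qed.
Let d0 : 0 <= d. Proof. exact: le_trans ler01 d1. Qed.
Let phi0 : 0 <= phi. Proof. exact: le_trans ler01 phi1. Qed.

Lemma row_inner : Xr <= Xs.
Proof. by rewrite lerDr; apply: mulr_ge0 => //; apply: mulr3_ge0 => //; apply: sqr_ge0. Qed.

(** The rate is [la + mu], whose square is at most [2 (la^2 + mu^2)]; the missing factors [phi] and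
    [psi] are at least one. *)
Lemma rate_inner : psi * s ^+ 2 * d <= 2 * Xs.
Proof.
have h : s ^+ 2 <= 2 * (mu ^+ 2 + la ^+ 2).
  have -> : s = la + mu by rewrite /rate mulrDl.
  have := sqr_ge0 (la - mu); rewrite sqrrB sqrrD.
  by move: (la ^+ 2) (mu ^+ 2) (la * mu) => x y z; lra.
apply: (@le_trans _ _ (psi * (2 * (mu ^+ 2 + la ^+ 2)) * d)).
  by rewrite ler_wpM2r // ler_wpM2l.
have m0 : 0 <= mu ^+ 2 * psi * d := mulr3_ge0 (sqr_ge0 _) psi0 d0.
have l0 : 0 <= la ^+ 2 * psi * d := mulr3_ge0 (sqr_ge0 _) psi0 d0.
rewrite /inner_bound row_boundE.
have -> : psi * (2 * (mu ^+ 2 + la ^+ 2)) * d = 2 * (mu ^+ 2 * psi * d + la ^+ 2 * psi * d) by ring.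
have -> : mu ^+ 2 * phi * psi * d + la ^+ 2 * psi ^+ 2 * d =
  mu ^+ 2 * psi * d * phi + la ^+ 2 * psi * d * psi by ring.
by rewrite ler_pM2l // lerD // ler_peMr.
Qed.

Local Notation dd := (depth delta).
Local Notation l1 := (scale (psi * (1 + la))).
Local Notation ell := (scale (psi * (1 + s))).

Lemma trials_le (k : nat) : (0 < k)%N -> (dd + k)%:R <= 6 * d * k%:R.
Proof.
move=> k0; have k1 : 1 <= k%:R :> R by rewrite ler1n.
rewrite natrD; have h := depth_log delta0 delta1.
have h1 : d <= d * k%:R by rewrite ler_peMr.
have h2 : k%:R <= d * k%:R by rewrite ler_peMl.
by move: h h1 h2; rewrite -mulrA; lra.
Qed.

Lemma double_scale x : 1 <= x -> psi * (1 + x) <= 2 * (psi * x ^+ 2).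
Proof.
move=> x1; have x2 : x <= x ^+ 2 by rewrite expr2 ler_peMl // (le_trans ler01).
by rewrite [leRHS]mulrCA; apply: ler_wpM2l => //; move: x1 x2; lra.
Qed.

Lemma scale_arg_ge1 x : 1 <= x -> 1 <= psi * (1 + x).
Proof. by move=> x1; rewrite mulr_ege1 //; move: x1; lra. Qed.

Lemma scale_col : l1%:R <= 6 * (1 + ln (1 + Xc)).
Proof.
apply: scale_log; first exact: scale_arg_ge1 lambda_ge1.
apply: le_trans (double_scale lambda_ge1) _.
have := col_bound_ge; have := col_bound_ge1; lra.
Qed.

(** [480] is [80] times the [6] of [trials_le], and [216] is the cube of the [6] of [scale_col]. The
    scale occurs to the third power, twice through the tolerance and once through the order of the
    moment. *)
Lemma col_count (c : R) : 2 ^+ 24 * (480 * 216) * Xc * polylog 3 Xc <= c ->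
  80 * 2 ^+ 24 * (dd + l1)%:R * psi * (la * l1%:R) ^+ 2 <= c.
Proof.
move=> h; apply: le_trans h; set P := 1 + ln (1 + Xc).
have hl := scale_col; rewrite -/P in hl.
have l0 : 0 <= l1%:R :> R by [].
have h3 : l1%:R ^+ 3 <= (6 * P) ^+ 3 by rewrite lerXn2r ?nnegrE // (le_trans l0).
have P0 : 0 <= P ^+ 3 by rewrite exprn_ge0 //; move: l0 hl; lra.
have X0 : 0 <= psi * la ^+ 2 * d := mulr3_ge0 psi0 (sqr_ge0 _) d0.
have X1 : psi * la ^+ 2 * d <= Xc.
  rewrite col_boundE; have -> : la ^+ 2 * phi * psi * d = psi * la ^+ 2 * d * phi by ring.
  by rewrite ler_peMr.
apply: (@le_trans _ _ (80 * 2 ^+ 24 * (6 * d * l1%:R) * psi * (la * l1%:R) ^+ 2)).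
  rewrite ler_wpM2r ?sqr_ge0 // ler_wpM2r // ler_wpM2l ?trials_le // mulr_ge0 // exprn_ge0 //.
have -> : 80 * 2 ^+ 24 * (6 * d * l1%:R) * psi * (la * l1%:R) ^+ 2 =
  2 ^+ 24 * 480 * (psi * la ^+ 2 * d) * l1%:R ^+ 3 by ring.
apply: (@le_trans _ _ (2 ^+ 24 * 480 * (psi * la ^+ 2 * d) * (6 * P) ^+ 3)).
  by rewrite ler_wpM2l // mulr_ge0 // mulr_ge0 // exprn_ge0.
have -> : 2 ^+ 24 * 480 * (psi * la ^+ 2 * d) * (6 * P) ^+ 3 =
  2 ^+ 24 * (480 * 216) * (psi * la ^+ 2 * d) * P ^+ 3 by ring.
by rewrite /polylog -/P ler_wpM2r // ler_wpM2l // count_ge0.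
Qed.

(** Without a dimension factor in the tail, [dd] moments suffice, so only [d] has to be covered; the
    polylogarithm is bounded below by [1]. *)
Lemma row_count (r : R) : 2 ^+ 24 * (480 * 216) * Xr * polylog 3 Xr <= r ->
  0 < r -> 1600 * dd%:R * (phi * F ^+ 2) ^+ 2 / r <= (eps / (32 * L * a)) ^+ 2.
Proof.
move=> h r0; rewrite ler_pdivrMr //.
apply: le_trans (ler_wpM2l (sqr_ge0 _) h).
have Xr1 : 1 <= Xr := le_trans col_bound_ge1 col_row.
have pl : 1 <= polylog 3 Xr by rewrite exprn_ege1 // lerDl ln_ge0 // lerDl (le_trans ler01).
have Xr0 : 0 <= Xr := le_trans ler01 Xr1.
have hd := depth_log delta0 delta1.
apply: (@le_trans _ _ ((eps / (32 * L * a)) ^+ 2 * (2 ^+ 24 * (480 * 216) * Xr))); last first.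
  by rewrite ler_wpM2l ?sqr_ge0 // ler_peMr //; apply: mulr_ge0 => //; apply: count_ge0.
have -> : (eps / (32 * L * a)) ^+ 2 * (2 ^+ 24 * (480 * 216) * Xr) =
  (2 ^+ 14 * (480 * 216)) * d * (phi * F ^+ 2) ^+ 2.
  rewrite row_boundE (_ : 2 ^+ 24 = 32 ^+ 2 * 2 ^+ 14 :> R); last by ring.
  by move: (2 ^+ 14) => t; field; rewrite !gt_eqF.
rewrite ler_wpM2r ?sqr_ge0 //.
have : 1 <= 2 ^+ 14 :> R by rewrite exprn_ege1 // ler1n.
have : d <= 2 ^+ 14 * d by rewrite ler_peMl // exprn_ege1 // ler1n.
by move: hd d1; rewrite mulrAC; move: (2 ^+ 14 * d) => x; lra.
Qed.

Local Notation T := (inner_target dd ell s psi).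

Lemma inner_count : 80 * 2 ^+ 24 * (2 * (dd + ell)%:R) * psi * (s * ell%:R) ^+ 2 <= (inner_size T)%:R.
Proof.
have := doublings_ge T (ltr01 : 0 < 1 :> R); rewrite mulr1 -natrX; apply: le_trans.
rewrite le_eqVlt; apply/orP; left; apply/eqP; rewrite /inner_target.
by rewrite (_ : 2 ^+ 24 = 64 ^+ 4 :> R); [ring|ring].
Qed.

Let ell1 : 1 <= ell%:R :> R. Proof. by rewrite ler1n. Qed.

Lemma target_ge : (dd + ell)%:R <= T.
Proof.
have -> : T = (dd + ell)%:R * (64 ^+ 4 * 160 * (psi * (s * s) * (ell%:R * ell%:R))).
  by rewrite /inner_target; ring.
rewrite ler_peMr //; apply: mulr_ege1; first by rewrite mulr_ege1 ?exprn_ege1 // ler1n.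
apply: mulr_ege1; last exact: mulr_ege1.
by apply: mulr_ege1 => //; apply: mulr_ege1; apply: rate_ge1.
Qed.

Lemma depth_le_inner : dd%:R + ell%:R <= (inner_size T)%:R :> R.
Proof.
have := doublings_ge T (ltr01 : 0 < 1 :> R); rewrite mulr1 -natrX; apply: le_trans.
by rewrite -natrD target_ge.
Qed.

Lemma inner_size_le : (inner_size T)%:R <= 2 * T.
Proof.
have T1 : 1 <= T by apply: le_trans target_ge; rewrite ler1n addn_gt0 orbC.
rewrite /inner_size natrX; case E : (doublings 1 T) => [|w].
  by rewrite expr0; move: T1; lra.
have := @doublings_min _ 1 T w ltr01; rewrite E ltnSn mulr1 => /(_ isT) /ltW h.
by rewrite exprS ler_wpM2l.
Qed.

Variable B : R.
Hypothesis BX : Xs <= B.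
Local Notation P := (1 + ln (1 + B)).

Lemma ell_log : ell%:R <= 6 * P.
Proof.
apply: scale_log; first exact: scale_arg_ge1 rate_ge1.
apply: le_trans (double_scale rate_ge1) _.
have h := rate_inner; have h2 : psi * s ^+ 2 <= psi * s ^+ 2 * d.
  by rewrite ler_peMr // mulr_ge0 // sqr_ge0.
by move: h h2 BX; lra.
Qed.

(** Beyond the [2^24] of the target, one factor [2] is the rounding to a power of two and one is
    that of [rate_inner]; [960] is [160 * 6]. *)
Lemma inner_log : (inner_size T)%:R <= 2 ^+ 26 * (960 * 216) * Xs * P ^+ 3.
Proof.
apply: le_trans inner_size_le _.
have hl := ell_log.
have l0 : 0 <= ell%:R :> R by [].
have h3 : ell%:R ^+ 3 <= (6 * P) ^+ 3 by rewrite lerXn2r ?nnegrE // (le_trans l0).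
have P0 : 0 <= P ^+ 3 by rewrite exprn_ge0 //; move: l0 hl; lra.
have X0 : 0 <= psi * s ^+ 2 * d := mulr3_ge0 psi0 (sqr_ge0 _) d0.
have -> : T = 2 ^+ 24 * 160 * psi * s ^+ 2 * ell%:R ^+ 2 * (dd + ell)%:R.
  by rewrite /inner_target (_ : 2 ^+ 24 = 64 ^+ 4 :> R); [ring|ring].
apply: (@le_trans _ _ (2 * (2 ^+ 24 * 160 * psi * s ^+ 2 * ell%:R ^+ 2 * (6 * d * ell%:R)))).
  rewrite ler_wpM2l // ler_wpM2l ?trials_le //.
  apply: (mulr_ge0 _ (sqr_ge0 _)); apply: (mulr_ge0 _ (sqr_ge0 _)); apply: mulr_ge0 => //.
  by rewrite mulr_ge0 ?exprn_ge0.
have -> : 2 * (2 ^+ 24 * 160 * psi * s ^+ 2 * ell%:R ^+ 2 * (6 * d * ell%:R)) =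
  2 ^+ 25 * 960 * (psi * s ^+ 2 * d) * ell%:R ^+ 3 by ring.
apply: (@le_trans _ _ (2 ^+ 25 * 960 * (2 * Xs) * (6 * P) ^+ 3)).
  have k0 : 0 <= 2 ^+ 25 * 960 :> R by rewrite mulr_ge0 ?exprn_ge0.
  apply: ler_pM => //; [exact: mulr_ge0|by rewrite exprn_ge0|].
  by rewrite ler_wpM2l ?rate_inner.
rewrite le_eqVlt; apply/orP; left; apply/eqP; ring.
Qed.
End Scaling.

Lemma double_both (R : realFieldType) (x y z : R) : 2 * z <= y * x -> 4 * z <= y * (2 * x).
Proof. by lra. Qed.

Lemma quadruple_both (R : realFieldType) (Q Phi N w : R) : 0 <= Q * Phi ->
  4 * (2 * Q) * Phi <= N * w -> 4 * Q * Phi <= N * (2 * w).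
Proof. by lra. Qed.

Lemma le_double (R : realFieldType) (x : R) : 0 < x -> x <= 2 * x.
Proof. by lra. Qed.

Lemma rounds_le (k : nat) : (0 < k)%N -> (4 * k + 24 <= 28 * k)%N.
Proof. by lia. Qed.

(** * The parameters put together *)

Section Instance.
Variables (R : realType) (m n : nat) (A : 'M[R[i]]_(m, n)) (phi : R).
Variables (acc : SQ phi A) (acc' : SQ phi (A^t*)).
Variables (f : R -> R[i]) (g0 : R[i]) (L Lbar eps delta : R).
Variables (l : nat) (sigma : 'I_l -> R) (U : 'M[R[i]]_(m, l)) (V : 'M[R[i]]_(n, l)).
Variables (r c : nat).
Local Notation a := (spec_norm A).
Local Notation F := (frob_norm A).
Local Notation d := (log_inv delta).
Local Notation Xr := (row_bound phi L a F eps d).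
Local Notation Xc := (col_bound phi L a F eps d).
Local Notation Phi := (frob_norm (tilde acc) ^+ 2).
Local Notation K := (2 ^+ 24 * (480 * 216)).
Hypothesis phi1 : 1 <= phi.
Hypothesis f0 : f 0 = 0.
Hypothesis gL : lipschitz_in [set x | 0 <= x]%classic (gfun f g0) L.
Hypothesis gLbar : lipschitz_in [set x | 0 < x]%classic (fun x => gfun f g0 x / x%:C) Lbar.
Hypothesis svdA : is_svd A sigma U V.
Hypothesis eps0 : 0 < eps.
Hypothesis epsL : eps <= L * a ^+ 3.
Hypothesis delta0 : 0 < delta.
Hypothesis delta1 : delta < 1.
Hypothesis rX : K * Xr * polylog 3 Xr <= r%:R.
Hypothesis cX : K * Xc * polylog 3 Xc <= c%:R.

(** The upper bound on [eps] excludes the degenerate cases. *)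
Lemma sizes_gt0 : 0 < a /\ 0 < L.
Proof.
have h : 0 < L * a ^+ 3 by apply: lt_le_trans epsL.
have a0 : 0 < a.
  rewrite lt_def spec_ge0 andbT; apply: contraTneq h => ->.
  by rewrite expr0n mulr0 ltxx.
by split=> //; move: h; rewrite pmulr_lgt0 // exprn_gt0.
Qed.

Let a0 : 0 < a. Proof. by case: sizes_gt0. Qed.
Let L0 : 0 < L. Proof. by case: sizes_gt0. Qed.
Let Lb0 : 0 <= Lbar. Proof. exact: lipschitz_ge0 gLbar. Qed.
Let aF : a <= F. Proof. exact: spec_frob. Qed.
Let PhiE : Phi = phi * F ^+ 2. Proof. exact: tilde_frob. Qed.

Lemma tilde_adj : frob_norm (tilde acc') ^+ 2 = Phi.
Proof. by rewrite !tilde_frob frob_adj. Qed.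

Lemma Phi_gt0 : 0 < Phi.
Proof.
rewrite PhiE mulr_gt0 //; first exact: lt_le_trans ltr01 phi1.
by rewrite exprn_gt0 // (lt_le_trans a0).
Qed.

Let Xc1 : 1 <= Xc. Proof. exact: col_bound_ge1. Qed.
Let Xcr : Xc <= Xr. Proof. exact: col_row. Qed.

Let count_pos (X : R) (k : nat) : 1 <= X -> K * X * polylog 3 X <= k%:R -> (0 < k)%N.
Proof.
move=> X1 h; rewrite -(ltr0n R); apply: lt_le_trans h.
have X0 : 0 < X := lt_le_trans ltr01 X1.
rewrite mulr_gt0 ?exprn_gt0 //; last by rewrite ltr_wpDr // ln_ge0 // lerDl ltW.
by rewrite mulr_gt0 // mulr_gt0 ?exprn_gt0 // mulr_gt0.
Qed.

Lemma c_gt0 : (0 < c)%N. Proof. exact: count_pos cX. Qed.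
Lemma r_gt0 : (0 < r)%N. Proof. exact: count_pos (le_trans Xc1 Xcr) rX. Qed.

Local Notation psi := (phi * F ^+ 2 / a ^+ 2).
Local Notation la := (L * a ^+ 3 / eps).
Local Notation s := (rate L Lbar eps a).
Local Notation dd := (p_depth delta).
Local Notation l1 := (scale (psi * (1 + la))).
Local Notation ell := (scale (psi * (1 + s))).

Let psi1 : 1 <= psi. Proof. exact: psi_ge1. Qed.
Let la1 : 1 <= la. Proof. exact: lambda_ge1. Qed.
Let s1 : 1 <= s. Proof. exact: rate_ge1. Qed.

Lemma stable_rankE : stable_rank acc a = psi.
Proof. by rewrite -PhiE. Qed.

Lemma p_scaleE : p_scale acc L Lbar eps a = ell.
Proof. by rewrite /p_scale stable_rankE. Qed.

Lemma p_innerE : p_inner acc L Lbar eps delta a = inner_size (inner_target dd ell s psi).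
Proof. by rewrite /p_inner /p_target p_scaleE stable_rankE. Qed.

Lemma p_roundsE : p_rounds acc L Lbar eps a = (4 * ell + 24)%N.
Proof. by rewrite /p_rounds p_scaleE. Qed.

(** The order of the moments is split: [dd] pays for the failure probability and [k], a scale, for
    the intrinsic dimension [x]. *)
Lemma tail_small (k : nat) (x : R) : x <= 4 ^+ k -> 4^-1 ^+ (dd + k) * x <= delta / 4.
Proof.
move=> h; apply: le_trans (depth_small delta0); rewrite exprD -mulrA ler_piMr ?exprn_ge0 ?invr_ge0 //.
by rewrite exprVn ler_pdivrMl ?exprn_gt0 // mulr1.
Qed.

Let sl (x : R) (k : nat) : (0 < k)%N -> 1 <= x -> 1 <= x * k%:R.
Proof. by move=> k0 x1; rewrite mulr_ege1 // ler1n. Qed.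

Let col_ok := col_count phi1 a0 aF eps0 epsL delta0 delta1 cX.
Let inner_ok := inner_count phi a F L Lbar eps delta.

Lemma failure (fin : outcome acc r c L Lbar eps delta a -> state R) :
  (forall o, outcome_prob acc' o != 0 ->
     exists M, [/\ out_ok acc' f o M, iarr (fin o) = mia M & zarr (fin o) = mza M]) ->
  \sum_o outcome_prob acc' o * `[< eps < spec_norm (A *m out_T n c (fin o) *m out_M c r (fin o)
     *m (out_S r m (fin o) *m A) + g0 *: A - svt f sigma U V) >]%:R < delta.
Proof.
apply: (@failure_bound _ _ _ _ _ _ _ _ _ _ _ _ _ _ _ _ _ _ _ delta0 Phi_gt0 tilde_adj
  c_gt0 r_gt0 f0 gL gLbar svdA (a ^+ 2 / (4096 * la * l1%:R)) (a ^+ 2 / (4096 * s * ell%:R))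
  (eps / (32 * L * a)) (2 ^ (13 + 2 * l1)) (2 * l1 + 14) (2 ^ (13 + 2 * ell)) (2 * ell + 14)
  (dd + l1) a0 (ltW L0) _ _ _ _ _ _ _ _ _ _ _ _ _ _ _ eps0 _ _ _ _ (dd + ell)).
- exact: rate_gt0.
- exact: tol_gt0.
- exact: tol_gt0.
- by rewrite divr_ge0 ?mulr_ge0 // ltW.
- exact: tol_le.
- exact: tol_le.
- rewrite p_roundsE PhiE; have := jacobi_rounds psi1 s1 a.
  by rewrite divfK // gt_eqF // exprn_gt0.
- exact: grid_exp.
- exact: grid_ge.
- exact: grid_exp.
- exact/double_both/grid_ge.
- by apply: error_left => //; apply: scale_factor.
- exact: error_shift.
- by apply: error_core => //; apply: scale_factor.
- exact: error_cross.
- by rewrite PhiE; apply: (count_low a0 _ _ _ col_ok) => //; [rewrite -PhiE Phi_gt0|exact: sl].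
- rewrite PhiE; apply: (count_high a0 _ _ col_ok); first by rewrite ltr0n c_gt0.
  by apply: lt_le_trans ltr01 _; apply: sl.
- apply: tail_small; apply: le_trans (scale_psi4 psi1 la1).
  by rewrite ler_wpM2r ?invr_ge0 ?exprn_ge0 ?(ltW a0) // ler_peMl // exprn_ge0 // ltW // (lt_le_trans a0).
- by [].
- by [].
- have P0 := Phi_gt0; rewrite p_innerE PhiE in P0 *.
  have Q0 : 0 <= 2 * (dd + ell)%:R :> R by rewrite mulr_ge0.
  apply: quadruple_both; first by rewrite mulr_ge0 // ltW.
  exact: (count_low a0 P0 Q0 (@sl s ell isT s1) inner_ok).
- rewrite p_innerE PhiE.
  have N0 : 0 < (inner_size (inner_target dd ell s psi))%:R :> R by rewrite ltr0n expn_gt0.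
  have := count_high a0 N0 (lt_le_trans ltr01 (@sl s ell isT s1)) inner_ok.
  by congr (_ / _ <= _); ring.
- apply: tail_small; apply: le_trans (scale_psi4 psi1 s1); rewrite PhiE.
  have a20 : 0 < a ^+ 2 by rewrite exprn_gt0.
  have P0 : 0 <= phi * F ^+ 2 by rewrite -PhiE ltW // Phi_gt0.
  by rewrite ler_wpM2l // lef_pV2 ?posrE ?mulr_gt0 // le_double.
- by rewrite PhiE; apply: (row_count phi1 a0 aF L0 eps0 epsL delta0 delta1 rX); rewrite ltr0n r_gt0.
- exact: depth_small.
Qed.

Local Notation B := (time_bound phi L Lbar a F eps d (cost_s acc) (cost_s acc')
  (cost_p acc) (cost_p acc') (cost_q acc) (cost_n acc)).
Local Notation Xs := (inner_bound phi a F L Lbar eps delta).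

Let Xrs : Xr <= Xs. Proof. exact: row_inner. Qed.

(** Through its unit-cost term the time bound dominates every size, so all logarithms can be
    expressed in [B]. *)
Lemma inner_time : Xs <= B.
Proof.
have Xs0 : 0 <= Xs := le_trans ler01 (le_trans Xc1 (le_trans Xcr Xrs)).
have Xc0 : 0 <= Xc := le_trans ler01 Xc1.
have [q0 s0 p0 n0] := cost_ge0 acc; have [_ s'0 p'0 _] := cost_ge0 acc'.
rewrite time_boundE //; apply: (@le_trans _ _ (Xs * Xc ^+ 2)); first by rewrite ler_peMr // exprn_ege1.
by rewrite ler_wpDr // ler_wpDl // addr_ge0 // mulr_ge0 // ?addr_ge0 // mulr_ge0.
Qed.

Lemma polylog_le (k : nat) (X Y : R) : 0 <= X -> X <= Y -> polylog k X <= polylog k Y.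
Proof.
move=> X0 XY; have h : ln (1 + X) <= ln (1 + Y).
  by rewrite ler_ln ?posrE ?lerD2l // ltr_pwDl // (le_trans X0).
by rewrite lerXn2r ?nnegrE ?lerD2l // addr_ge0 // ln_ge0 // lerDl // (le_trans X0).
Qed.

Lemma polylog_ge1 (k : nat) (X : R) : 0 <= X -> 1 <= polylog k X.
Proof. by move=> X0; rewrite exprn_ege1 // lerDl ln_ge0 // lerDl. Qed.

Lemma polylog_exp (j k : nat) (X : R) : 0 <= X -> (j <= k)%N -> polylog j X <= polylog k X.
Proof. by move=> X0 jk; rewrite ler_weXn2l // lerDl ln_ge0 // lerDl. Qed.

(** The given sizes carry the logarithmic power [k'] and the second sample the power [3]; both are
    covered by [k' + 3], and at most four such factors are multiplied. The modulus of [K'] allows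
    for either sign. *)
Lemma running_time (K' : R) (k' : nat) :
  r%:R <= K' * Xr * polylog k' Xr -> c%:R <= K' * Xc * polylog k' Xc ->
  cst acc acc' (budget acc r c L Lbar eps delta a) svt_cmd <=
  70 * 1000 * (`|K'| + 2 ^+ 26 * (960 * 216)) ^+ 4 * B * polylog ((k' + 3) * 4) B.
Proof.
move=> rX' cX'; set G := _ + _.
have Xr1 : 1 <= Xr := le_trans Xc1 Xcr.
have Xs1 : 1 <= Xs := le_trans Xr1 Xrs.
have [Xc0 Xr0 Xs0] : [/\ 0 <= Xc, 0 <= Xr & 0 <= Xs] by split; apply: le_trans ler01 _.
have XsB := inner_time; have XrB := le_trans Xrs XsB; have XcB := le_trans Xcr XrB.
have B0 : 0 <= B := le_trans Xs0 XsB.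
have k0 : 1 <= 2 ^+ 26 * (960 * 216) :> R.
  by rewrite mulr_ege1 ?exprn_ege1 ?ler1n // mulr_ege1 // ler1n.
have G1 : 1 <= G by rewrite ler_wpDl.
have G0 : 0 <= G := le_trans ler01 G1.
have KG : K' <= G by apply: le_trans (ler_norm _) _; rewrite lerDl (le_trans ler01).
have kG : 2 ^+ 26 * (960 * 216) <= G by rewrite lerDr.
set W := polylog (k' + 3) B.
have W1 : 1 <= W by apply: polylog_ge1.
have W0 : 0 <= W := le_trans ler01 W1.
have size X (z : R) : 0 <= X -> X <= B -> z <= K' * X * polylog k' X -> z <= G * W * X.
  move=> X0 XB h; apply: le_trans h _; rewrite [leRHS]mulrAC.
  have p1 := polylog_ge1 k' X0; have p0 := le_trans ler01 p1.
  apply: (@le_trans _ _ (G * X * polylog k' X)); first by rewrite ler_wpM2r // ler_wpM2r.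
  rewrite ler_wpM2l // ?mulr_ge0 //; apply: le_trans (polylog_le k' X0 XB) _.
  by apply: polylog_exp => //; rewrite leq_addr.
have cW := size _ _ Xc0 XcB cX'.
have rW : r%:R <= G * W * Xs.
  by apply: le_trans (size _ _ Xr0 XrB rX') _; rewrite ler_wpM2l // mulr_ge0.
have GW1 : 1 <= G * W by rewrite mulr_ege1.
have NW : (p_inner acc L Lbar eps delta a)%:R <= G * W * Xs.
  rewrite p_innerE; apply: le_trans (inner_log phi1 a0 aF Lb0 eps0 epsL delta0 delta1 XsB) _.
  rewrite mulrAC ler_wpM2r //; apply: ler_pM => //; first exact: le_trans ler01 k0.
    exact: le_trans ler01 (polylog_ge1 3 B0).
  by apply: (@polylog_exp 3) => //; rewrite leq_addl.
have PW : 1 + ln (1 + B) <= W.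
  by rewrite -[leLHS]expr1; apply: (@polylog_exp 1) => //; rewrite addn_gt0 orbT.
have eW : (p_rounds acc L Lbar eps a)%:R <= 168 * (G * W).
  have h1 := ell_log phi1 a0 aF Lb0 eps0 epsL XsB.
  have h2 : W <= G * W by rewrite ler_peMl.
  rewrite p_roundsE; apply: (@le_trans _ _ (28 * ell%:R)).
    by rewrite -natrM ler_nat rounds_le.
  apply: (@le_trans _ _ (28 * (6 * (G * W)))); last by rewrite mulrA -natrM.
  by rewrite ler_wpM2l //; apply: le_trans h1 _; rewrite ler_wpM2l // (le_trans PW).
have xyN : (p_depth delta)%:R + (p_scale acc L Lbar eps a)%:R <=
    (p_inner acc L Lbar eps delta a)%:R :> R.
  by rewrite p_innerE p_scaleE depth_le_inner.
have [q0 s0 p0 n0] := cost_ge0 acc; have [_ s'0 p'0 _] := cost_ge0 acc'.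
apply: le_trans (cst_svt _ _ _ _ _ _ _ _ _ _) _ => //=.
- by rewrite ler1n c_gt0.
- by rewrite ler1n r_gt0.
- by rewrite ler1n p_innerE expn_gt0.
- by rewrite ler1n p_roundsE addn_gt0 orbT.
- by rewrite natrM.
apply: le_trans (time_algebra _ _ _ _ Xc1 (le_trans Xcr Xrs) GW1 cW rW NW eW xyN q0 s0 s'0 p0 p'0 n0) _ => //.
rewrite -(time_boundE phi F L Lbar delta a0 eps0) exprMn /polylog exprM -/(polylog _ _) -/W.
by rewrite mulrA [leRHS]mulrAC.
Qed.
End Instance.

Theorem theorem3p3 (R : realType) :
  exists (P : program) (kappa K : R) (k : nat),
    [/\ 0 < kappa, 0 < K
      & forall (K' : R) (k' : nat), exists (Kt : R) (kt : nat),
        forall (m n : nat) (A : 'M[R[i]]_(m, n)) (phi : R)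
          (acc : SQ phi A) (acc' : SQ phi (A^t*))
          (f : R -> R[i]) (g0 : R[i]) (L Lbar eps delta : R)
          (l : nat) (sigma : 'I_l -> R) (U : 'M[R[i]]_(m, l)) (V : 'M[R[i]]_(n, l))
          (r c : nat),
        let a := spec_norm A in
        let F := frob_norm A in
        let d := log_inv delta in
        let Xr := row_bound phi L a F eps d in
        let Xc := col_bound phi L a F eps d in
        let B := time_bound phi L Lbar a F eps d (cost_s acc) (cost_s acc')
                   (cost_p acc) (cost_p acc') (cost_q acc) (cost_n acc) in
        1 <= phi ->
        f 0 = 0 ->
        lipschitz_in [set x | 0 <= x] (gfun f g0) L ->
        lipschitz_in [set x | 0 < x] (fun x => gfun f g0 x / x%:C) Lbar ->
        is_svd A sigma U V ->
        0 < eps -> eps <= kappa * L * a ^+ 3 ->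
        0 < delta -> delta < 1 ->
        K * Xr * polylog k Xr <= r%:R ->
        K * Xc * polylog k Xc <= c%:R ->
        exists N : nat,
          let Pr := pr_from acc acc' f P
                      (init_state m n r c phi L Lbar eps delta a) N in
          [/\ Pr (fun=> True) = 1,
              row_sampling Pr (@out_S R r m),
              row_sampling Pr (fun s => (@out_T R n c s)^T),
              Pr (fun s =>
                    let Rsk := out_S r m s *m A in
                    let Csk := A *m out_T n c s in
                    eps < spec_norm (Csk *m out_M c r s *m Rsk + g0 *: A
                                     - svt f sigma U V)) < delta
            & r%:R <= K' * Xr * polylog k' Xr ->
              c%:R <= K' * Xc * polylog k' Xc ->
              Pr (fun s => clock s <= Kt * B * polylog kt B) = 1]].
Proof.
exists (compile 0 svt_cmd), 1, (2 ^+ 24 * (480 * 216)), 3%N; split=> //.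
  by rewrite mulr_gt0 ?exprn_gt0 // mulr_gt0.
move=> K' k'; exists (70 * 1000 * (`|K'| + 2 ^+ 26 * (960 * 216)) ^+ 4), ((k' + 3) * 4)%N.
move=> m n A phi acc acc' f g0 L Lbar eps delta l sigma U V r c a F d Xr Xc B.
move=> phi1 f0 gL gLbar svdA eps0; rewrite mul1r => epsL delta0 delta1 rX cX.
have Phi0 := Phi_gt0 acc phi1 eps0 epsL.
have tilde' := tilde_adj acc acc'.
have c0 := c_gt0 phi1 eps0 epsL cX.
have [N [fin [finP PrE]]] := law_of_program f r L Lbar eps a delta0 tilde' c0.
have fin_ok o po := (finP o po).1.
exists N; move: PrE; set Pr := pr_from _ _ _ _ _ _ => PrE.
have {}PrE : Pr = fun E => \sum_o outcome_prob acc' o * `[< E (fin o) >]%:R.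
  by apply/funext => E; apply: PrE.
have sure E : (forall o, outcome_prob acc' o != 0 -> E (fin o)) ->
    \sum_o outcome_prob acc' o * `[< E (fin o) >]%:R = 1.
  move=> h; apply: etrans (sum_outcome_prob r L Lbar eps delta a Phi0 tilde' c0).
  apply: eq_bigr => o _; have [->|po] := eqVneq (outcome_prob acc' o) 0; first by rewrite mul0r.
  by rewrite asboolT ?mulr1 //; apply: h.
rewrite /= PrE; split.
- exact: (sure (fun=> True)).
- exact: row_sampling_S fin_ok.
- exact: row_sampling_T fin_ok.
- exact: (failure phi1 f0 gL gLbar svdA eps0 epsL delta0 delta1 rX cX fin_ok).
- move=> rX' cX'; apply: (sure (fun s => clock s <= _)) => o po; apply: le_trans (finP o po).2 _.
  exact: (running_time acc acc' phi1 gLbar eps0 epsL delta0 delta1 rX cX rX' cX').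
Qed.
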